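(* Fix $\lambda\in\mathbb{R}$. Let $G=G_n$ be a hierarchical configuration model (HCM) on $n$ communities satisfying the Community regularity condition and the Inter-community connectivity condition (with this $\lambda$), both stated in the context. Let $\mathscr{C}_{(j)}$ denote the $j$-th largest connected component of $G$ (measured by its number of vertices $v(\mathscr{C}_{(j)})$), and let $N$ be the total number of vertices of $G$. Then $$N^{-2/3}\big(v(\mathscr{C}_{(j)})\big)_{j\geq 1}\overset{d}{\longrightarrow} \mathbb{E}[S]^{-2/3}\,\frac{\mathbb{E}[DS]}{\mathbb{E}[D]}\,\boldsymbol{\gamma}^{\lambda}$$ as $n\to\infty$, with respect to the product topology.
   Context: A community is a pair $H=(F,\boldsymbol d)$ where $F=(V_F,E_F)$ is a finite simple connected graph and $\boldsymbol d=(d_v^{(b)})_{v\in V_F}$ are nonnegative integers (inter-community degrees). Write $s_H=|V_F|$ (size) and $d_H=\sum_{v\in V_F}d_v^{(b)}$ (inter-community degree). The HCM with community sequence $(H_i)_{i\in[n]}$ is obtained by attaching $d_v^{(b)}$ half-edges to each vertex $v$ of each community and pairing all these inter-community half-edges uniformly at random (their total $\ell_n=\sum_i d_{H_i}$ is assumed even); the edges inside the communities are kept. The graph has $N=\sum_{i} s_{H_i}$ vertices. Let $H_n$ be a uniformly chosen community among the $n$, $D_n=d_{H_n}$, $S_n=s_{H_n}$, and $P_n(H)$ the fraction of communities equal to $H$. Community regularity condition: (i) $P_n(H)\to P(H)$ for every $H$, where $P$ is a probability distribution on (labeled) communities; let $(S,D)$ be the size and inter-community degree of a community with law $P$; (ii)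 $\mathbb{E}[S_n]\to\mathbb{E}[S]<\infty$; (iii) $\mathbb{E}[D_nS_n]\to\mathbb{E}[DS]<\infty$; (iv) $s_{\max}=\max_{i\in[n]}s_{H_i}$ satisfies $s_{\max}\log(n)/n^{2/3}\to0$. Inter-community connectivity condition: (i) $\mathbb{E}[D_n^3]\to\mathbb{E}[D^3]<\infty$; (ii) $\mathbb{P}(D=0)<1$ and $\mathbb{P}(D=1)\in(0,1)$; (iii) $\nu_n:=\mathbb{E}[D_n(D_n-1)]/\mathbb{E}[D_n]=1+\lambda n^{-1/3}+o(n^{-1/3})$. Let $\mu=\mathbb{E}[D]$, $\eta=\mathbb{E}[D^3]\mathbb{E}[D]-\mathbb{E}[D^2]^2$, $B$ a standard Brownian motion, $B^\mu_{\lambda,\eta}(t)=\frac{\sqrt\eta}{\mu}B(t)+\lambda t-\frac{\eta t^2}{2\mu^3}$, and $W^\lambda(t)=B^\mu_{\lambda,\eta}(t)-\min_{0\le s\le t}B^\mu_{\lambda,\eta}(s)$ its reflected version. $\boldsymbol\gamma^\lambda$ denotes the vector of lengths of the excursions of $W^\lambda$ away from $0$, ordered decreasingly. *)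

(* Defs.v *)
From HB Require Import structures.
From mathcomp Require Import all_boot all_order all_algebra.
From mathcomp Require Import all_classical all_reals all_analysis.
Set Implicit Arguments.
Unset Strict Implicit.
Unset Printing Implicit Defensive.
Import Order.TTheory GRing.Theory Num.Theory.
Import numFieldNormedType.Exports.

Definition community : Type :=
  {s : nat & ({ffun 'I_s -> {ffun 'I_s -> bool}} * {ffun 'I_s -> nat})%type}.

Definition csize (H : community) : nat := tag H.
Definition cadj (H : community) (u v : 'I_(csize H)) : bool := (tagged H).1 u v.
Arguments cadj : clear implicits.
Definition cdeg (H : community) (v : 'I_(csize H)) : nat := (tagged H).2 v.
Arguments cdeg : clear implicits.
Definition cdtot (H : community) : nat := (\sum_(v < csize H) cdeg H v)%N.

Definition valid_community (H : community) : Prop :=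
  [/\ (0 < csize H)%N,
      (forall u, ~~ cadj H u u),
      (forall u v, cadj H u v = cadj H v u)
    & (forall u v, connect (cadj H) u v)].

Definition vtx n (Hs : 'I_n -> community) : finType :=
  {i : 'I_n & 'I_(csize (Hs i))}.
Definition vdeg n (Hs : 'I_n -> community) (x : vtx Hs) : nat :=
  cdeg (Hs (tag x)) (tagged x).
Definition hedge n (Hs : 'I_n -> community) : finType :=
  {x : vtx Hs & 'I_(vdeg x)}.

Definition hcm_matchings n (Hs : 'I_n -> community) : {set {ffun hedge Hs -> hedge Hs}} :=
  [set m : {ffun hedge Hs -> hedge Hs} | [forall h, (m (m h) == h) && (m h != h)]].

Definition hcm_rel n (Hs : 'I_n -> community) (m : {ffun hedge Hs -> hedge Hs}) :
  rel (vtx Hs) := fun x y =>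
  [exists i : 'I_n, [exists u : 'I_(csize (Hs i)), [exists v : 'I_(csize (Hs i)),
      [&& cadj (Hs i) u v, x == Tagged (fun i => 'I_(csize (Hs i))) u
        & y == Tagged (fun i => 'I_(csize (Hs i))) v]]]]
  || [exists h : hedge Hs, (tag h == x) && (tag (m h) == y)].

Definition hcm_components n (Hs : 'I_n -> community) (m : {ffun hedge Hs -> hedge Hs}) :
  {set {set vtx Hs}} :=
  [set [set y | connect (hcm_rel m) x y] | x : vtx Hs].

Definition sorted_comp_sizes n (Hs : 'I_n -> community) (m : {ffun hedge Hs -> hedge Hs}) :
  seq nat := sort geq (map (fun C : {set vtx Hs} => #|C|) (enum (hcm_components m))).

Definition hcm_N n (Hs : 'I_n -> community) : nat := (\sum_(i < n) csize (Hs i))%N.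

Local Open Scope ring_scope.
Local Open Scope classical_set_scope.

Definition scaled_comp_sizes {R : realType} n (Hs : 'I_n -> community)
  (m : {ffun hedge Hs -> hedge Hs}) : nat -> R :=
  fun j => (nth 0%N (sorted_comp_sizes m) j)%:R / ((hcm_N Hs)%:R `^ (2 / 3)).

Definition hcm_expect {R : realType} n (Hs : 'I_n -> community)
  (g : {ffun hedge Hs -> hedge Hs} -> R) : R :=
  (\sum_(m in hcm_matchings Hs) g m) / #|hcm_matchings Hs|%:R.

Definition emp_frac {R : realType} n (Hs : 'I_n -> community) (H : community) : R :=
  #|[set i : 'I_n | Hs i == H]%SET|%:R / n%:R.
Definition emp_mean {R : realType} n (Hs : 'I_n -> community) (g : community -> R) : R :=
  (\sum_(i < n) g (Hs i)) / n%:R.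

Definition cexp {R : realType} (P : community -> R) (g : community -> R) : \bar R :=
  (\esum_(H in [set: community]) (P H * g H)%:E)%E.

Definition is_std_BM {d} {T : measurableType d} {R : realType} (P : probability T R)
  (B : R -> T -> R) : Prop :=
  [/\ (forall t, measurable_fun setT (B t)),
      (forall w, B 0 w = 0),
      (forall w, {within `[0, +oo[, continuous (fun t => B t w)})
    & (forall (k : nat) (ts : nat -> R) (A : nat -> set R),
        0 <= ts 0%N -> (forall i, (i < k)%N -> ts i < ts i.+1) ->
        (forall i, measurable (A i)) ->
        P (\bigcap_(i in `I_k) [set w | A i (B (ts i.+1) w - B (ts i) w)]) =
        (\prod_(i < k) normal_prob 0 (Num.sqrt (ts i.+1 - ts i)) (A i))%E)].

Definition excursion {R : realType} (f : R -> R) (l r : R) : Prop :=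
  [/\ 0 <= l, l < r, f l = 0, f r = 0 & (forall t, l < t < r -> 0 < f t)].

(* (k+1)-th largest excursion length (with multiplicity), 0 if fewer *)
Definition ord_excursion {R : realType} (f : R -> R) (k : nat) : R :=
  sup [set x : R | 0 < x /\ exists e : 'I_k.+1 -> R * R,
        injective e /\ forall i, excursion f (e i).1 (e i).2 /\ x <= (e i).2 - (e i).1].

Definition drifted_BM {R : realType} {T : Type} (mu eta lam : R) (B : R -> T -> R) :
  R -> T -> R :=
  fun t w => Num.sqrt eta / mu * B t w + lam * t - eta * t ^+ 2 / (2 * mu ^+ 3).

Definition reflected {R : realType} (f : R -> R) : R -> R :=
  fun t => f t - inf [set f s | s in `[0, t]].

Definition gamma_lambda {R : realType} {T : Type} (mu eta lam : R) (B : R -> T -> R) :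
  nat -> T -> R :=
  fun k w => ord_excursion (reflected (fun t => drifted_BM mu eta lam B t w)) k.

Arguments hcm_expect {R n} Hs g.
Arguments emp_frac {R n} Hs H.
Arguments emp_mean {R n} Hs g.

(* Main.v *)
(* Reveal the inter-community pairing along an exploration in which an active half-edge
   is paired with a uniformly drawn half-edge, a draw that is already paired being skipped.
   The draws are then iid, and up to O(1) bad draws the number of active half-edges is
   the iid walk with steps d - 2 corrected by the repeated draws of a community; the
   correction obeys a law of large numbers and produces the parabolic drift.  By a
   Lindeberg argument on blocks the walk converges to the drifted Brownian motion.  The
   components are the excursions of the walk above its running minimum, and since the
   volume found by time t is proportional to t, their sizes are proportional to the
   excursion lengths.  Starting the exploration from uniform vertices makes the large
   components appear within a bounded time.  Instead of a continuous mapping theorem, a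
   deterministic relation between a path and a vector of component sizes is used: the
   relation is stable under uniform perturbation of the path, and for a Brownian path it
   pins down every coordinate, since minima over disjoint intervals are almost surely
   distinct. *)

Require Import Defs.
From HB Require Import structures.
From mathcomp Require Import all_boot all_order all_algebra.
From mathcomp Require Import all_classical all_reals all_analysis.
From mathcomp Require Import measurable_realfun perm ring lra zify.
Import Order.TTheory GRing.Theory Num.Theory.
Import numFieldNormedType.Exports.
Set Implicit Arguments.
Unset Strict Implicit.
Unset Printing Implicit Defensive.
Local Open Scope classical_set_scope.
Local Open Scope ring_scope.

(** * Iid draws from a finite law *)

(** The exploration starts from about [s^3 n^(1/3)] uniform vertices and runs for [s^2 n^(2/3)]
    draws. Two competing demands fix these powers of [s]. The total degree of the starting vertices,
    of order [s^3 n^(1/3)], must be exhausted by the end; the parabola has by then pushed the walk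
    down to order [- s^4 n^(1/3)]. Conversely no component of size at least [rho N^(2/3)] may be
    missed: each is missed with probability of order [s^(-3)], and only order [s^2] of them can be
    found within the horizon, which leaves an error of order [1 / s]. For fixed [s], [rho] and
    tolerance only one-sided bounds on the expectations are available. They are applied to a test
    function and to its opposite, and the parameters go to their limits after [n]. The integrand of
    the limit is not shown to be measurable: it is squeezed almost surely between measurable
    functions with equal integrals. *)

Section finite_iid_expectation.
Variables (R : realType) (T : finType) (p : T -> R).
Hypothesis p_ge0 : forall x, 0 <= p x.
Hypothesis p_sum1 : \sum_x p x = 1.

(** Expectation over [K] independent draws, taken one draw at a time: conditioning on a prefix is
    then [EL_cat], and no product measure has to be built. *)
Fixpoint EL K (g : seq T -> R) : R :=
  if K is K'.+1 then \sum_x p x * EL K' (fun s => g (x :: s)) else g [::].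

Lemma eq_EL K (g h : seq T -> R) :
  (forall s, size s = K -> g s = h s) -> EL K g = EL K h.
Proof.
elim: K g h => [|K IH] g h gh /=; first exact: gh.
by apply: eq_bigr => x _; congr (_ * _); apply: IH => s sK; rewrite gh //= sK.
Qed.

Lemma EL_le K (g h : seq T -> R) :
  (forall s, size s = K -> g s <= h s) -> EL K g <= EL K h.
Proof.
elim: K g h => [|K IH] g h gh /=; first exact: gh.
apply: ler_sum => x _; apply: ler_wpM2l => //.
by apply: IH => s sK; rewrite gh //= sK.
Qed.

Lemma EL_cst K (c : R) : EL K (fun=> c) = c.
Proof. by elim: K => //= K ->; rewrite -mulr_suml p_sum1 mul1r. Qed.

Lemma ELD K (g h : seq T -> R) :
  EL K (fun s => g s + h s) = EL K g + EL K h.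
Proof.
elim: K g h => //= K IH g h; rewrite -big_split /=.
by apply: eq_bigr => x _; rewrite IH mulrDr.
Qed.

Lemma ELZ K (c : R) (g : seq T -> R) : EL K (fun s => c * g s) = c * EL K g.
Proof.
elim: K g => //= K IH g; rewrite mulr_sumr.
by apply: eq_bigr => x _; rewrite IH mulrCA.
Qed.

Lemma ELN K (g : seq T -> R) : EL K (fun s => - g s) = - EL K g.
Proof.
by under eq_EL do rewrite -mulN1r; rewrite ELZ mulN1r.
Qed.

Lemma ELB K (g h : seq T -> R) :
  EL K (fun s => g s - h s) = EL K g - EL K h.
Proof. by rewrite ELD ELN. Qed.

Lemma EL_sum (I : Type) (r : seq I) (P : pred I) K (g : I -> seq T -> R) :
  EL K (fun s => \sum_(i <- r | P i) g i s) = \sum_(i <- r | P i) EL K (g i).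
Proof.
elim: r => [|i r IH]; first by under eq_EL do rewrite big_nil; rewrite EL_cst big_nil.
rewrite big_cons -IH; case: ifP => Pi; last first.
  by apply: eq_EL => s _; rewrite big_cons Pi.
by rewrite -ELD; apply: eq_EL => s _; rewrite big_cons Pi.
Qed.

Lemma EL_ge0 K (g : seq T -> R) :
  (forall s, size s = K -> 0 <= g s) -> 0 <= EL K g.
Proof. by move=> g0; rewrite -(EL_cst K 0); exact: EL_le. Qed.

Lemma EL_norm K (g : seq T -> R) : `|EL K g| <= EL K (fun s => `|g s|).
Proof.
rewrite ler_norml; apply/andP; split.
  by rewrite -ELN; apply: EL_le => s _; rewrite lerNl -normrN ler_norm.
by apply: EL_le => s _; exact: ler_norm.
Qed.

Lemma EL_cat a b (g : seq T -> R) :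
  EL (a + b) g = EL a (fun u => EL b (fun v => g (u ++ v))).
Proof.
elim: a g => [|a IH] g; first by [].
by rewrite addSn /=; apply: eq_bigr => x _; rewrite IH.
Qed.

Lemma EL_take a b (g : seq T -> R) :
  EL (a + b) (fun s => g (take a s)) = EL a g.
Proof.
rewrite EL_cat; apply: eq_EL => u ua; rewrite -[RHS](EL_cst b).
by apply: eq_EL => v _; rewrite take_cat ua ltnn subnn take0 cats0.
Qed.

Lemma EL_drop a b (g : seq T -> R) :
  EL (a + b) (fun s => g (drop a s)) = EL b g.
Proof.
rewrite EL_cat -[RHS](EL_cst a); apply: eq_EL => u ua.
by apply: eq_EL => v _; rewrite drop_cat ua ltnn subnn drop0.
Qed.

Lemma EL_rcons K (g : seq T -> R) :
  EL K.+1 g = EL K (fun s => \sum_x p x * g (rcons s x)).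
Proof.
rewrite -addn1 EL_cat; apply: eq_EL => u _ /=.
by apply: eq_bigr => x _; rewrite cats1.
Qed.

Lemma EL_markov K (P : pred (seq T)) (g : seq T -> R) (a : R) :
  (forall s, size s = K -> 0 <= g s) -> 0 < a ->
  (forall s, size s = K -> P s -> a <= g s) ->
  EL K (fun s => (P s)%:R) <= EL K g / a.
Proof.
move=> g0 a0 ag; rewrite ler_pdivlMr // mulrC -ELZ; apply: EL_le => s sK.
have := ag _ sK; have := g0 _ sK.
by case: (P s) => g0s h; rewrite ?mulr1 ?mulr0 //; exact: h.
Qed.

Lemma EL_count K (f : T -> R) :
  EL K (fun s => \sum_(x <- s) f x) = K%:R * \sum_x p x * f x.
Proof.
elim: K => [|K IH]; first by rewrite /= big_nil mul0r.
rewrite EL_rcons.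
under eq_EL => s _.
  under eq_bigr do rewrite -cats1 big_cat big_seq1 /= mulrDr.
  rewrite big_split /= -mulr_suml p_sum1 mul1r.
  over.
by rewrite ELD EL_cst IH -[K.+1]addn1 natrD mulrDl mul1r.
Qed.

Variable psi : seq T -> T -> R.

(** Increments may depend on all earlier draws, which [pre] carries along; this covers martingales
    and sums over repeated communities as well as iid sums. *)
Fixpoint awalk (pre s : seq T) : R :=
  if s is h :: s' then psi pre h + awalk (rcons pre h) s' else 0.

Fixpoint asq (pre s : seq T) : R :=
  if s is h :: s' then psi pre h ^+ 2 + asq (rcons pre h) s' else 0.

Fixpoint ahit (a x : R) (pre s : seq T) : bool :=
  (a <= `|x|) ||
  (if s is h :: s' then ahit a (x + psi pre h) (rcons pre h) s' else false).

Lemma awalk_cat pre s t : awalk pre (s ++ t) = awalk pre s + awalk (pre ++ s) t.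
Proof.
elim: s pre => [|h s IH] pre /=; first by rewrite cats0 add0r.
by rewrite IH cat_rcons addrA.
Qed.

Lemma ahitPn a x pre s : ~~ ahit a x pre s ->
  forall t, (t <= size s)%N -> `|x + awalk pre (take t s)| < a.
Proof.
elim: s x pre => [|h s IH] x pre /=; rewrite negb_or -ltNge => /andP[xa hs] t.
  by rewrite addr0.
case: t => [_|t]; first by rewrite addr0.
by rewrite ltnS => ts; rewrite /= addrA; apply: IH.
Qed.

(* [Phi K pre x] dominates the probability that the walk started from [x],
   with past [pre] and [K] steps left, ever reaches modulus [a]. *)
Lemma maximal_ineq (Phi : nat -> seq T -> R -> R) (a : R) :
  (forall K pre x, 0 <= Phi K pre x) ->
  (forall K pre x, a <= `|x| -> 1 <= Phi K pre x) ->
  (forall K pre x, \sum_h p h * Phi K (rcons pre h) (x + psi pre h)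
                   <= Phi K.+1 pre x) ->
  forall K pre x, EL K (fun s => (ahit a x pre s)%:R) <= Phi K pre x.
Proof.
move=> Phi0 Phi1 PhiS; elim=> [|K IH] pre x /=.
  by rewrite orbF; case: (lerP a `|x|) => [ax|_]; [exact: Phi1|exact: Phi0].
case: (lerP a `|x|) => [ax|xa] /=.
  apply: le_trans (Phi1 _ _ _ ax).
  by under eq_bigr do rewrite EL_cst mulr1; rewrite p_sum1.
apply: le_trans (PhiS _ _ _); apply: ler_sum => h _.
exact: ler_wpM2l.
Qed.

Lemma asq_ge0 pre s : 0 <= asq pre s.
Proof. by elim: s pre => //= h s IH pre; rewrite addr_ge0 ?sqr_ge0. Qed.

(** The squared position plus the expected squared increments still to come is preserved in mean by
    centred increments, and it is at least [a ^+ 2] once modulus [a] is reached. *)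
Lemma kolmogorov_ineq (a : R) K : 0 < a ->
  (forall pre, \sum_h p h * psi pre h = 0) ->
  EL K (fun s => (ahit a 0 [::] s)%:R) <= EL K (asq [::]) / a ^+ 2.
Proof.
move=> a0 mean0.
pose Phi K pre x := (x ^+ 2 + EL K (asq pre)) / a ^+ 2.
suff : forall pre x, EL K (fun s => (ahit a x pre s)%:R) <= Phi K pre x.
  by move=> /(_ [::] 0) /le_trans; apply; rewrite /Phi expr0n add0r.
apply: maximal_ineq.
- move=> k pre x; rewrite divr_ge0 ?sqr_ge0 // addr_ge0 ?sqr_ge0 //.
  by apply: EL_ge0 => s _; exact: asq_ge0.
- move=> k pre x ax; rewrite ler_pdivlMr ?exprn_gt0 // mul1r ler_wpDr //.
    by apply: EL_ge0 => s _; exact: asq_ge0.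
  by rewrite -[leRHS]real_normK ?num_real // ler_pXn2r ?nnegrE ?normr_ge0 // ltW.
- move=> k pre x; rewrite /Phi /=.
  under eq_bigr do rewrite mulrA.
  rewrite -mulr_suml ler_wpM2r ?invr_ge0 ?sqr_ge0 //.
  under [X in _ <= _ + X]eq_bigr do rewrite ELD EL_cst.
  rewrite le_eqVlt; apply/orP; left; apply/eqP.
  transitivity (\sum_h (p h * x ^+ 2 + 2 * x * (p h * psi pre h) +
     p h * (psi pre h ^+ 2 + EL k (asq (rcons pre h))))).
    by apply: eq_bigr => h _; ring.
  by rewrite !big_split /= -mulr_suml p_sum1 -mulr_sumr mean0; ring.
Qed.

End finite_iid_expectation.

(** * Exploring a uniform matching *)

Section partial_matchings.
Variables (R : realType) (H : finType).
Implicit Types (m : {ffun H -> H}) (a h z : H).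

Definition invol m := [forall z, m (m z) == z].

Definition full_matchings : {set {ffun H -> H}} :=
  [set m : {ffun H -> H} | [forall h, (m (m h) == h) && (m h != h)]]%SET.

(* A partial matching is an involution; its fixed points are the unpaired half-edges. *)
Definition extensions m : {set {ffun H -> H}} :=
  [set m' in full_matchings | [forall z, (m z != z) ==> (m' z == m z)]]%SET.

Definition link m a h : {ffun H -> H} :=
  [ffun z => if z == a then h else if z == h then a else m z].

Lemma full_matchingsP m :
  reflect (forall z, m (m z) = z /\ m z != z) (m \in full_matchings).
Proof.
rewrite inE; apply: (iffP forallP) => [h z|h z].
  by have /andP[/eqP -> ->] := h z.
by have [-> ->] := h z; rewrite eqxx.
Qed.

Lemma extensionsP m m' :
  reflect (m' \in full_matchings /\ forall z, m z != z -> m' z = m z)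
          (m' \in extensions m).
Proof.
rewrite [_ \in extensions _]inE; apply: (iffP andP) => -[fm mm']; split => //.
  by move=> z /(implyP (forallP mm' z)) /eqP.
by apply/forallP => z; apply/implyP => /mm' ->.
Qed.

Lemma involP m : reflect (forall z, m (m z) = z) (invol m).
Proof. by apply: (iffP forallP) => h z; apply/eqP; rewrite ?h. Qed.

Lemma invol_link m a h : invol m -> m a = a -> m h = h -> invol (link m a h).
Proof.
move=> /involP im ma mh; apply/involP => z; rewrite !ffunE.
case: (eqVneq z a) => [->|za]; first by rewrite eqxx; case: eqP.
case: (eqVneq z h) => [->|zh]; first by rewrite eqxx.
have zaF : (m z == a) = false.
  by apply: contra_neqF za => /eqP e; rewrite -(im z) e ma.
have zhF : (m z == h) = false.
  by apply: contra_neqF zh => /eqP e; rewrite -(im z) e mh.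
by rewrite zaF zhF im.
Qed.

Lemma extensions_link m a m' h : invol m -> m a = a -> m h = h -> h != a ->
  (m' \in extensions (link m a h)) = (m' \in extensions m) && (m' a == h).
Proof.
move=> /involP im ma mh ha; apply/extensionsP/andP.
  move=> [fm e]; have ea : m' a = h by rewrite e ffunE eqxx.
  split; last by rewrite ea.
  apply/extensionsP; split => // z mz.
  have za : z != a by apply: contra_neq mz => ->.
  have zh : z != h by apply: contra_neq mz => ->.
  by rewrite e ffunE (negbTE za) (negbTE zh).
move=> [/extensionsP[fm e] /eqP ea]; split => // z; rewrite ffunE.
case: (eqVneq z a) => [->|za]; first by rewrite ea.
case: (eqVneq z h) => [->|zh]; last exact: e.
by move=> _; have [] := full_matchingsP _ fm a; rewrite ea.
Qed.

Lemma sum_extensions_link m a (g : {ffun H -> H} -> R) : invol m -> m a = a ->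
  \sum_(m' in extensions m) g m' =
  \sum_(h | (m h == h) && (h != a)) \sum_(m' in extensions (link m a h)) g m'.
Proof.
move=> im ma.
rewrite (partition_big (fun m' => m' a) (fun h => (m h == h) && (h != a))) /=.
  apply: eq_bigr => h /andP[/eqP mh ha].
  by apply: eq_bigl => m'; rewrite extensions_link.
move=> m' /extensionsP[/full_matchingsP fm e].
have [mma ->] := fm a; rewrite andbT; apply: contraT => /e.
rewrite mma => /esym mm; have := (fm a).2; rewrite -{1}[m' a](involP _ im).
by rewrite mm ma eqxx.
Qed.

(** Conjugation by the transposition of [h] and [h'] maps the completions pairing [a] with [h]
    injectively into those pairing [a] with [h']. *)
Lemma card_extensions_link m a h h' : invol m -> m a = a ->
  m h = h -> h != a -> m h' = h' -> h' != a ->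
  (#|extensions (link m a h)| <= #|extensions (link m a h')|)%N.
Proof.
move=> im ma mh ha mh' ha'.
pose t := tperm h h'.
pose f (m' : {ffun H -> H}) : {ffun H -> H} := [ffun z => t (m' (t z))].
have fK : involutive f by move=> m'; apply/ffunP => z; rewrite !ffunE !tpermK.
rewrite -(card_imset _ (inv_inj fK)); apply/subset_leq_card/fintype.subsetP => m1.
case/imsetP => m'; rewrite !extensions_link // => /andP[/extensionsP[fm e]].
move=> /eqP ea ->; have ta : t a = a by rewrite tpermD // eq_sym.
apply/andP; split; last by rewrite !ffunE ta ea tpermL.
apply/extensionsP; split.
  apply/full_matchingsP => z; rewrite !ffunE !tpermK.
  have [-> mz] := full_matchingsP _ fm (t z); split; first by rewrite tpermK.
  by apply: contra_neq mz => e'; rewrite -[in RHS]e' tpermK.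
have tz z : m z != z -> t z = z.
  by move=> mz; rewrite tpermD //; apply: contra_neq mz => <-.
move=> z mz; rewrite ffunE tz // e // tz //.
by apply: contra_neq mz; rewrite (involP _ im) => <-.
Qed.

Definition Eext (g : {ffun H -> H} -> R) m : R :=
  (\sum_(m' in extensions m) g m') / #|extensions m|%:R.

(** Every admissible partner of [a] leaves the same number of completions, so revealing a uniform
    partner preserves the mean. *)
Lemma Eext_link m a g : invol m -> m a = a ->
  \sum_(h | (m h == h) && (h != a)) Eext g (link m a h) =
  \sum_(h | (m h == h) && (h != a)) Eext g m.
Proof.
move=> im ma; pose P h := (m h == h) && (h != a).
case: (pickP P) => [h0 Ph0|P0]; last by rewrite !(big_pred0 _ _ _ _ P0).
pose e := #|extensions (link m a h0)|.
have eE h : P h -> #|extensions (link m a h)| = e.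
  move: Ph0 => /andP[/eqP mh0 h0a] /andP[/eqP mh ha].
  by apply/eqP; rewrite eqn_leq !card_extensions_link.
have cE : #|extensions m|%:R = (\sum_(h | P h) 1) * e%:R :> R.
  rewrite -sum1_card natr_sum (@sum_extensions_link m a) // mulr_suml.
  by apply: eq_bigr => h Ph; rewrite -natr_sum sum1_card eE // mul1r.
have -> : \sum_(h | P h) Eext g m = (\sum_(h | P h) 1) * Eext g m.
  by rewrite mulr_suml; apply: eq_bigr => *; rewrite mul1r.
rewrite /Eext cE (@sum_extensions_link m a) //.
under eq_bigr => h Ph do rewrite eE //.
rewrite -mulr_suml; set S1 := \sum_(h | P h) 1; set A := (X in X / _ = _).
have S10 : S1 != 0.
  rewrite /S1 (bigD1 h0) //= paddr_eq0 ?oner_eq0 //; exact: sumr_ge0.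
(* Only [S1] is cancelled, so the identity also holds for [e = 0], where both sides are divisions by
   zero. *)
by rewrite invfM (mulrCA A) (mulrA S1) mulfV // mul1r.
Qed.

End partial_matchings.

Section exploration.
Variables (R : realType) (H I : finType) (c : H -> I).
Implicit Types (m : {ffun H -> H}) (h : H) (i x : I) (D S : {set I}).

(* [disc] are the communities found so far, [starts] those among them that opened a new
   component, [todo] the candidates for opening the next ones. *)
Record state := State {
  mt : {ffun H -> H}; disc : {set I}; starts : {set I}; todo : seq I }.

Definition active m D : {set H} := [set h | (c h \in D) && (m h == h)]%SET.

Definition act st := active (mt st) (disc st).

(** Restores the property that some half-edge is active as long as candidates remain. A candidate
    without half-edges forms a component by itself, and the search goes on. *)
Fixpoint normalise m D S xs : state :=
  if active m D != finset.set0 then State m D S xs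
  else if xs is x :: xs' then
    if x \in D then normalise m D S xs'
    else normalise m (x |: D)%SET (x |: S)%SET xs'
  else State m D S [::].

(* Skipping the draws that cannot be used keeps the draws independent of the state. *)
Definition step st h : state :=
  if [pick a in act st] is Some a then
    if (mt st h == h) && (h != a) then
      normalise (link (mt st) a h) (c h |: disc st)%SET (starts st) (todo st)
    else st
  else st.

Definition start xs := normalise [ffun z => z] finset.set0 finset.set0 xs.

Definition run xs w := foldl step (start xs) w.

Lemma run_rcons xs w h : run xs (rcons w h) = step (run xs w) h.
Proof. by rewrite /run -cats1 foldl_cat. Qed.

Lemma mt_normalise m D S xs : mt (normalise m D S xs) = m.
Proof. by elim: xs D S => [|x xs IH] D S /=; do !case: ifP. Qed.

Lemma act_in st a : a \in act st -> (c a \in disc st) /\ mt st a = a.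
Proof. by rewrite inE => /andP[-> /eqP]. Qed.

Lemma invol_step st h : invol (mt st) -> invol (mt (step st h)).
Proof.
rewrite /step => im; case: pickP => // a /act_in[_ ma].
by case: ifP => // /andP[/eqP mh _]; rewrite mt_normalise invol_link.
Qed.

Lemma invol_run xs w : invol (mt (run xs w)).
Proof.
elim/last_ind: w => [|w h IH]; last by rewrite run_rcons invol_step.
by rewrite /run /= mt_normalise; apply/involP => z; rewrite !ffunE.
Qed.

(** A skipped draw leaves the partial matching alone, and a usable draw is uniform over the possible
    partners; so the conditional mean is a martingale. *)
Lemma Eext_step (g : {ffun H -> H} -> R) st : invol (mt st) -> (0 < #|H|)%N ->
  \sum_h (#|H|%:R^-1) * Eext g (mt (step st h)) = Eext g (mt st).
Proof.
move=> im H0; rewrite -mulr_sumr.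
have cardE : \sum_(h : H) Eext g (mt st) = #|H|%:R * Eext g (mt st).
  by rewrite sumr_const mulr_natl.
suff -> : \sum_h Eext g (mt (step st h)) = \sum_(h : H) Eext g (mt st).
  by rewrite cardE mulKf // pnatr_eq0 -lt0n.
rewrite /step; case: pickP => [a /act_in[_ ma]|//].
rewrite (bigID (fun h => (mt st h == h) && (h != a))) /=.
rewrite [RHS](bigID (fun h => (mt st h == h) && (h != a))) /=.
congr (_ + _).
  rewrite -Eext_link //; apply: eq_bigr => h ->.
  by rewrite mt_normalise.
by apply: eq_bigr => h /negbTE ->.
Qed.

(** Iid draws followed by a uniform completion produce exactly a uniform matching. This transfers
    estimates on the draws to the random graph, for any list [xs] of starting points. *)
Lemma Eext_run (g : {ffun H -> H} -> R) xs K : (0 < #|H|)%N ->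
  EL (fun=> #|H|%:R^-1) K (fun w => Eext g (mt (run xs w))) =
  (\sum_(m in full_matchings H) g m) / #|full_matchings H|%:R.
Proof.
move=> H0; have fullE : extensions [ffun z => z] = full_matchings H.
  apply/finset.setP => m'; apply/extensionsP/idP => [[]//|fm]; split => // z.
  by rewrite ffunE eqxx.
suff -> : EL (fun=> #|H|%:R^-1) K (fun w => Eext g (mt (run xs w))) =
          Eext g (mt (run xs [::])).
  by rewrite /run /= mt_normalise /Eext fullE.
elim: K => // K IH; rewrite EL_rcons -IH; apply: eq_EL => w _.
by under eq_bigr do rewrite run_rcons; rewrite Eext_step // invol_run.
Qed.

End exploration.

(** * The exploration walk *)

Section exploration_trace.
Variables (R : realType) (H I : finType) (c : H -> I) (siz : I -> nat).
Variables (dmax smax : nat).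
Implicit Types (m : {ffun H -> H}) (h : H) (i x : I) (D S C cur : {set I}).
Implicit Type recs : seq (nat * nat * {set I}).

Definition hdeg i : nat := #|[set h | c h == i]%SET|.
Hypothesis dmaxP : forall i, (hdeg i <= dmax)%N.
Hypothesis smaxP : forall i, (siz i <= smax)%N.

Definition adj m : rel I :=
  fun i j => [exists h, [&& m h != h, c h == i & c (m h) == j]].

Definition extends m m' := forall z, m z != z -> m' z = m z.

(** For a partial matching [comp_closed] demands that all half-edges of [C] be paired already, so
    that a completed component survives every extension. *)
Record comp_of m C : Prop := CompOf {
  comp_neq0 : C != finset.set0;
  comp_closed : forall h, c h \in C -> m h != h /\ c (m h) \in C;
  comp_conn : {in C &, forall i j, connect (adj m) i j} }.

Lemma adj_extends m m' i j : extends m m' -> connect (adj m) i j -> connect (adj m') i j.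
Proof.
move=> mm'; apply: connect_sub => {}i {}j /existsP[h /and3P[mh ci cj]].
by apply/connect1/existsP; exists h; rewrite mm' // mh ci.
Qed.

Lemma comp_extends m m' C : extends m m' -> comp_of m C -> comp_of m' C.
Proof.
move=> mm' [C0 Ccl Cco]; split=> //.
  by move=> h /Ccl[mh ?]; rewrite mm'.
by move=> i j iC jC; apply: adj_extends mm' _; exact: Cco.
Qed.

Lemma extends_link m a h : m a = a -> m h = h -> extends m (link m a h).
Proof.
move=> ma mh z mz; rewrite ffunE.
case: (eqVneq z a) mz => [->|_]; first by rewrite ma eqxx.
by case: (eqVneq z h) => [->|_]; first by rewrite mh eqxx.
Qed.

Lemma extends_extensions m m' : m' \in extensions m -> extends m m'.
Proof. by move=> /extensionsP[]. Qed.

Definition degsum S : R := \sum_(i in S) (hdeg i)%:R.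
Definition sizsum S : R := \sum_(i in S) (siz i)%:R.
(** The number of active half-edges minus the degrees of the starts ([active_count]). Leaving the
    starts out lets the walk sink from one component to the next instead of being reset, so that
    components end at running minima. *)
Definition Zval m D S : R := degsum (D :\: S)%SET - #|[set h | m h != h]%SET|%:R.
Definition Vval D S : R := sizsum (D :\: S)%SET.

Lemma active_count m D S : (forall h, m h != h -> c h \in D) -> S \subset D ->
  #|active c m D|%:R = degsum S + Zval m D S :> R.
Proof.
move=> pd SD; rewrite /Zval addrA.
have -> : degsum S + degsum (D :\: S)%SET = degsum D.
  by rewrite /degsum [in RHS](big_setID S) /= (finset.setIidPr SD).
have -> : degsum D = #|[set h | c h \in D]%SET|%:R.
  rewrite -sum1_card (partition_big c (mem D)) /=; last by move=> h; rewrite inE.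
  rewrite natr_sum; apply: eq_bigr => i iD; rewrite /hdeg -sum1_card; congr (_%:R).
  apply: eq_bigl => h; rewrite !inE; case: eqP => [->|]; rewrite ?andbF ?iD //.
rewrite -(cardsID [set h | m h != h]%SET [set h | c h \in D]%SET) natrD addrAC.
have -> : ([set h | c h \in D]%SET :&: [set h | m h != h]%SET)%SET = [set h | m h != h]%SET.
  by apply/finset.setP => h; rewrite !inE andb_idl //; exact: pd.
rewrite subrr add0r; congr (_%:R); apply: eq_card => h.
by rewrite !inE negbK andbC.
Qed.

Fixpoint chain (a : nat) recs (b : nat) : Prop :=
  if recs is r :: recs' then r.1.1 = a /\ chain r.1.2 recs' b else a = b.

Lemma chain_rcons a recs b e C : chain a recs b -> chain a (rcons recs (b, e, C)) e.
Proof. by elim: recs a => [|r recs IH] a /= => [->|[-> /IH]]. Qed.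

Definition inrec recs i := has (fun r : nat * nat * {set I} => i \in r.2) recs.

Definition recdisj (r r' : nat * nat * {set I}) := (r.2 :&: r'.2)%SET == finset.set0.

(** A record holds beginning, end and communities of a finished component. The slack [dmax] is the
    degree of its start, the slack [smax] the size of its start: neither [Z] nor [V] sees that
    community. *)
Definition rec_ok (Zh Vh : nat -> R) (t : nat) (r : nat * nat * {set I}) : Prop :=
  [/\ (r.1.1 <= r.1.2 <= t)%N,
      (forall u, (u <= r.1.2)%N -> Zh r.1.2 <= Zh u),
      (forall u, (r.1.1 <= u <= r.1.2)%N -> Zh r.1.1 - dmax%:R <= Zh u)
    & Vh r.1.2 - Vh r.1.1 <= sizsum r.2 <= Vh r.1.2 - Vh r.1.1 + smax%:R].

(** Here [k] candidates have been consumed, and [cur] is the component under exploration since time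
    [tau]. The bound [k.-1] in [ti_first] is there because the last candidate consumed may have
    opened [cur]. *)
Record trace_inv (xs : seq I) (Zh Vh : nat -> R) (t : nat) (k : nat) recs cur
    (tau : nat) m D S (xs' : seq I) : Prop := TraceInv {
  ti_invol : invol m;
  ti_paired : forall h, m h != h -> c h \in D;
  ti_SD : S \subset D;
  ti_todo : xs' = drop k xs;
  ti_popped : {subset take k xs <= D};
  ti_starts : {subset S <= take k xs};
  ti_D : forall i, (i \in D) = (i \in cur) || inrec recs i;
  ti_first : forall i, i \in take k.-1 xs -> inrec recs i;
  ti_disj : pairwise recdisj recs;
  ti_curdisj : forall i, i \in cur -> ~~ inrec recs i;
  ti_chain : chain 0 recs tau;
  ti_tau : (tau <= t)%N;
  ti_comp : forall r, r \in recs -> comp_of m r.2;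
  ti_curcl : forall h, c h \in cur -> c (m h) \in cur;
  ti_curco : {in cur &, forall i j, connect (adj m) i j};
  ti_Z : forall u, (u <= t)%N -> - degsum S <= Zh u;
  ti_DZ : degsum S <= - Zh tau + dmax%:R;
  ti_Zt : Zh t = Zval m D S;
  ti_Vt : Vh t = Vval D S;
  ti_rec : forall r, r \in recs -> rec_ok Zh Vh t r;
  ti_min : forall u, (u <= tau)%N -> Zh tau <= Zh u;
  ti_curV : Vh t - Vh tau <= sizsum cur <= Vh t - Vh tau + smax%:R;
  ti_empty : cur = finset.set0 -> xs' = [::] \/ tau = t }.

Lemma active_in_cur xs Zh Vh t k recs cur tau m D S xs' :
  trace_inv xs Zh Vh t k recs cur tau m D S xs' ->
  forall a, c a \in D -> m a = a -> c a \in cur.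
Proof.
move=> i a; rewrite (ti_D i) => /orP[//|/hasP[r rr ar]] ma.
by have [] := comp_closed (ti_comp i rr) ar; rewrite ma eqxx.
Qed.

(** Without active half-edges [Zh t = - degsum S], and [ti_Z] says that this is the lowest value so
    far. *)
Lemma trace_close xs Zh Vh t k recs cur tau m D S xs' :
  trace_inv xs Zh Vh t k recs cur tau m D S xs' ->
  active c m D = finset.set0 -> cur != finset.set0 ->
  trace_inv xs Zh Vh t k (rcons recs (tau, t, cur)) finset.set0 t m D S xs'.
Proof.
move=> i a0 cur0.
have AZ : degsum S + Zh t = 0.
  by rewrite (ti_Zt i) -active_count ?a0 ?finset.cards0 //; [exact: ti_paired i|exact: ti_SD i].
have minZ u : (u <= t)%N -> Zh t <= Zh u.
  by move=> /(ti_Z i) h; lra.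
case: (i) => im pd SD td pop st Deq fs dj cdj ch tt co ccl cco Z DZ Zt Vt rk mn cV em.
split=> //.
- by move=> j; rewrite Deq /inrec has_rcons finset.in_set0.
- by move=> j /fs; rewrite /inrec has_rcons => ->; rewrite orbT.
- rewrite -cats1 pairwise_cat dj /= allrel1r andbT; apply/allP => r rr /=.
  apply/eqP/finset.setP => j; rewrite !inE; apply/negbTE/negP => /andP[jr].
  by move=> /cdj /hasPn/(_ _ rr) /negP.
- by move=> j; rewrite finset.in_set0.
- exact: chain_rcons.
- move=> r; rewrite mem_rcons inE => /orP[/eqP ->|/co//] /=; split=> //.
  move=> h hc; split; last exact: ccl.
  apply/negP => /eqP mh; have : h \in active c m D.
    by rewrite inE mh eqxx Deq hc.
  by rewrite a0 finset.in_set0.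
- by move=> h; rewrite finset.in_set0.
- by move=> ? ?; rewrite finset.in_set0.
- rewrite -[degsum S]opprK -(addr0_eq AZ) opprK.
  by rewrite lerDl.
- move=> r; rewrite mem_rcons inE => /orP[/eqP ->|/rk//] /=.
  split=> //=; first by rewrite tt leqnn.
  move=> u /andP[_ ut]; have := Z _ ut; apply: le_trans.
  by move: DZ; lra.
- by rewrite /sizsum big_set0 subrr lexx /= add0r ler0n.
- by move=> _; right.
Qed.

Lemma trace_skip xs Zh Vh t k recs tau m D S x xs' :
  trace_inv xs Zh Vh t k recs finset.set0 tau m D S (x :: xs') -> x \in D ->
  trace_inv xs Zh Vh t k.+1 recs finset.set0 tau m D S xs'.
Proof.
move=> [im pd SD td pop st Deq fs dj cdj ch tt co ccl cco Z DZ Zt Vt rk mn cV em] xD.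
have kxs : (k < size xs)%N.
  by rewrite ltnNge; apply/negP => /drop_oversize e; rewrite e in td.
have xE : x = nth x xs k by rewrite -[k in RHS]addn0 -nth_drop -td.
have tk : take k.+1 xs = rcons (take k xs) x by rewrite (take_nth x) // -xE.
split=> //.
- by rewrite -[k.+1]add1n -drop_drop -td /= drop0.
- by move=> i; rewrite tk mem_rcons inE => /orP[/eqP ->|/pop].
- by move=> i /st; rewrite tk mem_rcons inE => ->; rewrite orbT.
- by move=> i /= /pop; rewrite Deq finset.in_set0.
- by move=> _; case: em => // ->; right.
Qed.

(** Opening a component changes neither [Z] nor [V], since both leave the starts out. *)
Lemma trace_new xs Zh Vh t k recs m D S x xs' :
  trace_inv xs Zh Vh t k recs finset.set0 t m D S (x :: xs') -> x \notin D ->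
  active c m D = finset.set0 ->
  trace_inv xs Zh Vh t k.+1 recs [set x]%SET t m (x |: D)%SET (x |: S)%SET xs'.
Proof.
move=> i xD a0.
have AZ : degsum S + Zh t = 0.
  by rewrite (ti_Zt i) -active_count ?a0 ?finset.cards0 //; [exact: ti_paired i|exact: ti_SD i].
move: i => [im pd SD td pop st Deq fs dj cdj ch tt co ccl cco Z DZ Zt Vt rk mn cV em].
have kxs : (k < size xs)%N.
  by rewrite ltnNge; apply/negP => /drop_oversize e; rewrite e in td.
have xE : x = nth x xs k by rewrite -[k in RHS]addn0 -nth_drop -td.
have tk : take k.+1 xs = rcons (take k xs) x by rewrite (take_nth x) // -xE.
have xS : x \notin S by apply: contra xD => /(fintype.subsetP SD).
have DS : ((x |: D) :\: (x |: S))%SET = (D :\: S)%SET.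
  apply/finset.setP => i; rewrite !inE; case: eqP => [->|] //=.
  by rewrite (negbTE xD) andbF.
have mx h : c h = x -> m h = h.
  by move=> cx; apply/eqP; apply: contraT => /pd; rewrite cx (negbTE xD).
have sS : degsum (x |: S)%SET = (hdeg x)%:R + degsum S by rewrite /degsum big_setU1.
split=> //.
- by move=> h /pd hD; rewrite inE hD orbT.
- by apply: finset.setUS.
- by rewrite -[k.+1]add1n -drop_drop -td /= drop0.
- by move=> i; rewrite tk mem_rcons !inE => /orP[->//|/pop ->]; rewrite orbT.
- by move=> i; rewrite !inE tk mem_rcons inE => /orP[->//|/st ->]; rewrite orbT.
- by move=> i; rewrite !inE Deq finset.in_set0.
- by move=> i /= /pop; rewrite Deq finset.in_set0.
- by move=> i; rewrite inE => /eqP ->; apply: contra xD; rewrite Deq => ->; rewrite orbT.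
- by move=> h; rewrite !inE => /eqP hx; rewrite mx ?hx.
- by move=> i j; rewrite !inE => /eqP -> /eqP ->.
- move=> u ut; apply: le_trans (Z _ ut).
  by rewrite lerN2 sS lerDr.
- by rewrite sS addrC -(addr0_eq AZ) opprK lerD2l ler_nat.
- by rewrite /Zval DS.
- by rewrite /Vval DS.
- by rewrite subrr add0r /sizsum big_set1 ler0n ler_nat smaxP.
- by move=> /finset.setP/(_ x); rewrite !inE eqxx.
Qed.

Lemma trace_normalise xs Zh Vh t k recs cur tau m D S xs' :
  trace_inv xs Zh Vh t k recs cur tau m D S xs' ->
  exists k' recs' cur' tau', let st := normalise c m D S xs' in
   trace_inv xs Zh Vh t k' recs' cur' tau' m (disc st) (starts st) (todo st) /\
   (act c st != finset.set0 \/ todo st = [::]).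
Proof.
elim: xs' k recs cur tau D S => [|x xs' IH] k recs cur tau D S i /=.
  case: ifPn => [a0|_]; exists k, recs, cur, tau; split=> //; by [left|right].
case: ifPn => [a0|]; first by exists k, recs, cur, tau; split=> //; left.
rewrite negbK => /eqP a0.
have {i} [recs1 i] : exists recs1,
    trace_inv xs Zh Vh t k recs1 finset.set0 t m D S (x :: xs').
  have [cur0|cur0] := eqVneq cur finset.set0; last first.
    by exists (rcons recs (tau, t, cur)); exact: trace_close.
  move: i; rewrite cur0 => i; have [//|e] := ti_empty i erefl.
  by move: i; rewrite e => i; exists recs.
case: ifPn => xD; first exact: IH (trace_skip i xD).
exact: IH (trace_new i xD a0).
Qed.

Lemma eq_trace xs Zh Vh Zh' Vh' t k recs cur tau m D S xs' :
  (forall u, (u <= t)%N -> Zh' u = Zh u) -> (forall u, (u <= t)%N -> Vh' u = Vh u) ->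
  trace_inv xs Zh Vh t k recs cur tau m D S xs' ->
  trace_inv xs Zh' Vh' t k recs cur tau m D S xs'.
Proof.
move=> eZ eV [im pd SD td pop st Deq fs dj cdj ch tt co ccl cco Z DZ Zt Vt rk mn cV em].
split=> //.
- by move=> u ut; rewrite eZ // Z.
- by rewrite eZ.
- by rewrite eZ.
- by rewrite eV.
- move=> r /rk[/andP[r1 r2] rZ rZ2 rV]; split; rewrite ?r1 ?r2 //.
  + by move=> u ur; rewrite !eZ ?rZ // (leq_trans ur).
  + move=> u /andP[ur1 ur2]; rewrite !eZ ?rZ2 ?ur1 ?(leq_trans ur2) //.
    exact: leq_trans r1 r2.
  + by rewrite !eV // (leq_trans r1).
- by move=> u ut; rewrite !eZ ?mn // (leq_trans ut).
- by rewrite !eV.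
Qed.

Lemma rec_okS Zh Vh t r : rec_ok Zh Vh t r -> rec_ok Zh Vh t.+1 r.
Proof. by case=> /andP[r1 r2] *; split=> //; rewrite r1 ltnW. Qed.

Lemma trace_stay xs Zh Vh t k recs cur tau m D S xs' :
  trace_inv xs Zh Vh t k recs cur tau m D S xs' ->
  (cur = finset.set0 -> xs' = [::]) -> Zh t.+1 = Zh t -> Vh t.+1 = Vh t ->
  trace_inv xs Zh Vh t.+1 k recs cur tau m D S xs'.
Proof.
move=> [im pd SD td pop st Deq fs dj cdj ch tt co ccl cco Z DZ Zt Vt rk mn cV em] cn eZ eV.
split; rewrite ?eZ ?eV //.
- exact: leqW.
- by move=> u; rewrite leq_eqVlt => /orP[/eqP ->|]; [rewrite eZ; exact: Z|exact: Z].
- by move=> r /rk /rec_okS.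
- by left; exact: cn.
Qed.

Lemma trace_link xs Zh Vh t k recs cur tau m D S xs' a h :
  trace_inv xs Zh Vh t k recs cur tau m D S xs' ->
  c a \in cur -> m a = a -> m h = h -> h != a ->
  Zh t.+1 = Zval (link m a h) (c h |: D)%SET S -> Vh t.+1 = Vval (c h |: D)%SET S ->
  trace_inv xs Zh Vh t.+1 k recs (c h |: cur)%SET tau (link m a h) (c h |: D)%SET S xs'.
Proof.
move=> [im pd SD td pop st Deq fs dj cdj ch tt co ccl cco Z DZ Zt Vt rk mn cV em].
move=> acur ma mh ha eZ eV.
have norec z : m z = z -> ~~ inrec recs (c z).
  move=> mz; apply/negP => /hasP[r rr zr].
  by have [] := comp_closed (co _ rr) zr; rewrite mz eqxx.
have ext := extends_link ma mh.
have la : link m a h a = h by rewrite ffunE eqxx.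
have lh : link m a h h = a by rewrite ffunE (negbTE ha) eqxx.
have pd' z : link m a h z != z -> c z \in (c h |: D)%SET.
  rewrite ffunE; case: (eqVneq z a) => [-> _|_].
    by rewrite inE Deq acur !orbT.
  case: (eqVneq z h) => [-> _|_]; first by rewrite !inE eqxx.
  by move=> /pd zD; rewrite inE zD orbT.
have SD' : S \subset (c h |: D)%SET by apply: (fintype.subset_trans SD); exact: finset.subsetUr.
have nD : c h \notin D -> c h \notin cur by apply: contra => hc; rewrite Deq hc.
have eqv : forall i, i \in (c h |: cur)%SET ->
    connect (adj (link m a h)) i (c a) /\ connect (adj (link m a h)) (c a) i.
  move=> i; rewrite !inE => /orP[/eqP ->|ic]; last first.
    by split; apply: adj_extends ext _; exact: cco.
  split; apply/connect1/existsP.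
    by exists h; rewrite lh eq_sym ha !eqxx.
  by exists a; rewrite la ha !eqxx.
split=> //.
- exact: invol_link.
- by move=> i /pop iD; rewrite inE iD orbT.
- by move=> i; rewrite !inE Deq orbA.
- move=> i; rewrite !inE => /orP[/eqP ->|/cdj//]; exact: norec.
- exact: leqW.
- by move=> r /co; exact: comp_extends.
- move=> z; rewrite ffunE; case: (eqVneq z a) => [_ _|_].
    by rewrite !inE eqxx.
  case: (eqVneq z h) => [_ _|_]; first by rewrite !inE acur orbT.
  rewrite !inE => /orP[/eqP cz|/ccl ->]; last by rewrite orbT.
  have [mz|mz] := eqVneq (m z) z; first by rewrite mz cz eqxx.
  suff zc : c z \in cur by rewrite ccl // orbT.
  have := pd _ mz; rewrite Deq => /orP[//|].
  by rewrite cz (negbTE (norec _ mh)).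
- move=> i j /eqv[ia _] /eqv[_ aj]; exact: connect_trans ia aj.
(* At the new time the bound says that the number of active half-edges is nonnegative. *)
- move=> u; rewrite leq_eqVlt => /orP[/eqP ->|]; last exact: Z.
  have := active_count pd' SD'; rewrite -eZ => e.
  have : 0 <= degsum S + Zh t.+1 by rewrite -e ler0n.
  by lra.
- by move=> r /rk /rec_okS.
- rewrite eV; have [hD|hD] := boolP (c h \in D).
    have hc : c h \in cur by move: hD; rewrite Deq (negbTE (norec _ mh)) orbF.
    by rewrite !(finset.setUidPr _) ?finset.sub1set // -Vt.
  have hS : c h \notin S by apply: contra hD => /(fintype.subsetP SD).
  have E : ((c h |: D) :\: S)%SET = (c h |: (D :\: S))%SET.
    by rewrite finset.setDUl; congr (_ :|: _)%SET; apply/finset.setDidPl; rewrite disjoints1.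
  rewrite /Vval E /sizsum !big_setU1 ?nD //=; last by rewrite inE negb_and hD orbT.
  have := cV; rewrite Vt /Vval /sizsum => /andP[? ?].
  by apply/andP; split; lra.
- by move=> /finset.setP/(_ (c h)); rewrite !inE eqxx.
Qed.

Definition Zrun xs w : R := let st := run c xs w in Zval (mt st) (disc st) (starts st).
Definition Vrun xs w : R := let st := run c xs w in Vval (disc st) (starts st).

Lemma normalise_new m D S xs' : S \subset D -> let st := normalise c m D S xs' in
  (disc st :\: starts st)%SET = (D :\: S)%SET.
Proof.
elim: xs' D S => [|x xs' IH] D S SD /=; case: ifP => // _.
case: ifPn => xD; first exact: IH.
rewrite /= IH; last exact: finset.setUS.
apply/finset.setP => i; rewrite !inE; case: eqP => [->|] //=.
by rewrite (negbTE xD) andbF.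
Qed.

Lemma trace_run xs w : exists k recs cur tau, let st := run c xs w in
  trace_inv xs (fun u => Zrun xs (take u w)) (fun u => Vrun xs (take u w))
    (size w) k recs cur tau (mt st) (disc st) (starts st) (todo st) /\
  (act c st != finset.set0 \/ todo st = [::]).
Proof.
elim/last_ind: w => [|w h [k [recs [cur [tau [i ac]]]]]].
  pose m0 : {ffun H -> H} := [ffun z => z].
  have m0E z : m0 z = z by rewrite ffunE.
  have runE : run c xs [::] = normalise c m0 finset.set0 finset.set0 xs by [].
  have DS0 := normalise_new m0 xs (fintype.subxx (finset.set0 : {set I})).
  have Z0 u : Zrun xs (take u [::]) = 0.
    rewrite /Zrun /= runE /Zval DS0 mt_normalise finset.set0D /degsum big_set0.
    rewrite (_ : [set h | m0 h != h]%SET = finset.set0) ?finset.cards0 ?subrr //.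
    by apply/finset.setP => z; rewrite !inE m0E eqxx.
  have V0 u : Vrun xs (take u [::]) = 0.
    by rewrite /Vrun /= runE /Vval DS0 finset.set0D /sizsum big_set0.
  have [|k [recs [cur [tau i]]]] := @trace_normalise xs
    (fun u => Zrun xs (take u [::])) (fun u => Vrun xs (take u [::]))
    0 0 [::] finset.set0 0 m0 finset.set0 finset.set0 xs; last first.
    by exists k, recs, cur, tau; rewrite /= runE mt_normalise; exact: i.
  have d0 : degsum finset.set0 = 0 by rewrite /degsum big_set0.
  split=> //.
  - by apply/involP => z; rewrite !m0E.
  - by move=> z; rewrite m0E eqxx.
  - by rewrite drop0.
  - by rewrite take0.
  - by move=> z; rewrite finset.in_set0.
  - by move=> z; rewrite finset.in_set0.
  - by rewrite take0.
  - by move=> z; rewrite finset.in_set0.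
  - by move=> z; rewrite finset.in_set0.
  - by move=> u _; rewrite Z0 d0 oppr0.
  - by rewrite Z0 d0 oppr0 add0r.
  - by rewrite /Zrun /= runE /Zval DS0 mt_normalise.
  - by rewrite V0 /Vval finset.set0D /sizsum big_set0.
  - by rewrite !V0 /sizsum big_set0 subrr lexx add0r ler0n.
  - by move=> _; right.
pose Zh u := Zrun xs (take u (rcons w h)).
pose Vh u := Vrun xs (take u (rcons w h)).
have tk u : (u <= size w)%N -> take u (rcons w h) = take u w.
  by move=> uw; rewrite -cats1 takel_cat.
have tkS : take (size w).+1 (rcons w h) = rcons w h by rewrite take_oversize // size_rcons.
have {}i := @eq_trace _ _ _ Zh Vh _ _ _ _ _ _ _ _ _
  (fun u uw => congr1 (Zrun xs) (tk u uw)) (fun u uw => congr1 (Vrun xs) (tk u uw)) i.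
rewrite run_rcons size_rcons -/Zh -/Vh.
have ZS : Zh (size w).+1 = let st := step c (run c xs w) h in Zval (mt st) (disc st) (starts st).
  by rewrite /Zh tkS /Zrun run_rcons.
have VS : Vh (size w).+1 = let st := step c (run c xs w) h in Vval (disc st) (starts st).
  by rewrite /Vh tkS /Vrun run_rcons.
have stay : (cur = finset.set0 -> todo (run c xs w) = [::]) ->
    step c (run c xs w) h = run c xs w ->
    exists k recs cur tau, let st := step c (run c xs w) h in
      trace_inv xs Zh Vh (size w).+1 k recs cur tau (mt st) (disc st) (starts st) (todo st) /\
      (act c st != finset.set0 \/ todo st = [::]).
  move=> cn e; exists k, recs, cur, tau; rewrite /= e; split=> //.
  apply: trace_stay i cn _ _.
    by rewrite ZS e /Zh tk // take_size.
  by rewrite VS e /Vh tk // take_size.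
move: ZS VS stay; rewrite /step; case: pickP => [a aa|a0] ZS VS stay; last first.
  apply: stay => // _; case: ac => // /set0Pn[a]; by rewrite a0.
have [aD ma] := act_in aa; have acur := active_in_cur i aD ma.
move: ZS VS stay; case: ifP => [/andP[/eqP mh ha]|_] ZS VS stay; last first.
  by apply: stay => // cur0; rewrite cur0 finset.in_set0 in acur.
have SD : starts (run c xs w) \subset (c h |: disc (run c xs w))%SET.
  by apply: (fintype.subset_trans (ti_SD i)); exact: finset.subsetUr.
have [||k' [recs' [cur' [tau' i']]]] := trace_normalise (trace_link i acur ma mh ha _ _).
- by rewrite ZS /= /Zval normalise_new // mt_normalise.
- by rewrite VS /= /Vval normalise_new.
by exists k', recs', cur', tau'; rewrite /= mt_normalise.
Qed.

Definition covers (xs : seq I) := forall x, x \in xs.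

Lemma card_paired_run xs w :
  (#|[set h | mt (run c xs w) h != h]%SET| <= 2 * size w)%N.
Proof.
elim/last_ind: w => [|w h IH].
  rewrite /run /= mt_normalise (_ : [set h | _]%SET = finset.set0) ?finset.cards0 //.
  by apply/finset.setP => h; rewrite !inE ffunE eqxx.
have IH' : (#|[set h | mt (run c xs w) h != h]%SET| <= 2 * (size w).+1)%N.
  by apply: leq_trans IH _; rewrite leq_pmul2l.
rewrite run_rcons size_rcons /step; case: pickP => // a aa.
case: ifP => // _; rewrite mt_normalise.
set P := [set h | mt (run c xs w) h != h]%SET in IH *.
apply: (@leq_trans #|(a |: (h |: P))%SET|).
  apply/subset_leq_card/fintype.subsetP => z; rewrite !inE ffunE.
  by case: (z == a) => //=; case: (z == h) => //=.
rewrite !cardsU1; have := leq_b1 (a \notin (h |: P)%SET); have := leq_b1 (h \notin P).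
by move: IH; lia.
Qed.

(** Each draw pairs at most two half-edges, so some half-edge is still unpaired; as the candidates
    cover all communities, the exploration cannot have run dry. *)
Lemma act_run_neq0 xs w : covers xs -> (2 * size w < #|H|)%N ->
  act c (run c xs w) != finset.set0.
Proof.
move=> cov wH; have [k [recs [cur [tau [i [//|todo0]]]]]] := trace_run xs w.
apply/negP => /eqP a0.
have DT j : j \in disc (run c xs w).
  have kx : (size xs <= k)%N.
    by rewrite leqNgt; apply/negP => kx; move: (ti_todo i); rewrite todo0 (drop_nth j).
  by apply: (ti_popped i); rewrite take_oversize.
have : (#|H| <= #|[set h | mt (run c xs w) h != h]%SET|)%N.
  rewrite -cardsT; apply/subset_leq_card/fintype.subsetP => h _; rewrite inE.
  apply/negP => mh; have : h \in act c (run c xs w) by rewrite inE DT mh.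
  by rewrite a0 finset.in_set0.
by rewrite leqNgt (leq_ltn_trans _ wH) // card_paired_run.
Qed.

Lemma disc_normalise m D S xs' i :
  i \in disc (normalise c m D S xs') ->
  (i \in D) || (i \in starts (normalise c m D S xs')).
Proof.
elim: xs' D S => [|x xs' IH] D S /=; case: ifP => _ /=; do ?by move=> ->.
case: ifP => xD; first exact: IH.
move=> /IH; rewrite !inE => /orP[/orP[/eqP ->|->//]|->]; last by rewrite orbT.
suff -> : x \in starts (normalise c m (x |: D) (x |: S) xs') by rewrite orbT.
have sub : forall D' S' ys, S' \subset starts (normalise c m D' S' ys).
  move=> D' S' ys; elim: ys D' S' => [|y ys IH'] D' S' /=; case: ifP => //= _.
  case: ifP => // _; apply: fintype.subset_trans (IH' _ _); exact: finset.subsetUr.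
by apply: (fintype.subsetP (sub _ _ _)); rewrite !inE eqxx.
Qed.

Lemma sub_disc_normalise m D S xs' : D \subset disc (normalise c m D S xs').
Proof.
elim: xs' D S => [|x xs' IH] D S /=; case: ifP => //= _.
by case: ifP => // _; apply: fintype.subset_trans (IH _ _); exact: finset.subsetUr.
Qed.

Lemma sub_starts_normalise m D S xs' : S \subset starts (normalise c m D S xs').
Proof.
elim: xs' D S => [|x xs' IH] D S /=; case: ifP => //= _.
by case: ifP => // _; apply: fintype.subset_trans (IH _ _); exact: finset.subsetUr.
Qed.

Lemma disc_run xs w i : i \in disc (run c xs w) ->
  (i \in map c w) || (i \in starts (run c xs w)).
Proof.
elim/last_ind: w => [|w h IH]; first by move=> /disc_normalise; rewrite finset.in_set0.
have key : i \in disc (run c xs w) ->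
    (i \in map c (rcons w h)) || (i \in starts (run c xs w)).
  by move=> /IH; rewrite map_rcons mem_rcons inE => /orP[->|->]; rewrite ?orbT.
rewrite run_rcons /step; case: pickP => // a aa; case: ifP => // _.
move=> /disc_normalise; rewrite !inE => /orP[/orP[/eqP ->|/key]|->]; last by rewrite orbT.
- by rewrite map_rcons mem_rcons inE eqxx.
- by move=> /orP[->//|iS]; rewrite (fintype.subsetP (sub_starts_normalise _ _ _ _) _ iS) orbT.
Qed.

(** Even a skipped draw lies in a community already found: it is a paired half-edge or the active
    half-edge to be matched. *)
Lemma map_run xs w : covers xs -> (2 * size w < #|H|)%N ->
  {subset map c w <= disc (run c xs w)}.
Proof.
move=> cov; elim/last_ind: w => [//|w h IH]; rewrite size_rcons => wH i.
have {}wH : (2 * size w < #|H|)%N by apply: leq_ltn_trans wH; rewrite leq_pmul2l.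
rewrite map_rcons mem_rcons inE run_rcons /step.
case: pickP => [a aa|a0]; last first.
  by have /set0Pn[a] := act_run_neq0 cov wH; rewrite a0.
case: ifPn => [_|].
  move=> ih; apply: (fintype.subsetP (sub_disc_normalise _ _ _ _)).
  by rewrite !inE; case/orP: ih => [->//|/(IH wH) ->]; rewrite orbT.
rewrite negb_and negbK => ha /orP[/eqP ->|/(IH wH)//].
have [k [recs [cur [tau [ti _]]]]] := trace_run xs w.
case/orP: ha => [/(ti_paired ti)//|/eqP ->]; by case/act_in: aa.
Qed.

(* Outside this set, a drawn half-edge changes the exploration walk exactly as
   in the first-occurrence walk, which depends on the drawn half-edges only. *)
Definition badset xs w : {set H} :=
  [set h | (c h \in starts (run c xs w)) || (h \in act c (run c xs w))]%SET.

Definition fresh (f : I -> R) (pre : seq H) h : R :=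
  if c h \in map c pre then 0 else f (c h).

Lemma Zrun_rcons xs w h : covers xs -> (2 * size w < #|H|)%N ->
  let st := run c xs w in
  Zrun xs (rcons w h) - Zrun xs w =
    (if c h \in disc st then 0 else (hdeg (c h))%:R)
    - (if (mt st h == h) && (Some h != [pick a in act c st]) then 2 else 0) /\
  Vrun xs (rcons w h) - Vrun xs w = (if c h \in disc st then 0 else (siz (c h))%:R).
Proof.
move=> cov wH /=; have [k [recs [cur [tau [i _]]]]] := trace_run xs w.
rewrite /Zrun /Vrun run_rcons /step.
case: pickP => [a aa|a0]; last first.
  by have /set0Pn[a] := act_run_neq0 cov wH; rewrite a0.
have [aD ma] := act_in aa.
rewrite (_ : (Some h != Some a) = (h != a)) //.
set st := run c xs w in i aa aD ma *.
case: ifPn => [/andP[/eqP mh ha]|nh]; last first.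
  rewrite !subrr; case: ifPn; rewrite ?subr0 // => hD.
  have mh : mt st h = h by apply/eqP; apply: contraNT hD => /(ti_paired i).
  move: nh; rewrite mh eqxx /= negbK => /eqP e.
  by rewrite e aD in hD.
have SD : starts st \subset (c h |: disc st)%SET.
  by apply: (fintype.subset_trans (ti_SD i)); exact: finset.subsetUr.
rewrite /Zval /Vval !normalise_new // mt_normalise.
have -> : #|[set z | link (mt st) a h z != z]%SET| = (#|[set z | mt st z != z]%SET| + 2)%N.
  have -> : [set z | link (mt st) a h z != z]%SET = (a |: (h |: [set z | mt st z != z]))%SET.
    apply/finset.setP => z; rewrite !inE ffunE.
    case: (eqVneq z a) => [->|za] /=; first by rewrite ha.
    by case: (eqVneq z h) => [->|zh] //=; rewrite eq_sym.
  rewrite !cardsU1 !inE ma mh !eqxx /= orbF eq_sym ha /=; lia.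
rewrite natrD; case: ifPn => hD.
  rewrite (finset.setUidPr _) ?finset.sub1set //; split; lra.
have hS : c h \notin starts st by apply: contra hD => /(fintype.subsetP (ti_SD i)).
have E : ((c h |: disc st) :\: starts st)%SET = (c h |: (disc st :\: starts st))%SET.
  by rewrite finset.setDUl; congr (_ :|: _)%SET; apply/finset.setDidPl; rewrite disjoints1.
rewrite E /degsum /sizsum !big_setU1 /=; try by rewrite inE negb_and hD orbT.
split; lra.
Qed.

(** A discrepancy needs a draw in a community already found. Then either the drawn half-edge is
    active, or its community was found without being drawn and is a start. *)
Lemma Zrun_fresh xs w h : covers xs -> (2 * size w < #|H|)%N ->
  `|Zrun xs (rcons w h) - Zrun xs w - fresh (fun i => (hdeg i)%:R - 2) w h|
    <= (h \in badset xs w)%:R * (dmax%:R + 2) /\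
  `|Vrun xs (rcons w h) - Vrun xs w - fresh (fun i => (siz i)%:R) w h|
    <= (h \in badset xs w)%:R * smax%:R.
Proof.
move=> cov wH; have [-> ->] := Zrun_rcons h cov wH.
set st := run c xs w; set pk := [pick a in _].
have dm : (hdeg (c h))%:R <= dmax%:R :> R by rewrite ler_nat.
have d0 : 0 <= (hdeg (c h))%:R :> R by rewrite ler0n.
have sm : (siz (c h))%:R <= smax%:R :> R by rewrite ler_nat.
have s0 : 0 <= (siz (c h))%:R :> R by rewrite ler0n.
have pkP : h \notin act c st -> c h \notin disc st -> Some h != pk.
  move=> hA hD; rewrite /pk; case: pickP => // a /act_in[aD _].
  by apply: contra hD => /eqP [->].
have hDm : c h \notin disc st -> mt st h == h.
  have [k [recs [cur [tau [i _]]]]] := trace_run xs w.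
  by apply: contraNT => /(ti_paired i).
have mD : c h \in map c w -> c h \in disc st by move=> /(map_run cov wH).
have Dm := @disc_run xs w (c h).
rewrite /fresh !inE -/st.
have [hD|hD] := boolP (c h \in disc st).
  have [hm|hm] := boolP (c h \in map c w).
    rewrite !subr0 !sub0r normrN normr0 mulr_ge0 ?ler0n //; split=> //.
    have [mh|mh] := boolP (mt st h == h); last by rewrite normr0 mulr_ge0 ?addr_ge0 ?ler0n.
    rewrite /= orbT mul1r; case: ifP => _; rewrite ?normr0 ?addr_ge0 ?ler0n //.
    by rewrite ger0_norm //; lra.
  have hS : c h \in starts st by move: (Dm hD); rewrite (negbTE hm).
  rewrite hS !mul1r; split.
    by case: ifP => _; rewrite ler_norml; apply/andP; split; lra.
  by rewrite sub0r normrN ger0_norm.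
have hS : c h \notin starts st.
  have [k [recs [cur [tau [i _]]]]] := trace_run xs w.
  by apply: contra hD => /(fintype.subsetP (ti_SD i)).
have hA : h \notin act c st by apply: contra hD => /act_in[].
have hm : c h \notin map c w by apply: contra hD => /mD.
rewrite (negbTE hS) (negbTE hm) hDm // pkP //= !mul0r.
by rewrite !subrr !normr0.
Qed.

Fixpoint nbad xs (pre s : seq H) : nat :=
  if s is h :: s' then ((h \in badset xs pre) + nbad xs (rcons pre h) s')%N else 0.

Lemma nbad_rcons xs pre s h : nbad xs pre (rcons s h) = (nbad xs pre s + (h \in badset xs (pre ++ s)))%N.
Proof.
elim: s pre => [|h' s IH] pre /=; first by rewrite cats0 addn0.
by rewrite IH cat_rcons addnA.
Qed.

Lemma awalk_rcons (psi : seq H -> H -> R) pre s h :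
  awalk psi pre (rcons s h) = awalk psi pre s + psi (pre ++ s) h.
Proof. by rewrite -cats1 awalk_cat /= addr0. Qed.

Lemma Zrun0 xs : Zrun xs [::] = 0 /\ Vrun xs [::] = 0.
Proof.
pose m0 : {ffun H -> H} := [ffun z => z].
have m0E z : m0 z = z by rewrite ffunE.
have runE : run c xs [::] = normalise c m0 finset.set0 finset.set0 xs by [].
have DS0 := normalise_new m0 xs (fintype.subxx (finset.set0 : {set I})).
split; last by rewrite /Vrun /= runE /Vval DS0 finset.set0D /sizsum big_set0.
rewrite /Zrun /= runE /Zval DS0 mt_normalise finset.set0D /degsum big_set0.
rewrite (_ : [set h | m0 h != h]%SET = finset.set0) ?finset.cards0 ?subrr //.
by apply/finset.setP => z; rewrite !inE m0E eqxx.
Qed.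

Lemma Zrun_approx xs w : covers xs -> (2 * size w <= #|H|)%N ->
  `|Zrun xs w - awalk (fresh (fun i => (hdeg i)%:R - 2)) [::] w|
    <= (nbad xs [::] w)%:R * (dmax%:R + 2) /\
  `|Vrun xs w - awalk (fresh (fun i => (siz i)%:R)) [::] w|
    <= (nbad xs [::] w)%:R * smax%:R.
Proof.
move=> cov; elim/last_ind: w => [|w h IH] wH.
  by have [-> ->] := Zrun0 xs; rewrite /= subrr normr0 !mul0r lexx.
rewrite size_rcons in wH.
have wH1 : (2 * size w < #|H|)%N by apply: leq_trans wH; rewrite ltn_pmul2l.
have [Z1 V1] := IH (ltnW wH1).
have [Z2 V2] := Zrun_fresh h cov wH1.
rewrite !awalk_rcons nbad_rcons /= natrD !mulrDl; split.
- apply: le_trans (lerD Z1 Z2); apply: le_trans (ler_normD _ _).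
  by rewrite le_eqVlt; apply/orP; left; apply/eqP; congr (`| _ |); ring.
- apply: le_trans (lerD V1 V2); apply: le_trans (ler_normD _ _).
  by rewrite le_eqVlt; apply/orP; left; apply/eqP; congr (`| _ |); ring.
Qed.

(** The half-edges of the starts number at most [b + dmax], because [degsum] is within [dmax] of
    [- Z] at the last completion; the active ones number [degsum + Z], which adds another [b + dmax]
    and [b]. *)
Lemma card_badset xs w (b : R) :
  (forall u, (u <= size w)%N -> `|Zrun xs (take u w)| <= b) ->
  #|badset xs w|%:R <= 3 * b + 2 * dmax%:R.
Proof.
move=> Zb; have [k [recs [cur [tau [i _]]]]] := trace_run xs w.
have A := active_count (ti_paired i) (ti_SD i).
rewrite -(ti_Zt i) in A.
have : #|badset xs w|%:R <= degsum (starts (run c xs w)) + #|act c (run c xs w)|%:R.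
  have -> : degsum (starts (run c xs w)) = #|[set h | c h \in starts (run c xs w)]%SET|%:R.
    rewrite -sum1_card (partition_big c (mem (starts (run c xs w)))) /=; last by move=> h; rewrite inE.
    rewrite natr_sum; apply: eq_bigr => j jD; rewrite /hdeg -sum1_card; congr (_%:R).
    by apply: eq_bigl => h; rewrite !inE; case: eqP => [->|]; rewrite ?andbF ?jD.
  rewrite -natrD ler_nat; apply: leq_trans (leq_card_setU _ _).
  by apply/subset_leq_card/fintype.subsetP => h; rewrite !inE.
rewrite /act A; have := ti_DZ i; have := Zb _ (ti_tau i); have := Zb _ (leqnn _).
rewrite !ler_norml take_size => /andP[_ ?] /andP[? _] ? ?; lra.
Qed.

(** Bad draws are counted only while the bad set has at most [M] elements; each draw is then counted
    with conditional probability at most [M / #|H|]. *)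
Fixpoint nbadM (M : R) xs (pre s : seq H) : nat :=
  if s is h :: s' then
    (((#|badset xs pre|%:R <= M)%R && (h \in badset xs pre)) + nbadM M xs (rcons pre h) s')%N
  else 0.

Lemma nbadM_rcons M xs pre s h : nbadM M xs pre (rcons s h) =
  (nbadM M xs pre s + ((#|badset xs (pre ++ s)|%:R <= M)%R && (h \in badset xs (pre ++ s))))%N.
Proof.
elim: s pre => [|h' s IH] pre /=; first by rewrite cats0 addn0.
by rewrite IH cat_rcons addnA.
Qed.

Lemma EL_nbadM M xs pre K : (0 < #|H|)%N -> 0 <= M ->
  EL (fun=> #|H|%:R^-1) K (fun s => (nbadM M xs pre s)%:R) <= K%:R * (M / #|H|%:R).
Proof.
move=> H0 M0; have H0' : 0 < #|H|%:R :> R by rewrite ltr0n.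
elim: K pre => [|K IH] pre /=; first by rewrite mul0r.
under eq_bigr => h _.
  under eq_EL do rewrite natrD.
  rewrite ELD EL_cst; last by rewrite sumr_const -[_ *+ _]mulr_natl divff // gt_eqF.
  over.
rewrite -mulr_sumr big_split /= mulrDr -[K.+1]addn1 addrC natrD mulrDl mul1r lerD //.
  rewrite -ler_pdivlMl ?invr_gt0 // invrK mulrC.
  apply: le_trans (_ : \sum_(h : H) K%:R * (M / #|H|%:R) <= _).
    by apply: ler_sum => h _; exact: IH.
  by rewrite sumr_const -[leLHS]mulr_natr.
rewrite mulrC ler_wpM2r ?invr_ge0 ?ler0n //.
case: (boolP (#|badset xs pre|%:R <= M)) => [bM|_]; last by rewrite big1.
apply: le_trans bM; rewrite -natr_sum ler_nat -sum1_card [leqRHS]big_mkcond /=.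
by apply: leq_sum => h _; case: (h \in badset xs pre).
Qed.

(* As long as few bad draws have occurred the walk is close to the first-occurrence
   walk, hence bounded, hence the set of bad half-edges is small. *)
Lemma nbad_nbadM xs w (b : R) (beta : nat) : covers xs -> (2 * size w <= #|H|)%N ->
  (forall u, (u <= size w)%N ->
     `|awalk (fresh (fun i => (hdeg i)%:R - 2)) [::] (take u w)| + beta%:R * (dmax%:R + 2) <= b) ->
  (minn (nbad xs [::] w) beta.+1 <= nbadM (3 * b + 2 * dmax%:R)%R xs [::] w)%N.
Proof.
move=> cov; elim/last_ind: w => [//|w h IH] wH Yb.
rewrite size_rcons in wH.
have wH1 : (2 * size w <= #|H|)%N by apply: leq_trans wH; rewrite leq_pmul2l.
have tk u : (u <= size w)%N -> take u (rcons w h) = take u w.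
  by move=> uw; rewrite -cats1 takel_cat.
have {}IH : (minn (nbad xs [::] w) beta.+1 <= nbadM (3 * b + 2 * dmax%:R)%R xs [::] w)%N.
  by apply: IH => // u uw; rewrite -tk // Yb // size_rcons leqW.
rewrite nbad_rcons nbadM_rcons /=.
(* Beyond [beta] bad draws the minimum is saturated; up to [beta] the bad set is still small and
   both counters move together. *)
have [nb|nb] := leqP (nbad xs [::] w) beta; last first.
  by apply: leq_trans (leq_addr _ _); apply: leq_trans IH; rewrite leq_min geq_minr (leq_trans _ nb) // geq_minr.
have -> : #|badset xs w|%:R <= 3 * b + 2 * dmax%:R; last first.
  by move: IH nb => /=; lia.
apply: card_badset => u uw.
have tuH : (2 * size (take u w) <= #|H|)%N.
  by apply: leq_trans wH1; rewrite leq_pmul2l // size_take_min geq_minr.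
have [Z1 _] := Zrun_approx cov tuH.
apply: le_trans (Yb u _); last by rewrite size_rcons leqW.
rewrite tk // -lerBlDl; apply: le_trans (lerB_dist _ _) _.
apply: le_trans Z1 _; rewrite ler_wpM2r ?addr_ge0 ?ler0n // ler_nat.
apply: leq_trans nb; rewrite -[X in (_ <= nbad _ _ X)%N](cat_take_drop u w).
elim/last_ind: (drop u w) => [|v z IHv]; first by rewrite cats0.
by rewrite -rcons_cat nbad_rcons (leq_trans IHv) ?leq_addr.
Qed.

(** The last clause detects completion from the walk alone: once [Z] is below minus the total degree
    of the first [q] candidates, more than [q] candidates were consumed, and the first [q] lie in
    finished components. *)
Lemma trace_summary xs w m' : m' \in extensions (mt (run c xs w)) ->
  exists recs tau, [/\ chain 0 recs tau, (tau <= size w)%N,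
    (forall r, r \in recs -> rec_ok (fun u => Zrun xs (take u w))
                               (fun u => Vrun xs (take u w)) (size w) r),
    (forall u, (tau <= u <= size w)%N -> Zrun xs (take tau w) - dmax%:R <= Zrun xs (take u w)) &
    [/\ (forall r, r \in recs -> comp_of m' r.2), pairwise recdisj recs &
    forall q, Zrun xs w < - \sum_(i <- take q xs) (hdeg i)%:R ->
      forall i, i \in take q xs -> inrec recs i]].
Proof.
move=> ext; have [k [recs [cur [tau [i _]]]]] := trace_run xs w.
exists recs, tau; split; [exact: ti_chain i|exact: ti_tau i|exact: ti_rec i| |split].
- move=> u /andP[_ uw]; have := ti_Z i uw; have := ti_DZ i; lra.
- move=> r /(ti_comp i); apply: comp_extends; exact: extends_extensions.
- exact: ti_disj i.
- move=> q Zq; have [kq|qk] := leqP k q; last first.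
    move=> j jq; apply: (ti_first i); rewrite -(take_takel _ (_ : q <= k.-1)%N) in jq; last by lia.
    exact: mem_take jq.
  have := ti_Z i (leqnn _); rewrite take_size.
  suff : degsum (starts (run c xs w)) <= \sum_(j <- take q xs) (hdeg j)%:R by lra.
  have sub : {subset starts (run c xs w) <= take q xs}.
    by move=> j /(ti_starts i); rewrite -(take_takel xs kq); exact: mem_take.
  rewrite /degsum -big_enum /=; apply: le_trans (_ : \sum_(j <- undup (take q xs)) (hdeg j)%:R <= _).
    rewrite (perm_big [seq j <- undup (take q xs) | j \in starts (run c xs w)]) /=.
      by rewrite big_filter [leRHS](bigID (fun j => j \in starts (run c xs w))) /= lerDl sumr_ge0.
    apply: uniq_perm; rewrite ?enum_uniq ?filter_uniq ?undup_uniq // => j.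
    rewrite mem_enum mem_filter mem_undup; case: (boolP (j \in starts (run c xs w))) => //= jS.
    by rewrite (sub _ jS).
  elim: (take q xs) => [|y s IHs] //=; case: ifP => _; rewrite ?big_cons ?lerD2l //.
  by apply: le_trans IHs _; rewrite lerDr.
Qed.

End exploration_trace.

(** * Lindeberg replacement *)

Section smooth_steps.
Variable R : realType.
Implicit Types (phi h : R -> R) (x y : R).

(** [phi1] and [phi2] stand for two derivatives but are arbitrary functions: the third-order
    estimate is all that is used, and it passes to sums, affine substitutions and averages without
    any calculus. *)
Definition taylor2 (C : R) phi (phi1 phi2 : R -> R) :=
  forall x y, `|phi (x + y) - phi x - phi1 x * y - phi2 x * y ^+ 2| <= C * `|y| ^+ 3.

Definition rcube x : R := if 0 <= x then x ^+ 3 else 0.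

Lemma taylor2_rcube : exists r1 r2, taylor2 1 rcube r1 r2.
Proof.
exists (fun x => if 0 <= x then 3 * x ^+ 2 else 0), (fun x => if 0 <= x then 3 * x else 0).
move=> x y; rewrite mul1r /rcube.
have cube_le (a b : R) : 0 <= a <= b -> a ^+ 3 <= b ^+ 3.
  by move=> /andP[a0 ab]; rewrite lerXn2r ?nnegrE // (le_trans a0).
have [x0|x0] := leP 0 x; have [xy0|xy0] := leP 0 (x + y).
- rewrite (_ : _ - _ - _ - _ = y ^+ 3); last by ring.
  by rewrite normrX.
- have y0 : y < 0 by lra.
  rewrite (_ : _ - _ - _ - _ = y ^+ 3 - (x + y) ^+ 3); last by ring.
  rewrite (ltr0_norm y0) ler_norml.
  have := @cube_le (- (x + y)) (- y); have := @cube_le 0 (- (x + y)).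
  rewrite (_ : (- (x + y)) ^+ 3 = - (x + y) ^+ 3); last by ring.
  rewrite (_ : (- y) ^+ 3 = - y ^+ 3); last by ring.
  by rewrite expr0n /= => a b; have := a ltac:(lra); have := b ltac:(lra); lra.
- rewrite !mul0r !subr0 ger0_norm ?exprn_ge0 // ger0_norm; last by lra.
  by apply: cube_le; rewrite xy0; lra.
- by rewrite !mul0r !subr0 normr0 exprn_ge0.
Qed.

Lemma taylor2_comp (C a b : R) phi : 0 <= C -> (exists f1 f2, taylor2 C phi f1 f2) ->
  exists f1 f2, taylor2 (C * `|a| ^+ 3) (fun x => phi (a * x + b)) f1 f2.
Proof.
move=> C0 [f1 [f2 Hf]].
exists (fun x => a * f1 (a * x + b)), (fun x => a ^+ 2 * f2 (a * x + b)) => x y.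
rewrite -[leRHS]mulrA -[in leRHS]exprMn -[in leRHS]normrM; apply: le_trans (Hf (a * x + b) (a * y)).
by rewrite le_eqVlt; apply/orP; left; apply/eqP; congr (`|_|); 
  rewrite (_ : a * (x + y) + b = a * x + b + a * y); ring.
Qed.

Lemma taylor2D (C D : R) (f g : R -> R) : (exists f1 f2, taylor2 C f f1 f2) ->
  (exists f1 f2, taylor2 D g f1 f2) ->
  exists f1 f2, taylor2 (C + D) (fun x => f x + g x) f1 f2.
Proof.
move=> [f1 [f2 Hf]] [g1 [g2 Hg]].
exists (fun x => f1 x + g1 x), (fun x => f2 x + g2 x) => x y.
rewrite [leRHS]mulrDl; apply: le_trans (lerD (Hf x y) (Hg x y)).
apply: le_trans (ler_normD _ _).
by rewrite le_eqVlt; apply/orP; left; apply/eqP; congr (`|_|); ring.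
Qed.

Lemma taylor2Z (C a : R) (f : R -> R) : (exists f1 f2, taylor2 C f f1 f2) ->
  exists f1 f2, taylor2 (`|a| * C) (fun x => a * f x) f1 f2.
Proof.
move=> [f1 [f2 Hf]]; exists (fun x => a * f1 x), (fun x => a * f2 x) => x y.
rewrite -[leRHS]mulrA; apply: le_trans (ler_wpM2l (normr_ge0 a) (Hf x y)).
rewrite -normrM.
by rewrite le_eqVlt; apply/orP; left; apply/eqP; congr (`|_|); ring.
Qed.

Lemma taylor2_cst a : exists f1 f2, taylor2 0 (fun=> a) f1 f2.
Proof.
by exists (fun=> 0), (fun=> 0) => x y; rewrite !mul0r subrr !subr0 normr0.
Qed.

Lemma taylor2_sum n (C : R) (f : 'I_n -> R -> R) :
  (forall i, exists f1 f2, taylor2 C (f i) f1 f2) ->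
  exists f1 f2, taylor2 (n%:R * C) (fun x => \sum_(i < n) f i x) f1 f2.
Proof.
elim: n f => [|n IH] f Hf.
  have [f1 [f2 H]] := taylor2_cst 0; exists f1, f2; rewrite mul0r => x y.
  by have := H x y; rewrite !big_ord0.
have [f1 [f2 H]] := taylor2D (IH _ (fun i => Hf (widen_ord (leqnSn n) i))) (Hf ord_max).
exists f1, f2 => x y; have := H x y; rewrite !big_ord_recr /=.
by have -> : n.+1%:R * C = n%:R * C + C by rewrite -natr1 mulrDl mul1r.
Qed.

(** The integral of the quadratic B-spline: a twice differentiable step rising from 0 to 1 on
    [[0, 3]]. *)
Definition sstep x : R := (rcube x - 3 * rcube (x - 1) + 3 * rcube (x - 2) - rcube (x - 3)) / 6.

Lemma sstep0 x : x <= 0 -> sstep x = 0.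
Proof.
move=> x0; rewrite /sstep /rcube.
have -> : (0 <= x - 1) = false by apply/negbTE; rewrite -ltNge; lra.
have -> : (0 <= x - 2) = false by apply/negbTE; rewrite -ltNge; lra.
have -> : (0 <= x - 3) = false by apply/negbTE; rewrite -ltNge; lra.
case: ifP => [x0'|_]; last by ring.
have -> : x = 0 by apply/eqP; rewrite eq_le x0 x0'.
by ring.
Qed.

Lemma sstep1 x : 3 <= x -> sstep x = 1.
Proof.
move=> x3; rewrite /sstep /rcube.
have -> : 0 <= x by lra.
have -> : 0 <= x - 1 by lra.
have -> : 0 <= x - 2 by lra.
have -> : 0 <= x - 3 by lra.
by field.
Qed.

Lemma sstep_itv x : 0 <= sstep x <= 1.
Proof.
have [x0|x0] := leP x 0; first by rewrite sstep0 // lexx ler01.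
have [x3|x3] := leP 3 x; first by rewrite sstep1 // lexx ler01.
rewrite /sstep /rcube.
have -> : (0 <= x - 3) = false by apply/negbTE; rewrite -ltNge; lra.
have -> : 0 <= x by lra.
have [x1|x1] := leP 0 (x - 1); have [x2|x2] := leP 0 (x - 2).
- have h : 0 <= (3 - x) ^+ 3 <= 1.
    by rewrite exprn_ge0 ?exprn_ile1 //; lra.
  rewrite (_ : (_ - 0) / 6 = 1 - (3 - x) ^+ 3 / 6); last by field.
  by move: h => /andP[? ?]; lra.
- have y1 : 0 <= x - 1 <= 1 by lra.
  move: y1; set y := x - 1 => /andP[y0 y1].
  have -> : x = y + 1 by rewrite /y; ring.
  rewrite (_ : _ / 6 = (1 + 3 * y + 3 * y ^+ 2 - 2 * y ^+ 3) / 6); last by field.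
  have y2 : 0 <= y ^+ 2 <= 1 by rewrite exprn_ge0 ?exprn_ile1.
  have y3 : 0 <= y ^+ 3 <= y ^+ 2.
    by rewrite exprn_ge0 //= exprS ler_piMl //; case/andP: y2.
  have y4 : 0 <= (1 - y) ^+ 2 * y by rewrite mulr_ge0 // exprn_ge0 //; lra.
  by move: y2 y3 => /andP[? ?] /andP[? ?]; lra.
- lra.
- have h : 0 <= x ^+ 3 <= 1 by rewrite exprn_ge0 ?exprn_ile1 //; lra.
  by move: h => /andP[? ?]; lra.
Qed.

Lemma taylor2_sstep : exists f1 f2, taylor2 2 sstep f1 f2.
Proof.
have Hr b := @taylor2_comp 1 1 b _ (ler01) taylor2_rcube.
have H := taylor2D (taylor2D (taylor2D (Hr 0) (taylor2Z (-3) (Hr (-1))))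
  (taylor2Z 3 (Hr (-2)))) (taylor2Z (-1) (Hr (-3))).
have [f1 [f2 H']] := taylor2Z (6^-1) H.
exists f1, f2 => x y; have := H' x y.
rewrite !(mul1r, addr0) /sstep.
have -> : `|6^-1| * (`|1| ^+ 3 + `|-3| * `|1| ^+ 3 + `|3| * `|1| ^+ 3 + `|-1| * `|1| ^+ 3) = 8 / 6 :> R.
  by rewrite !normrN !ger0_norm ?invr_ge0 //; field.
move=> h; apply: le_trans (_ : 8 / 6 * `|y| ^+ 3 <= _); last first.
  by rewrite ler_wpM2r ?exprn_ge0 //; lra.
apply: le_trans h.
by rewrite le_eqVlt; apply/orP; left; apply/eqP; congr (`|_|); ring.
Qed.

Variables (tau : R) (A : nat).
Hypothesis tau0 : 0 < tau.

Definition gridpt (k : nat) : R := - (A%:R * tau) + k%:R * tau.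

(** Sampling [h] on the grid gives a sum of jumps; each jump is replaced by a smooth step of width
    [3 * tau]. *)
Definition smoothing h x : R :=
  h (gridpt 0) + \sum_(k < 2 * A) (h (gridpt k.+1) - h (gridpt k)) * sstep ((x - gridpt k) / tau).

Lemma gridptS k : gridpt k.+1 - gridpt k = tau.
Proof. by rewrite /gridpt -[k.+1]addn1 natrD; ring. Qed.

Lemma taylor2_smoothing (L : R) h : (forall x y, `|h x - h y| <= L * `|x - y|) ->
  exists f1 f2, taylor2 ((2 * A)%:R * (L * tau * (2 / tau ^+ 3))) (smoothing h) f1 f2.
Proof.
move=> hL; have L0 : 0 <= L.
  by have := hL 1 0; rewrite subr0 normr1 mulr1; apply: le_trans.
have Hk (k : 'I_(2 * A)) : exists f1 f2, taylor2 (L * tau * (2 / tau ^+ 3))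
    (fun x => (h (gridpt k.+1) - h (gridpt k)) * sstep ((x - gridpt k) / tau)) f1 f2.
  have [f1 [f2 H]] := taylor2Z (h (gridpt k.+1) - h (gridpt k))
    (@taylor2_comp 2 (tau^-1) (- gridpt k / tau) _ (ler0n R 2) taylor2_sstep).
  exists f1, f2 => x y; have := H x y.
  have E z : tau^-1 * z + - gridpt k / tau = (z - gridpt k) / tau by ring.
  rewrite !E => h1; apply: le_trans h1 _.
  have -> : `|tau^-1| = tau^-1 by rewrite ger0_norm // invr_ge0 ltW.
  rewrite exprVn ler_wpM2r ?exprn_ge0 // ler_wpM2r ?divr_ge0 ?exprn_ge0 ?(ltW tau0) //.
  by have := hL (gridpt k.+1) (gridpt k); rewrite gridptS (gtr0_norm tau0).
have [f1 [f2 H]] := taylor2D (taylor2_cst (h (gridpt 0))) (taylor2_sum Hk).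
by exists f1, f2 => x y; have := H x y; rewrite add0r.
Qed.

Lemma smoothing_bound (M L : R) h : (forall x, `|h x| <= M) ->
  (forall x y, `|h x - h y| <= L * `|x - y|) ->
  forall x, `|smoothing h x| <= M + (2 * A)%:R * (L * tau).
Proof.
move=> hM hL x; apply: le_trans (ler_normD _ _) _; rewrite lerD //.
apply: le_trans (ler_norm_sum _ _ _) _.
apply: le_trans (_ : \sum_(k < 2 * A) L * tau <= _); last first.
  by rewrite sumr_const card_ord mulr_natl.
apply: ler_sum => k _; rewrite normrM -[L * tau]mulr1 ler_pM //.
  by have := hL (gridpt k.+1) (gridpt k); rewrite gridptS (gtr0_norm tau0).
by have /andP[s0 s1] := sstep_itv ((x - gridpt k) / tau); rewrite ger0_norm.
Qed.

(** Steps that are finished or not begun at [x] reproduce the sampled value exactly. At most three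
    are in progress, each costing [L * tau], and rounding [x] to the grid costs one more. *)
Lemma smoothing_approx (L : R) h : (forall x y, `|h x - h y| <= L * `|x - y|) ->
  forall x, `|x| < A%:R * tau -> `|smoothing h x - h x| <= 4 * (L * tau).
Proof.
move=> hL x; rewrite ltr_norml => /andP[xl xr].
have L0 : 0 <= L.
  by have := hL 1 0; rewrite subr0 normr1 mulr1; apply: le_trans.
have Lt0 : 0 <= L * tau by rewrite mulr_ge0 // ltW.
set z := (x + A%:R * tau) / tau.
have z0 : 0 <= z by rewrite divr_ge0 ?ltW //; lra.
set j := Num.trunc z.
have /andP[jz zj] : j%:R <= z < j.+1%:R by rewrite truncn_itv.
have xE : x = gridpt 0 + z * tau.
  by rewrite /z /gridpt divfK ?gt_eqF // mul0r; ring.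
have jA : (j < 2 * A)%N.
  rewrite -(ltr_nat R) (le_lt_trans jz) // ltr_pdivrMr // natrM; lra.
have hj : h (gridpt j) = h (gridpt 0) +
    \sum_(k < 2 * A) (h (gridpt k.+1) - h (gridpt k)) * (k < j)%N%:R.
  rewrite -(big_mkord xpredT (fun k => (h (gridpt k.+1) - h (gridpt k)) * (k < j)%N%:R)).
  rewrite (big_cat_nat (leq0n j) (ltnW jA)) /=.
  have -> : \sum_(j <= k < 2 * A) (h (gridpt k.+1) - h (gridpt k)) * (k < j)%N%:R = 0.
    by rewrite big_nat_cond big1 // => k /andP[/andP[jk _] _]; rewrite ltnNge jk mulr0.
  rewrite addr0.
  under eq_big_nat => k /andP[_ kj] do rewrite kj mulr1.
  by rewrite telescope_sumr // addrC subrK.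
rewrite (_ : 4 * (L * tau) = 3 * (L * tau) + L * tau); last by ring.
rewrite (_ : smoothing h x - h x = (smoothing h x - h (gridpt j)) + (h (gridpt j) - h x)); last by ring.
apply: le_trans (ler_normD _ _) _; apply: lerD; last first.
  apply: le_trans (hL _ _) _; rewrite ler_wpM2l // distrC xE /gridpt ler_norml.
  rewrite -[j.+1]addn1 natrD in zj.
  have := ler_wpM2r (ltW tau0) jz; have := ler_wpM2r (ltW tau0) (ltW zj).
  by rewrite mulrDl; lra.
rewrite /smoothing hj opprD addrACA subrr add0r -sumrB.
apply: le_trans (ler_norm_sum _ _ _) _.
have cnt n : (\sum_(k < n) (k <= j <= k + 2) = minn n j.+1 - minn n (j - 2))%N.
  elim: n => [|n IH]; first by rewrite big_ord0 !min0n.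
  by rewrite big_ord_recr /= IH; case: (leqP n j) => ?; case: (leqP j (n + 2)) => ? /=; lia.
apply: le_trans (_ : \sum_(k < 2 * A) (k <= j <= k + 2)%N%:R * (L * tau) <= _).
  apply: ler_sum => k _; rewrite -mulrBr.
  have -> : (x - gridpt k) / tau = z - k%:R by rewrite /z /gridpt; field; rewrite gt_eqF.
  have kR := ltr_nat R; have hLk : `|h (gridpt k.+1) - h (gridpt k)| <= L * tau.
    by have := hL (gridpt k.+1) (gridpt k); rewrite gridptS (gtr0_norm tau0).
  have [jk|kj] := ltnP j k.
    rewrite sstep0; last by rewrite subr_le0 (le_trans (ltW zj)) // ler_nat.
    by rewrite ltnNge (ltnW jk) subrr mulr0 normr0 mulr_ge0 ?ler0n.
  have [k2j|jk2] := ltnP (k + 2) j.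
    rewrite sstep1; last first.
      rewrite lerBrDl (le_trans _ jz) // -natrD ler_nat; lia.
    have -> : (k < j)%N by lia.
    by rewrite subrr mulr0 normr0 mulr_ge0 ?ler0n.
  rewrite mul1r normrM -[leRHS]mulr1 ler_pM //.
  have /andP[s0 s1] := sstep_itv (z - k%:R).
  by case: (k < j)%N => /=; rewrite ?subr0 ler_norml; apply/andP; split; lra.
rewrite -mulr_suml ler_wpM2r // -natr_sum cnt ler_nat; lia.
Qed.

End smooth_steps.

(** * Comparing two walks with nearly equal variances *)

Section lindeberg.
Variable R : realType.

Definition wsum (T : Type) (xi : T -> R) (s : seq T) : R := \sum_(x <- s) xi x.

Lemma wsum_cons (T : Type) (xi : T -> R) x s : wsum xi (x :: s) = xi x + wsum xi s.
Proof. by rewrite /wsum big_cons. Qed.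

Lemma wsum_cat (T : Type) (xi : T -> R) s t : wsum xi (s ++ t) = wsum xi s + wsum xi t.
Proof. by rewrite /wsum big_cat. Qed.

Definition is_pmf (T : finType) (p : T -> R) := (forall x, 0 <= p x) /\ \sum_x p x = 1.

Lemma pmf_mean_le (T : finType) (p f : T -> R) (c : R) : is_pmf p ->
  (forall x, f x <= c) -> \sum_x p x * f x <= c.
Proof.
move=> [p0 p1] fc; apply: le_trans (_ : \sum_x p x * c <= _).
  by apply: ler_sum => x _; exact: ler_wpM2l.
by rewrite -mulr_suml p1 mul1r.
Qed.

Lemma pmf_norm_le (T : finType) (p f : T -> R) : is_pmf p ->
  `|\sum_x p x * f x| <= \sum_x p x * `|f x|.
Proof.
move=> [p0 p1]; apply: le_trans (ler_norm_sum _ _ _) _.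
by apply: ler_sum => x _; rewrite normrM ger0_norm.
Qed.

(** Adding the expansions for [y = 1] and [y = -1] eliminates [phi1]. *)
Lemma taylor2_bound (M C : R) phi phi1 phi2 : (forall x : R, `|phi x| <= M) ->
  taylor2 C phi phi1 phi2 -> forall x, `|phi2 x| <= 2 * M + C.
Proof.
move=> Mphi H x; have := H x 1; have := H x (-1).
have := Mphi x; have := Mphi (x + 1); have := Mphi (x - 1).
rewrite !mulrN !mulr1 !expr1n sqrrN expr1n normrN normr1 expr1n !mulr1.
rewrite !ler_norml => /andP[? ?] /andP[? ?] /andP[? ?] /andP[? ?] /andP[? ?].
by apply/andP; split; lra.
Qed.

Lemma taylor2_EL (T : finType) (p : T -> R) K (g : seq T -> R) (C : R) phi phi1 phi2 :
  is_pmf p -> taylor2 C phi phi1 phi2 ->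
  taylor2 C (fun x => EL p K (fun s => phi (x + g s)))
    (fun x => EL p K (fun s => phi1 (x + g s))) (fun x => EL p K (fun s => phi2 (x + g s))).
Proof.
move=> [p0 p1] H x y; rewrite ![_ * y]mulrC ![_ * y ^+ 2]mulrC -!ELZ // -!ELB //.
apply: le_trans (EL_norm p0 _ _) _; rewrite -[leRHS](EL_cst p1 K).
apply: EL_le => // s _; have := H (x + g s) y.
by rewrite [_ * y]mulrC [_ * y ^+ 2]mulrC [x + g s + y]addrAC.
Qed.

Lemma lindeberg_one (T : finType) (p xi : T -> R) (C v t : R) u u1 u2 : is_pmf p ->
  taylor2 C u u1 u2 -> \sum_x p x * xi x = 0 -> \sum_x p x * xi x ^+ 2 = v ->
  \sum_x p x * `|xi x| ^+ 3 = t ->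
  forall x, `|\sum_h p h * u (x + xi h) - (u x + u2 x * v)| <= C * t.
Proof.
move=> pp H m0 vE tE x.
have -> : \sum_h p h * u (x + xi h) - (u x + u2 x * v) =
    \sum_h p h * (u (x + xi h) - u x - u1 x * xi h - u2 x * xi h ^+ 2).
  rewrite -vE mulr_sumr -[u x in LHS]mul1r -pp.2 mulr_suml -[LHS]addr0.
  rewrite -[X in _ + X](_ : - (u1 x * \sum_h p h * xi h) = 0); last by rewrite m0 mulr0 oppr0.
  rewrite mulr_sumr opprD -!sumrN -!big_split /=.
  by apply: eq_bigr => h _; ring.
apply: le_trans (pmf_norm_le _ pp) _.
rewrite -tE mulr_sumr; apply: ler_sum => h _.
by rewrite [leRHS]mulrCA ler_wpM2l ?pp.1 //; exact: H.
Qed.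

(** Averaging over the later steps of the second walk preserves [taylor2] with the same constant.
    Exchanging one step therefore costs only the difference of the variances and the third
    moments. *)
Lemma lindeberg (T T' : finType) (p xi : T -> R) (p' xi' : T' -> R) (M C v t v' t' : R)
    phi phi1 phi2 : is_pmf p -> is_pmf p' -> 0 <= C ->
  (forall x, `|phi x| <= M) -> taylor2 C phi phi1 phi2 ->
  \sum_x p x * xi x = 0 -> \sum_x p x * xi x ^+ 2 = v -> \sum_x p x * `|xi x| ^+ 3 = t ->
  \sum_x p' x * xi' x = 0 -> \sum_x p' x * xi' x ^+ 2 = v' ->
  \sum_x p' x * `|xi' x| ^+ 3 = t' ->
  forall K x, `|EL p K (fun s => phi (x + wsum xi s)) -
               EL p' K (fun s => phi (x + wsum xi' s))|
     <= K%:R * ((2 * M + C) * `|v - v'| + C * (t + t')).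
Proof.
move=> pp pp' C0 Mphi H m0 vE tE m0' vE' tE'.
elim=> [|K IH] x /=; first by rewrite /wsum !big_nil subrr normr0 mul0r.
pose u y := EL p' K (fun s => phi (y + wsum xi' s)).
pose u2 y := EL p' K (fun s => phi2 (y + wsum xi' s)).
have Hu := taylor2_EL K (wsum xi') pp' H.
have Mu y : `|u y| <= M.
  by rewrite /u (le_trans (EL_norm pp'.1 _ _)) // -[leRHS](EL_cst pp'.2 K) EL_le // => *; exact: pp'.1.
have M2 := taylor2_bound Mu Hu x.
have o1 := lindeberg_one pp Hu m0 vE tE x.
have o2 := lindeberg_one pp' Hu m0' vE' tE' x.
have e2 : \sum_h p' h * EL p' K (fun s => phi (x + wsum xi' (h :: s))) = \sum_h p' h * u (x + xi' h).
  apply: eq_bigr => h _; congr (_ * _); apply: eq_EL => s _.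
  by rewrite wsum_cons addrA.
have e1 : `|\sum_h p h * EL p K (fun s => phi (x + wsum xi (h :: s))) - \sum_h p h * u (x + xi h)| <=
    K%:R * ((2 * M + C) * `|v - v'| + C * (t + t')).
  rewrite -sumrB; under eq_bigr do rewrite -mulrBr.
  apply: le_trans (pmf_norm_le _ pp) _; apply: pmf_mean_le => // h.
  by have := IH (x + xi h); congr (`|_ - _| <= _); apply: eq_EL => s _; rewrite wsum_cons addrA.
rewrite e2 -[K.+1]addn1 natrD mulrDl mul1r.
set S1 := \sum_h p h * EL p K _ in e1 *; set S2 := \sum_h p h * u _ in o1 e1.
set S3 := \sum_h p' h * u _ in o2 *.
rewrite (_ : S1 - S3 = (S1 - S2) + ((S2 - (u x + u2 x * v)) - (S3 - (u x + u2 x * v')) + u2 x * (v - v'))); last by ring.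
apply: le_trans (ler_normD _ _) _; apply: lerD => //.
apply: le_trans (ler_normD _ _) _; rewrite addrC; apply: lerD.
  by rewrite normrM ler_wpM2r.
by apply: le_trans (ler_normB _ _) _; rewrite mulrDr lerD.
Qed.

Lemma EL_wsum_sq (T : finType) (p xi : T -> R) K : is_pmf p ->
  \sum_x p x * xi x = 0 ->
  EL p K (fun s => wsum xi s ^+ 2) = K%:R * \sum_x p x * xi x ^+ 2.
Proof.
move=> [p0 p1] m0.
suff H x : EL p K (fun s => (x + wsum xi s) ^+ 2) = x ^+ 2 + K%:R * \sum_x p x * xi x ^+ 2.
  have := H 0; rewrite expr0n add0r => <-.
  by apply: eq_EL => s _; rewrite add0r.
elim: K x => [|K IH] x /=; first by rewrite /wsum big_nil addr0 mul0r addr0.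
transitivity (\sum_h p h * ((x + xi h) ^+ 2 + K%:R * \sum_x p x * xi x ^+ 2)).
  apply: eq_bigr => h _; congr (_ * _); rewrite -IH; apply: eq_EL => s _.
  by rewrite wsum_cons addrA.
transitivity (\sum_h (p h * (x ^+ 2 + K%:R * \sum_x p x * xi x ^+ 2) + 2 * x * (p h * xi h) + p h * xi h ^+ 2)).
  by apply: eq_bigr => h _; ring.
by rewrite !big_split /= -mulr_suml -mulr_sumr p1 m0 -natr1; ring.
Qed.

Lemma EL_wsum_tail (T : finType) (p xi : T -> R) K (a V : R) : is_pmf p -> 0 < a ->
  \sum_x p x * xi x = 0 -> K%:R * \sum_x p x * xi x ^+ 2 <= V ->
  EL p K (fun s => (a <= `|wsum xi s|)%R%:R) <= V / a ^+ 2.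
Proof.
move=> [p0 p1] a0 m0 KV.
apply: le_trans (EL_markov p0 (g := fun s => wsum xi s ^+ 2) (a := a ^+ 2) _ _ _) _.
- by move=> s _; exact: sqr_ge0.
- by rewrite exprn_gt0.
- move=> s _ h; rewrite -[leRHS]real_normK ?num_real //.
  by rewrite ler_pXn2r ?nnegrE // ltW.
by rewrite ler_wpM2r ?EL_wsum_sq // invr_ge0 exprn_ge0 // ltW.
Qed.

(** The point is uniformity: [del] depends neither on the laws, nor on [K], nor on [h]. This permits
    [h] to be a conditional expectation over later blocks. *)
Lemma clt_lipschitz (M L V e : R) : 0 <= M -> 0 <= L -> 0 < V -> 0 < e -> exists2 del : R, 0 < del &
  forall (T T' : finType) (p xi : T -> R) (p' xi' : T' -> R) (v t v' t' : R) (K : nat),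
  is_pmf p -> is_pmf p' ->
  \sum_x p x * xi x = 0 -> \sum_x p x * xi x ^+ 2 = v -> \sum_x p x * `|xi x| ^+ 3 = t ->
  \sum_x p' x * xi' x = 0 -> \sum_x p' x * xi' x ^+ 2 = v' ->
  \sum_x p' x * `|xi' x| ^+ 3 = t' ->
  K%:R * v <= V -> K%:R * v' <= V ->
  K%:R * `|v - v'| <= del -> K%:R * t <= del -> K%:R * t' <= del ->
  forall h : R -> R, (forall x, `|h x| <= M) -> (forall x y, `|h x - h y| <= L * `|x - y|) ->
  `|EL p K (fun s => h (wsum xi s)) - EL p' K (fun s => h (wsum xi' s))| <= e.
Proof.
move=> M0 L0 V0 e0.
(* Smoothing costs [4 * (L * tau)], at most [e / 4], for each of the two walks. *)
pose tau : R := e / (16 * (L + 1)).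
have tau0 : 0 < tau by rewrite divr_gt0 // mulr_gt0 //; lra.
have Lt : 8 * (L * tau) <= e / 2.
  rewrite /tau mulrA mulrA ler_pdivrMr; last by rewrite mulr_gt0 //; lra.
  by rewrite (_ : e / 2 * (16 * (L + 1)) = 8 * L * e + 8 * e); [lra|field].
clearbody tau.
(* The grid is wide enough for Chebyshev's inequality to bound the cost of leaving it by [e / 8]. *)
set A := (Num.trunc (16 * (M + L * tau) * V / (tau ^+ 2 * e))).+1.
have AR : 16 * (M + L * tau) * V / (tau ^+ 2 * e) <= A%:R.
  by rewrite ltW // truncnS_gt.
have A1 : 1 <= A%:R :> R by rewrite ler1n.
have Lt0 : 0 <= L * tau by rewrite mulr_ge0 // ltW.
set MM := M + (2 * A)%:R * (L * tau).
set C := (2 * A)%:R * (L * tau * (2 / tau ^+ 3)).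
have C0 : 0 <= C by rewrite mulr_ge0 ?ler0n // mulr_ge0 // divr_ge0 // exprn_ge0 // ltW.
have MM0 : 0 <= MM by rewrite addr_ge0 // mulr_ge0.
have tailA : (M + MM) * (V / (A%:R * tau) ^+ 2) <= e / 8.
  rewrite mulrA ler_pdivrMr ?exprn_gt0 ?mulr_gt0 ?ltr0n //.
  have -> : e / 8 * (A%:R * tau) ^+ 2 = (A%:R * (tau ^+ 2 * e)) * A%:R / 8 by field.
  rewrite ler_pdivrMr ?mulr_gt0 ?exprn_gt0 // in AR.
  rewrite ler_pdivlMr //.
  apply: le_trans (_ : 16 * (M + L * tau) * V * A%:R <= _); last by rewrite ler_wpM2r // ler0n.
  have -> : (M + MM) * V * 8 = (16 * M + 16 * A%:R * (L * tau)) * V.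
    by rewrite /MM natrM; ring.
  have -> : 16 * (M + L * tau) * V * A%:R = (16 * M * A%:R + 16 * A%:R * (L * tau)) * V by ring.
  rewrite ler_wpM2r ?(ltW V0) // lerD2r ler_peMr ?mulr_ge0 //.
have B0 : 0 < (2 * MM + C) + 2 * C + 1 by lra.
exists (e / (4 * ((2 * MM + C) + 2 * C + 1))); first by rewrite divr_gt0 // mulr_gt0.
move=> T T' p xi p' xi' v t v' t' K pp pp' m0 vE tE m0' vE' tE' KV KV' dv dt dt' h hM hL.
set del := e / _ in dv dt dt'.
have delE : del * ((2 * MM + C) + 2 * C + 1) = e / 4.
  by rewrite /del; field; rewrite gt_eqF //; lra.
have del0 : 0 < del by rewrite divr_gt0 // mulr_gt0.
have smooth (U : finType) (q z : U -> R) : is_pmf q -> \sum_x q x * z x = 0 ->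
    K%:R * \sum_x q x * z x ^+ 2 <= V ->
    `|EL q K (fun s => h (wsum z s)) - EL q K (fun s => smoothing tau A h (0 + wsum z s))| <= e / 4 + e / 8.
  move=> qq qm qV; rewrite -ELB.
  apply: le_trans (EL_norm qq.1 _ _) _.
  apply: le_trans (_ : EL q K (fun s => 4 * (L * tau) + (M + MM) * (A%:R * tau <= `|wsum z s|)%R%:R) <= _).
    apply: EL_le => [|s _]; first exact: qq.1.
    rewrite add0r; have [At|At] := leP (A%:R * tau) `|wsum z s|.
      rewrite mulr1 ler_wpDl ?(mulr_ge0 _ Lt0) //; apply: le_trans (ler_normB _ _) _.
      by rewrite lerD // smoothing_bound.
    by rewrite mulr0 addr0 distrC smoothing_approx.
  rewrite ELD EL_cst ?ELZ; last exact: qq.2.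
  apply: lerD; first by lra.
  apply: le_trans tailA; rewrite ler_wpM2l ?(addr_ge0 M0 MM0) //.
  by apply: EL_wsum_tail; rewrite ?mulr_gt0 ?ltr0n.
have [f1 [f2 Hf]] := taylor2_smoothing A tau0 hL.
have lind := lindeberg pp pp' C0 (smoothing_bound A tau0 hM hL) Hf m0 vE tE m0' vE' tE' K 0.
have s1 := smooth _ _ _ pp m0 (_ : _ <= V); rewrite vE in s1.
have s2 := smooth _ _ _ pp' m0' (_ : _ <= V); rewrite vE' in s2.
have {}lind := le_trans lind (_ : _ <= e / 4).
rewrite (_ : EL p K _ - EL p' K _ = 
  (EL p K (fun s => h (wsum xi s)) - EL p K (fun s => smoothing tau A h (0 + wsum xi s)))
  + (EL p K (fun s => smoothing tau A h (0 + wsum xi s)) - EL p' K (fun s => smoothing tau A h (0 + wsum xi' s)))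
  - (EL p' K (fun s => h (wsum xi' s)) - EL p' K (fun s => smoothing tau A h (0 + wsum xi' s)))); last by ring.
apply: le_trans (ler_normB _ _) _; apply: le_trans (lerD (ler_normD _ _) (s2 KV')) _.
apply: le_trans (lerD (lerD (s1 KV) (lind _)) (lexx _)) _; last by lra.
rewrite -delE; apply: le_trans (_ : (2 * MM + C) * (K%:R * `|v - v'|) + C * (K%:R * t + K%:R * t') <= _).
  by rewrite -/MM le_eqVlt; apply/orP; left; apply/eqP; ring.
apply: le_trans (_ : (2 * MM + C) * del + C * (del + del) <= _); last first.
  by rewrite mulrC -subr_ge0 (_ : _ - _ = del); [exact: ltW|ring].
by rewrite lerD // ler_wpM2l ?lerD //; lra.
Qed.

Definition bsums (T : Type) (xi : T -> R) k :=
  fix bs m (s : seq T) : seq R :=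
    if m is m'.+1 then wsum xi (take k s) :: bs m' (drop k s) else [::].

(** Blocks are exchanged one at a time; averaging over the remaining blocks of the second walk
    leaves a bounded Lipschitz function of one block sum. *)
Lemma blocks_lipschitz (T T' : finType) (p xi : T -> R) (p' xi' : T' -> R) (M L e : R) k :
  is_pmf p -> is_pmf p' ->
  (forall h : R -> R, (forall x, `|h x| <= M) -> (forall x y, `|h x - h y| <= L * `|x - y|) ->
    `|EL p k (fun s => h (wsum xi s)) - EL p' k (fun s => h (wsum xi' s))| <= e) ->
  forall m (F : seq R -> R), (forall s, `|F s| <= M) ->
  (forall u x y v, `|F (u ++ x :: v) - F (u ++ y :: v)| <= L * `|x - y|) ->
  `|EL p (m * k) (fun s => F (bsums xi k m s)) - EL p' (m * k) (fun s => F (bsums xi' k m s))|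
    <= m%:R * e.
Proof.
move=> pp pp' H1; elim=> [|m IH] F FM FL; first by rewrite mul0n /= subrr normr0 mul0r.
have split_bs (U : finType) (q z : U -> R) : EL q (m.+1 * k) (fun s => F (bsums z k m.+1 s)) =
    EL q k (fun s1 => EL q (m * k) (fun s2 => F (wsum z s1 :: bsums z k m s2))).
  rewrite mulSn EL_cat; apply: eq_EL => u uk; apply: eq_EL => v _ /=.
  by rewrite take_cat drop_cat uk ltnn subnn take0 cats0 drop0.
rewrite !split_bs -natr1 mulrDl mul1r.
pose h x := EL p' (m * k) (fun s2 => F (x :: bsums xi' k m s2)).
rewrite (_ : _ - _ = (EL p k (fun s1 => EL p (m * k) (fun s2 => F (wsum xi s1 :: bsums xi k m s2))
    - h (wsum xi s1))) + (EL p k (fun s1 => h (wsum xi s1)) - EL p' k (fun s1 => h (wsum xi' s1)))); last first.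
  by rewrite ELB; ring.
apply: le_trans (ler_normD _ _) _; apply: lerD.
  apply: le_trans (EL_norm pp.1 _ _) _; rewrite -[leRHS](EL_cst pp.2 k).
  apply: EL_le => [|s _]; first exact: pp.1.
  apply: (IH (fun r => F (wsum xi s :: r))) => // u x y v.
  exact: (FL (wsum xi s :: u)).
apply: H1 => [x|x y].
  by rewrite (le_trans (EL_norm pp'.1 _ _)) // -[leRHS](EL_cst pp'.2 (m * k)) EL_le // => *; exact: pp'.1.
rewrite /h -ELB (le_trans (EL_norm pp'.1 _ _)) // -[leRHS](EL_cst pp'.2 (m * k)) EL_le // => *.
  exact: pp'.1.
exact: (FL [::]).
Qed.

End lindeberg.

(** * Discretised Gaussian increments *)

Section finite_valued_integrals.
Context d (X : measurableType d) (R : realType) (mu : {measure set X -> \bar R}).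

Lemma integrable_Rsum (I : Type) (r : seq I) (f : I -> X -> R) :
  (forall i, mu.-integrable setT (EFin \o f i)) ->
  mu.-integrable setT (EFin \o (fun x => \sum_(i <- r) f i x)).
Proof.
move=> fi; have := @integrable_sum _ _ _ mu setT measurableT I r xpredT (fun i => EFin \o f i) (fun i _ => fi i).
apply: eq_integrable => // x _ /=.
by elim: r => [|i r IH]; rewrite ?big_nil ?big_cons //= EFinD IH.
Qed.

Lemma Rintegral_sum (I : Type) (r : seq I) (f : I -> X -> R) :
  (forall i, mu.-integrable setT (EFin \o f i)) ->
  \int[mu]_x (\sum_(i <- r) f i x) = \sum_(i <- r) \int[mu]_x f i x.
Proof.
move=> fi; elim: r => [|i r IH].
  by rewrite big_nil; under eq_Rintegral do rewrite big_nil; rewrite Rintegral_cst // mul0r.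
under eq_Rintegral do rewrite big_cons.
by rewrite RintegralD // ?big_cons ?IH //; exact: integrable_Rsum.
Qed.

Variables (C : finType) (Y : X -> C) (k : X -> R) (g : C -> R).
Hypothesis mY : forall c, measurable (Y @^-1` [set c]).
Hypothesis ik : mu.-integrable setT (EFin \o k).

Let gk c x := g c * (k \_ (Y @^-1` [set c])) x.

Let igk c : mu.-integrable setT (EFin \o gk c).
Proof.
have : mu.-integrable setT (EFin \o (k \_ (Y @^-1` [set c]))).
  have := integrable_mkcond (EFin \o k) (mY c) (mu := mu).
  rewrite restrict_EFin => <-; exact: integrableS ik.
by move=> /(integrableZl measurableT (g c)); apply: eq_integrable.
Qed.

Let gkE x : g (Y x) * k x = \sum_(c <- enum C) gk c x.
Proof.
rewrite big_enum /= (bigD1 (Y x)) //= /gk patchE mem_set //.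
rewrite big1 ?addr0 // => c cY; rewrite patchE memNset ?mulr0 //=.
by move=> /eqP; rewrite eq_sym (negbTE cY).
Qed.

Lemma integrable_cells : mu.-integrable setT (EFin \o (fun x => g (Y x) * k x)).
Proof.
apply: eq_integrable (integrable_Rsum (enum C) igk) => // x _ /=.
by rewrite gkE.
Qed.

Lemma Rintegral_cells :
  \int[mu]_x (g (Y x) * k x) = \sum_c g c * \int[mu]_(x in Y @^-1` [set c]) k x.
Proof.
under eq_Rintegral do rewrite gkE.
rewrite Rintegral_sum // big_enum /=; apply: eq_bigr => c _.
rewrite /gk RintegralZl //; last first.
  have := integrable_mkcond (EFin \o k) (mY c) (mu := mu).
  rewrite restrict_EFin => <-; exact: integrableS ik.
by rewrite -Rintegral_mkcond.
Qed.

End finite_valued_integrals.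

(** * Gaussian moments up to order four *)

Section gaussian_moments.
Variables (R : realType) (s : R).
Hypothesis s0 : 0 < s.
Notation mu := (@lebesgue_measure R).
Local Notation pdf := (normal_pdf (0 : R) s).

Let sn0 : s != 0. Proof. by rewrite gt_eqF. Qed.

Lemma normal_pdf_neq0 (m t x : R) : t != 0 ->
  normal_pdf m t x = normal_peak t * expR (- (x - m) ^+ 2 / (2 * t ^+ 2)).
Proof. by move=> t0; rewrite /normal_pdf (negbTE t0) mulr_natl. Qed.

Lemma normal_tilt2 (r x : R) : 0 < r ->
  expR ((1 - r ^+ 2) * (x ^+ 2 / (2 * s ^+ 2))) * pdf x = r^-1 * normal_pdf 0 (s / r) x.
Proof.
move=> r0; have rn0 : r != 0 by rewrite gt_eqF.
rewrite !normal_pdf_neq0 ?mulf_neq0 ?invr_eq0 //.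
have -> : normal_peak (s / r) = r * normal_peak s.
  rewrite /normal_peak expr_div_n -mulr_natr -mulrA mulrAC -mulrA.
  rewrite mulrC -[X in Num.sqrt X](_ : (r^-1) ^+ 2 * (s ^+ 2 * pi *+ 2) = _); last by field.
  by rewrite sqrtrM ?sqr_ge0 // sqrtr_sqr ger0_norm ?invr_ge0 ?(ltW r0) // invfM invrK.
rewrite -[r * _ * _]mulrA mulKf // mulrCA -expRD; congr (_ * expR _); rewrite !subr0.
rewrite expr_div_n.
move: (expf_neq0 2 sn0) (expf_neq0 2 rn0); move: (s ^+ 2) (r ^+ 2) (x ^+ 2) => u v y u0 v0.
by field; rewrite u0 v0.
Qed.

Lemma normal_tilt1 (a x : R) :
  expR (a * x / s ^+ 2) * pdf x = expR (a ^+ 2 / (2 * s ^+ 2)) * normal_pdf a s x.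
Proof.
rewrite !normal_pdf_neq0 //.
rewrite mulrCA -expRD [RHS]mulrCA -expRD; congr (_ * expR _).
rewrite subr0; move: (expf_neq0 2 sn0); move: (s ^+ 2) => u u0.
by field.
Qed.

Lemma integrable_tilt2 (r : R) : 0 < r -> mu.-integrable setT
  (EFin \o (fun x => expR ((1 - r ^+ 2) * (x ^+ 2 / (2 * s ^+ 2))) * pdf x)).
Proof.
move=> r0; have := integrableZl measurableT r^-1 (integrable_normal_pdf 0 (s / r)).
by apply: eq_integrable => // x _ /=; rewrite -EFinM -normal_tilt2.
Qed.

Lemma Rintegral_tilt2 (r : R) : 0 < r ->
  \int[mu]_x (expR ((1 - r ^+ 2) * (x ^+ 2 / (2 * s ^+ 2))) * pdf x) = r^-1.
Proof.
move=> r0; under eq_Rintegral do rewrite normal_tilt2 //.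
rewrite RintegralZl //; last exact: integrable_normal_pdf.
by rewrite /Rintegral integral_normal_pdf /= mulr1.
Qed.

Lemma integrable_tilt1 (a : R) : mu.-integrable setT
  (EFin \o (fun x => expR (a * x / s ^+ 2) * pdf x)).
Proof.
have := integrableZl measurableT (expR (a ^+ 2 / (2 * s ^+ 2))) (integrable_normal_pdf a s).
by apply: eq_integrable => // x _ /=; rewrite -EFinM -normal_tilt1.
Qed.

Lemma Rintegral_tilt1 (a : R) :
  \int[mu]_x (expR (a * x / s ^+ 2) * pdf x) = expR (a ^+ 2 / (2 * s ^+ 2)).
Proof.
under eq_Rintegral do rewrite normal_tilt1 //.
rewrite RintegralZl //; last exact: integrable_normal_pdf.
by rewrite /Rintegral integral_normal_pdf /= mulr1.
Qed.

(** With [y = x^2 / (4 s^2)] the quadratic term of the exponential gives [y^2 <= 2 e^y]; the value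
    [r^2 = 1/2] makes the exponent of the tilt equal to [y]. *)
Lemma normal_fourth_bound (x : R) :
  x ^+ 4 <= 32 * s ^+ 4 * expR ((1 - (Num.sqrt 2^-1) ^+ 2) * (x ^+ 2 / (2 * s ^+ 2))).
Proof.
rewrite sqr_sqrtr ?invr_ge0 //.
set y := (1 - 2^-1) * _; have yE : x ^+ 4 = 16 * s ^+ 4 * y ^+ 2.
  by rewrite /y; field.
have y0 : 0 <= y.
  apply: mulr_ge0; first by lra.
  by apply: divr_ge0; [exact: sqr_ge0|apply: mulr_ge0; [|exact: sqr_ge0]].
rewrite yE (_ : 32 * s ^+ 4 = 16 * s ^+ 4 * 2); last by ring.
rewrite -[leRHS]mulrA ler_wpM2l ?mulr_ge0 ?exprn_ge0 ?(ltW s0) //.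
have := expR_ge1Dxn 1 y0; rewrite (_ : 2`!%:R = 2) //.
by have := sqr_ge0 y; lra.
Qed.

Lemma integrable_fourth : mu.-integrable setT (EFin \o (fun x => x ^+ 4 * pdf x)).
Proof.
have r0 : 0 < Num.sqrt (2^-1 : R) by rewrite sqrtr_gt0.
have := integrableZl measurableT (32 * s ^+ 4) (integrable_tilt2 r0).
apply: le_integrable => //.
  apply/measurable_EFinP/measurable_funM; last exact: measurable_normal_pdf.
  exact: measurable_funX.
move=> x _; rewrite /= lee_fin mulrA [leLHS]ger0_norm; last first.
  by rewrite mulr_ge0 ?normal_pdf_ge0 ?exprn_even_ge0.
apply: le_trans (ler_norm _); rewrite ler_wpM2r ?normal_pdf_ge0 //.
exact: normal_fourth_bound.
Qed.

Lemma Rintegral_fourth : \int[mu]_x (x ^+ 4 * pdf x) <= 64 * s ^+ 4.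
Proof.
have r0 : 0 < Num.sqrt (2^-1 : R) by rewrite sqrtr_gt0.
apply: le_trans (_ : \int[mu]_x (32 * s ^+ 4 *
   (expR ((1 - (Num.sqrt (2^-1 : R)) ^+ 2) * (x ^+ 2 / (2 * s ^+ 2))) * pdf x)) <= _).
  apply: le_Rintegral => //; first exact: integrable_fourth.
    have := integrableZl measurableT (32 * s ^+ 4) (integrable_tilt2 r0).
    by apply: eq_integrable.
  move=> x _; rewrite mulrA ler_wpM2r ?normal_pdf_ge0 //; exact: normal_fourth_bound.
rewrite RintegralZl //; last exact: integrable_tilt2.
rewrite Rintegral_tilt2 // (_ : 64 * s ^+ 4 = 32 * s ^+ 4 * 2); last by ring.
rewrite ler_wpM2l ?mulr_ge0 ?exprn_ge0 ?(ltW s0) // -[leRHS]invrK lef_pV2 ?posrE ?invr_gt0 //.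
by rewrite -ler_sqr ?nnegrE ?sqrtr_ge0 ?invr_ge0 // sqr_sqrtr ?invr_ge0 //; lra.
Qed.

Lemma integrable_le_fourth (f : R -> R) : measurable_fun setT f ->
  (forall x, `|f x| <= 1 + x ^+ 4) -> mu.-integrable setT (EFin \o (fun x => f x * pdf x)).
Proof.
move=> mf fb.
have i1 : mu.-integrable setT (EFin \o (fun x => (1 + x ^+ 4) * pdf x)).
  have := integrableD measurableT (integrable_normal_pdf 0 s) integrable_fourth.
  by apply: eq_integrable => // x _ /=; rewrite mulrDl mul1r.
apply: le_integrable i1 => //.
  by apply/measurable_EFinP/measurable_funM => //; exact: measurable_normal_pdf.
move=> x _ /=; rewrite lee_fin !normrM ler_wpM2r //.
by apply: le_trans (fb x) (ler_norm _).
Qed.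

Lemma pow_le_fourth (x : R) : [/\ `|x| <= 1 + x ^+ 4, x ^+ 2 <= 1 + x ^+ 4 & `|x| ^+ 3 <= 1 + x ^+ 4].
Proof.
have -> : x ^+ 4 = `|x| ^+ 4 by rewrite -normrX ger0_norm // exprn_even_ge0.
have -> : x ^+ 2 = `|x| ^+ 2 by rewrite -normrX ger0_norm // exprn_even_ge0.
move: (normr_ge0 x); set y := `|x| => y0.
have h2 : 0 <= (y ^+ 2 - 1) ^+ 2 by exact: sqr_ge0.
have h3 : 0 <= (y - 1) ^+ 2 by exact: sqr_ge0.
have h4 : 0 <= (y ^+ 2 - y) ^+ 2 by exact: sqr_ge0.
have h5 := sqr_ge0 (y ^+ 2).
by split; nra.
Qed.

Lemma Rintegral_pdf : \int[mu]_x (1 * pdf x) = 1.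
Proof. by under eq_Rintegral do rewrite mul1r; rewrite /Rintegral integral_normal_pdf. Qed.

Lemma integrable_id_pdf : mu.-integrable setT (EFin \o (fun x => x * pdf x)).
Proof. by apply: integrable_le_fourth => // x; case: (pow_le_fourth x). Qed.

Lemma integrable_sq_pdf : mu.-integrable setT (EFin \o (fun x => x ^+ 2 * pdf x)).
Proof.
apply: integrable_le_fourth; first exact: measurable_funX.
by move=> x; rewrite ger0_norm ?sqr_ge0 //; case: (pow_le_fourth x).
Qed.

Lemma integrable_1_pdf : mu.-integrable setT (EFin \o (fun x => 1 * pdf x)).
Proof. by have := integrable_normal_pdf 0 s; apply: eq_integrable => // x _ /=; rewrite mul1r. Qed.

(* Both moments follow from [1 + u <= expR u] applied to the exponential tilts
   of the density, which are again multiples of normal densities. *)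
Lemma Rintegral_sq : \int[mu]_x (x ^+ 2 * pdf x) = s ^+ 2.
Proof.
set W := Rintegral _ _ _.
have key r : 0 < r -> 1 + (1 - r ^+ 2) * (W / (2 * s ^+ 2)) <= r^-1.
  move=> r0; rewrite -(Rintegral_tilt2 r0).
  have i2 : mu.-integrable setT (EFin \o (fun x => (1 - r ^+ 2) / (2 * s ^+ 2) * (x ^+ 2 * pdf x))).
    have := integrableZl measurableT ((1 - r ^+ 2) / (2 * s ^+ 2)) integrable_sq_pdf.
    by apply: eq_integrable.
  have -> : 1 + (1 - r ^+ 2) * (W / (2 * s ^+ 2)) =
      \int[mu]_x (1 * pdf x + (1 - r ^+ 2) / (2 * s ^+ 2) * (x ^+ 2 * pdf x)).
    rewrite RintegralD //; last exact: integrable_1_pdf.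
    rewrite Rintegral_pdf RintegralZl //; last exact: integrable_sq_pdf.
    by rewrite -/W; ring.
  apply: le_Rintegral => //; [|exact: integrable_tilt2|].
    have := integrableD measurableT integrable_1_pdf i2.
    by apply: eq_integrable.
  move=> x _; rewrite [_ / _ * _]mulrA -mulrDl ler_wpM2r ?normal_pdf_ge0 //.
  rewrite (_ : _ / _ * _ = (1 - r ^+ 2) * (x ^+ 2 / (2 * s ^+ 2))); last by ring.
  exact: expR_ge1Dx.
have s2 : 0 < s ^+ 2 by rewrite exprn_gt0.
suff : W / (2 * s ^+ 2) = 2^-1.
  by move=> /(congr1 (fun z => z * (2 * s ^+ 2))); rewrite divfK ?mulf_neq0 ?gt_eqF // => ->; field.
move: key; set w := W / _ => key.
have key' r : 0 < r -> r * (1 + (1 - r ^+ 2) * w) <= 1.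
  by move=> r0; rewrite -[leRHS](mulfV (_ : r != 0)) ?gt_eqF // ler_wpM2l ?key // ltW.
clearbody w; clear key.
(* [key'] bounds a cubic in [r] by its value at [r = 1], so its derivative [1 - 2 * w] there must
   vanish; the values of [r] below are explicit perturbations of 1 that contradict either sign. *)
have [h|h|//] := ltgtP w (2^-1).
  have e0 : 0 < 2^-1 - w by lra.
  have := key' (1 + (2^-1 - w)) ltac:(lra).
  move: e0; set e := 2^-1 - w => e0; have -> : w = 2^-1 - e by rewrite /e; ring.
  have e2 : 0 < e ^+ 2 by rewrite exprn_gt0.
  have e3 : 0 < e ^+ 3 by rewrite exprn_gt0.
  have e4 : 0 < e ^+ 4 by rewrite exprn_gt0.
  have -> : (1 + e) * (1 + (1 - (1 + e) ^+ 2) * (2^-1 - e)) =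
     1 + (2^-1 * e ^+ 2 + (5 / 2) * e ^+ 3 + e ^+ 4) by field.
  by lra.
have e0 : 0 < w - 2^-1 by lra.
move: e0; set e := w - 2^-1 => e0; have wE : w = 2^-1 + e by rewrite /e; ring.
have e1 : 0 < 1 + 2 * e by lra.
have t0 : 0 < e / (1 + 2 * e) by rewrite divr_gt0.
have t1 : e / (1 + 2 * e) < 1 by rewrite ltr_pdivrMr //; lra.
have tE : e / (1 + 2 * e) * (1 + 2 * e) = e by rewrite divfK // gt_eqF.
have := key' (1 - e / (1 + 2 * e)) ltac:(lra).
move: t0 t1 tE; set t := e / _ => t0 t1 tE; rewrite wE.
have -> : (1 - t) * (1 + (1 - (1 - t) ^+ 2) * (2^-1 + e)) =
   1 + t * (2 * e - 3 / 2 * (t * (1 + 2 * e)) + t ^+ 2 * (1 + 2 * e) / 2) by field.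
rewrite tE; have : 0 < t * (2 * e - 3 / 2 * e + t ^+ 2 * (1 + 2 * e) / 2).
  have : 0 <= t ^+ 2 * (1 + 2 * e) by rewrite mulr_ge0 ?sqr_ge0 // ltW.
  by move=> ?; rewrite mulr_gt0 //; lra.
by lra.
Qed.

Lemma Rintegral_id : \int[mu]_x (x * pdf x) = 0.
Proof.
set W := Rintegral _ _ _.
have s2 : 0 < s ^+ 2 by rewrite exprn_gt0.
have key a : 1 + a / s ^+ 2 * W <= expR (a ^+ 2 / (2 * s ^+ 2)).
  rewrite -Rintegral_tilt1.
  have i2 : mu.-integrable setT (EFin \o (fun x => a / s ^+ 2 * (x * pdf x))).
    have := integrableZl measurableT (a / s ^+ 2) integrable_id_pdf.
    by apply: eq_integrable.
  have -> : 1 + a / s ^+ 2 * W = \int[mu]_x (1 * pdf x + a / s ^+ 2 * (x * pdf x)).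
    rewrite RintegralD //; last exact: integrable_1_pdf.
    by rewrite Rintegral_pdf RintegralZl //; exact: integrable_id_pdf.
  apply: le_Rintegral => //; [|exact: integrable_tilt1|].
    have := integrableD measurableT integrable_1_pdf i2.
    by apply: eq_integrable.
  move=> x _; rewrite [_ / _ * _]mulrA -mulrDl ler_wpM2r ?normal_pdf_ge0 //.
  by rewrite [a / _ * _]mulrAC; exact: expR_ge1Dx.
(* A linear function dominated by a square near zero must vanish; the case analysis below tests this
   at [b = w / 2]. *)
have key2 b : `|b| < 1 -> b * (W / s) <= b ^+ 2.
  move=> b1; have := key (b * s).
  have -> : b * s / s ^+ 2 * W = b * (W / s) by field; rewrite gt_eqF.
  have -> : (b * s) ^+ 2 / (2 * s ^+ 2) = b ^+ 2 / 2 by field; rewrite gt_eqF.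
  have b2 : 0 <= b ^+ 2 < 1 by rewrite sqr_ge0 -[X in _ < X](expr1n _ 2) -[b ^+ 2]real_normK ?num_real // ltr_pXn2r ?nnegrE.
  have := expR_ge1Dx (- (b ^+ 2 / 2)); rewrite expRN => h1.
  have h0 : 0 < 1 - b ^+ 2 / 2 by lra.
  have : expR (b ^+ 2 / 2) <= (1 - b ^+ 2 / 2)^-1.
    by rewrite -[leLHS]invrK lef_pV2 ?posrE ?invr_gt0 ?expR_gt0 //; lra.
  move=> h2 h3; have : (1 - b ^+ 2 / 2)^-1 <= 1 + b ^+ 2.
    rewrite -[leLHS]mul1r ler_pdivrMr //.
    have := sqr_ge0 (b ^+ 2); have : b ^+ 2 * b ^+ 2 <= b ^+ 2 by rewrite ler_piMl //; lra.
    by move=> ? ?; lra.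
  by lra.
suff : W / s = 0 by move=> /eqP; rewrite mulf_eq0 invr_eq0 (negbTE sn0) orbF => /eqP.
move: key2; set w := W / s; clearbody w; clear => key.
have [h|h|//] := ltgtP w 0.
  have [w1|w1] := leP w (-1).
    by have := key (- 2^-1) ltac:(rewrite normrN ger0_norm; lra); lra.
  have := key (w / 2) ltac:(rewrite ltr0_norm; lra); have : 0 < w * w by rewrite nmulr_rgt0.
  by move=> ? ?; lra.
have [w1|w1] := leP 1 w.
  by have := key (2^-1) ltac:(rewrite ger0_norm; lra); lra.
have := key (w / 2) ltac:(rewrite ger0_norm; lra); have : 0 < w * w by rewrite mulr_gt0.
by move=> ? ?; lra.
Qed.

End gaussian_moments.

(** * Rounding a Gaussian variable to finitely many values *)

Section cells.
Variable R : realType.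
Implicit Types (x s : R) (m : nat).

Definition ncell m := (2 * m.+1 ^ 2)%N.

(** The interval from [- m.+1] to [m.+1] is cut into cells of length [1 / m.+1]; [None] collects
    both tails. *)
Definition cellof m x : option 'I_(ncell m) :=
  let z := (x + m.+1%:R) * m.+1%:R in if 0 <= z then insub (Num.trunc z) else None.

Definition cval m (c : option 'I_(ncell m)) : R :=
  if c is Some i then i%:R / m.+1%:R - m.+1%:R else 0.

Lemma cellof_some m x (i : 'I_(ncell m)) : cellof m x = Some i <->
  i%:R / m.+1%:R - m.+1%:R <= x < (i.+1)%:R / m.+1%:R - m.+1%:R.
Proof.
have m0 : 0 < m.+1%:R :> R by rewrite ltr0n.
rewrite lerBlDr ltrBrDr ler_pdivrMr // ltr_pdivlMr // /cellof.
set z := (x + _) * _; split.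
  case: ifP => // z0; case: insubP => // j jn ji [ij].
  have := truncn_itv z0; by rewrite -ij ji.
move=> zi; have z0 : 0 <= z by rewrite (le_trans _ (andP zi).1).
by rewrite z0 (truncn_def zi) valK.
Qed.

Lemma cval_approx m x : `|x| < m.+1%:R -> `|cval (cellof m x) - x| <= m.+1%:R^-1.
Proof.
have m0 : 0 < m.+1%:R :> R by rewrite ltr0n.
rewrite ltr_norml => /andP[xl xr].
case E : (cellof m x) => [i|].
  move/cellof_some : E; rewrite -[i.+1]addn1 natrD mulrDl mul1r /=.
  have aux (a b c : R) : a - c <= x < a + b - c -> `|a - c - x| <= b.
    by move=> /andP[? ?]; rewrite ler_norml; apply/andP; split; lra.
  exact: aux.
move: E; rewrite /cellof; set z := (x + _) * _.
have z0 : 0 <= z by rewrite mulr_ge0 //; lra.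
rewrite z0; case: insubP => // /negP[].
rewrite -(ltr_nat R) (le_lt_trans (andP (truncn_itv z0)).1) // /z /ncell natrM natrX.
by rewrite expr2 mulrA ltr_pM2r //; lra.
Qed.

Lemma cval_bound m x : `|cval (cellof m x)| <= `|x| + 1.
Proof.
case E : (cellof m x) => [i|] /=; last by rewrite normr0 addr_ge0.
have m1 : m.+1%:R^-1 <= 1 :> R by rewrite invf_le1 ?ltr0n // ler1n.
move/cellof_some : E; rewrite -[i.+1]addn1 natrD mulrDl mul1r; move: m1.
have aux (a b c : R) : b <= 1 -> a - c <= x < a + b - c -> `|a - c| <= `|x| + 1.
  have := ler_norm x; have := ler_norm (- x); rewrite normrN => ? ? ? /andP[? ?].
  by rewrite ler_norml; apply/andP; split; lra.
exact: aux.
Qed.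

Lemma cval_cvg x : cval (cellof m x) @[m --> \oo] --> x.
Proof.
apply/cvgrPdist_le => e e0.
near=> m; rewrite distrC; apply: le_trans (cval_approx _) _.
  near: m; exists (Num.trunc `|x|) => // m /= xm.
  by apply: lt_le_trans (truncnS_gt _) _; rewrite ler_nat ltnS.
rewrite -[leRHS]invrK lef_pV2 ?posrE ?invr_gt0 ?ltr0n //.
near: m; exists (Num.trunc e^-1) => // m /= xm.
by apply: le_trans (ltW (truncnS_gt _)) _; rewrite ler_nat ltnS.
Unshelve. all: by end_near. Qed.

Lemma measurable_cell m c : measurable (cellof m @^-1` [set c]).
Proof.
have mS (i : 'I_(ncell m)) : measurable (cellof m @^-1` [set Some i]).
  rewrite (_ : _ @^-1` _ = [set` `[i%:R / m.+1%:R - m.+1%:R, (i.+1)%:R / m.+1%:R - m.+1%:R[ ]).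
    exact: measurable_itv.
  apply/seteqP; split=> x /=; rewrite in_itv /=; by move/cellof_some.
case: c => [i|]; first exact: mS.
rewrite (_ : _ @^-1` _ = ~` (\bigcup_(i in [set: 'I_(ncell m)]) (cellof m @^-1` [set Some i]))).
  apply: measurableC; apply: fin_bigcup_measurable => // i _; exact: mS.
apply/seteqP; split=> x /=; first by move=> e [i _ /=]; rewrite e.
by case E : (cellof m x) => [i|] // h; exfalso; apply: h; exists i.
Qed.

Definition gauss_pmf s m (c : option 'I_(ncell m)) : R :=
  fine (normal_prob 0 s (cellof m @^-1` [set c])).

Lemma gauss_pmf_sum s m (g : option 'I_(ncell m) -> R) :
  \sum_c gauss_pmf s c * g c =
  \int[lebesgue_measure]_x (g (cellof m x) * normal_pdf 0 s x).
Proof.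
rewrite (Rintegral_cells (mu := lebesgue_measure) (k := normal_pdf 0 s) (Y := cellof m) g (measurable_cell (m := m))).
  by apply: eq_bigr => c _; rewrite mulrC.
exact: integrable_normal_pdf.
Qed.

Lemma is_pmf_gauss s m : is_pmf (@gauss_pmf s m).
Proof.
split=> [c|]; first by rewrite fine_ge0.
have := gauss_pmf_sum s (fun _ : option 'I_(ncell m) => 1).
under eq_bigr do rewrite mulr1.
by move=> ->; under eq_Rintegral do rewrite mul1r; rewrite /Rintegral integral_normal_pdf.
Qed.

Lemma gauss_pmf_cvg s (g : R -> R) : 0 < s -> continuous g ->
  (forall y, `|g y| <= 1 + `|y| ^+ 3) ->
  (fun m => \sum_c gauss_pmf s c * g (cval (m := m) c)) @ \oo -->
  \int[lebesgue_measure]_x (g x * normal_pdf 0 s x).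
Proof.
move=> s0 cg gb.
have mg : measurable_fun setT g by exact: continuous_measurable_fun.
have gb4 x : `|g x| <= 2 * (1 + x ^+ 4).
  by have [_ _ h] := pow_le_fourth x; have := gb x; have : 0 <= x ^+ 4 by [rewrite exprn_even_ge0]; lra.
have gbr m x : `|g (cval (cellof m x))| <= 17 * (1 + x ^+ 4).
  apply: le_trans (gb _) _.
  have h1 := cval_bound m x; have : `|cval (cellof m x)| ^+ 3 <= (`|x| + 1) ^+ 3.
    by rewrite lerXn2r ?nnegrE ?addr_ge0.
  have [a1 a2 a3] := pow_le_fourth x; move: a2.
  rewrite -[x ^+ 2]real_normK ?num_real // => a2.
  have -> : (`|x| + 1) ^+ 3 = `|x| ^+ 3 + 3 * `|x| ^+ 2 + 3 * `|x| + 1 by ring.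
  have : 0 <= x ^+ 4 by rewrite exprn_even_ge0.
  by lra.
pose f_ m (x : R) := (g (cval (cellof m x)) * normal_pdf 0 s x)%:E.
pose f (x : R) := (g x * normal_pdf 0 s x)%:E.
pose dom (x : R) := (17 * (1 + x ^+ 4) * normal_pdf 0 s x)%:E.
have idom : lebesgue_measure.-integrable setT dom.
  have := integrableZl measurableT 17 (integrableD measurableT (integrable_1_pdf s) (integrable_fourth s0)).
  by apply: eq_integrable => // x _; rewrite /dom /= -EFinD -EFinM; congr (_%:E); ring.
have if_ m : lebesgue_measure.-integrable setT (f_ m).
  have := integrable_cells (mu := lebesgue_measure) (k := normal_pdf 0 s) (Y := cellof m) (fun c => g (cval c)) (measurable_cell (m := m)) (integrable_normal_pdf 0 s).
  by apply: eq_integrable.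
have mf_ m : measurable_fun setT (f_ m) by case/integrableP: (if_ m).
have mf : measurable_fun setT f.
  apply/measurable_EFinP/measurable_funM => //; exact: measurable_normal_pdf.
have [] := @dominated_convergence _ _ _ lebesgue_measure setT measurableT f_ f dom mf_ mf.
- apply: aeW => x _; apply: cvg_EFin; first exact: nearW.
  have h : (fun m => g (cval (cellof m x))) @ \oo --> g x.
    by apply: continuous_cvg; [exact: cg|exact: cval_cvg].
  exact: (cvgM h (cvg_cst _)).
- exact: idom.
- apply: aeW => x m _ /=; rewrite lee_fin normrM (ger0_norm (normal_pdf_ge0 _ _ _)).
  by rewrite ler_wpM2r ?normal_pdf_ge0.
move=> intf _ cvgf.
under eq_fun do rewrite (gauss_pmf_sum s (fun c => g (cval c))).
apply: fine_cvg; rewrite fineK; first exact: cvgf.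
exact: integrable_fin_num.
Qed.

End cells.

Section lipschitz_sequences.
Variable R : realType.

Definition l1dist (xs ys : seq R) : R := \sum_(q <- zip xs ys) `|q.1 - q.2|.

Definition lipseq (L : R) (F : seq R -> R) := forall xs ys, size xs = size ys ->
  `|F xs - F ys| <= L * l1dist xs ys.

Lemma l1dist_cat xs ys xs' ys' : size xs = size ys ->
  l1dist (xs ++ xs') (ys ++ ys') = l1dist xs ys + l1dist xs' ys'.
Proof. by move=> e; rewrite /l1dist zip_cat // big_cat. Qed.

Lemma l1dist_ge0 xs ys : 0 <= l1dist xs ys.
Proof. exact: sumr_ge0. Qed.

Lemma l1dist_mkseq (f g : nat -> R) K :
  l1dist (mkseq f K) (mkseq g K) = \sum_(j < K) `|f j - g j|.
Proof.
rewrite /l1dist /mkseq -(big_mkord xpredT (fun j => `|f j - g j|)) /index_iota subn0.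
by elim: (iota 0 K) => [|j s IH] /=; rewrite ?big_nil ?big_cons ?IH.
Qed.

Lemma wsum_l1dist xs ys : size xs = size ys -> `|wsum idfun xs - wsum idfun ys| <= l1dist xs ys.
Proof.
elim: xs ys => [|x xs IH] [|y ys] //=; first by rewrite /wsum big_nil subrr normr0 l1dist_ge0.
move=> [/IH h]; rewrite !wsum_cons /l1dist /= big_cons /=.
rewrite opprD addrACA; apply: le_trans (ler_normD _ _) _; exact: lerD.
Qed.

Lemma bsums_map (T : Type) (xi : T -> R) k m s : bsums xi k m s = bsums idfun k m (map xi s).
Proof.
elim: m s => //= m IH s; rewrite IH map_drop -map_take; congr (_ :: _).
by rewrite /wsum big_map.
Qed.

Lemma size_bsums (T : Type) (xi : T -> R) k m s : size (bsums xi k m s) = m.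
Proof. by elim: m s => //= m IH s; rewrite IH. Qed.

Lemma l1dist_bsums k m xs ys : size xs = size ys ->
  l1dist (bsums idfun k m xs) (bsums idfun k m ys) <= l1dist xs ys.
Proof.
elim: m xs ys => [|m IH] xs ys e /=; first by rewrite {1}/l1dist big_nil l1dist_ge0.
rewrite /l1dist /= big_cons -/(l1dist _ _) -/(l1dist _ _).
have et : size (take k xs) = size (take k ys) by rewrite !size_take e.
rewrite -[in leRHS](cat_take_drop k xs) -[in leRHS](cat_take_drop k ys) l1dist_cat //.
by rewrite lerD ?wsum_l1dist // IH // !size_drop e.
Qed.

Lemma lipseq_bsums (L : R) F k m : 0 <= L -> lipseq L F -> lipseq L (fun s => F (bsums idfun k m s)).
Proof.
move=> L0 FL xs ys e; apply: le_trans (FL _ _ _) _; first by rewrite !size_bsums.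
by rewrite ler_wpM2l // l1dist_bsums.
Qed.

Lemma lipseq_coord (L : R) F u x y v : lipseq L F -> `|F (u ++ x :: v) - F (u ++ y :: v)| <= L * `|x - y|.
Proof.
move=> FL; have := FL (u ++ x :: v) (u ++ y :: v); rewrite !size_cat => /(_ erefl).
rewrite l1dist_cat // /l1dist /= big_cons /= !big1_seq ?addr0 ?add0r //.
  by move=> q /andP[_]; elim: v => //= z v IH; rewrite inE => /orP[/eqP ->|//]; rewrite subrr normr0.
by move=> q /andP[_]; elim: u => //= z u IH; rewrite inE => /orP[/eqP ->|//]; rewrite subrr normr0.
Qed.

End lipschitz_sequences.

(** * Brownian increments as limits of finite laws *)

Section brownian_cells.
Context d (T : measurableType d) (R : realType) (Pr : probability T R) (B : R -> T -> R).
Hypothesis hB : is_std_BM Pr B.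

Definition incr (dt : R) (j : nat) (w : T) : R := B (j.+1%:R * dt) w - B (j%:R * dt) w.

Lemma measurable_incr dt j : measurable_fun setT (incr dt j).
Proof. by case: hB => mB _ _ _; exact: measurable_funB. Qed.

Lemma EL_tuple (C : finType) (p : C -> R) K (F : seq C -> R) :
  EL p K F = \sum_(t : K.-tuple C) (\prod_(j < K) p (tnth t j)) * F t.
Proof.
elim: K F => [|K IH] F /=.
  rewrite (eq_bigl (xpred1 [tuple])) ?big_pred1_eq ?big_ord0 ?mul1r //.
  by move=> t; rewrite tuple0; apply/esym/eqP.
under eq_bigr => x _ do rewrite IH mulr_sumr.
rewrite pair_big /= (reindex (fun t : K.+1.-tuple C => (thead t, [tuple of behead t]))) /=.
  apply: eq_bigr => t _; case/tupleP: t => x t.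
  rewrite theadE mulrA big_ord_recl tnth0 /=; congr (_ * _ * _).
  by apply: eq_bigr => j _; rewrite !(tnth_nth x).
exists (fun q : C * K.-tuple C => [tuple of q.1 :: q.2]) => [t _|[x t] _] /=.
  by rewrite [RHS]tuple_eta.
by rewrite theadE; congr (_, _); exact: val_inj.
Qed.

Variables (dt : R).
Hypothesis dt0 : 0 < dt.
Let s := Num.sqrt dt.

Definition cellseq m K (w : T) := mkseq (fun j => cellof m (incr dt j w)) K.

Lemma cell_law m K (t : K.-tuple (option 'I_(ncell m))) :
  Pr [set w | cellseq m K w = t] = (\prod_(j < K) gauss_pmf s (tnth t j))%:E.
Proof.
case: hB => _ _ _ /(_ K (fun j => j%:R * dt) (fun j => cellof m @^-1` [set nth None t j])).
rewrite mul0r lexx => /(_ isT) H.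
rewrite (_ : [set w | _] = \bigcap_(j in `I_K) [set w | (cellof m @^-1` [set nth None t j]) (incr dt j w)]).
  rewrite H; last 2 first.
  - by move=> i _; rewrite ltr_pM2r // ltr_nat.
  - by move=> i; exact: measurable_cell.
  rewrite -prodEFin; apply: eq_bigr => j _.
  rewrite -mulrBl -natrB // subSnn mul1r /gauss_pmf fineK ?fin_num_measure //; last exact: measurable_cell.
  by rewrite (tnth_nth None).
apply/seteqP; split=> w /=.
  by move=> <- j jK; rewrite nth_mkseq.
move=> h; apply: (@eq_from_nth _ None); rewrite size_mkseq ?size_tuple // => j jK.
by rewrite nth_mkseq //; exact: h.
Qed.

Lemma measurable_cellseq m K (t : seq (option 'I_(ncell m))) :
  measurable [set w | cellseq m K w = t].
Proof.
have [tK|tK] := eqVneq (size t) K; last first.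
  rewrite (_ : [set w | _] = set0) //; apply/seteqP; split=> // w /= e.
  by move: tK; rewrite -e size_mkseq eqxx.
rewrite (_ : [set w | _] = \bigcap_(j in `I_K) (incr dt j @^-1` (cellof m @^-1` [set nth None t j]))).
  apply: bigcap_measurableType => j _.
  by rewrite -[X in measurable X]setTI; apply: measurable_incr => //; exact: measurable_cell.
apply/seteqP; split=> w /=.
  by move=> <- j jK; rewrite nth_mkseq.
move=> h; apply: (@eq_from_nth _ None); rewrite size_mkseq ?tK // => j jK.
by rewrite nth_mkseq //; exact: h.
Qed.

Lemma EL_cellseq m K (F : seq (option 'I_(ncell m)) -> R) :
  Pr.-integrable setT (EFin \o (fun w => F (cellseq m K w))) /\
  \int[Pr]_w F (cellseq m K w) = EL (gauss_pmf s (m := m)) K F.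
Proof.
pose Y w : K.-tuple (option 'I_(ncell m)) := Tuple (introT eqP (size_mkseq (fun j => cellof m (incr dt j w)) K)).
have YE t : Y @^-1` [set t] = [set w | cellseq m K w = t].
  by apply/seteqP; split=> w /= [e]; [rewrite -e|apply: val_inj].
have mY t : measurable (Y @^-1` [set t]) by rewrite YE; exact: measurable_cellseq.
have i1 : Pr.-integrable setT (EFin \o (fun _ : T => 1 : R)) by exact: finite_measure_integrable_cst.
split.
  have := integrable_cells (mu := Pr) (Y := Y) (fun t => F t) mY i1.
  by apply: eq_integrable => // w _ /=; rewrite mulr1.
have := Rintegral_cells (mu := Pr) (Y := Y) (fun t => F t) mY i1.
under eq_Rintegral do rewrite mulr1; move=> ->.
rewrite EL_tuple; apply: eq_bigr => t _; rewrite mulrC; congr (_ * _).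
by rewrite Rintegral_cst // mul1r YE; move: (cell_law t) => /= ->.
Qed.

Lemma EL_cells_cvg K (v : forall m, option 'I_(ncell m) -> R) (M L : R) (F : seq R -> R) :
  (forall x : R, v m (cellof m x) @[m --> \oo] --> x) ->
  (forall xs, `|F xs| <= M) -> lipseq L F ->
  measurable_fun setT (fun w => F (mkseq (fun j => incr dt j w) K)) /\
  (fun m => EL (gauss_pmf s (m := m)) K (fun c => F (map (v m) c))) @ \oo -->
  \int[Pr]_w F (mkseq (fun j => incr dt j w) K).
Proof.
move=> vx FM FL.
pose f_ m w := F (map (v m) (cellseq m K w)).
pose f w := F (mkseq (fun j => incr dt j w) K).
have if_ m : Pr.-integrable setT (EFin \o f_ m) by have [] := @EL_cellseq m K (fun c => F (map (v m) c)).
have mf_ m : measurable_fun setT (f_ m) by case/integrableP: (if_ m) => /measurable_EFinP.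
have cvgf w : f_ m w @[m --> \oo] --> f w.
  apply/cvgrPdist_le => e e0.
  have sumcvg : (fun m => L * \sum_(j < K) `|incr dt j w - v m (cellof m (incr dt j w))|) @ \oo --> 0.
    rewrite -[X in _ --> X](mulr0 L); apply: cvgM; first exact: cvg_cst.
    elim: K {f f_ if_ mf_} => [|K' IH]; first by under eq_fun do rewrite big_ord0; exact: cvg_cst.
    under eq_fun do rewrite big_ord_recr /=.
    have c1 : (fun m => `|incr dt K' w - v m (cellof m (incr dt K' w))|) @ \oo --> (0 : R).
      have c0 : (fun m => incr dt K' w - v m (cellof m (incr dt K' w))) @ \oo --> (0 : R).
        rewrite -(subrr (incr dt K' w)); apply: cvgB; [exact: cvg_cst|exact: vx].
      by have := cvg_norm c0; rewrite (@normr0 _ R); apply.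
    by have := cvgD IH c1; rewrite addr0; apply.
  move/cvgrPdist_le: sumcvg => /(_ e e0); apply: filterS => m.
  rewrite sub0r normrN => h; apply: le_trans (le_trans (ler_norm _) h).
  have := FL (mkseq (fun j => incr dt j w) K) (map (v m) (cellseq m K w)).
  rewrite size_mkseq size_map size_mkseq => /(_ erefl).
  have E : map (v m) (cellseq m K w) = mkseq (fun j => v m (cellof m (incr dt j w))) K.
    by rewrite /cellseq /mkseq -map_comp.
  by rewrite /f /f_ E (l1dist_mkseq (fun j => incr dt j w)).
have mf : measurable_fun setT f by apply: (measurable_fun_cvg mf_) => w _; exact: cvgf.
split=> //.
have [] := @dominated_convergence _ _ _ Pr setT measurableT (fun m => EFin \o f_ m) (EFin \o f) (EFin \o cst M).
- by move=> m; exact/measurable_EFinP.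
- exact/measurable_EFinP.
- by apply: aeW => w _; apply: cvg_EFin; [exact: nearW|exact: cvgf].
- exact: finite_measure_integrable_cst.
- by apply: aeW => w m _; rewrite /= lee_fin; exact: FM.
move=> intf _ cv.
under eq_fun => m do rewrite -(@EL_cellseq m K (fun c => F (map (v m) c))).2.
by apply: fine_cvg; rewrite fineK; [exact: cv|exact: integrable_fin_num].
Qed.

End brownian_cells.

Section brownian_blocks.
Context d (T : measurableType d) (R : realType) (Pr : probability T R) (B : R -> T -> R).
Hypothesis hB : is_std_BM Pr B.

Lemma bsums_incr (dt : R) k m w : (0 < k)%N ->
  bsums idfun k m (mkseq (fun j => incr B (dt / k%:R) j w) (m * k)) =
  mkseq (fun j => incr B dt j w) m.
Proof.
move=> k0; have kn0 : k%:R != 0 :> R by rewrite pnatr_eq0 -lt0n.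
suff H a : bsums idfun k m (map (fun j => incr B (dt / k%:R) j w) (iota (a * k) (m * k))) =
    map (fun j => incr B dt j w) (iota a m) by have := H 0; rewrite mul0n.
have wi b n : wsum idfun (map (fun j => incr B (dt / k%:R) j w) (iota b n)) =
    B ((b + n)%N%:R * (dt / k%:R)) w - B (b%:R * (dt / k%:R)) w.
  elim: n b => [|n IH] b /=; first by rewrite /wsum big_nil addn0 subrr.
  by rewrite wsum_cons IH /incr /= addSnnS addrC addrA subrK.
elim: m a => //= m IH a.
rewrite -map_take -map_drop mulSn iotaD take_cat drop_cat size_iota ltnn subnn take0 drop0 cats0.
rewrite -[(a * k + k)%N]addnC -mulSn IH; congr (_ :: _).
rewrite wi /incr -mulSnr; congr (B _ w - B _ w); rewrite natrM; field; exact: kn0.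
Qed.

(** The comparison of walks works with finite laws, so each Brownian increment over [dt] is split
    into [k] pieces and each piece is replaced by its cell value. Subtracting the mean makes the
    values exactly centred, as [lindeberg] requires. *)
Lemma gauss_blocks (dt e M L : R) (m k : nat) (F : seq R -> R) : 0 < dt -> 0 < e -> (0 < k)%N ->
  0 <= L -> (forall xs, `|F xs| <= M) -> lipseq L F ->
  exists (C : finType) (p xi : C -> R), [/\ is_pmf p, \sum_c p c * xi c = 0,
    `|k%:R * \sum_c p c * xi c ^+ 2 - dt| <= e,
    \sum_c p c * `|xi c| ^+ 3 <= 140 * Num.sqrt (dt / k%:R) ^+ 3 &
    `|EL p (m * k) (fun s => F (bsums xi k m s)) -
      \int[Pr]_w F (mkseq (fun j => incr B dt j w) m)| <= e].
Proof.
move=> dt0 e0 k0 L0 FM FL.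
have k0' : 0 < k%:R :> R by rewrite ltr0n.
have dk0 : 0 < dt / k%:R by rewrite divr_gt0.
set s := Num.sqrt (dt / k%:R); have s0 : 0 < s by rewrite sqrtr_gt0.
have s2 : s ^+ 2 = dt / k%:R by rewrite sqr_sqrtr // ltW.
pose p n := gauss_pmf s (m := n).
have pp n : is_pmf (p n) by exact: is_pmf_gauss.
pose mean n := \sum_c p n c * cval R c.
have mean0 : mean @ \oo --> 0.
  rewrite -(Rintegral_id s0); apply: (gauss_pmf_cvg s0 (g := idfun)).
    by move=> x; exact: cvg_id.
  move=> y; have [y1|y1] := leP `|y| 1; first by rewrite (le_trans y1) // lerDl exprn_ge0.
  by rewrite (@le_trans _ _ (`|y| ^+ 3)) ?lerDr // -[leLHS]expr1 ler_eXn2l.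
have sq : (fun n => \sum_c p n c * cval R c ^+ 2) @ \oo --> s ^+ 2.
  rewrite -(Rintegral_sq s0); apply: (gauss_pmf_cvg s0 (g := fun x => x ^+ 2)).
    by move=> x; exact: exprn_continuous.
  move=> y; rewrite ger0_norm ?sqr_ge0 // -[y ^+ 2]real_normK ?num_real //.
  have [y1|y1] := leP `|y| 1; first by rewrite (@le_trans _ _ 1) ?exprn_ile1 // lerDl exprn_ge0.
  by rewrite (@le_trans _ _ (`|y| ^+ 3)) ?lerDr // ler_eXn2l.
have cnt3 : continuous (fun x : R => `|x| ^+ 3).
  move=> x; exact: (@continuous_comp R R R (fun y : R => `|y|) (fun y => y ^+ 3) x
    (@norm_continuous _ _ x) (@exprn_continuous _ 3 _)).
have cube : (fun n => \sum_c p n c * `|cval R c| ^+ 3) @ \oo -->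
    \int[lebesgue_measure]_x (`|x| ^+ 3 * normal_pdf 0 s x).
  apply: (gauss_pmf_cvg s0 (g := fun x => `|x| ^+ 3)).
    exact: cnt3.
  by move=> y; rewrite ger0_norm ?exprn_ge0 // lerDr.
(* Uses [|x|^3 <= (s / 2) x^2 + x^4 / (2 s)] with second moment [s^2] and fourth moment at most
   [64 s^4], rounded up to [65 s^4]. *)
have cubeb : \int[lebesgue_measure]_x (`|x| ^+ 3 * normal_pdf 0 s x) <= 33 * s ^+ 3.
  have i2 := integrableZl measurableT (s / 2) (integrable_sq_pdf s0).
  have i4 := integrableZl measurableT (1 / (2 * s)) (integrable_fourth s0).
  apply: le_trans (_ : \int[lebesgue_measure]_x (s / 2 * (x ^+ 2 * normal_pdf 0 s x) +
      1 / (2 * s) * (x ^+ 4 * normal_pdf 0 s x)) <= _).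
    apply: le_Rintegral => //.
    - apply: integrable_le_fourth => //.
        exact: (continuous_measurable_fun cnt3).
      by move=> x; rewrite ger0_norm ?exprn_ge0 //; case: (pow_le_fourth x).
    - by have := integrableD measurableT i2 i4; apply: eq_integrable.
    - move=> x _; rewrite [s / 2 * _]mulrA [1 / (2 * s) * _]mulrA -mulrDl ler_wpM2r ?normal_pdf_ge0 //.
      have -> : x ^+ 2 = `|x| ^+ 2 by rewrite real_normK ?num_real.
      have -> : x ^+ 4 = `|x| ^+ 4 by rewrite -normrX ger0_norm // exprn_even_ge0.
      rewrite -subr_ge0 (_ : _ - _ = `|x| ^+ 2 * (`|x| - s) ^+ 2 / (2 * s)); last first.
        by field; rewrite gt_eqF.
      by apply: divr_ge0; [rewrite mulr_ge0 ?sqr_ge0|rewrite mulr_ge0 // ltW].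
  rewrite RintegralD //.
  rewrite !RintegralZl //; [|exact: integrable_fourth|exact: integrable_sq_pdf].
  rewrite Rintegral_sq //; have := Rintegral_fourth s0; set W4 := Rintegral _ _ _ => h4.
  have -> : 33 * s ^+ 3 = s / 2 * s ^+ 2 + 1 / (2 * s) * (65 * s ^+ 4) by field; rewrite gt_eqF.
  rewrite lerD2l ler_wpM2l ?divr_ge0 ?mulr_ge0 ?(ltW s0) // (le_trans h4) //.
  by rewrite ler_wpM2r ?exprn_ge0 ?(ltW s0) //; lra.
pose xi n (c : option 'I_(ncell n)) := cval R c - mean n.
have xim n : \sum_c p n c * xi n c = 0.
  rewrite /xi; under eq_bigr do rewrite mulrBr.
  by rewrite big_split /= sumrN -mulr_suml (pp n).2 mul1r subrr.
have xisq n : \sum_c p n c * xi n c ^+ 2 = \sum_c p n c * cval R c ^+ 2 - mean n ^+ 2.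
  transitivity (\sum_c (p n c * cval R c ^+ 2 - (2 * mean n) * (p n c * cval R c) + p n c * mean n ^+ 2)).
    by apply: eq_bigr => c _; rewrite /xi; ring.
  by rewrite !big_split /= sumrN -mulr_sumr -mulr_suml (pp n).2 -/(mean n); ring.
have xicube n : \sum_c p n c * `|xi n c| ^+ 3 <= 4 * \sum_c p n c * `|cval R c| ^+ 3 + 4 * `|mean n| ^+ 3.
  have -> : 4 * \sum_c p n c * `|cval R c| ^+ 3 + 4 * `|mean n| ^+ 3 =
      \sum_c p n c * (4 * `|cval R c| ^+ 3 + 4 * `|mean n| ^+ 3).
    under [RHS]eq_bigr do rewrite mulrDr.
    rewrite big_split /= -mulr_suml (pp n).2 mul1r; congr (_ + _).
    by rewrite mulr_sumr; apply: eq_bigr => c _; rewrite mulrCA.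
  apply: ler_sum => c _; rewrite ler_wpM2l ?(pp n).1 //.
  apply: le_trans (_ : (`|cval R c| + `|mean n|) ^+ 3 <= _).
    by rewrite lerXn2r ?nnegrE ?addr_ge0 // ler_normB.
  have := normr_ge0 (cval R c); have := normr_ge0 (mean n).
  move: (`|cval R c|) (`|mean n|) => a b b0 a0.
  have : 0 <= (a + b) * (a - b) ^+ 2 by rewrite mulr_ge0 ?sqr_ge0 // addr_ge0.
  rewrite (_ : (a + b) ^+ 3 = 4 * a ^+ 3 + 4 * b ^+ 3 - 3 * ((a + b) * (a - b) ^+ 2)); last by ring.
  by lra.
have vx x : (fun n => xi n (cellof n x)) @ \oo --> x.
  by rewrite -[X in _ --> X]subr0; apply: cvgB; [exact: cval_cvg|exact: mean0].
have [_ cv] := EL_cells_cvg hB dk0 (m * k) (v := xi) vx (fun xs => FM (bsums idfun k m xs)) (lipseq_bsums k m L0 FL).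
have cv' : (fun n => EL (p n) (m * k) (fun c => F (bsums (xi n) k m c))) @ \oo -->
    \int[Pr]_w F (mkseq (fun j => incr B dt j w) m).
  under eq_Rintegral do rewrite -(bsums_incr dt m _ k0).
  rewrite (_ : (fun n => _) = fun n => EL (p n) (m * k) (fun c => F (bsums idfun k m (map (xi n) c)))).
    exact: cv.
  by apply/funext => n; apply: eq_EL => c _; rewrite bsums_map.
have csq : (fun n => k%:R * \sum_c p n c * xi n c ^+ 2) @ \oo --> dt.
  have -> : dt = k%:R * (s ^+ 2 - 0 ^+ 2) by rewrite s2 expr0n subr0 mulrC divfK // gt_eqF.
  under eq_fun do rewrite xisq.
  apply: cvgM; [exact: cvg_cst|apply: cvgB => //].
  by apply: (@continuous_cvg _ _ _ _ _ mean (fun x : R => x ^+ 2)) => //; exact: exprn_continuous.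
have ccube : (fun n => 4 * \sum_c p n c * `|cval R c| ^+ 3 + 4 * `|mean n| ^+ 3) @ \oo -->
    4 * (\int[lebesgue_measure]_x (`|x| ^+ 3 * normal_pdf 0 s x)) + 4 * `|0 : R| ^+ 3.
  apply: cvgD; apply: cvgM; [exact: cvg_cst|exact: cube|exact: cvg_cst|].
  apply: (@continuous_cvg _ _ _ _ _ mean (fun x : R => `|x| ^+ 3)) => //.
  exact: cnt3.
(* Centring costs a factor 4, and [4 * 33 < 140] leaves the strict room needed to pass from the
   limit to large [n]. *)
have cube_lt : 4 * (\int[lebesgue_measure]_x (`|x| ^+ 3 * normal_pdf 0 s x)) + 4 * `|0 : R| ^+ 3 < 140 * s ^+ 3.
  have s3 : 0 < s ^+ 3 by rewrite exprn_gt0.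
  by rewrite normr0 expr0n /= mulr0 addr0; lra.
near \oo => n; exists (option 'I_(ncell n)), (p n), (xi n); split; [exact: pp|exact: xim| | |].
- by near: n; move/cvgrPdist_le : csq => /(_ e e0); apply: filterS => n; rewrite distrC.
- apply: le_trans (xicube n) _; near: n.
  exact: (cvgr_le _ ccube).
- by near: n; move/cvgrPdist_le : cv' => /(_ e e0); apply: filterS => n; rewrite distrC.
Unshelve. all: by end_near. Qed.

End brownian_blocks.

(** * Donsker's theorem *)

Section doob4.
Variables (R : realType) (T : finType) (p xi : T -> R) (b v : R).
Hypothesis pp : is_pmf p.
Hypothesis m0 : \sum_x p x * xi x = 0.
Hypothesis vE : \sum_x p x * xi x ^+ 2 = v.
Hypothesis xib : forall x, `|xi x| <= b.

Lemma awalk_wsum pre s : awalk (fun _ h => xi h) pre s = wsum xi s.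
Proof.
by elim: s pre => [|h s IH] pre /=; [rewrite /wsum big_nil|rewrite wsum_cons IH].
Qed.

(** A fourth moment is needed because the bound is summed over [m] blocks with variance of order
    [1 / m]: the sum is of order [1 / m], whereas second moments would leave a constant. *)
Lemma doob4 (a : R) K : 0 < a ->
  EL p K (fun s => (ahit (fun _ h => xi h) a 0 [::] s)%:R) <=
  (3 * (K%:R * v) ^+ 2 + K%:R * v * b ^+ 2) / a ^+ 4.
Proof.
move=> a0.
pose m3 := \sum_x p x * xi x ^+ 3; pose m4 := \sum_x p x * xi x ^+ 4.
have v0 : 0 <= v by rewrite -vE sumr_ge0 // => x _; rewrite mulr_ge0 ?sqr_ge0 // pp.1.
have m4b : m4 <= v * b ^+ 2.
  rewrite -vE mulr_suml; apply: ler_sum => x _; rewrite -mulrA ler_wpM2l ?pp.1 //.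
  rewrite (_ : xi x ^+ 4 = xi x ^+ 2 * xi x ^+ 2); last by ring.
  rewrite ler_wpM2l ?sqr_ge0 // -[leLHS]real_normK ?num_real // ler_pXn2r ?nnegrE //.
  exact: le_trans (xib x).
have key x : 0 <= 6 * x ^+ 2 * v + 4 * x * m3 + m4.
  rewrite -vE /m3 /m4 !mulr_sumr -!big_split /= sumr_ge0 // => y _.
  rewrite (_ : _ + _ = p y * xi y ^+ 2 * (2 * x ^+ 2 + (2 * x + xi y) ^+ 2)); last by ring.
  apply: mulr_ge0; first by apply: mulr_ge0; [exact: pp.1|exact: sqr_ge0].
  by apply: addr_ge0; [apply: mulr_ge0 => //; exact: sqr_ge0|exact: sqr_ge0].
pose Phi (K : nat) (pre : seq T) x := (x ^+ 4 + K%:R * (6 * x ^+ 2 * v + 4 * x * m3 + m4) + 3 * (K%:R * v) ^+ 2) / a ^+ 4.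
have a4 : 0 < a ^+ 4 by rewrite exprn_gt0.
have x4 (x : R) : 0 <= x ^+ 4 by rewrite exprn_even_ge0.
have := @maximal_ineq R T p pp.1 pp.2 (fun _ h => xi h) Phi a _ _ _ K [::] 0.
move=> H; apply: le_trans (H _ _ _) _.
- move=> k pre x; rewrite divr_ge0 ?(ltW a4) //.
  by rewrite !addr_ge0 // ?mulr_ge0 ?sqr_ge0 // key.
- move=> k pre x ax; rewrite ler_pdivlMr // mul1r.
  apply: le_trans (_ : x ^+ 4 <= _).
    rewrite -[leRHS]ger0_norm // normrX ler_pXn2r ?nnegrE // ltW //.
  rewrite -addrA lerDl addr_ge0 ?mulr_ge0 ?sqr_ge0 // key.
- move=> k pre x; rewrite /Phi.
  under eq_bigr do rewrite mulrA.
  rewrite -mulr_suml ler_wpM2r ?invr_ge0 ?(ltW a4) //.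
  have e3 : \sum_x p x * xi x ^+ 3 = m3 by [].
  have e4 : \sum_x p x * xi x ^+ 4 = m4 by [].
  clearbody m3 m4.
  have -> : \sum_h p h * ((x + xi h) ^+ 4 + k%:R * (6 * (x + xi h) ^+ 2 * v + 4 * (x + xi h) * m3 + m4) + 3 * (k%:R * v) ^+ 2) =
      \sum_h ((x ^+ 4 + k%:R * (6 * x ^+ 2 * v + 4 * x * m3 + m4) + 3 * (k%:R * v) ^+ 2) * p h
    + (4 * x ^+ 3 + k%:R * (12 * x * v + 4 * m3)) * (p h * xi h)
    + (6 * x ^+ 2 + 6 * k%:R * v) * (p h * xi h ^+ 2) + 4 * x * (p h * xi h ^+ 3) + p h * xi h ^+ 4).
    by apply: eq_bigr => h _; ring.
  rewrite !big_split /= -!mulr_sumr e3 e4.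
  rewrite pp.2 m0 vE -[k.+1%:R]natr1.
  rewrite -subr_ge0 (_ : _ - _ = 3 * v ^+ 2); last by ring.
  by rewrite mulr_ge0 ?sqr_ge0.
rewrite /Phi ler_wpM2r ?invr_ge0 ?(ltW a4) //.
rewrite !expr0n /= !(mulr0, mul0r, add0r) addrC lerD2l -mulrA ler_wpM2l //.
Qed.

End doob4.

Section step_paths.
Variable R : realType.

Definition steppath (dt : R) (bs : seq R) : R -> R :=
  fun t => wsum idfun (take (Num.trunc (t / dt)) bs).

Definition walkpath (T : Type) (xi : T -> R) (N : R) (w : seq T) : R -> R :=
  fun t => wsum xi (take (Num.trunc (t * N)) w).

(** Required for arbitrary functions and not only continuous ones, since it is applied to step paths
    as well as to Brownian paths. *)
Definition lip_path (TT L : R) (F : (R -> R) -> R) :=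
  forall (p q : R -> R) (e : R), 0 <= e ->
    (forall t : R, 0 <= t <= TT -> `|p t - q t| <= e) -> `|F p - F q| <= L * e.

Lemma lipseq_steppath TT L dt F : lip_path TT L F -> lipseq L (fun bs => F (steppath dt bs)).
Proof.
move=> FL xs ys e; apply: FL; first exact: l1dist_ge0.
move=> t _; rewrite /steppath; set j := Num.trunc _.
have et : size (take j xs) = size (take j ys) by rewrite !size_take e.
apply: le_trans (wsum_l1dist et) _.
rewrite -[in leRHS](cat_take_drop j xs) -[in leRHS](cat_take_drop j ys) l1dist_cat //.
by rewrite lerDl l1dist_ge0.
Qed.

Lemma bsums_take (T : Type) (xi : T -> R) k m s : bsums xi k m (take (m * k) s) = bsums xi k m s.
Proof.
elim: m s => //= m IH s; rewrite mulSn take_takel ?leq_addr //; congr (_ :: _).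
by rewrite -[RHS]IH take_drop addnC.
Qed.

Lemma wsum_take_bsums (T : Type) (xi : T -> R) k m i s : (i <= m)%N ->
  wsum idfun (take i (bsums xi k m s)) = wsum xi (take (i * k) s).
Proof.
elim: m i s => [|m IH] [|i] s //= im; rewrite ?take0 /wsum ?big_nil //.
rewrite -!/(wsum _ _) wsum_cons IH // mulSn.
rewrite -[X in wsum xi (take (k + i * k) X)](cat_take_drop k s) takeD -wsum_cat.
by rewrite cat_take_drop.
Qed.

Definition blockhit (T : finType) (xi : T -> R) (a : R) (k i : nat) (w : seq T) : bool :=
  ahit (fun _ h => xi h) a 0 [::] (take k (drop (i * k) w)).

Lemma norm_wsum_le (T : Type) (xi : T -> R) (b : R) s : (forall x, `|xi x| <= b) ->
  `|wsum xi s| <= (size s)%:R * b.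
Proof.
move=> xib; elim: s => [|x s IH]; first by rewrite /wsum big_nil normr0 mul0r.
rewrite wsum_cons /= -natr1 mulrDl mul1r addrC.
by apply: le_trans (ler_normD _ _) _; rewrite lerD.
Qed.

(* Inside a block without excursion above [a] the walk stays close to its value at
   the block start; rounding the block length loses at most [m.+1] further steps. *)
Lemma walk_step_close (T : finType) (xi : T -> R) (N TT a b : R) (m : nat) (w : seq T) :
  0 < N -> 0 < TT -> (0 < m)%N -> (forall x, `|xi x| <= b) ->
  let k := Num.trunc (TT / m%:R * N) in
  (forall i, (i < m)%N -> ~~ blockhit xi a k i w) -> 0 <= a -> 0 <= b ->
  (m * k <= size w)%N ->
  forall t, 0 <= t <= TT ->
  `|walkpath xi N w t - steppath (TT / m%:R) (bsums xi k m w) t| <= a + m.+1%:R * b.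
Proof.
move=> N0 TT0 m0 xib k nohit a0 b0 kw t /andP[t0 tT].
have m0' : 0 < m%:R :> R by rewrite ltr0n.
set dt := TT / m%:R; have dt0 : 0 < dt by rewrite divr_gt0.
have dtN0 : 0 <= dt * N by rewrite mulr_ge0 // ltW.
have /andP[kl kr] := truncn_itv dtN0; rewrite -/k -[k.+1]addn1 natrD in kl kr.
rewrite /walkpath /steppath; set i := Num.trunc (t / dt); set j := Num.trunc (t * N).
have td0 : 0 <= t / dt by rewrite divr_ge0 // ltW.
have /andP[il ir] := truncn_itv td0; rewrite -/i in il ir.
have tN0 : 0 <= t * N by rewrite mulr_ge0 // ltW.
have /andP[jl jr] := truncn_itv tN0; rewrite -/j in jl jr.
have tE : t * N = t / dt * (dt * N) by rewrite mulrA divfK // gt_eqF.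
clearbody i j k.
have im : (i <= m)%N.
  by rewrite -(ler_nat R) (le_trans il) // ler_pdivrMr // /dt mulrC divfK // gt_eqF.
rewrite wsum_take_bsums //.
have ikj : (i * k <= j)%N.
  rewrite -ltnS -(ltr_nat R) (le_lt_trans _ jr) // tE natrM ler_pM //.
have jik : (j <= i.+1 * k + m.+1)%N.
  rewrite -ltnS -(ltr_nat R) (le_lt_trans jl) // tE.
  apply: lt_le_trans (_ : i.+1%:R * (k%:R + 1) <= _).
    by rewrite ltr_pM // ?(le_trans _ il).
  by rewrite natr1 -natrM ler_nat mulnS; move: im; clear; lia.
have split_sum : wsum xi (take j w) - wsum xi (take (i * k) w) = wsum xi (take (j - i * k) (drop (i * k) w)).
  rewrite -[in LHS](subnKC ikj) takeD wsum_cat addrC addKr //.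
rewrite split_sum.
have [im'|mi] := ltnP i m; last first.
  have {}mi : i = m by apply/eqP; rewrite eqn_leq im mi.
  apply: le_trans (norm_wsum_le _ xib) _.
  apply: le_trans (_ : m.+1%:R * b <= _); last by rewrite lerDr.
  rewrite ler_wpM2r // ler_nat size_take_min (leq_trans (geq_minl _ _)) // mi leq_subLR.
  have : t / dt <= m%:R by rewrite ler_pdivrMr // /dt mulrC divfK // gt_eqF.
  move=> tm; have : (j <= m * k + m)%N.
    rewrite -(ler_nat R) (le_trans jl) // tE -mulnSr natrM ler_pM // -natr1 ltW //.
  by move=> h; rewrite (leq_trans h) // leq_add2l.
have [jk|kj] := leqP (j - i * k) k.
  have := ahitPn (nohit _ im') (t := j - i * k); rewrite awalk_wsum add0r take_takel // size_take_min size_drop.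
  have jw : (j - i * k <= minn k (size w - i * k))%N.
    rewrite leq_min jk /= leq_sub2r //; apply: leq_trans kw.
    by move: jk ikj im'; clear; nia.
  by move=> /(_ jw) /ltW h; rewrite (le_trans h) // lerDl mulr_ge0.
rewrite -(subnKC (ltnW kj)) takeD wsum_cat; apply: le_trans (ler_normD _ _) _; apply: lerD.
  have := ahitPn (nohit _ im') (t := k); rewrite awalk_wsum add0r take_takel // size_take_min size_drop.
  have jw : (k <= minn k (size w - i * k))%N.
    by rewrite leq_min leqnn /=; move: kw im'; clear; nia.
  by move=> /(_ jw) /ltW.
apply: le_trans (norm_wsum_le _ xib) _; rewrite ler_wpM2r // ler_nat.
by rewrite size_take_min (leq_trans (geq_minl _ _)) //; move: jik ikj; clear; nia.
Qed.

End step_paths.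

Lemma cvgr_near_eq (R : realType) (f g : nat -> R) (l : R) :
  (\forall n \near \oo, f n = g n) -> f @ \oo --> l -> g @ \oo --> l.
Proof.
move=> fg fl; apply: cvg_trans fl; apply: near_eq_cvg.
exact: fg.
 Qed.

Lemma cvgr_distP (R : realType) (T : Type) (F : set_system T) (FF : Filter F) (f : T -> R) (l : R) :
  (forall e : R, 0 < e -> \forall x \near F, `|l - f x| <= e) -> f @ F --> l.
Proof. by move=> h; apply/cvgrPdist_le => e; exact: h. Qed.

Lemma cvgrM_near (R : realType) (f g h : nat -> R) (a b c : R) : a * b = c ->
  (\forall n \near \oo, f n * g n = h n) -> f @ \oo --> a -> g @ \oo --> b -> h @ \oo --> c.
Proof. by move=> <- fgh fa gb; apply: (cvgr_near_eq fgh); exact: cvgM. Qed.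

Lemma near_divSn_le (R : realType) (c e : R) : 0 < e -> \forall m \near \oo, c / m.+1%:R <= e.
Proof.
move=> e0; exists (Num.trunc (c / e)) => // m /= Nm.
rewrite ler_pdivrMr ?ltr0n // mulrC -ler_pdivrMr //.
by apply: le_trans (ltW (truncnS_gt _)) _; rewrite ler_nat ltnS.
Qed.

Section half_line_continuity.
Variable R : realType.
Implicit Types f : R -> R.

Lemma segment_cluster (a b : R) (u : nat -> R) : (forall n, a <= u n <= b) ->
  exists2 x : R, a <= x <= b & forall e : R, 0 < e -> forall N, exists2 n, (N <= n)%N & `|u n - x| < e.
Proof.
move=> uab; have := @segment_compact R a b (u @ \oo) _ _.
case=> [|x [xab cx]].
  by exists 0%N => // n _ /=; rewrite in_itv /=.
exists x; first by move: xab; rewrite /= in_itv.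
move=> e e0 N; have [_ [[n Nn <-] xe]] : [set u n | n in [set n | (N <= n)%N]] `&` ball x e !=set0.
  apply: cx; last exact: nbhsx_ballx.
  by exists N => // n Nn; exists n.
by exists n => //; rewrite distrC.
Qed.

Definition ccont f := forall x : R, 0 <= x -> forall e : R, 0 < e ->
  exists2 del : R, 0 < del & forall y : R, 0 <= y -> `|y - x| <= del -> `|f y - f x| <= e.

Lemma ccont_within f : {within `[0, +oo[, continuous f} -> ccont f.
Proof.
move=> /subspace_continuousP cf x x0 e e0.
have := cf x; rewrite /= in_itv /= x0 => /(_ isT) /cvgrPdist_le /(_ e e0).
move=> /nbhs_ballP[del /= del0 H].
exists (del / 2); first by rewrite divr_gt0.
move=> y y0 yx; rewrite distrC; apply: H.
  by rewrite /ball /= distrC (le_lt_trans yx) // ltr_pdivrMr //; lra.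
by rewrite /= in_itv /= y0.
Qed.

Lemma ccont_unif f (T e : R) : ccont f -> 0 < e -> exists2 del : R, 0 < del &
  forall x y : R, 0 <= x <= T -> 0 <= y <= T -> `|x - y| <= del -> `|f x - f y| <= e.
Proof.
move=> cf e0; apply: contrapT => H.
have Hn n : exists xy : R * R, [/\ 0 <= xy.1 <= T, 0 <= xy.2 <= T,
    `|xy.1 - xy.2| <= n.+1%:R^-1 & e < `|f xy.1 - f xy.2|].
  apply: contrapT => H'; apply: H; exists n.+1%:R^-1; first by rewrite invr_gt0.
  move=> x y xT yT xy; rewrite leNgt; apply/negP => h; apply: H'.
  by exists (x, y).
have [u Hu] := choice Hn.
have uT n : 0 <= (u n).1 <= T by case: (Hu n).
have [x /andP[x0 xT] cx] := segment_cluster uT.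
have [del del0 Hd] := cf x x0 (e / 2) (divr_gt0 e0 (ltr0n _ 2)).
have d2 : 0 < del / 2 by rewrite divr_gt0.
have [n Nn un] := cx _ d2 (Num.trunc (del / 2)^-1).
have [/andP[u1 _] /andP[u2 _] u12] := Hu n; rewrite ltNge => /negP; apply.
have n1 : n.+1%:R^-1 <= del / 2.
  rewrite -[leRHS]invrK lef_pV2 ?posrE ?invr_gt0 ?ltr0n //.
  by apply: le_trans (ltW (truncnS_gt _)) _; rewrite ler_nat ltnS.
have h1 := Hd _ u1 ltac:(lra).
have u2x : `|(u n).2 - x| <= del.
  move: un (le_trans u12 n1); rewrite ltr_norml ler_norml => /andP[? ?] /andP[? ?].
  by rewrite ler_norml; apply/andP; split; lra.
have h2 := Hd _ u2 u2x.
move: h1 h2; rewrite ler_norml => /andP[? ?]; rewrite ler_norml => /andP[? ?].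
by rewrite ler_norml; apply/andP; split; lra.
Qed.

End half_line_continuity.

Section walk_blocks.
Variables (R : realType) (T : finType) (p xi : T -> R) (N TT a b v M L : R) (m K : nat).
Hypothesis pp : is_pmf p.
Hypothesis m0 : \sum_x p x * xi x = 0.
Hypothesis vE : \sum_x p x * xi x ^+ 2 = v.
Hypothesis xib : forall x, `|xi x| <= b.
Hypotheses (N0 : 0 < N) (TT0 : 0 < TT) (mpos : (0 < m)%N) (a0 : 0 < a) (b0 : 0 <= b).
Hypotheses (L0 : 0 <= L) (M0 : 0 <= M).
Variable F : (R -> R) -> R.
Hypothesis FM : forall q, `|F q| <= M.
Hypothesis FL : lip_path TT L F.
Let k := Num.trunc (TT / m%:R * N).
Hypothesis mkK : (m * k <= K)%N.

Lemma EL_blockhit i : (i < m)%N ->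
  EL p K (fun w => (blockhit xi a k i w)%:R) <= (3 * (k%:R * v) ^+ 2 + k%:R * v * b ^+ 2) / a ^+ 4.
Proof.
move=> im; have -> : K = (i * k + (k + (K - i.+1 * k)))%N.
  have : (i.+1 * k <= m * k)%N by rewrite leq_mul2r im orbT.
  rewrite mulSn; move: mkK; clear; lia.
rewrite (EL_drop pp.2 (i * k) _ (fun w => (ahit (fun _ h => xi h) a 0 [::] (take k w))%:R)).
rewrite (EL_take pp.2 k _ (fun w => (ahit (fun _ h => xi h) a 0 [::] w)%:R)).
exact: (doob4 pp m0 vE xib).
Qed.

Lemma walkpath_blocks :
  `|EL p K (fun w => F (walkpath xi N w)) -
    EL p (m * k) (fun w => F (steppath (TT / m%:R) (bsums xi k m w)))| <=
  L * (a + m.+1%:R * b) +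
  2 * M * (m%:R * ((3 * (k%:R * v) ^+ 2 + k%:R * v * b ^+ 2) / a ^+ 4)).
Proof.
have -> : EL p (m * k) (fun w => F (steppath (TT / m%:R) (bsums xi k m w))) =
    EL p K (fun w => F (steppath (TT / m%:R) (bsums xi k m w))).
  rewrite -[in RHS](subnKC mkK).
  rewrite -(EL_take pp.2 (m * k) (K - m * k) (fun w => F (steppath (TT / m%:R) (bsums xi k m w)))).
  by apply: eq_EL => w _; rewrite bsums_take.
rewrite -ELB; apply: le_trans (EL_norm pp.1 _ _) _.
apply: le_trans (_ : _ <= EL p K (fun w => L * (a + m.+1%:R * b) +
    2 * M * \sum_(i < m) (blockhit xi a k i w)%:R)) _.
  apply: (EL_le pp.1) => w wK.
  case: (boolP [exists i : 'I_m, blockhit xi a k i w]) => [/existsP[i hi]|/existsPn nh].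
    have s1 : 1 <= \sum_(i < m) (blockhit xi a k i w)%:R :> R.
      by rewrite (bigD1 i) //= hi lerDl sumr_ge0.
    apply: le_trans (_ : 2 * M <= _).
      rewrite mulr_natl mulr2n; apply: le_trans (ler_normB _ _) _.
      by rewrite lerD.
    rewrite -[leLHS]add0r lerD //.
      by rewrite mulr_ge0 // addr_ge0 ?(ltW a0) // mulr_ge0.
    by rewrite -[leLHS]mulr1 ler_wpM2l // mulr_ge0.
  rewrite -[leLHS]addr0 lerD //; last first.
    by rewrite mulr_ge0 ?mulr_ge0 // sumr_ge0.
  have ab0 : 0 <= a + m.+1%:R * b by rewrite addr_ge0 ?(ltW a0) // mulr_ge0.
  apply: (FL ab0) => t tT.
  apply: (walk_step_close (a := a) N0 TT0 mpos xib _ (ltW a0) b0 _ tT); last by rewrite wK.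
  by move=> i im; exact: (nh (Ordinal im)).
rewrite ELD (EL_cst pp.2) ELZ EL_sum ?pp.2 // lerD2l ler_wpM2l ?mulr_ge0 //.
apply: le_trans (ler_sum _ (fun i _ => EL_blockhit (ltn_ord i))) _.
by rewrite sumr_const card_ord -[leLHS]mulr_natl.
Qed.

End walk_blocks.

Section distance_estimates.
Variable R : realType.

Lemma norm_double (a d : R) : `|a - d| <= d -> a <= 2 * d.
Proof. by rewrite ler_norml => /andP[_]; lra. Qed.

Lemma dist_half (a b d del : R) : `|d - b| <= del / 2 -> `|a - d| <= del / 2 -> `|b - a| <= del.
Proof. by rewrite !ler_norml => /andP[? ?] /andP[? ?]; apply/andP; split; lra. Qed.

Lemma dist_chain (x0 x1 x2 x3 x4 q1 q2 e : R) : `|x0 - x4| <= e / 8 -> `|x1 - x2| <= q1 + q2 ->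
  `|x2 - x3| <= e / 8 -> `|x3 - x4| <= e / 8 -> q1 <= e / 4 -> q2 <= e / 4 -> `|x0 - x1| <= e.
Proof.
by rewrite !ler_norml => /andP[? ?] /andP[? ?] /andP[? ?] /andP[? ?] ? ?; apply/andP; split; lra.
Qed.

End distance_estimates.

Section donsker.
Context d (Om : measurableType d) (R : realType) (Pr : probability Om R) (B : R -> Om -> R).
Hypothesis hB : is_std_BM Pr B.

Lemma BM_ccont w : ccont (B^~ w).
Proof. by case: hB => _ _ cB _; exact/ccont_within. Qed.

Variables (TT M L : R) (F : (R -> R) -> R).
Hypothesis TT0 : 0 < TT.
Hypothesis L0 : 0 <= L.
Hypothesis FM : forall p, `|F p| <= M.
Hypothesis FL : lip_path TT L F.

Lemma steppath_incr (dt : R) m w t : 0 < dt -> (Num.trunc (t / dt) <= m)%N ->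
  steppath dt (mkseq (fun j => incr B dt j w) m) t = B ((Num.trunc (t / dt))%:R * dt) w.
Proof.
move=> dt0; rewrite /steppath; move: (Num.trunc _) => i im.
case: hB => _ B0 _ _; rewrite -[RHS]subr0 -(B0 w).
have -> : take i (mkseq (fun j => incr B dt j w) m) = mkseq (fun j => incr B dt j w) i.
  by rewrite /mkseq -map_take take_iota (minn_idPl im).
elim: i {im} => [|i IH]; first by rewrite /wsum big_nil mul0r subrr.
rewrite mkseqS -cats1 wsum_cat IH wsum_cons /wsum big_nil addr0 /incr.
by rewrite addrC addrA subrK.
Qed.

Let Fm m w := F (steppath (TT / m.+1%:R) (mkseq (fun j => incr B (TT / m.+1%:R) j w) m.+1)).

Lemma measurable_Fm m : measurable_fun setT (Fm m).
Proof.
have dt0 : 0 < TT / m.+1%:R by rewrite divr_gt0.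
have vx x : (fun n => cval R (cellof n x)) @ \oo --> x by exact: cval_cvg.
exact: (EL_cells_cvg hB dt0 m.+1 (v := fun n => @cval R n) vx
  (F := fun bs => F (steppath (TT / m.+1%:R) bs)) (fun bs => FM _) (lipseq_steppath _ FL)).1.
Qed.

Lemma Fm_cvg w : Fm m w @[m --> \oo] --> F (B^~ w).
Proof.
have L0' := L0; apply: cvgr_distP => e e0.
have e1 : 0 < e / (L + 1) by rewrite divr_gt0 //; lra.
have [del del0 Hd] := ccont_unif TT (BM_ccont w) e1.
near=> m.
have dt0 : 0 < TT / m.+1%:R by rewrite divr_gt0.
have dtd : TT / m.+1%:R <= del.
  rewrite ler_pdivrMr // mulrC -ler_pdivrMr //.
  near: m; exists (Num.trunc (TT / del)) => // m /= Nm.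
  by apply: le_trans (ltW (truncnS_gt _)) _; rewrite ler_nat ltnS.
apply: le_trans (_ : L * (e / (L + 1)) <= _); last first.
  by rewrite mulrA ler_pdivrMr; [rewrite mulrC ler_wpM2l ?(ltW e0) //; lra|lra].
apply: FL; first exact: ltW.
move=> t /andP[t0 tT].
have tdt0 : 0 <= t / (TT / m.+1%:R) by rewrite divr_ge0 // ltW.
have /andP[il ir] := truncn_itv tdt0.
rewrite steppath_incr //; last first.
  rewrite -(ler_nat R) (le_trans il) // ler_pdivrMr // mulrC divfK // pnatr_eq0.
move: il ir; set i := Num.trunc _; rewrite ler_pdivlMr // ltr_pdivrMr // -(natr1 i) mulrDl mul1r => il ir.
apply: Hd; [by rewrite t0|by rewrite mulr_ge0 ?(ltW dt0) //= (le_trans il)|].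
move: il ir dtd del0; move: (TT / m.+1%:R) => D ? ? ? ?.
by rewrite ler_norml; apply/andP; split; lra.
Unshelve. all: by end_near. Qed.

(** By path continuity [F] of the Brownian path is a pointwise limit of functions of finitely many
    increments. *)
Lemma donsker_measurable : measurable_fun setT (fun w => F (B^~ w)).
Proof. by apply: (measurable_fun_cvg measurable_Fm) => w _; exact: Fm_cvg. Qed.

Lemma Rintegral_Fm_cvg : (fun m => \int[Pr]_w Fm m w) @ \oo --> \int[Pr]_w F (B^~ w).
Proof.
have [] := @dominated_convergence _ _ _ Pr setT measurableT (fun m => EFin \o Fm m)
  (fun w => (F (B^~ w))%:E) (EFin \o cst M).
- by move=> m; exact/measurable_EFinP/measurable_Fm.
- exact/measurable_EFinP/donsker_measurable.
- by apply: aeW => w _; apply: cvg_EFin; [exact: nearW|exact: Fm_cvg].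
- exact: finite_measure_integrable_cst.
- by apply: aeW => w m _; rewrite /= lee_fin; exact: FM.
move=> intf _ cv.
by apply: fine_cvg; rewrite fineK; [exact: cv|exact: integrable_fin_num].
Qed.

Variables (T_ : nat -> finType) (p : forall n, T_ n -> R) (xi : forall n, T_ n -> R).
Variables (N b : nat -> R) (K : nat -> nat).
Hypothesis pp : forall n, is_pmf (@p n).
Hypothesis mean0 : forall n, \sum_x @p n x * @xi n x = 0.
Hypothesis xib : forall n x, `|@xi n x| <= b n.
Hypothesis Ny : N @ \oo --> +oo.
Hypothesis b0 : b @ \oo --> (0 : R).
Hypothesis var1 : (fun n => N n * \sum_x @p n x * @xi n x ^+ 2) @ \oo --> (1 : R).
Hypothesis KT : forall n, TT * N n <= (K n)%:R.

(** The number of blocks is fixed first, so that both the walk and Brownian motion are close to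
    their block skeletons; then [n] grows, and the skeletons are compared through discretised
    Gaussian blocks. *)
Theorem donsker : (fun n => EL (@p n) (K n) (fun w => F (walkpath (@xi n) (N n) w))) @ \oo -->
  \int[Pr]_w F (B^~ w).
Proof.
have L0' := L0; have TT0' := TT0.
apply: cvgr_distP => e e0.
have M0 : 0 <= M by apply: le_trans (FM (fun=> 0)).
pose eta := e / (8 * (L + 1)).
have eta0 : 0 < eta by rewrite divr_gt0 // mulr_gt0 //; lra.
have Leta : L * (eta + eta) <= e / 4.
  rewrite /eta (_ : L * _ = L * e / (4 * (L + 1))); last by field; rewrite gt_eqF //; lra.
  by rewrite ler_pdivrMr; [lra|rewrite mulr_gt0 //; lra].
(* The second bound is the probability of a large oscillation within some block. Its constant 4
   exceeds the 3 of [doob4] to absorb the terms that vanish with [n]. *)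
have [m [m1 mB]] : exists m, `|\int[Pr]_w F (B^~ w) - \int[Pr]_w Fm m w| <= e / 8 /\
    2 * M * (m.+1%:R * (4 * (TT / m.+1%:R) ^+ 2 / eta ^+ 4)) <= e / 4.
  near \oo => m; exists m; split.
    near: m; have e8 : 0 < e / 8 by rewrite divr_gt0.
    by move/cvgrPdist_le : Rintegral_Fm_cvg => /(_ _ e8); exact.
  have -> : 2 * M * (m.+1%:R * (4 * (TT / m.+1%:R) ^+ 2 / eta ^+ 4)) = 8 * M * TT ^+ 2 / eta ^+ 4 / m.+1%:R.
    have : (m.+1%:R : R) != 0 by rewrite pnatr_eq0.
    by move: (m.+1%:R : R) (lt0r_neq0 eta0) => y e1 y0; field; rewrite ?y0 ?e1.
  by near: m; apply: near_divSn_le; rewrite divr_gt0.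
pose dt := TT / m.+1%:R.
have dt0 : 0 < dt by rewrite divr_gt0.
pose G bs := F (steppath dt bs).
have GM bs : `|G bs| <= M by exact: FM.
have GL : lipseq L G := lipseq_steppath dt FL.
have em0 : 0 < e / (8 * m.+1%:R) by rewrite divr_gt0 // mulr_gt0.
have dt2 : 0 < 2 * dt by rewrite mulr_gt0.
have [del del0 Hclt] := clt_lipschitz M0 L0 dt2 em0.
pose v n := \sum_x @p n x * @xi n x ^+ 2.
pose k n := Num.trunc (TT / m.+1%:R * N n).
have N0 : \forall n \near \oo, 0 < N n.
  by move/cvgryPgt : Ny => /(_ 0).
have Ninv : (fun n => (N n)^-1) @ \oo --> (0 : R).
  by apply/gtr0_cvgV0 => //; near=> n; near: n.
have v0 n : 0 <= v n by apply: sumr_ge0 => x _; rewrite mulr_ge0 ?sqr_ge0 // (pp n).1.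
have vcv : v @ \oo --> (0 : R).
  apply: (cvgrM_near (mulr0 1) _ var1 Ninv).
  near=> n; rewrite /= mulrAC divff ?mul1r //; apply: lt0r_neq0; near: n; exact: N0.
have kcv : (fun n => (k n)%:R / N n) @ \oo --> dt.
  have dN : (fun n => dt - (N n)^-1) @ \oo --> dt.
    by rewrite -[X in _ --> X]subr0; apply: cvgB => //; exact: cvg_cst.
  apply: (squeeze_cvgr _ dN); last exact: cvg_cst.
  near=> n; have n0 : 0 < N n by near: n.
  have /andP[k1 k2] : (k n)%:R <= TT / m.+1%:R * N n < (k n).+1%:R.
    by apply: truncn_itv; rewrite mulr_ge0 // ltW.
  rewrite ler_pdivrMr // k1 andbT ler_pdivlMr // mulrBl mulVf ?gt_eqF //.
    by rewrite lerBlDr natr1 ltW.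
have kv : (fun n => (k n)%:R * v n) @ \oo --> dt.
  apply: (cvgrM_near (mulr1 dt) _ kcv var1).
  near=> n; rewrite /= mulrA divfK //; apply: lt0r_neq0; near: n; exact: N0.
have kinv : (fun n => (N n)^-1 * ((k n)%:R / N n)^-1) @ \oo --> (0 : R).
  rewrite -[X in _ --> X](mul0r dt^-1); apply: cvgM => //; apply: cvgV => //; exact: lt0r_neq0.
have kpos : \forall n \near \oo, (0 < k n)%N.
  have : \forall n \near \oo, 0 < (k n)%:R / N n by apply: (cvgr_gt dt kcv).
  move=> h; near=> n; have : 0 < (k n)%:R / N n by near: n.
  have n0 : 0 < N n by near: n.
  by rewrite pmulr_lgt0 ?invr_gt0 // ltr0n.
have Sk : (fun n => 140 * dt * Num.sqrt (dt / (k n)%:R)) @ \oo --> (0 : R).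
  rewrite -[X in _ --> X](mulr0 (140 * dt)); apply: cvgM; first exact: cvg_cst.
  rewrite -[X in _ --> X]sqrtr0.
  apply: (@cvg_comp _ _ _ (fun n => dt / (k n)%:R) Num.sqrt); last exact: sqrt_continuous.
  rewrite -(mulr0 dt); apply: cvgM; first exact: cvg_cst.
  apply: (cvgr_near_eq _ kinv); near=> n.
  by rewrite /= invfM invrK mulrCA mulVf ?mulr1 //; apply: lt0r_neq0; near: n.
have kbv : (fun n => b n * ((k n)%:R * v n)) @ \oo --> (0 : R).
  by rewrite -(mul0r dt); exact: cvgM.
have E1 : (fun n => L * (eta + m.+2%:R * b n)) @ \oo --> L * eta.
  rewrite -[X in L * X]addr0; apply: cvgM; first exact: cvg_cst.
  apply: cvgD; first exact: cvg_cst.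
  by rewrite -(mulr0 m.+2%:R); apply: cvgM => //; exact: cvg_cst.
have E2 : (fun n => (3 * ((k n)%:R * v n) ^+ 2 + (k n)%:R * v n * b n ^+ 2) / eta ^+ 4) @ \oo
    --> 3 * dt ^+ 2 / eta ^+ 4.
  apply: cvgM; last exact: cvg_cst.
  have bb : (fun n => b n ^+ 2) @ \oo --> (0 : R).
    by rewrite -(mulr0 0); apply: (cvgrM_near _ _ b0 b0) => //; apply: nearW => n; rewrite expr2.
  have kb : (fun n => (k n)%:R * v n * b n ^+ 2) @ \oo --> (0 : R).
    by apply: (cvgrM_near (mulr0 dt) _ kv bb); exact: nearW.
  rewrite -[X in _ --> X]addr0; apply: cvgD; last exact: kb.
  by apply: cvgM; [exact: cvg_cst|rewrite expr2; exact: cvgM].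
have d4 : 3 * dt ^+ 2 / eta ^+ 4 < 4 * dt ^+ 2 / eta ^+ 4.
  by rewrite ltr_pM2r ?invr_gt0 ?exprn_gt0 // ltr_pM2r ?exprn_gt0 //; lra.
have L1 : L * eta <= e / 8.
  by move: Leta; rewrite mulrDr; lra.
have L2 : L * eta < e / 4 by lra.
have min0 : 0 < Num.min (e / 8) (Num.min (del / 2) dt).
  by rewrite !lt_min dt0 !divr_gt0.
near=> n.
have n0 : 0 < N n by near: n.
have b0n : 0 <= b n.
  have [x _] : exists x : T_ n, true; last exact: le_trans (xib x).
  have [_] := pp n; case: (pickP (T_ n)) => [x _ _|e0' /eqP]; first by exists x.
  by rewrite big_pred0 // eq_sym oner_eq0.
have mkK : (m.+1 * k n <= K n)%N.
  rewrite -(ler_nat R) (le_trans _ (KT n)) // natrM.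
  have k1 : (k n)%:R <= TT / m.+1%:R * N n.
    by apply: (proj1 (andP (truncn_itv _))); rewrite mulr_ge0 // ltW.
  apply: le_trans (ler_wpM2l (ler0n _ _) k1) _.
  by rewrite mulrA mulrCA divff ?mulr1 // pnatr_eq0.
have S1 := walkpath_blocks (pp n) (mean0 n) (erefl (v n)) (@xib n) n0 TT0 (ltn0Sn m) eta0 b0n
  L0 M0 FM FL mkK.
have kp : (0 < k n)%N by near: n.
have [C [p' [xi' [pp' mean' var' third' int']]]] :=
  gauss_blocks hB m.+1 dt0 min0 kp L0 GM GL.
move: var' int'; rewrite !le_min => /and3P[var8 vard vardt] /and3P[int8 _ _].
have b1 : b n * ((k n)%:R * v n) <= del by near: n; apply: (cvgr_le 0 kbv).
have kv1 : `|dt - (k n)%:R * v n| <= del / 2.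
  by near: n; move/cvgrPdist_le : kv => /(_ _ (divr_gt0 del0 (ltr0n _ 2))); exact.
have kv2 : (k n)%:R * v n <= 2 * dt by near: n; apply: (cvgr_le dt kv); lra.
have S2 : `|EL (@p n) (m.+1 * k n) (fun s => G (bsums (@xi n) (k n) m.+1 s)) -
    EL p' (m.+1 * k n) (fun s => G (bsums xi' (k n) m.+1 s))| <= e / 8.
  apply: le_trans (_ : m.+1%:R * (e / (8 * m.+1%:R)) <= _); last first.
    rewrite le_eqVlt; apply/orP; left; apply/eqP.
    have : (m.+1%:R : R) != 0 by rewrite pnatr_eq0.
    by move: (m.+1%:R : R) => y y0; field; rewrite ?y0.
  apply: (blocks_lipschitz (M := M) (L := L) (pp n) pp') => // [|u x y w]; last exact: lipseq_coord.
  apply: (Hclt _ _ _ _ _ _ (v n) _ _ _ (k n) (pp n) pp' (mean0 n) (erefl _) (erefl _) mean' (erefl _) (erefl _)) => //.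
  - exact: norm_double.
  - rewrite -[X in X * _](ger0_norm (ler0n R (k n))) -normrM mulrBr.
    exact: (dist_half kv1 vard).
  - apply: le_trans b1; rewrite mulrCA ler_wpM2l // mulr_sumr; apply: ler_sum => x _.
    rewrite [leRHS]mulrCA ler_wpM2l ?(pp n).1 // exprS real_normK ?num_real //.
    by rewrite ler_wpM2r ?sqr_ge0.
  - have s0 : 140 * dt * Num.sqrt (dt / (k n)%:R) <= del by near: n; apply: (cvgr_le 0 Sk).
    apply: le_trans s0; apply: le_trans (ler_wpM2l (ler0n _ _) third') _.
    have ds : 0 <= dt / (k n)%:R by apply: divr_ge0; [exact: ltW|exact: ler0n].
    rewrite exprS (sqr_sqrtr ds).
    rewrite le_eqVlt; apply/orP; left; apply/eqP.
    have : ((k n)%:R : R) != 0 by rewrite pnatr_eq0 -lt0n.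
    by move: ((k n)%:R : R) (Num.sqrt _) => y z y0; field; rewrite ?y0.
have e1 : L * (eta + m.+2%:R * b n) <= e / 4 by near: n; apply: (cvgr_le _ E1).
have e2 : (3 * ((k n)%:R * v n) ^+ 2 + (k n)%:R * v n * b n ^+ 2) / eta ^+ 4 <=
   4 * dt ^+ 2 / eta ^+ 4 by near: n; apply: (cvgr_le _ E2).
have e3 : 2 * M * (m.+1%:R * ((3 * ((k n)%:R * v n) ^+ 2 + (k n)%:R * v n * b n ^+ 2) / eta ^+ 4)) <= e / 4.
  by apply: (le_trans _ mB); rewrite ler_wpM2l ?mulr_ge0 // ler_wpM2l.
exact: (dist_chain m1 S1 S2 int8 e1 e3).
Unshelve. all: by end_near. Qed.

End donsker.

(** * Excursions *)

Section excursions.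
Variable R : realType.
Implicit Types f : R -> R.

Lemma ccont_argmin f (a b : R) : ccont f -> 0 <= a -> a <= b ->
  exists2 s : R, a <= s <= b & forall u : R, a <= u <= b -> f s <= f u.
Proof.
move=> cf a0 ab.
have : {within `[a, b], continuous f}.
  apply/subspace_continuousP => x; rewrite /= in_itv /= => /andP[ax xb].
  apply: cvgr_distP => e e0.
  have [del del0 H] := cf x (le_trans a0 ax) e e0.
  apply/nbhs_ballP; exists del => //= y xy; rewrite in_itv /= => /andP[ay _].
  by rewrite distrC; apply: H; [exact: le_trans ay|rewrite distrC; exact: ltW].
move=> /(EVT_min ab)[s]; rewrite in_itv /= => sab H; by exists s.
Qed.

Lemma reflected_argmin f (t s : R) : 0 <= s <= t ->
  (forall u : R, 0 <= u <= t -> f s <= f u) -> reflected f t = f t - f s.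
Proof.
move=> st H; rewrite /reflected; congr (_ - _); apply/eqP; rewrite eq_le; apply/andP; split.
  apply: ge_inf; last by exists s => //=; rewrite in_itv.
  by exists (f s) => ? [u /=]; rewrite in_itv /= => /H h <-.
apply: lb_le_inf; first by exists (f s), s => //=; rewrite in_itv.
by move=> ? [u /=]; rewrite in_itv /= => /H h <-.
Qed.

Lemma reflected_eq0 f (t : R) : ccont f -> 0 <= t ->
  reflected f t = 0 -> forall u : R, 0 <= u <= t -> f t <= f u.
Proof.
move=> cf t0; have [s st H] := ccont_argmin cf (lexx 0) t0.
rewrite (reflected_argmin st H) => /eqP; rewrite subr_eq0 => /eqP ->; exact: H.
Qed.

(** The running minimum cannot drop where the reflected path is positive, so [f] exceeds [f l]
    inside; continuity at [r] then yields [f l = f r]. *)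
Lemma excursionP f (l r : R) : ccont f -> excursion (reflected f) l r <->
  [/\ 0 <= l, l < r, f l = f r, (forall u : R, 0 <= u <= r -> f l <= f u) &
      (forall u : R, l < u < r -> f l < f u)].
Proof.
move=> cf; split=> [[l0 lr Wl Wr Wp]|[l0 lr fE fmin fpos]]; last first.
  have r0 : 0 <= r by rewrite (le_trans l0) ?ltW.
  have lm (t : R) : l <= t -> t <= r -> reflected f t = f t - f l.
    move=> lt tr; apply: reflected_argmin; rewrite ?l0 // => u /andP[u0 ut].
    by rewrite fmin // u0 (le_trans ut).
  split=> //; first by rewrite lm ?subrr // ltW.
    by rewrite (lm r (ltW lr) (lexx r)) fE subrr.
  by move=> t /[dup] /fpos ft /andP[lt tr]; rewrite lm ?ltW // subr_gt0.
have r0 : 0 <= r by rewrite (le_trans l0) ?ltW.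
have lmin := reflected_eq0 cf l0 Wl; have rmin := reflected_eq0 cf r0 Wr.
have key (c : R) : l < c < r -> f l < f c.
  move=> /andP[lc cr]; rewrite ltNge; apply/negP => fcl.
  have [s /andP[ls sc] H] := ccont_argmin cf l0 (ltW lc).
  have [v /andP[lv vc] Hv] : exists2 v : R, l < v <= c & forall u : R, l <= u <= c -> f v <= f u.
    have [sl|sl] := eqVneq s l; last by exists s => //; rewrite lt_neqAle eq_sym sl ls sc.
    exists c; first by rewrite lc lexx.
    by move=> u uc; rewrite (le_trans fcl) // -sl H.
  have : 0 < reflected f v by rewrite Wp // lv (le_lt_trans vc).
  rewrite (reflected_argmin (s := v)) ?subrr ?ltxx //.
    by rewrite lexx andbT (le_trans l0) // ltW.
  move=> u /andP[u0 uv]; have [ul|lu] := leP u l; last by rewrite Hv // (ltW lu) (le_trans uv).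
  by rewrite (le_trans (Hv l _)) ?lexx ?(ltW lc) // lmin // u0.
have flr : f l = f r.
  apply/eqP; rewrite eq_le [X in _ && X]rmin ?l0 ?(ltW lr) // andbT leNgt; apply/negP => frl.
  have e0 : 0 < (f l - f r) / 2 by rewrite divr_gt0 // subr_gt0.
  have [del del0 H] := cf r r0 _ e0.
  pose c := Num.max ((l + r) / 2) (r - del).
  have cr : c < r by rewrite gt_max; apply/andP; split; lra.
  have lc : l < c by rewrite lt_max; apply/orP; left; lra.
  have : `|f c - f r| <= (f l - f r) / 2.
    apply: H; first by rewrite (le_trans l0) // ltW.
    have : r - del <= c by rewrite le_max lexx orbT.
    by move: cr; clear; move=> ? ?; rewrite ler_norml; apply/andP; split; lra.
  have := key c; rewrite lc cr => /(_ isT) fc; rewrite ler_norml => /andP[_ ?]; lra.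
by split=> // u ur; rewrite flr rmin.
Qed.

Lemma excursion_disjoint f (e1 e2 : R * R) : excursion f e1.1 e1.2 -> excursion f e2.1 e2.2 ->
  e1 <> e2 -> e1.2 <= e2.1 \/ e2.2 <= e1.1.
Proof.
case: e1 e2 => [l1 r1] [l2 r2] /= [_ lr1 fl1 fr1 p1] [_ lr2 fl2 fr2 p2] ne.
have n1 x : f x = 0 -> x <= l1 \/ r1 <= x.
  move=> fx; have [?|lx] := leP x l1; first by left.
  have [?|xr] := leP r1 x; first by right.
  by have := p1 x; rewrite lx xr fx ltxx => /(_ isT).
have n2 x : f x = 0 -> x <= l2 \/ r2 <= x.
  move=> fx; have [?|lx] := leP x l2; first by left.
  have [?|xr] := leP r2 x; first by right.
  by have := p2 x; rewrite lx xr fx ltxx => /(_ isT).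
case: (n1 _ fl2) => h1; last by left.
case: (n2 _ fl1) => h2; last by right.
have El : l1 = l2 by apply/eqP; rewrite eq_le h1 h2.
case: (n1 _ fr2) => h3; first lra.
case: (n2 _ fr1) => h4; first lra.
by case: ne; rewrite El; congr pair; apply/eqP; rewrite eq_le h3 h4.
Qed.

(* Restricting to rational endpoints leaves countably many almost sure events. *)
Definition minima_differ f := forall b c d : rat, 0 < b -> b < c -> c < d ->
  forall u v : R, 0 <= u <= ratr b -> ratr c <= v <= ratr d ->
  (forall s : R, 0 <= s <= ratr b -> f u <= f s) ->
  (forall s : R, ratr c <= s <= ratr d -> f v <= f s) -> f u <> f v.

(** Rationals separate [a] from [v]; if [v] were a minimiser too, two disjoint intervals would share
    their minimum. The room between [v] and [d] is needed to enclose [v]. *)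
Lemma minima_differ_lt f (a v d : R) : minima_differ f -> 0 <= a -> a < v -> v < d ->
  (forall s : R, 0 <= s <= d -> f a <= f s) -> f a < f v.
Proof.
move=> st a0 av vd H.
have [b] := rat_in_itvoo av; rewrite in_itv /= => /andP[ab bv].
have [c] := rat_in_itvoo bv; rewrite in_itv /= => /andP[bc cv].
have [d'] := rat_in_itvoo vd; rewrite in_itv /= => /andP[vd' dd].
rewrite lt_neqAle; apply/andP; split; last by rewrite H // (ltW vd) (le_trans a0) // ltW.
apply/negP => /eqP E; apply: (st b c d' _ _ _ a v _ _ _ _ E).
- by rewrite -(ltr_rat R) rmorph0 (le_lt_trans a0).
- by rewrite -(ltr_rat R).
- by rewrite -(ltr_rat R) (lt_trans cv).
- by rewrite a0 ltW.
- by rewrite !ltW.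
- by move=> s /andP[s0 sb]; rewrite H // s0 (le_trans sb) // ltW // (lt_trans bv).
- move=> s /andP[cs sd]; rewrite -E H // (le_trans sd (ltW dd)) andbT.
  by rewrite (le_trans _ cs) // (le_trans a0) // ltW // (lt_trans ab).
Qed.

(** Right after the end of an excursion the path goes strictly lower; otherwise [r] would be a
    second minimiser in the interior of a longer interval. *)
Lemma minima_differ_dip f (a r u : R) : minima_differ f -> 0 <= a -> a < r -> f r = f a ->
  (forall s : R, 0 <= s <= r -> f a <= f s) -> r < u -> exists2 s : R, r < s < u & f s < f a.
Proof.
move=> st a0 ar fr H ru; apply: contrapT => nex.
have := @minima_differ_lt f a r ((r + u) / 2) st a0 ar.
rewrite fr ltxx => h; apply: notF; apply: h; first lra.
move=> s /andP[s0 su]; have [sr|rs] := leP s r; first by rewrite H // s0.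
rewrite leNgt; apply/negP => fs; apply: nex; exists s => //; rewrite rs /=; lra.
Qed.

Lemma cluster_finite (J : eqType) (s : seq J) (T : R) (u : nat -> J -> R) :
  (forall n j, 0 <= u n j <= T) ->
  exists x : J -> R, (forall j, 0 <= x j <= T) /\
    forall e : R, 0 < e -> forall N, exists2 n, (N <= n)%N & forall j, j \in s -> `|u n j - x j| < e.
Proof.
move=> uT.
suff [x [xT [phi [phin H]]]] : exists x : J -> R, (forall j, 0 <= x j <= T) /\
    exists phi : nat -> nat, (forall n, n <= phi n)%N /\
    forall j, j \in s -> forall e : R, 0 < e -> exists N, forall n, (N <= n)%N -> `|u (phi n) j - x j| < e.
  exists x; split=> // e e0 N.
  suff [M HM] : exists M, forall n, (M <= n)%N -> forall j, j \in s -> `|u (phi n) j - x j| < e.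
    exists (phi (maxn N M)); first by rewrite (leq_trans _ (phin _)) // leq_maxl.
    by apply: HM; rewrite leq_maxr.
  elim: s H => [|j s IH] H; first by exists 0%N.
  have [|M HM] := IH; first by move=> i is_; apply: H; rewrite inE is_ orbT.
  have [M' HM'] := H j (mem_head _ _) e e0.
  exists (maxn M M') => n; rewrite geq_max => /andP[Mn M'n] i; rewrite inE => /predU1P[->|is_].
    exact: HM'.
  exact: HM.
elim: s => [|j s [x [xT [phi [phin H]]]]].
  by exists (u 0%N); split; [exact: uT|exists id].
have [y yT Hy] := segment_cluster (fun n => uT (phi n) j).
have Hn n : exists m, (n <= m)%N /\ `|u (phi m) j - y| < n.+1%:R^-1.
  by have [|m nm h] := Hy n.+1%:R^-1 _ n; [rewrite invr_gt0|exists m].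
have [psi Hpsi] := choice Hn.
exists (fun i => if i == j then y else x i); split; first by move=> i; case: eqP.
exists (phi \o psi); split.
  by move=> n; rewrite (leq_trans _ (phin _)) //; case: (Hpsi n).
have Hj (e : R) : 0 < e -> exists N, forall n, (N <= n)%N -> `|u (phi (psi n)) j - y| < e.
  move=> e0; exists (Num.trunc e^-1) => n Nn; case: (Hpsi n) => _ h; apply: lt_le_trans h _.
  rewrite -[leRHS]invrK lef_pV2 ?posrE ?invr_gt0 ?ltr0n //.
  by apply: le_trans (ltW (truncnS_gt _)) _; rewrite ler_nat ltnS.
move=> i; rewrite inE => ijs e e0; case: eqP ijs => [->|_] /=; first by move=> _; exact: Hj.
move=> /H /(_ e e0)[N HN]; exists N => n Nn; apply: HN; apply: leq_trans Nn _.
by case: (Hpsi n).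
Qed.

(* The [tau i] are the completion times of the components found by time [T]: these are
   times of near-minima of [f], and up to [eps] the component sizes [y k] above [rho] are
   the gaps between consecutive [tau i], multiplied by [kap]. *)
Record compat (T eps rho kap : R) f (y : nat -> R) : Prop := Compat {
  compat_ge0 : forall k, 0 <= y k;
  compat_times : exists r (tau : nat -> R), [/\ tau 0%N = 0,
    (forall i, (i < r)%N -> tau i <= tau i.+1), tau r <= T,
    (forall i (s : R), (i <= r)%N -> 0 <= s <= tau i -> f (tau i) <= f s + eps) &
    [/\ (forall i (s : R), (i < r)%N -> tau i <= s <= tau i.+1 -> f (tau i) <= f s + eps),
      (forall s : R, tau r <= s <= T -> f (tau r) <= f s + eps),
      (forall k (x : R), rho < x -> x <= y k -> exists e : 'I_k.+1 -> 'I_r, injective e /\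
         forall i, x - eps <= kap * (tau (e i).+1 - tau (e i))) &
      (forall k (x : R) (e : 'I_k.+1 -> 'I_r), injective e ->
         (forall i, x + eps <= kap * (tau (e i).+1 - tau (e i))) -> x <= y k)]] }.

Lemma times_mono r (tau : nat -> R) : (forall i, (i < r)%N -> tau i <= tau i.+1) ->
  forall i j, (i <= j <= r)%N -> tau i <= tau j.
Proof.
move=> H i j; elim: j => [|j IH] /andP[ij jr]; first by rewrite leqn0 in ij; rewrite (eqP ij).
move: ij; rewrite leq_eqVlt => /predU1P[->//|ij]; apply: le_trans (H _ jr); apply: IH.
by rewrite -ltnS ij ltnW.
Qed.

Definition bounded_excursions f := exists Lam : R, forall l r : R,
  excursion (reflected f) l r -> r - l <= Lam.

Lemma ord_excursion_ub f k : bounded_excursions f ->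
  has_ubound [set x : R | 0 < x /\ exists e : 'I_k.+1 -> R * R, injective e /\
     forall i, excursion (reflected f) (e i).1 (e i).2 /\ x <= (e i).2 - (e i).1].
Proof.
move=> [Lam H]; exists Lam => x [x0 [e [_ he]]]; have [/H h1 h2] := he ord0.
exact: le_trans h1.
Qed.

Lemma ord_excursion_ge0 f k : bounded_excursions f -> 0 <= ord_excursion (reflected f) k.
Proof.
move=> bd; rewrite /ord_excursion; set A := [set x | _].
have [->|/set0P[z hz]] := eqVneq A set0; first by rewrite sup0.
exact: le_trans (ltW hz.1) (ub_le_sup (ord_excursion_ub k bd) hz).
Qed.

(** By compactness: along counterexamples with vanishing tolerance, the endpoints of the [k.+1]
    large gaps cluster at endpoints of [k.+1] distinct excursions, which are too long for the
    definition of [ord_excursion]. *)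
Lemma compat_upper f (T rho kap del : R) k : ccont f -> minima_differ f ->
  bounded_excursions f -> 0 < kap -> 0 < del ->
  exists2 eps0 : R, 0 < eps0 & forall (eps : R) y, 0 <= eps <= eps0 -> compat T eps rho kap f y ->
   y k <= Num.max (kap * ord_excursion (reflected f) k) rho + del.
Proof.
move=> cf st bd kap0 del0; apply: contrapT => nex.
set x := Num.max _ _ + del in nex.
have xrho : rho < x.
  by rewrite /x; have := lexx (Num.max (kap * ord_excursion (reflected f) k) rho);
     rewrite {1}ge_max => /andP[_]; lra.
have xg : kap * ord_excursion (reflected f) k < x.
  by rewrite /x; have := lexx (Num.max (kap * ord_excursion (reflected f) k) rho);
     rewrite {1}ge_max => /andP[]; lra.
(* The boolean tells the two ends of a gap apart: [false] is the left end, [true] the right end. *)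
have Hn n : exists ab : 'I_k.+1 * bool -> R, [/\ (forall j, 0 <= ab j <= T),
    (forall i, x - n.+1%:R^-1 <= kap * (ab (i, true) - ab (i, false))),
    (forall i (s : R), 0 <= s <= ab (i, true) -> f (ab (i, false)) <= f s + n.+1%:R^-1),
    (forall i, f (ab (i, true)) <= f (ab (i, false)) + n.+1%:R^-1 /\ ab (i, false) <= ab (i, true)) &
    (forall i j, i != j -> ab (i, true) <= ab (j, false) \/ ab (j, true) <= ab (i, false))].
  apply: contrapT => nab; apply: nex; exists n.+1%:R^-1; first by rewrite invr_gt0.
  move=> eps y /andP[eps0 epsn] [_ [r [tau [tau0 taum taur p1 [p2 p2' p3 _]]]]].
  rewrite leNgt; apply/negP => /ltW /(p3 _ _ xrho)[e [inj_e He]]; apply: nab.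
  have mono := times_mono taum.
  exists (fun j => tau (if j.2 then (e j.1).+1 else e j.1)); split=> /=.
  - move=> [i b] /=; rewrite -tau0 mono /=; last by case: b => /=; rewrite ?ltn_ord // ltnW.
    by apply: le_trans taur; apply: mono; rewrite leqnn andbT; case: b; rewrite // ltnW.
  - by move=> i; apply: le_trans (He i); rewrite lerB.
  - move=> i s /andP[s0 st']; have [sa|sa] := leP s (tau (e i)).
      by apply: le_trans (p1 _ s _ _) _; rewrite ?s0 ?lerD2l // ltnW.
    by apply: le_trans (p2 _ s _ _) _; rewrite ?(ltW sa) ?lerD2l.
  - move=> i; split; last exact: taum.
    apply: le_trans (p1 _ (tau (e i)) _ _) _; rewrite ?lerD2l // taum //= andbT -tau0.
    by apply: mono; rewrite leq0n ltnW.
  - move=> i j ij; have ne : (e i : nat) != e j by apply: contraNneq ij => /val_inj /inj_e ->.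
    move: ne; rewrite neq_ltn => /orP[lt|lt]; [left|right]; apply: mono; rewrite lt /= ltnW //.
have [u Hu] := choice Hn.
have [|ab [abT Hab]] := @cluster_finite _ (enum [set: 'I_k.+1 * bool]%SET) T u.
  by move=> n j; case: (Hu n).
have near_ (e : R) : 0 < e -> exists n, n.+1%:R^-1 < e /\ forall j, `|u n j - ab j| < e.
  move=> e0; have [n Nn H] := Hab e e0 (Num.trunc e^-1); exists n; split.
    rewrite -[ltRHS]invrK ltf_pV2 ?posrE ?invr_gt0 ?ltr0n //.
    by apply: lt_le_trans (truncnS_gt _) _; rewrite ler_nat ltnS.
  by move=> j; apply: H; rewrite mem_enum inE.
have le_lim (a b : R) : (forall e : R, 0 < e -> a <= b + e) -> a <= b by move=> h; apply/ler_addgt0Pr.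
have gap i : x <= kap * (ab (i, true) - ab (i, false)).
  apply: le_lim => e e0; have e1 : 0 < e / (1 + 2 * kap) by rewrite divr_gt0 // addr_gt0 ?mulr_gt0.
  have [n [n1 H]] := near_ _ e1; have [_ /(_ i) g _ _ _] := Hu n.
  have := H (i, true); have := H (i, false); rewrite !ltr_norml => /andP[h1 h2] /andP[h3 h4].
  have : kap * (u n (i, true) - u n (i, false)) <=
         kap * (ab (i, true) - ab (i, false)) + kap * (2 * (e / (1 + 2 * kap))).
    by rewrite -mulrDr ler_wpM2l ?(ltW kap0) //; lra.
  have E : e / (1 + 2 * kap) + kap * (2 * (e / (1 + 2 * kap))) = e.
    by field; rewrite gt_eqF // addr_gt0 ?mulr_gt0.
  have aux (X Y Z W I : R) : X + W = e -> x - I <= Y -> I < X -> Y <= Z + W -> x <= Z + e.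
    by clear => *; lra.
  exact: aux E g n1.
have lt_ab i : ab (i, false) < ab (i, true).
  have x0 : 0 <= x - del; last first.
    have := gap i; rewrite -subr_gt0 -(pmulr_rgt0 _ kap0); lra.
  rewrite /x addrK le_max; apply/orP; left; rewrite mulr_ge0 ?(ltW kap0) //.
  exact: ord_excursion_ge0.
have fmin i (s : R) : 0 <= s <= ab (i, true) -> f (ab (i, false)) <= f s.
  have [/andP[a0 _] /andP[b0 _]] := (abT (i, false), abT (i, true)).
  have main (s' : R) : 0 <= s' < ab (i, true) -> f (ab (i, false)) <= f s'.
    move=> /andP[s0 sb]; apply: le_lim => e e0.
    have e2 : 0 < e / 2 by rewrite divr_gt0.
    have [del1 del10 Hc] := cf _ a0 _ e2.
    have m0 : 0 < Num.min (Num.min del1 (e / 2)) (ab (i, true) - s').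
      by rewrite !lt_min del10 e2 subr_gt0.
    have [n [n1 H]] := near_ _ m0; have [ub _ /(_ i s') g _ _] := Hu n.
    have := H (i, false); have := H (i, true); rewrite !lt_min => /andP[_ h1] /andP[/andP[h2 _] _].
    have /andP[ua0 _] := ub (i, false).
    have := Hc _ ua0 (ltW h2); move: n1; rewrite !lt_min => /andP[/andP[_ n1] _].
    have {}g : f (u n (i, false)) <= f s' + n.+1%:R^-1.
      by apply: g; rewrite s0 /=; move: h1; rewrite ltr_norml => /andP[]; lra.
    have {}g : f (u n (i, false)) <= f s' + e / 2 by apply: le_trans g _; rewrite lerD2l ltW.
    rewrite ler_norml => /andP[? ?]; lra.
  move=> /andP[s0]; rewrite le_eqVlt => /predU1P[sE|sb]; last by apply: main; rewrite s0.
  apply: le_lim => e e0; rewrite sE.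
  have [del1 del10 Hc] := cf _ b0 _ e0.
  pose s' := Num.max (ab (i, false)) (ab (i, true) - del1).
  have s'b : s' < ab (i, true) by rewrite gt_max lt_ab /=; lra.
  have s'0 : 0 <= s' by rewrite le_max a0.
  have := main s'; rewrite s'0 s'b => /(_ isT) h.
  have : `|f s' - f (ab (i, true))| <= e.
    apply: Hc => //; have : ab (i, true) - del1 <= s' by rewrite le_max lexx orbT.
    by move: s'b; clear; move=> ? ?; rewrite ler_norml; apply/andP; split; lra.
  rewrite ler_norml => /andP[? ?]; lra.
have fE i : f (ab (i, false)) = f (ab (i, true)).
  have [/andP[a0 _] /andP[b0 _]] := (abT (i, false), abT (i, true)).
  apply/eqP; rewrite eq_le fmin ?b0 ?lexx //=; apply: le_lim => e e0.
  have e3 : 0 < e / 3 by rewrite divr_gt0.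
  have [d1 d10 H1] := cf _ a0 _ e3; have [d2 d20 H2] := cf _ b0 _ e3.
  have m0 : 0 < Num.min (e / 3) (Num.min d1 d2) by rewrite !lt_min e3 d10 d20.
  have [n [n1 H]] := near_ _ m0; have [ub _ _ /(_ i)[g _] _] := Hu n.
  have := H (i, false); have := H (i, true); rewrite !lt_min => /and3P[_ _ h2] /and3P[_ h1 _].
  have /andP[ua0 _] := ub (i, false); have /andP[ub0 _] := ub (i, true).
  have := H1 _ ua0 (ltW h1); have := H2 _ ub0 (ltW h2).
  move: n1; rewrite !lt_min => /and3P[n1 _ _].
  have {}g : f (u n (i, true)) <= f (u n (i, false)) + e / 3 by apply: le_trans g _; rewrite lerD2l ltW.
  rewrite ler_norml => /andP[? ?]; rewrite ler_norml => /andP[? ?]; lra.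
have inset : [set z : R | 0 < z /\ exists e : 'I_k.+1 -> R * R, injective e /\
     forall i, excursion (reflected f) (e i).1 (e i).2 /\ z <= (e i).2 - (e i).1] (x / kap).
  split.
    rewrite divr_gt0 //; have := lt_ab ord0; rewrite -subr_gt0 -(pmulr_rgt0 _ kap0) => h.
    apply: le_lt_trans xg; apply: mulr_ge0; first exact: ltW.
    exact: ord_excursion_ge0.
  exists (fun i => (ab (i, false), ab (i, true))); split.
    move=> i j [E1 E2]; apply/eqP; apply: contraT => ij.
    have [d1 d2] := (lt_ab i, lt_ab j).
    have m0 : 0 < (ab (i, true) - ab (i, false)) / 2 by rewrite divr_gt0 // subr_gt0.
    have [n [_ H]] := near_ _ m0; have [_ _ _ _ /(_ i j ij) g] := Hu n.
    have := H (i, false); have := H (i, true); have := H (j, false); have := H (j, true).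
    rewrite !ltr_norml -E1 -E2 => /andP[? ?] /andP[? ?] /andP[? ?] /andP[? ?].
    by case: g => ?; lra.
  move=> i /=; split; last by rewrite ler_pdivrMr // mulrC gap.
  have [/andP[a0 _] /andP[b0 _]] := (abT (i, false), abT (i, true)).
  apply/(excursionP _ _ cf); split=> //; first exact: fmin.
  (* Distinct minima prevent the limit interval from splitting into several excursions. *)
  move=> v /andP[av vb]; apply: (minima_differ_lt st a0 av vb); exact: fmin.
have := ub_le_sup (ord_excursion_ub k bd) inset.
by rewrite -/(ord_excursion _ k) leNgt => /negP; apply; rewrite ltr_pdivlMr // mulrC.
Qed.

(** Take the last near-minimum time before [l + del]. The next one cannot lie deep inside the
    excursion, where [f] is well above [f l], nor beyond [r + del], because the path dips below
    [f l] just after [r]. *)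
Lemma excursion_track f (l r del : R) : ccont f -> minima_differ f -> excursion (reflected f) l r ->
  0 < del -> 2 * del < r - l ->
  exists2 eps0 : R, 0 < eps0 & forall (T eps : R) q (tau : nat -> R), r + del <= T -> eps <= eps0 ->
   tau 0%N = 0 -> (forall i, (i < q)%N -> tau i <= tau i.+1) ->
   (forall i (s : R), (i <= q)%N -> 0 <= s <= tau i -> f (tau i) <= f s + eps) ->
   (forall i (s : R), (i < q)%N -> tau i <= s <= tau i.+1 -> f (tau i) <= f s + eps) ->
   (forall s : R, tau q <= s <= T -> f (tau q) <= f s + eps) ->
   exists2 i, (i < q)%N & tau i <= l + del /\ r - del <= tau i.+1 <= r + del.
Proof.
move=> cf st /(excursionP _ _ cf)[l0 lr flr fmin fpos] del0 del2.
have ru : r < r + del by lra.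
have [s /andP[rs su] fs] := minima_differ_dip st l0 lr (esym flr) fmin ru.
have ld0 : 0 <= l + del by lra.
have lrd : l + del <= r - del by lra.
have [v /andP[lv vr] vmin] := ccont_argmin cf ld0 lrd.
have fv : f l < f v by apply: fpos; lra.
exists (Num.min (f v - f l) (f l - f s) / 2).
  by rewrite divr_gt0 // lt_min !subr_gt0 fv.
move=> T eps q tau rT epsle tau0 taum p1 p2 p2'.
have mono := times_mono taum.
have [e1 e2] : eps < f v - f l /\ eps < f l - f s.
  have : eps < Num.min (f v - f l) (f l - f s).
    apply: le_lt_trans epsle _; rewrite ltr_pdivrMr // ltr_pMr ?lt_min ?subr_gt0 ?fv //; lra.
  by rewrite lt_min => /andP[].
pose Q i := (i <= q)%N && (tau i <= l + del).
have exQ : exists i, Q i by exists 0%N; rewrite /Q tau0 ld0.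
have ubQ i : Q i -> (i <= q)%N by case/andP.
case: (ex_maxnP exQ ubQ) => i /andP[iq ti] imax.
have ti0 : 0 <= tau i by rewrite -tau0 mono.
have fti : f l <= f (tau i) by rewrite fmin // ti0 /=; lra.
have [Eiq|niq] := eqVneq i q.
  have := p2' s; rewrite -Eiq (_ : tau i <= s <= T); last by apply/andP; split; lra.
  by move=> /(_ isT); lra.
have iltq : (i < q)%N by rewrite ltn_neqAle niq.
have tS : l + del < tau i.+1.
  rewrite ltNge; apply/negP => h; have := imax i.+1; rewrite /Q iltq h => /(_ isT).
  by rewrite ltnn.
have f1 : f (tau i.+1) <= f l + eps by apply: p1 => //; rewrite l0 /=; lra.
exists i => //; split=> //; apply/andP; split.
  rewrite leNgt; apply/negP => h.
  have := vmin (tau i.+1); rewrite (ltW tS) (ltW h) => /(_ isT); lra.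
rewrite leNgt; apply/negP => h.
have := p2 i s iltq; rewrite (_ : tau i <= s <= tau i.+1); last by apply/andP; split; lra.
by move=> /(_ isT); lra.
Qed.

Lemma finite_pos_lb (J : finType) (e : J -> R) : (forall j, 0 < e j) ->
  exists2 m : R, 0 < m & forall j, m <= e j.
Proof.
move=> e0; have s0 : 0 <= \sum_j (e j)^-1 by apply: sumr_ge0 => j _; rewrite invr_ge0 ltW.
exists (1 + \sum_j (e j)^-1)^-1; first by rewrite invr_gt0; lra.
move=> j; rewrite -[leRHS]invrK lef_pV2 ?posrE ?invr_gt0 //; last lra.
rewrite (bigD1 j) //=.
have : 0 <= \sum_(i | i != j) (e i)^-1 by apply: sumr_ge0 => i _; rewrite invr_ge0 ltW.
by move: (_^-1) (\sum_(i | _) _) => X Y ?; lra.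
Qed.

(** Finitely many nearly optimal excursions are tracked at once; the horizon [T0] depends on [f]
    because it has to contain all of them. *)
Lemma compat_lower f (kap del : R) k : ccont f -> minima_differ f ->
  bounded_excursions f -> 0 < kap -> 0 < del ->
  exists T0 : R, forall T : R, T0 <= T -> exists2 eps0 : R, 0 < eps0 &
   forall (rho eps : R) y, 0 <= eps <= eps0 -> compat T eps rho kap f y ->
   kap * ord_excursion (reflected f) k - del <= y k.
Proof.
move=> cf st bd kap0 del0.
have [small|big] := leP (kap * ord_excursion (reflected f) k - del) 0.
  exists 0 => T _; exists 1 => // rho eps y _ [y0 _]; exact: le_trans (y0 k).
set A := [set x : R | 0 < x /\ exists e : 'I_k.+1 -> R * R, injective e /\
     forall i, excursion (reflected f) (e i).1 (e i).2 /\ x <= (e i).2 - (e i).1].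
have AE : ord_excursion (reflected f) k = sup A by [].
have A0 : A !=set0.
  by apply/set0P/eqP => A0; move: big; rewrite AE A0 sup0 mulr0; lra.
have hs : has_sup A by split=> //; exact: ord_excursion_ub.
have d2 : 0 < del / (2 * kap) by rewrite divr_gt0 // mulr_gt0.
have [x [x0 [e [inj_e He]]] xsup] := sup_adherent d2 hs.
have kx : kap * ord_excursion (reflected f) k - del / 2 < kap * x.
  move: xsup; rewrite -AE -(ltr_pM2l kap0) mulrBr.
  by rewrite (_ : kap * (del / (2 * kap)) = del / 2) //; field; rewrite gt_eqF.
(* The bound [x / 4] keeps the tracked gaps of different excursions distinct; the other bound limits
   the loss of length. *)
pose d := Num.min (x / 4) (del / (8 * kap)).
have dpos : 0 < d by rewrite lt_min !divr_gt0 // mulr_gt0.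
have dx : d <= x / 4 by rewrite ge_min lexx.
have dd : kap * d <= del / 8.
  rewrite (_ : del / 8 = kap * (del / (8 * kap))); last by field; rewrite gt_eqF.
  by rewrite ler_wpM2l ?(ltW kap0) // ge_min lexx orbT.
have tr i : exists eps0 : R, 0 < eps0 /\ forall (T eps : R) q (tau : nat -> R),
   (e i).2 + d <= T -> eps <= eps0 ->
   tau 0%N = 0 -> (forall i, (i < q)%N -> tau i <= tau i.+1) ->
   (forall i (s : R), (i <= q)%N -> 0 <= s <= tau i -> f (tau i) <= f s + eps) ->
   (forall i (s : R), (i < q)%N -> tau i <= s <= tau i.+1 -> f (tau i) <= f s + eps) ->
   (forall s : R, tau q <= s <= T -> f (tau q) <= f s + eps) ->
   exists2 j, (j < q)%N & tau j <= (e i).1 + d /\ (e i).2 - d <= tau j.+1 <= (e i).2 + d.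
  have [ex xle] := He i.
  have [|e0 e00 H] := excursion_track cf st ex dpos; first lra.
  by exists e0; split.
have [E HE] := choice tr.
have [m m0 Hm] := finite_pos_lb (fun i => (HE i).1).
exists (\sum_i ((e i).2 + d)) => T TT.
have iT i : (e i).2 + d <= T.
  apply: le_trans TT; rewrite (bigD1 i) //= lerDl sumr_ge0 // => j _.
  by case: (He j) => -[? ? _ _ _] _; lra.
exists (Num.min m (del / 4)); first by rewrite lt_min m0 divr_gt0.
move=> rho eps y /andP[eps0]; rewrite le_min => /andP[em ed].
move=> [_ [r [tau [tau0 taum taur p1 [p2 p2' _ p4]]]]].
have ch i : exists j : 'I_r, tau j <= (e i).1 + d /\ (e i).2 - d <= tau j.+1 <= (e i).2 + d.
  have [j jr H] := (HE i).2 T eps r tau (iT i) (le_trans em (Hm i)) tau0 taum p1 p2 p2'.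
  by exists (Ordinal jr).
have [g Hg] := choice ch.
apply: (p4 _ _ g).
  move=> i j gij; apply/eqP; apply: contraT => ij.
  have ne : e i <> e j by move=> /inj_e /eqP; rewrite (negPf ij).
  have [[exi xi] [exj xj]] := (He i, He j).
  have [_ /andP[? ?]] := Hg i; have [_ /andP[]] := Hg j; rewrite -gij => ? ?.
  by case: (excursion_disjoint exi exj ne) => ?; lra.
move=> i; have [h1 /andP[h2 _]] := Hg i; have [_ xi] := He i.
have : kap * (x - 2 * d) <= kap * (tau (g i).+1 - tau (g i)).
  by rewrite ler_wpM2l ?(ltW kap0) //; lra.
rewrite mulrBr (mulrCA kap 2 d) => h; move: h kx dd ed.
by move: (kap * x) (kap * d) (kap * ord_excursion _ k) (kap * _) => X1 X2 X3 X4 *; lra.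
Qed.

End excursions.

(** * Almost sure properties of Brownian paths *)

Section bounded_functions.
Context d (Om : measurableType d) (R : realType) (Pr : probability Om R).

Lemma integrable_bounded (h : Om -> R) (M : R) : measurable_fun setT h ->
  (forall w, `|h w| <= M) -> Pr.-integrable setT (EFin \o h).
Proof.
move=> mh hM; apply: (@le_integrable _ _ _ _ _ measurableT _ (EFin \o cst M)).
- exact/measurable_EFinP.
- by move=> w _; rewrite /= lee_fin (le_trans (hM w)) // ler_norm.
- exact: finite_measure_integrable_cst.
Qed.

Lemma prob_ge1_le (h : Om -> R) (M : R) : measurable_fun setT h ->
  (forall w, 0 <= h w <= M) ->
  measurable [set w | 1 <= h w] /\ (Pr [set w | (1 <= h w)%R] <= (\int[Pr]_w h w)%:E)%E.
Proof.
move=> mh hM.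
have mE : measurable [set w | 1 <= h w].
  rewrite (_ : [set w | _] = h @^-1` `[1, +oo[); last first.
    by apply/seteqP; split=> w /=; rewrite in_itv /= andbT.
  by rewrite -[X in measurable X]setTI; apply: mh.
have ih : Pr.-integrable setT (EFin \o h).
  by apply: (integrable_bounded mh (M := M)) => w; case/andP: (hM w) => h0 h1; rewrite ger0_norm.
split=> //; rewrite /Rintegral fineK; last exact: integrable_fin_num.
rewrite -[X in (Pr X <= _)%E]setIT -integral_indic //; apply: ge0_le_integral => //.
- by apply/measurable_EFinP; exact: measurable_indic.
- exact/measurable_EFinP.
- move=> w _; rewrite lee_fin indicE; case: (boolP (w \in _)) => [|_] /=.
    by rewrite inE.
  by case/andP: (hM w).
Qed.

Lemma ae_lt1 (h : nat -> Om -> R) (M : R) (c : nat -> R) : (forall j, measurable_fun setT (h j)) ->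
  (forall j w, 0 <= h j w <= M) -> (forall j, \int[Pr]_w h j w <= c j) -> c @ \oo --> (0 : R) ->
  {ae Pr, forall w, exists j, h j w < 1}.
Proof.
move=> mh hM hc c0.
have mE j : measurable [set w | 1 <= h j w] by exact: (prob_ge1_le (mh j) (hM j)).1.
suff N : Pr.-negligible (\bigcap_j [set w | 1 <= h j w]).
  apply: negligibleS N.
  by move=> w /= nex j _ /=; rewrite leNgt; apply/negP => hj; apply: nex; exists j.
apply/negligibleP; first exact: bigcapT_measurable.
apply/eqP; rewrite eq_le measure_ge0 andbT; apply/lee_addgt0Pr => e e0; rewrite add0e.
have : \forall j \near \oo, c j <= e by apply: (cvgr_le 0 c0).
case=> j _ /(_ j (leqnn j)) /= cj.
apply: le_trans (_ : (Pr [set w | (1 <= h j w)%R] <= _)%E).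
  apply: le_measure; rewrite ?inE //; first exact: bigcapT_measurable.
  exact: bigcap_inf.
apply: le_trans (prob_ge1_le (mh j) (hM j)).2 _.
by rewrite lee_fin (le_trans (hc j)).
Qed.

(** Borel-Cantelli: the integrals bound the probabilities of the events [1 <= h j w] by a summable
    sequence. *)
Lemma ae_eventually_lt1 (h : nat -> Om -> R) (M C : R) : (forall j, measurable_fun setT (h j)) ->
  (forall j w, 0 <= h j w <= M) -> 0 <= C -> (forall j, \int[Pr]_w h j w <= C / 2 ^+ j.+1) ->
  {ae Pr, forall w, exists j0, forall j, (j0 <= j)%N -> h j w < 1}.
Proof.
move=> mh hM C0 hc.
have mE j : measurable [set w | 1 <= h j w] by exact: (prob_ge1_le (mh j) (hM j)).1.
have := lim_sup_set_cvg0 (mu := Pr) mE.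
have le_s : (\sum_(j <oo) Pr [set w | (1 <= h j w)%R] < +oo)%E.
  apply: (@le_lt_trans _ _ C%:E); last exact: ltry.
  have := @cvg_geometric_eseries_half R C 0; rewrite expr0 divr1.
  rewrite [X in eseries X](_ : _ = (fun j => (C / 2 ^+ j.+1)%:E)); last first.
    by apply/funext => n; rewrite addn1 natrX.
  move/cvg_lim => <- //; apply: lee_nneseries => [j _ _|j _]; first exact: measure_ge0.
  by apply: le_trans (prob_ge1_le (mh j) (hM j)).2 _; rewrite lee_fin.
move=> /(_ le_s) null0.
have mlim : measurable (lim_sup_set (fun j => [set w | 1 <= h j w])).
  by apply: bigcapT_measurable => k; apply: bigcup_measurable.
apply: (negligibleS _ ((negligibleP _ mlim).2 null0)).
move=> w /= nex j0 _; apply: contrapT => nj; apply: nex; exists j0 => j j0j.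
by rewrite ltNge; apply/negP => hj; apply: nj; exists j.
Qed.

End bounded_functions.

Lemma limr_le_cst (R : realType) (u : nat -> R) (l c : R) : u @ \oo --> l ->
  (forall n, u n <= c) -> l <= c.
Proof.
move=> ul uc; have <- := cvg_lim (@Rhausdorff R) ul.
apply: limr_le; first by apply/cvg_ex; exists l.
exact: nearW.
Qed.

(** * Growth and minima of Brownian paths, read off from the simple random walk *)

Section rademacher_walk.
Context d (Om : measurableType d) (R : realType) (Pr : probability Om R) (B : R -> Om -> R).
Hypothesis hB : is_std_BM Pr B.

Definition half_pmf (_ : bool) : R := 2^-1.
Definition rad (n : nat) (b : bool) : R := (if b then 1 else -1) * Num.sqrt n.+1%:R^-1.

Lemma is_pmf_half : is_pmf half_pmf.
Proof.
split=> [x|]; first by rewrite /half_pmf invr_ge0.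
by rewrite big_bool /half_pmf /=; lra.
Qed.

Lemma rad_mean n : \sum_x half_pmf x * rad n x = 0.
Proof. by rewrite big_bool /half_pmf /rad /=; lra. Qed.

Lemma rad_var n : \sum_x half_pmf x * rad n x ^+ 2 = n.+1%:R^-1.
Proof.
rewrite big_bool /half_pmf /rad /= !exprMn sqr_sqrtr ?invr_ge0 //.
by rewrite sqrrN !expr1n !mul1r; move: (n.+1%:R^-1 : R) => y; lra.
Qed.

Lemma norm_rad n x : `|rad n x| = Num.sqrt n.+1%:R^-1.
Proof. by rewrite /rad normrM (ger0_norm (sqrtr_ge0 _)); case: x; rewrite ?normrN normr1 mul1r. Qed.

Lemma invS_cvg0 : (fun n : nat => n.+1%:R^-1 : R) @ \oo --> (0 : R).
Proof.
apply: cvgr_distP => e e0; have := near_divSn_le 1 e0; apply: filterS => n.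
by rewrite div1r sub0r normrN ger0_norm.
Qed.

Lemma sqrt_invS_cvg0 : (fun n : nat => Num.sqrt n.+1%:R^-1 : R) @ \oo --> (0 : R).
Proof.
rewrite -[X in _ --> X](@sqrtr0 R).
apply: (@cvg_comp _ _ _ (fun n : nat => n.+1%:R^-1 : R) Num.sqrt); first exact: invS_cvg0.
exact: sqrt_continuous.
Qed.

Definition radK (TT : R) n := (Num.trunc (TT * n.+1%:R)).+1.

(** Estimates on a Brownian functional follow from the same estimates for the walk of random signs,
    where conditioning is finite and elementary. *)
Lemma donsker_rad (TT M L : R) (F : (R -> R) -> R) : 0 < TT -> 0 <= L ->
  (forall p, `|F p| <= M) -> lip_path TT L F ->
  (fun n => EL half_pmf (radK TT n) (fun w => F (walkpath (rad n) n.+1%:R w))) @ \oo -->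
  \int[Pr]_w F (B^~ w).
Proof.
move=> TT0 L0 FM FL.
apply: (donsker hB TT0 L0 FM FL (T_ := fun=> bool) (p := fun=> half_pmf) (xi := rad)
  (N := fun n => n.+1%:R) (b := fun n => Num.sqrt n.+1%:R^-1)).
- by move=> n; exact: is_pmf_half.
- exact: rad_mean.
- by move=> n x; rewrite norm_rad.
- apply/cvgryPge => A; exists (Num.trunc A) => // n /= An.
  by apply: le_trans (ltW (truncnS_gt _)) _; rewrite ler_nat ltnS.
- exact: sqrt_invS_cvg0.
- under eq_fun do rewrite rad_var divff ?pnatr_eq0 //; exact: cvg_cst.
- by move=> n; rewrite /radK ltW // truncnS_gt.
Qed.

Definition clip01 (x : R) : R := Num.max 0 (Num.min x 1).

Lemma clip01_itv x : 0 <= clip01 x <= 1.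
Proof. by rewrite /clip01 le_max lexx ge_max ler01 ge_min lexx orbT. Qed.

Lemma clip01_le x y e : 0 <= e -> x <= y + e -> clip01 x <= clip01 y + e.
Proof.
move=> e0 xy; rewrite /clip01 !maxElt !minElt.
by repeat case: ifPn; rewrite -?leNgt; lra.
Qed.

(** A Lipschitz substitute for an indicator: it is 1 if [|p|] reaches [2 * a] on the interval and 0
    if [|p|] stays below [a]. *)
Definition sup_clip (TT a : R) (p : R -> R) : R :=
  sup [set clip01 (`|p t| / a - 1) | t in `[0, TT]].

Lemma sup_clip_has (TT a : R) (p : R -> R) : 0 <= TT -> has_sup [set clip01 (`|p t| / a - 1) | t in `[0, TT]].
Proof.
move=> T0; split; first by exists (clip01 (`|p 0| / a - 1)), 0 => //=; rewrite in_itv /= lexx.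
by exists 1 => _ [t _ <-]; case/andP: (clip01_itv (`|p t| / a - 1)).
Qed.

Lemma sup_clip_itv (TT a : R) (p : R -> R) : 0 <= TT -> 0 <= sup_clip TT a p <= 1.
Proof.
move=> T0; have hs := sup_clip_has a p T0; apply/andP; split.
  apply: le_trans (ub_le_sup hs.2 _); last by exists 0 => //=; rewrite in_itv /= lexx.
  by case/andP: (clip01_itv (`|p 0| / a - 1)).
apply: ge_sup; first exact: hs.1.
by move=> _ [t _ <-]; case/andP: (clip01_itv (`|p t| / a - 1)).
Qed.

Lemma lip_sup_clip (TT a : R) : 0 <= TT -> 0 < a -> lip_path TT a^-1 (sup_clip TT a).
Proof.
move=> T0 a0.
suff main (p q : R -> R) (e : R) : 0 <= e -> (forall t : R, 0 <= t <= TT -> `|p t - q t| <= e) ->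
    sup_clip TT a p <= sup_clip TT a q + a^-1 * e.
  move=> p q e e0 H; rewrite ler_norml; apply/andP; split.
    rewrite lerNl opprB lerBlDl; apply: main => // t /H; by rewrite distrC.
  by rewrite lerBlDl; exact: main.
move=> e0 H; have hq := sup_clip_has a q T0.
apply: ge_sup; first exact: (sup_clip_has a p T0).1.
move=> _ [t tT <-]; apply: le_trans (_ : clip01 (`|q t| / a - 1) + a^-1 * e <= _).
  apply: clip01_le; first by rewrite mulr_ge0 // invr_ge0 ltW.
  rewrite addrAC lerD2r mulrC [X in _ <= X + _]mulrC -mulrDr ler_wpM2l ?invr_ge0 ?(ltW a0) //.
  move: tT; rewrite /= in_itv /= => /H h.
  by have := ler_normD (p t - q t) (q t); rewrite subrK; move: h; lra.
by rewrite lerD2r; apply: ub_le_sup; [exact: hq.2|exists t].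
Qed.

Lemma EL_sup_clip (TT a : R) n : 0 < TT -> 0 < a ->
  EL half_pmf (radK TT n) (fun w => sup_clip TT a (walkpath (rad n) n.+1%:R w)) <= (TT + 1) / a ^+ 2.
Proof.
move=> TT0 a0; have [p0 p1] := is_pmf_half.
apply: le_trans (EL_le p0 (h := fun w => (ahit (fun _ h => rad n h) a 0 [::] w)%:R) _) _.
  move=> w _; case: (boolP (ahit _ _ _ _ _)) => [_|/ahitPn nh].
    by case/andP: (sup_clip_itv a (walkpath (rad n) n.+1%:R w) (ltW TT0)).
  apply: ge_sup; first exact: (sup_clip_has a _ (ltW TT0)).1.
  move=> _ [t _ <-]; rewrite /clip01 ge_max lexx /= ge_min; apply/orP; left.
  rewrite subr_le0 ler_pdivrMr // mul1r ltW // /walkpath.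
  have [le|/ltnW ge] := leqP (Num.trunc (t * n.+1%:R)) (size w).
    by have := nh _ le; rewrite add0r awalk_wsum.
  by have := nh _ (leqnn _); rewrite add0r awalk_wsum take_size (take_oversize ge).
apply: le_trans (kolmogorov_ineq p0 p1 _ a0 (fun=> rad_mean n)) _.
rewrite ler_pM2r ?invr_gt0 ?exprn_gt0 //.
have -> : EL half_pmf (radK TT n) (asq (fun _ h => rad n h) [::]) =
    EL half_pmf (radK TT n) (fun w => \sum_(h <- w) rad n h ^+ 2).
  apply: eq_EL => w _; elim: w [::] => [|h w IH] pre /=; first by rewrite big_nil.
  by rewrite big_cons IH.
rewrite (EL_count p1) rad_var /radK -natr1 mulrDl mul1r lerD //.
  have h : (Num.trunc (TT * n.+1%:R))%:R <= TT * n.+1%:R.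
    by apply: (proj1 (andP (truncn_itv _))); rewrite mulr_ge0 // ltW.
  by rewrite ler_pdivrMr.
by rewrite invf_le1 // ler1n.
Qed.

(** Exceeding height of order [2^j] before time [2^(j+1)] has probability of order [2^(-j)] by
    Kolmogorov's inequality, which is summable over dyadic scales. *)
Lemma BM_growth : {ae Pr, forall w, exists C : R, forall t : R, 0 <= t -> `|B t w| <= 2 * t + C}.
Proof.
pose h j w := sup_clip (2 ^+ j.+1) (2 ^+ j) (B^~ w).
have T0 j : 0 < 2 ^+ j :> R by rewrite exprn_gt0.
have L0 j : 0 <= (2 ^+ j : R)^-1 by rewrite invr_ge0 ltW.
have M1 j p : `|sup_clip (2 ^+ j.+1 : R) (2 ^+ j) p| <= 1.
  by have /andP[h0 h1] := sup_clip_itv (2 ^+ j) p (ltW (T0 j.+1)); rewrite ger0_norm.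
have LP j := lip_sup_clip (ltW (T0 j.+1)) (T0 j).
have mh j : measurable_fun setT (h j).
  exact: (donsker_measurable hB (T0 j.+1) (L0 j) (M1 j) (LP j)).
have hM j w : 0 <= h j w <= 1 by exact: sup_clip_itv (ltW (T0 j.+1)).
have hc j : \int[Pr]_w h j w <= 6 / 2 ^+ j.+1.
  have cv := donsker_rad (T0 j.+1) (L0 j) (M1 j) (LP j).
  apply: (limr_le_cst cv) => n; apply: le_trans (EL_sup_clip n (T0 j.+1) (T0 j)) _.
  rewrite ler_pdivrMr ?exprn_gt0 // exprS.
  have : 1 <= 2 ^+ j :> R by rewrite exprn_ege1 // ler1n.
  have := T0 j; move: (2 ^+ j : R) => x x0 x1.
  rewrite (_ : 6 / (2 * x) * x ^+ 2 = 3 * x); first lra.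
  by field; rewrite gt_eqF.
have := ae_eventually_lt1 mh hM (_ : 0 <= 6) hc.
move=> /(_ (ler0n _ _)); apply: filterS => w [j0 Hj].
have small j (t : R) : (j0 <= j)%N -> 0 <= t <= 2 ^+ j.+1 -> `|B t w| < 2 * 2 ^+ j.
  move=> j0j tT; rewrite ltNge; apply/negP => big.
  have := Hj j j0j; rewrite ltNge => /negP; apply; rewrite /h.
  apply: le_trans (ub_le_sup (sup_clip_has (2 ^+ j) (B^~ w) (ltW (T0 j.+1))).2 _); last first.
    by exists t => //=; rewrite in_itv.
  rewrite /clip01 le_max le_min lexx andbT; apply/orP; right.
  by rewrite lerBrDr ler_pdivlMr //; lra.
exists (2 * 2 ^+ j0) => t t0; have [tj|jt] := leP t (2 ^+ j0.+1).
  by apply: le_trans (ltW (small j0 t (leqnn _) _)) _; rewrite ?t0 //; lra.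
pose Q j := (2 ^+ j <= t).
have exQ : exists j, Q j by exists j0.+1; exact: ltW.
have ubQ j : Q j -> (j <= Num.trunc t)%N.
  move=> Qj; rewrite -ltnS -(ltr_nat R); apply: le_lt_trans (truncnS_gt t).
  by apply: le_trans Qj; rewrite -natrX ler_nat ltnW // ltn_expl.
case: (ex_maxnP exQ ubQ) => j Qj jmax.
have j0j : (j0 <= j)%N by apply: ltnW; apply: jmax; exact: ltW.
have tS : t <= 2 ^+ j.+1.
  by rewrite leNgt; apply/negP => /ltW /jmax; rewrite ltnn.
have := small j t j0j; rewrite t0 tS => /(_ isT) hs; move: Qj; rewrite /Q => Qj.
by have := T0 j0; lra.
Qed.

Definition tent (del x : R) : R := Num.max 0 (1 - `|x| / del).

Lemma tent_itv del x : 0 < del -> 0 <= tent del x <= 1.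
Proof.
move=> d0; rewrite /tent le_max lexx ge_max ler01 /= lerBlDr lerDl.
by rewrite divr_ge0 // ltW.
Qed.

Lemma tent_lip del x y : 0 < del -> `|tent del x - tent del y| <= del^-1 * `|x - y|.
Proof.
move=> d0; suff main (x' y' : R) : tent del x' <= tent del y' + del^-1 * `|x' - y'|.
  rewrite ler_norml; apply/andP; split; last by rewrite lerBlDl.
  by rewrite lerNl opprB lerBlDl distrC.
have h : `|y'| / del <= `|x'| / del + del^-1 * `|x' - y'|.
  rewrite [del^-1 * _]mulrC -mulrDl ler_pM2r ?invr_gt0 //.
  by have := ler_normB x' (x' - y'); rewrite subKr; lra.
have : 0 <= del^-1 * `|x' - y'| by rewrite mulr_ge0 // invr_ge0 ltW.
rewrite /tent; move: (`|y'| / del) (`|x'| / del) (del^-1 * _) h => Y X Z h Z0.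
by rewrite !maxElt; do 2 case: ifPn; rewrite -?leNgt; lra.
Qed.

Lemma tent_near del x : 0 < del -> tent del x != 0 -> `|x| <= del.
Proof.
move=> d0; apply: contraNT; rewrite -ltNge => h; apply/eqP; rewrite /tent.
apply/eqP; rewrite eq_le le_max lexx ge_max lexx /= andbT subr_le0 ler_pdivlMr //.
by rewrite mul1r ltW.
Qed.

Lemma incr_tent_le (dt sg del x : R) : 0 < dt -> 0 < sg -> 0 < del ->
  \int[Pr]_w tent del (x - sg * incr B dt 0 w) <= normal_peak (Num.sqrt dt) * (2 * del / sg).
Proof.
move=> dt0 sg0 d0; pose V := `[(x - del) / sg, (x + del) / sg]%classic : set R.
have mV : measurable V by exact: measurable_itv.
have mi : measurable_fun setT (incr B dt 0) by exact: (measurable_incr hB).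
have mt : measurable_fun setT (fun w => tent del (x - sg * incr B dt 0 w)).
  apply: measurable_maxr; first exact: measurable_cst.
  apply: measurable_funB; first exact: measurable_cst.
  apply: measurable_funM; last exact: measurable_cst.
  apply: measurableT_comp => //; apply: measurable_funB; first exact: measurable_cst.
  by apply: measurable_funM => //; exact: measurable_cst.
have mS : measurable (incr B dt 0 @^-1` V) by rewrite -[X in measurable X]setTI; exact: mi.
have PrV : Pr (incr B dt 0 @^-1` V) = normal_prob 0 (Num.sqrt dt) V.
  case: hB => _ _ _ /(_ 1%N (fun i => i%:R * dt) (fun=> V)).
  rewrite mul0r lexx big_ord1 /= !mul0r mul1r subr0 => <- //.
  - by congr (Pr _); apply/seteqP; split=> w /= => [h [|//] _|/(_ 0%N isT)].
  - by move=> [|//] _; rewrite mul0r mul1r.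
have le1 : (\int[Pr]_w (tent del (x - sg * incr B dt 0 w))%:E <= Pr (incr B dt 0 @^-1` V))%E.
  rewrite -[X in (_ <= Pr X)%E]setIT -integral_indic //; apply: ge0_le_integral => //.
  - by move=> w _; rewrite lee_fin; case/andP: (tent_itv (x - sg * incr B dt 0 w) d0).
  - exact/measurable_EFinP.
  - by apply/measurable_EFinP; exact: measurable_indic.
  - move=> w _; rewrite lee_fin indicE.
    have [->|/(tent_near d0)] := eqVneq (tent del (x - sg * incr B dt 0 w)) 0; first exact: ler0n.
    rewrite ler_norml => /andP[h1 h2]; rewrite mem_set /=.
      by case/andP: (tent_itv (x - sg * incr B dt 0 w) d0).
    by rewrite /V /= in_itv /= ler_pdivrMr // ler_pdivlMr // !(mulrC _ sg); apply/andP; split; lra.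
have le2 : (normal_prob 0 (Num.sqrt dt) V <= (normal_peak (Num.sqrt dt) * (2 * del / sg))%:E)%E.
  have s0 : Num.sqrt dt != 0 by rewrite gt_eqF // sqrtr_gt0.
  apply: (@le_trans _ _ (\int[lebesgue_measure]_(y in V) (normal_peak (Num.sqrt dt))%:E)%E).
    apply: ge0_le_integral => //.
    - by move=> y _; rewrite lee_fin normal_pdf_ge0.
    - by apply/measurable_EFinP; apply: measurable_funTS; exact: measurable_normal_pdf.
    - by move=> y _; rewrite lee_fin normal_pdf_ub.
  rewrite integral_cst //.
  have LV := @lebesgue_measure_itv R `[(x - del) / sg, (x + del) / sg].
  rewrite /= lte_fin ltr_pM2r ?invr_gt0 // ifT in LV; last lra.
  rewrite [X in (_ * X)%E](_ : _ = (2 * del / sg)%:E); first by rewrite -EFinM.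
  apply: etrans LV _.
  by rewrite -EFinB -mulrBl; congr (_ / _)%:E; lra.
have ih : Pr.-integrable setT (EFin \o (fun w => tent del (x - sg * incr B dt 0 w))).
  apply: (integrable_bounded Pr mt (M := 1)) => w.
  by have /andP[? ?] := tent_itv (x - sg * incr B dt 0 w) d0; rewrite ger0_norm.
rewrite -lee_fin /Rintegral fineK; last exact: integrable_fin_num.
by apply: le_trans le1 _; rewrite PrV.
Qed.

Lemma trunc_bounds (x : R) : 0 <= x -> (Num.trunc x)%:R <= x < (Num.trunc x)%:R + 1.
Proof. by move=> /truncn_itv /andP[h1 h2]; rewrite natr1 h1 h2. Qed.

Lemma leq_trunc (x y : R) : 0 <= x -> x <= y -> (Num.trunc x <= Num.trunc y)%N.
Proof.
move=> x0 xy; have /andP[h1 _] := trunc_bounds x0.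
have /andP[_ h2] := trunc_bounds (le_trans x0 xy).
by rewrite -ltnS -(ltr_nat R) -[ltRHS]natr1 (le_lt_trans h1) // (le_lt_trans xy).
Qed.

(** A small-ball bound uniform in the centre [x]: the block of the walk is compared with a Gaussian
    increment of bounded density, and the Lipschitz constant of the tent does not depend on [x]. *)
Lemma rad_block_tent (b c sg del e : R) : 0 < b -> b < c -> 0 < sg -> 0 < del -> 0 < e ->
  \forall n \near \oo, forall x : R,
   EL half_pmf (Num.trunc (c * n.+1%:R) - Num.trunc (b * n.+1%:R))
     (fun v => tent del (x - sg * wsum (rad n) v)) <=
   normal_peak (Num.sqrt (c - b)) * (2 * del / sg) + e.
Proof.
move=> b0 bc sg0 d0 e0; set dt := c - b; have dt0 : 0 < dt by rewrite subr_gt0.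
have dt2 : 0 < 2 * dt by rewrite mulr_gt0.
have L0 : 0 <= sg / del by rewrite divr_ge0 // ltW.
have e2 : 0 < e / 2 by rewrite divr_gt0.
have [eta eta0 Hclt] := clt_lipschitz ler01 L0 dt2 e2.
pose k n := (Num.trunc (c * n.+1%:R) - Num.trunc (b * n.+1%:R))%N.
have kE n : `|(k n)%:R - dt * n.+1%:R| <= 1.
  have n0 : 0 < n.+1%:R :> R by [].
  have c0 : 0 < c by exact: lt_trans bc.
  have bn0 : 0 <= b * n.+1%:R by rewrite mulr_ge0 // ltW.
  have cn0 : 0 <= c * n.+1%:R by rewrite mulr_ge0 // ltW.
  have /andP[h1 h2] := trunc_bounds cn0; have /andP[h3 h4] := trunc_bounds bn0.
  have bcn : b * n.+1%:R <= c * n.+1%:R by rewrite ler_pM2r // ltW.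
  rewrite /k natrB; last first.
    by rewrite -ltnS -(ltr_nat R) -[ltRHS]natr1 (le_lt_trans h3) // (le_lt_trans bcn).
  by rewrite /dt mulrBl ler_norml; apply/andP; split; lra.
have kv n : `|(k n)%:R * n.+1%:R^-1 - dt| <= n.+1%:R^-1.
  rewrite -[dt](mulfK (_ : n.+1%:R != 0 :> R)) ?pnatr_eq0 // -mulrBl normrM.
  by rewrite (ger0_norm (_ : 0 <= n.+1%:R^-1 :> R)) // -[leRHS]mul1r ler_wpM2r.
have m0 : 0 < Num.min (e / 2) (Num.min (eta / 2) dt) by rewrite !lt_min e2 dt0 divr_gt0.
have i0 := invS_cvg0; have s0 := sqrt_invS_cvg0.
have kinv : (fun n => Num.sqrt (dt / (k n)%:R)) @ \oo --> (0 : R).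
  rewrite -[X in _ --> X](@sqrtr0 R).
  apply: (@cvg_comp _ _ _ (fun n => dt / (k n)%:R) Num.sqrt); last exact: sqrt_continuous.
  have dthalf : \forall n \near \oo, n.+1%:R^-1 <= dt / 2 :> R.
    by apply: (cvgr_le 0 i0); rewrite divr_gt0.
  have ub : (fun n => 2 * n.+1%:R^-1) @ \oo --> (0 : R).
    by rewrite -(mulr0 2); apply: cvgM => //; exact: cvg_cst.
  apply: (squeeze_cvgr _ (cvg_cst 0) ub); near=> n.
  have hn : n.+1%:R^-1 <= dt / 2 by near: n.
  rewrite divr_ge0 ?(ltW dt0) //=.
  have := kv n; rewrite ler_norml => /andP[h _].
  have h' : dt / 2 <= (k n)%:R / n.+1%:R.
    by move: hn h; move: ((k n)%:R / n.+1%:R) => X; move: (n.+1%:R^-1 : R) => Y hn h; lra.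
  have kp : 0 < (k n)%:R :> R.
    have : 0 < (k n)%:R / n.+1%:R :> R by apply: lt_le_trans h'; rewrite divr_gt0.
    by rewrite pmulr_lgt0 // invr_gt0.
  rewrite ler_pdivrMr // mulrAC -mulrA; move: h'; move: ((k n)%:R / n.+1%:R) => X; lra.
near=> n => x.
have hn : n.+1%:R^-1 <= Num.min (eta / 2) (dt / 2) :> R.
  by near: n; apply: (cvgr_le 0 i0); rewrite lt_min !divr_gt0.
have {hn}[hn1 hn2] : n.+1%:R^-1 <= eta / 2 :> R /\ n.+1%:R^-1 <= dt / 2 :> R.
  by move: hn; rewrite le_min => /andP[].
have a2 := le_trans (kv n) hn1.
have a1 : (k n)%:R * n.+1%:R^-1 <= 2 * dt.
  have := le_trans (kv n) hn2; rewrite ler_norml => /andP[_].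
  by move: ((k n)%:R / n.+1%:R) => X ?; lra.
have a3 : dt / 2 <= (k n)%:R * n.+1%:R^-1.
  have := le_trans (kv n) hn2; rewrite ler_norml => /andP[+ _].
  by move: ((k n)%:R / n.+1%:R) => X ?; lra.
have kp : (0 < k n)%N.
  by rewrite lt0n; apply/eqP => k0; move: a3; rewrite k0 mul0r; lra.
pose h (y : R) := tent del (x - sg * y).
have hM y : `|h y| <= 1.
  by have /andP[? ?] := tent_itv (x - sg * y) d0; rewrite /h ger0_norm.
have hL y z : `|h y - h z| <= sg / del * `|y - z|.
  apply: le_trans (tent_lip _ _ d0) _; rewrite opprB addrC addrA subrK -mulrBr normrM.
  by rewrite (gtr0_norm sg0) distrC mulrA [del^-1 * sg]mulrC.
pose G (bs : seq R) := h (nth 0 bs 0).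
have GL : lipseq (sg / del) G.
  move=> [|u us] [|v vs] //= _; first by rewrite subrr normr0 mulr_ge0 // l1dist_ge0.
  rewrite /G /=; apply: le_trans (hL _ _) _; rewrite ler_wpM2l //.
  by rewrite /l1dist /= big_cons /= lerDl sumr_ge0.
have [C [p' [xi' [pp' mean' var' third' int']]]] :=
  gauss_blocks hB 1%N dt0 m0 kp L0 (fun bs => hM _) GL.
move: var' int'; rewrite !le_min => /and3P[_ vard vardt] /and3P[int2 _ _].
move: vardt vard; rewrite !ler_norml => /andP[_ vdt] /andP[vd1 vd2].
have S2 : `|EL half_pmf (k n) (fun s => h (wsum (rad n) s)) -
            EL p' (k n) (fun s => h (wsum xi' s))| <= e / 2.
  apply: (Hclt _ _ _ _ _ _ n.+1%:R^-1 _ _ _ (k n) is_pmf_half pp' (rad_mean n) (rad_var n)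
     (erefl _) mean' (erefl _) (erefl _)) => //.
  - lra.
  - rewrite -[X in X * _](ger0_norm (ler0n R (k n))) -normrM mulrBr.
    move: a2 vd1 vd2; rewrite !ler_norml => /andP[].
    move: ((k n)%:R / n.+1%:R) (_ * \sum_c _) => X Y ? ? ? ?.
    by apply/andP; split; lra.
  - have -> : \sum_x half_pmf x * `|rad n x| ^+ 3 = n.+1%:R^-1 * Num.sqrt n.+1%:R^-1.
      under eq_bigr => y _ do rewrite norm_rad.
      rewrite -mulr_suml is_pmf_half.2 mul1r exprSr sqr_sqrtr //.
    apply: le_trans (_ : 2 * dt * Num.sqrt n.+1%:R^-1 <= _).
      by rewrite mulrA ler_wpM2r ?sqrtr_ge0.
    near: n; apply: (cvgr_le (2 * dt * 0)); last by rewrite mulr0.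
    by apply: cvgM => //; exact: cvg_cst.
  - apply: le_trans (ler_wpM2l (ler0n _ _) third') _.
    have ds : 0 <= dt / (k n)%:R by apply: divr_ge0; [exact: ltW|exact: ler0n].
    rewrite exprS (sqr_sqrtr ds).
    apply: le_trans (_ : 140 * dt * Num.sqrt (dt / (k n)%:R) <= _).
      rewrite le_eqVlt; apply/orP; left; apply/eqP.
      have : ((k n)%:R : R) != 0 by rewrite pnatr_eq0 -lt0n.
      by move: ((k n)%:R : R) (Num.sqrt _) => y z y0; field; rewrite ?y0.
    near: n; apply: (cvgr_le (140 * dt * 0)); last by rewrite mulr0.
    by apply: cvgM => //; exact: cvg_cst.
have Eb : EL p' (1 * k n) (fun s => G (bsums xi' (k n) 1 s)) = EL p' (k n) (fun s => h (wsum xi' s)).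
  by rewrite mul1n; apply: eq_EL => s sk; rewrite /G /= take_oversize // sk.
have I1 := incr_tent_le x dt0 sg0 d0.
move: int2 S2; rewrite Eb !ler_norml => /andP[_ h2] /andP[_ h3].
move: h2 h3 I1; rewrite /G /= /h -/(k n).
have aux (E1 E2 I P : R) : E1 - I <= e / 2 -> E2 - E1 <= e / 2 -> I <= P -> E2 <= P + e.
  by clear; lra.
exact: aux.
Unshelve. all: by end_near. Qed.

Definition runinf (q : R -> R) (a b : R) : R := inf [set q s | s in `[a, b]].

Lemma eq_runinf (q q' : R -> R) (a b : R) : (forall s : R, a <= s <= b -> q s = q' s) ->
  runinf q a b = runinf q' a b.
Proof.
move=> H; congr inf; apply/seteqP.
by split=> x [s /= sab <-]; exists s => //=; rewrite H //; move: sab; rewrite in_itv.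
Qed.

Lemma runinf_lip (q q' : R -> R) (a b e : R) : a <= b -> 0 <= e ->
  (forall s : R, a <= s <= b -> `|q s - q' s| <= e) -> `|runinf q a b - runinf q' a b| <= e.
Proof.
move=> ab.
have ne (u : R -> R) : [set u s | s in `[a, b]] !=set0 by exists (u a), a => //=; rewrite in_itv /= lexx.
have lb (u u' : R -> R) (e' : R) : (forall s : R, a <= s <= b -> `|u s - u' s| <= e') ->
    has_lbound [set u s | s in `[a, b]] -> has_lbound [set u' s | s in `[a, b]] /\
    runinf u a b <= runinf u' a b + e'.
  move=> H hl; have pt (s : R) : a <= s <= b -> runinf u a b <= u' s + e'.
    move=> sab; apply: le_trans (_ : u s <= _).
      by apply: ge_inf => //; exists s => //=; rewrite in_itv.
    by have := H s sab; rewrite ler_norml => /andP[_]; lra.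
  split.
    exists (runinf u a b - e') => ? [s /=]; rewrite in_itv /= => /pt h <-; lra.
  rewrite -lerBlDr; apply: lb_le_inf => // ? [s /=]; rewrite in_itv /= => /pt h <-; lra.
move=> e0 H; have H' (s : R) : a <= s <= b -> `|q' s - q s| <= e by move=> /H; rewrite distrC.
have [hl|nl] := pselect (has_lbound [set q s | s in `[a, b]]).
  have [hl' h1] := lb _ _ _ H hl; have [_ h2] := lb _ _ _ H' hl'.
  by rewrite ler_norml; apply/andP; split; lra.
(* If one path is unbounded below so is the other, and both infima take the same default value. *)
have nl' : ~ has_lbound [set q' s | s in `[a, b]] by move=> /(lb _ _ _ H')[].
by rewrite /runinf !inf_out ?subrr ?normr0 // => -[].
Qed.

Lemma runinfD (q : R -> R) (a b x : R) : a <= b -> has_lbound [set q s | s in `[a, b]] ->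
  runinf (fun s => x + q s) a b = x + runinf q a b.
Proof.
move=> ab hl; have ne : [set q s | s in `[a, b]] !=set0 by exists (q a), a => //=; rewrite in_itv /= lexx.
have pt (s : R) : s \in `[a, b] -> runinf q a b <= q s by move=> sab; apply: ge_inf => //; exists s.
apply/eqP; rewrite eq_le; apply/andP; split; last first.
  apply: lb_le_inf; first by exists (x + q a), a => //=; rewrite in_itv /= lexx.
  by move=> _ [s /= /pt h <-]; rewrite lerD2l.
rewrite -lerBlDl; apply: lb_le_inf => // _ [s /= sab <-]; rewrite lerBlDl.
apply: ge_inf; last by exists s.
by exists (x + runinf q a b) => _ [u /= /pt h <-]; rewrite lerD2l.
Qed.

Lemma EL_exchange (C : finType) (p : C -> R) a b (g : seq C -> seq C -> R) : is_pmf p ->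
  EL p a (fun u => EL p b (fun v => g u v)) = EL p b (fun v => EL p a (fun u => g u v)).
Proof.
move=> pp; elim: a g => [|a IH] g //=.
rewrite (EL_sum pp.2); apply: eq_bigr => x _.
by rewrite ELZ; congr (_ * _); exact: IH.
Qed.

Section distinct_minima.
Variables (b c e sg G : R) (g : R -> R).
Hypotheses (b0 : 0 < b) (bc : b < c) (ce : c < e) (sg0 : 0 < sg).
Hypothesis gG : forall s : R, 0 <= s <= e -> `|g s| <= G.

Definition infgap (p : R -> R) : R :=
  runinf (fun s => sg * p s + g s) 0 b - runinf (fun s => sg * p s + g s) c e.

Let e0 : 0 < e. Proof. exact: lt_trans (lt_trans b0 bc) ce. Qed.
Let c0 : 0 < c. Proof. exact: lt_trans b0 bc. Qed.

Lemma infgap_lip (p q : R -> R) (d' : R) : 0 <= d' ->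
  (forall s : R, 0 <= s <= e -> `|p s - q s| <= d') -> `|infgap p - infgap q| <= 2 * sg * d'.
Proof.
move=> d0 H; have H' (s : R) : 0 <= s <= e -> `|(sg * p s + g s) - (sg * q s + g s)| <= sg * d'.
  move=> /H h; rewrite opprD addrACA subrr addr0 -mulrBr normrM (gtr0_norm sg0).
  by rewrite ler_wpM2l // ltW.
have sd0 : 0 <= sg * d' by rewrite mulr_ge0 // ltW.
have h1 : `|runinf (fun s => sg * p s + g s) 0 b - runinf (fun s => sg * q s + g s) 0 b| <= sg * d'.
  apply: runinf_lip (ltW b0) sd0 _ => s /andP[s0 sb]; apply: H'; rewrite s0 /=.
  by rewrite (le_trans sb) // ltW // (lt_trans bc).
have h2 : `|runinf (fun s => sg * p s + g s) c e - runinf (fun s => sg * q s + g s) c e| <= sg * d'.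
  apply: runinf_lip (ltW ce) sd0 _ => s /andP[cs se]; apply: H'; rewrite se andbT.
  by rewrite (le_trans _ cs) // ltW.
rewrite /infgap; move: h1 h2; rewrite ler_norml => /andP[? ?]; rewrite ler_norml => /andP[? ?].
by rewrite ler_norml; apply/andP; split; lra.
Qed.

(** The steps between [b] and [c] enter only through their sum, which shifts the second infimum as a
    whole. Given all other steps, the gap of the infima is thus a constant minus a spread-out
    variable. *)
Lemma infgap_walk n (u v z : seq bool) :
  let N := n.+1%:R in
  size u = Num.trunc (b * N) -> size v = (Num.trunc (c * N) - Num.trunc (b * N))%N ->
  infgap (walkpath (rad n) N (u ++ (v ++ z))) =
  (runinf (fun s => sg * walkpath (rad n) N u s + g s) 0 b -
   runinf (fun s => sg * (wsum (rad n) u + wsum (rad n) (take (Num.trunc (s * N) - (size u + size v)) z)) + g s) c e)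
  - sg * wsum (rad n) v.
Proof.
move=> N su sv; have N0 : 0 < N by rewrite ltr0n.
have tm (x y : R) : 0 <= x -> x <= y -> (Num.trunc (x * N) <= Num.trunc (y * N))%N.
  by move=> x0 xy; apply: leq_trunc; rewrite ?ler_pM2r // mulr_ge0 // ltW.
have tbc : (Num.trunc (b * N) <= Num.trunc (c * N))%N by apply: tm; rewrite ltW.
have suv : (size u + size v = Num.trunc (c * N))%N by rewrite su sv subnKC.
rewrite /infgap -addrA; congr (_ + _).
  apply: eq_runinf => s /andP[s0 sb]; congr (_ * _ + _); rewrite /walkpath.
  have le : (Num.trunc (s * N) <= size u)%N by rewrite su tm.
  rewrite take_cat; case: ltnP => // ge; rewrite (_ : Num.trunc (s * N) = size u).
    by rewrite subnn take0 cats0 take_size.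
  by apply/eqP; rewrite eqn_leq le.
rewrite -opprD; congr (- _); rewrite addrC.
rewrite -runinfD; last 2 first.
- exact: ltW.
- pose m := size z; exists (- (sg * (`|wsum (rad n) u| + m%:R) + G)) => ? [s /=]; rewrite in_itv /=.
  move=> /andP[cs se] <-; have /ler_normlP[h1 _] : `|g s| <= G.
    by apply: gG; rewrite se (le_trans _ cs) // ltW.
  rewrite opprD lerD //; last by rewrite lerNl.
  rewrite -mulrN ler_wpM2l ?(ltW sg0) // opprD lerD //; first by rewrite lerNl ler_normr lexx orbT.
  rewrite lerNl; apply: le_trans (ler_norm _) _; rewrite normrN.
  apply: le_trans (norm_wsum_le (b := 1) _ _) _.
    move=> x; by rewrite norm_rad -[leRHS](sqrtr1 R) ler_sqrt // invf_le1 // ler1n.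
  by rewrite mulr1 ler_nat size_take_min geq_minr.
apply: eq_runinf => s /andP[cs se]; rewrite addrA; congr (_ + _); rewrite -mulrDr; congr (_ * _).
rewrite /walkpath catA take_cat size_cat suv ltnNge tm ?(ltW c0) //=.
by rewrite !wsum_cat addrCA addrA.
Qed.

Lemma EL_infgap (del e' : R) : 0 < del -> 0 < e' -> \forall n \near \oo,
  EL half_pmf (radK e n) (fun w => tent del (infgap (walkpath (rad n) n.+1%:R w))) <=
  normal_peak (Num.sqrt (c - b)) * (2 * del / sg) + e'.
Proof.
move=> d0 e'0; have := rad_block_tent b0 bc sg0 d0 e'0; apply: filterS => n H.
set tb := Num.trunc (b * n.+1%:R); set tc := Num.trunc (c * n.+1%:R).
have N0 : 0 < n.+1%:R :> R by rewrite ltr0n.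
have tm (x y : R) : 0 <= x -> x <= y -> (Num.trunc (x * n.+1%:R) <= Num.trunc (y * n.+1%:R))%N.
  by move=> x0 xy; apply: leq_trunc; rewrite ?ler_pM2r // mulr_ge0 // ltW.
have tbc : (tb <= tc)%N by apply: tm; rewrite ltW.
have tce : (tc <= Num.trunc (e * n.+1%:R))%N by apply: tm; rewrite ltW.
have -> : radK e n = (tb + ((tc - tb) + (radK e n - tc)))%N.
  by rewrite /radK; move: tbc tce; clear; lia.
rewrite EL_cat.
apply: le_trans (_ : EL half_pmf tb (fun=> normal_peak (Num.sqrt (c - b)) * (2 * del / sg) + e') <= _); last first.
  by rewrite (EL_cst is_pmf_half.2).
(* The middle block is averaged innermost, with the blocks before and after it frozen. *)
apply: (EL_le is_pmf_half.1) => u su; rewrite EL_cat (EL_exchange _ _ _ is_pmf_half).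
apply: le_trans (_ : EL half_pmf (radK e n - tc) (fun=> normal_peak (Num.sqrt (c - b)) * (2 * del / sg) + e') <= _); last first.
  by rewrite (EL_cst is_pmf_half.2).
apply: (EL_le is_pmf_half.1) => z _.
apply: le_trans (H (runinf (fun s => sg * walkpath (rad n) n.+1%:R u s + g s) 0 b -
   runinf (fun s => sg * (wsum (rad n) u + wsum (rad n) (take (Num.trunc (s * n.+1%:R) - (tb + (tc - tb))) z)) + g s) c e)).
apply: (EL_le is_pmf_half.1) => v sv.
by rewrite infgap_walk // su sv.
Qed.

Lemma ae_infgap_neq0 : {ae Pr, forall w, infgap (B^~ w) != 0}.
Proof.
pose dl j : R := j.+1%:R^-1.
have dl0 j : 0 < dl j by rewrite invr_gt0.
have L0 j : 0 <= (dl j)^-1 * (2 * sg) by rewrite mulr_ge0 ?invr_ge0 ?(ltW (dl0 j)) // mulr_ge0 // ltW.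
have F1 j p : `|tent (dl j) (infgap p)| <= 1.
  by have /andP[? ?] := tent_itv (infgap p) (dl0 j); rewrite ger0_norm.
have FL j : lip_path e ((dl j)^-1 * (2 * sg)) (fun p => tent (dl j) (infgap p)).
  move=> p q d' d'0 H; apply: le_trans (tent_lip _ _ (dl0 j)) _.
  rewrite -mulrA ler_wpM2l ?invr_ge0 ?(ltW (dl0 j)) //; exact: infgap_lip.
have mh j : measurable_fun setT (fun w => tent (dl j) (infgap (B^~ w))).
  exact: (donsker_measurable hB e0 (L0 j) (F1 j) (FL j)).
have hM j w : 0 <= tent (dl j) (infgap (B^~ w)) <= 1 by exact: tent_itv.
pose C := normal_peak (Num.sqrt (c - b)) * (2 / sg).
have hc j : \int[Pr]_w tent (dl j) (infgap (B^~ w)) <= C * dl j.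
  apply/ler_addgt0Pr => e' e'0.
  have cv := donsker_rad e0 (L0 j) (F1 j) (FL j).
  rewrite -(cvg_lim (@Rhausdorff R) cv); apply: limr_le; first by apply/cvg_ex; eexists; exact: cv.
  have := EL_infgap (dl0 j) e'0; apply: filterS => n h; apply: le_trans h _.
  by rewrite lerD2r /C le_eqVlt; apply/orP; left; apply/eqP; ring.
have c0' : (fun j => C * dl j) @ \oo --> (0 : R).
  by rewrite -(mulr0 C); apply: cvgM; [exact: cvg_cst|exact: invS_cvg0].
have := ae_lt1 mh hM hc c0'; apply: filterS => w [j]; apply: contraTneq => ->.
by rewrite /tent normr0 mul0r subr0 -leNgt le_max lexx orbT.
Qed.

End distinct_minima.

Lemma ae_minima_differ (sg : R) (g : R -> R) : 0 < sg ->
  (forall T : R, exists G : R, forall s : R, 0 <= s <= T -> `|g s| <= G) ->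
  {ae Pr, forall w, minima_differ (fun s => sg * B s w + g s)}.
Proof.
move=> sg0 Hg.
have ae3 (q : rat * rat * rat) : {ae Pr, forall w, 0 < q.1.1 -> q.1.1 < q.1.2 -> q.1.2 < q.2 ->
    infgap (ratr q.1.1) (ratr q.1.2) (ratr q.2) sg g (B^~ w) != 0}.
  case: q => -[b c] e /=; case: (ltP 0 b) => b0; last by apply: aeW.
  case: (ltP b c) => bc; last by apply: aeW.
  case: (ltP c e) => ce; last by apply: aeW.
  have [G HG] := Hg (ratr e).
  have b0' : 0 < ratr b :> R by rewrite -(rmorph0 (@ratr R)) ltr_rat.
  have bc' : ratr b < ratr c :> R by rewrite ltr_rat.
  have ce' : ratr c < ratr e :> R by rewrite ltr_rat.
  by have := ae_infgap_neq0 b0' bc' ce' sg0 HG; apply: filterS => w.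
have : {ae Pr, forall w, forall n, forall q : rat * rat * rat, unpickle n = Some q ->
    0 < q.1.1 -> q.1.1 < q.1.2 -> q.1.2 < q.2 ->
    infgap (ratr q.1.1) (ratr q.1.2) (ratr q.2) sg g (B^~ w) != 0}.
  apply: ae_foralln => n; case E : (unpickle n) => [q|]; last by apply: aeW.
  by have := ae3 q; apply: filterS => w h q' [<-].
apply: filterS => w H b c e b0 bc ce u v ub vce umin vmin E.
have := H _ (b, c, e) (pickleK _) b0 bc ce; rewrite /infgap /= => /eqP; apply.
have infE (a a' x : R) (f : R -> R) : a <= x <= a' -> (forall s : R, a <= s <= a' -> f x <= f s) ->
    runinf f a a' = f x.
  move=> xa H'; apply/eqP; rewrite eq_le; apply/andP; split.
    apply: ge_inf; last by exists x => //=; rewrite in_itv.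
    by exists (f x) => ? [s /=]; rewrite in_itv /= => /H' h <-.
  apply: lb_le_inf; first by exists (f x), x => //=; rewrite in_itv.
  by move=> ? [s /=]; rewrite in_itv /= => /H' h <-.
by rewrite (infE _ _ u) // (infE _ _ v) // E subrr.
Qed.

End rademacher_walk.

(** As [f l = f r], the quadratic gap [cc * (r - l) * (r + l)] is at most a multiple of [r + l] as
    soon as [r - l > 1]. *)
Lemma bounded_excursions_parabola (R : realType) (f : R -> R) (lam cc A C : R) : ccont f -> 0 < cc ->
  0 <= A -> 0 <= C ->
  (forall t : R, 0 <= t -> `|f t - (lam * t - cc * t ^+ 2)| <= A * t + C) -> bounded_excursions f.
Proof.
move=> cf cc0 A0 C0 H; exists (1 + (`|lam| + A + 2 * C) / cc) => l r /(excursionP _ _ cf)[l0 lr flr _ _].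
have r0 : 0 <= r by rewrite (le_trans l0) // ltW.
have [small|big] := leP (r - l) 1.
  by rewrite (le_trans small) // lerDl divr_ge0 ?(ltW cc0) // !addr_ge0 // mulr_ge0.
have := H l l0; have := H r r0; rewrite flr !ler_norml => /andP[h1 h2] /andP[h3 h4].
have E : cc * (r - l) * (r + l) <= (lam * (r - l) + A * (r + l) + 2 * C).
  by rewrite -mulrA -subr_sqr; lra.
have l1 : lam * (r - l) <= `|lam| * (r + l).
  apply: le_trans (ler_norm _) _; rewrite normrM ler_wpM2l // ger0_norm; lra.
have E2 : cc * (r - l) * (r + l) <= (`|lam| + A + 2 * C) * (r + l).
  apply: le_trans E _; rewrite !mulrDl.
  have : 2 * C <= 2 * C * (r + l) by rewrite ler_peMr ?mulr_ge0 //; lra.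
  by lra.
have rl : 0 < r + l by lra.
rewrite ler_pM2r // in E2; rewrite -[leLHS]add0r lerD // ler_pdivlMr // mulrC //.
Qed.

(** * Repeated draws of a community *)

Section repeats.
Variables (R : realType) (H I : finType) (c : H -> I) (p : H -> R).
Hypothesis pp : is_pmf p.
Implicit Types (f : I -> R) (s : seq H).

Definition pushpmf (i : I) : R := \sum_(h | c h == i) p h.
Local Notation pc := pushpmf.

Lemma pushpmf_ge0 i : 0 <= pc i.
Proof. by apply: sumr_ge0 => h _; exact: pp.1. Qed.

Lemma sum_pushpmf f : \sum_h p h * f (c h) = \sum_i pc i * f i.
Proof.
rewrite (partition_big c xpredT) //=; apply: eq_bigr => i _.
by rewrite /pushpmf mulr_suml; apply: eq_bigr => h /eqP ->.
Qed.

Lemma EL_awalk (psi : seq H -> H -> R) K :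
  EL p K (awalk psi [::]) = \sum_(j < K) EL p j (fun s => \sum_h p h * psi s h).
Proof.
elim: K => [|K IH]; first by rewrite big_ord0.
rewrite EL_rcons big_ord_recr /= -IH -ELD; apply: eq_EL => s _.
under eq_bigr => h _ do rewrite awalk_rcons /= mulrDr.
by rewrite big_split /= -mulr_suml pp.2 mul1r.
Qed.

Lemma asq_awalk (psi : seq H -> H -> R) pre s :
  asq psi pre s = awalk (fun pre h => psi pre h ^+ 2) pre s.
Proof. by elim: s pre => [|h s IH] pre //=; rewrite IH. Qed.

Lemma EL_seen i j : EL p j (fun s => (i \in map c s)%:R) <= j%:R * pc i.
Proof.
have -> : pc i = \sum_h p h * (c h == i)%:R.
  by rewrite /pushpmf big_mkcond; apply: eq_bigr => h _; case: eqP; rewrite ?mulr1 ?mulr0.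
rewrite -(EL_count pp.2 j (fun h => (c h == i)%:R)); apply: (EL_le pp.1) => s _.
elim: s => [|h s IH]; first by rewrite big_nil.
rewrite big_cons /= inE eq_sym; case: eqP => _ /=; last by rewrite add0r.
by rewrite lerDl sumr_ge0.
Qed.

Definition rep f (pre : seq H) (h : H) : R := if c h \in map c pre then f (c h) else 0.

Lemma sum_rep f s : \sum_h p h * rep f s h = \sum_i pc i * ((i \in map c s)%:R * f i).
Proof.
rewrite -(sum_pushpmf (fun i => (i \in map c s)%:R * f i)); apply: eq_bigr => h _.
by rewrite /rep; case: ifP; rewrite ?mul1r ?mul0r ?mulr0.
Qed.

Lemma EL_rep_le f j : (forall i, 0 <= f i) ->
  EL p j (fun s => \sum_h p h * rep f s h) <= j%:R * \sum_i pc i ^+ 2 * f i.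
Proof.
move=> f0.
rewrite (eq_EL _ (h := fun s => \sum_i (pc i * f i) * (i \in map c s)%:R)); last first.
  by move=> s _; rewrite sum_rep; apply: eq_bigr => i _; rewrite mulrCA mulrC.
rewrite (EL_sum pp.2) mulr_sumr; apply: ler_sum => i _; rewrite ELZ.
apply: le_trans (ler_wpM2l _ (EL_seen i j)) _; first by rewrite mulr_ge0 ?pushpmf_ge0.
by rewrite le_eqVlt; apply/orP; left; apply/eqP; ring.
Qed.

Lemma EL_awalk_rep_le f K : (forall i, 0 <= f i) ->
  EL p K (awalk (rep f) [::]) <= K%:R ^+ 2 * \sum_i pc i ^+ 2 * f i.
Proof.
move=> f0; rewrite EL_awalk.
have A0 : 0 <= \sum_i pc i ^+ 2 * f i by apply: sumr_ge0 => i _; rewrite mulr_ge0 ?sqr_ge0.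
apply: le_trans (_ : \sum_(j < K) K%:R * (\sum_i pc i ^+ 2 * f i) <= _).
  apply: ler_sum => j _; apply: le_trans (EL_rep_le j f0) _.
  by rewrite ler_wpM2r // ler_nat ltnW.
by rewrite sumr_const card_ord -[leLHS]mulr_natl mulrA -expr2.
Qed.

Lemma awalkB (psi phi : seq H -> H -> R) pre s :
  awalk (fun pre h => psi pre h - phi pre h) pre s = awalk psi pre s - awalk phi pre s.
Proof. by elim: s pre => [|h s IH] pre /=; rewrite ?subr0 // IH; ring. Qed.

Lemma awalk_ge0 (psi : seq H -> H -> R) pre s : (forall pre h, 0 <= psi pre h) ->
  0 <= awalk psi pre s.
Proof. by move=> psi0; elim: s pre => [|h s IH] pre //=; rewrite addr_ge0. Qed.

Lemma awalk_take_le (psi : seq H -> H -> R) s j : (forall pre h, 0 <= psi pre h) ->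
  awalk psi [::] (take j s) <= awalk psi [::] s.
Proof.
by move=> psi0; rewrite -{2}(cat_take_drop j s) awalk_cat /= lerDl awalk_ge0.
Qed.

Lemma awalk_norm_le (psi phi : seq H -> H -> R) pre s :
  (forall pre h, `|psi pre h| <= phi pre h) -> `|awalk psi pre s| <= awalk phi pre s.
Proof.
move=> H1; elim: s pre => [|h s IH] pre /=; first by rewrite normr0.
by apply: le_trans (ler_normD _ _) _; rewrite lerD.
Qed.

Lemma awalk_fresh_rep f s : awalk (fresh c f) [::] s = wsum (fun h => f (c h)) s - awalk (rep f) [::] s.
Proof.
rewrite -(awalk_wsum _ [::]) -awalkB; elim: s [::] => //= h s IH pre.
rewrite IH; congr (_ + _); rewrite /fresh /rep; case: ifP; rewrite ?subrr ?subr0 //.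
Qed.

Lemma awalk_fresh_sum f s : awalk (fresh c f) [::] s = \sum_i (i \in map c s)%:R * f i.
Proof.
elim/last_ind: s => [|s h IH]; first by rewrite big1 // => i _; rewrite mul0r.
rewrite awalk_rcons IH /= /fresh map_rcons.
case: ifP => hs.
  rewrite addr0; apply: eq_bigr => i _; congr (_%:R * _); rewrite mem_rcons inE.
  by case: eqP => // ->; rewrite hs.
rewrite (bigD1 (c h)) //= hs mul0r add0r [RHS](bigD1 (c h)) //= mem_rcons inE eqxx mul1r addrC.
congr (_ + _); apply: eq_bigr => i ih; congr (_%:R * _).
by rewrite mem_rcons inE (negPf ih).
Qed.

Lemma awalk_sum_prefix (Q : seq H -> R) s :
  awalk (fun pre _ => Q pre) [::] s = \sum_(j < size s) Q (take j s).
Proof.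
elim/last_ind: s => [|s h IH]; first by rewrite big_ord0.
rewrite awalk_rcons IH size_rcons big_ord_recr /=; congr (_ + _).
  by apply: eq_bigr => j _; rewrite -cats1 takel_cat // ltnW.
by rewrite -cats1 take_size_cat.
Qed.

Lemma EL_orb K (P Q : pred (seq H)) :
  EL p K (fun s => (P s || Q s)%:R) <= EL p K (fun s => (P s)%:R) + EL p K (fun s => (Q s)%:R).
Proof.
by rewrite -ELD; apply: (EL_le pp.1) => s _; case: (P s); case: (Q s); rewrite /= ?lerDl ?lerDr ?addr0 ?add0r //.
Qed.

Lemma centred_iid_lln f K (del : R) : 0 < del ->
  let m := \sum_i pc i * f i in
  exists bad : pred (seq H),
    EL p K (fun s => (bad s)%:R) <= K%:R * (\sum_i pc i * f i ^+ 2) / del ^+ 2 /\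
    forall s, ~~ bad s -> forall t, (t <= size s)%N ->
      `|wsum (fun h => f (c h)) (take t s) - t%:R * m| < del.
Proof.
move=> del0 m; pose psi (_ : seq H) h := f (c h) - m.
exists (ahit psi del 0 [::]); split.
  have psi0 pre : \sum_h p h * psi pre h = 0.
    under eq_bigr do rewrite mulrBr.
    by rewrite sumrB sum_pushpmf -mulr_suml pp.2 mul1r subrr.
  apply: le_trans (kolmogorov_ineq pp.1 pp.2 K del0 psi0) _.
  rewrite ler_pM2r ?invr_gt0 ?exprn_gt0 //.
  rewrite (eq_EL _ (h := awalk (fun pre h => psi pre h ^+ 2) [::])); last by move=> s _; rewrite asq_awalk.
  rewrite EL_awalk; apply: le_trans (_ : \sum_(j < K) \sum_i pc i * f i ^+ 2 <= _); last first.
    by rewrite sumr_const card_ord -[leLHS]mulr_natl.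
  apply: ler_sum => j _; rewrite /psi (EL_cst pp.2).
  rewrite (sum_pushpmf (fun i => (f i - m) ^+ 2)).
  have -> : \sum_i pc i * (f i - m) ^+ 2 = \sum_i pc i * f i ^+ 2 - 2 * m * (\sum_i pc i * f i) + m ^+ 2 * \sum_i pc i.
    rewrite [2 * m * _]mulr_sumr [m ^+ 2 * _]mulr_sumr -sumrB -big_split /=.
    by apply: eq_bigr => i _; ring.
  have -> : \sum_i pc i = 1.
    have := sum_pushpmf (fun=> 1); under eq_bigr do rewrite mulr1.
    by rewrite pp.2 => ->; apply: eq_bigr => i _; rewrite mulr1.
  have := sqr_ge0 m; rewrite -/m mulr1; move: (\sum_i _) => X; rewrite expr2; lra.
move=> s /ahitPn nh t ts; have := nh t ts; rewrite add0r awalk_wsum.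
congr (`|_| < _); rewrite /wsum /psi sumrB; congr (_ - _).
by rewrite big_const_seq count_predT size_takel // iter_addr addr0 mulr_natl.
Qed.

(** The compensator of the repeats after [j] draws is the sum of [pc i * f i] over the communities
    seen, which is an iid sum of mean [j * m] minus its own repeats. The three error terms are the
    martingale part, these second-level repeats, and the fluctuation of the iid sum. *)
Lemma repeats_lln f K (del : R) : 0 < del -> (0 < K)%N ->
  let m := \sum_i pc i ^+ 2 * f i in
  exists bad : pred (seq H),
    EL p K (fun s => (bad s)%:R) <=
      K%:R ^+ 2 * (\sum_i pc i ^+ 2 * f i ^+ 2) / del ^+ 2 +
      K%:R ^+ 3 * (\sum_i pc i ^+ 3 * `|f i|) / del +
      K%:R ^+ 3 * (\sum_i pc i ^+ 3 * f i ^+ 2) / del ^+ 2 /\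
    forall s, size s = K -> ~~ bad s -> forall t, (t <= K)%N ->
      `|awalk (rep f) [::] (take t s) - (\sum_(j < t) j%:R) * m| <= 3 * del.
Proof.
move=> del0 K0 m; have K0' : 0 < K%:R :> R by rewrite ltr0n.
pose g i := pc i * f i; pose ag i := `|g i|.
pose Q (pre : seq H) := \sum_h p h * rep f pre h.
pose psi pre h := rep f pre h - Q pre.
have dK0 : 0 < del / K%:R by rewrite divr_gt0.
have [bad3 [P3 H3]] := centred_iid_lln g K dK0.
pose bad1 := ahit psi del 0 [::].
pose bad2 (s : seq H) := del / K%:R <= awalk (rep ag) [::] s.
exists (fun s => bad1 s || bad2 s || bad3 s); split.
  apply: le_trans (EL_orb K (fun s => bad1 s || bad2 s) bad3) _; rewrite lerD //; last first.
    apply: le_trans P3 _; rewrite le_eqVlt; apply/orP; left; apply/eqP.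
    have -> : \sum_i pc i * g i ^+ 2 = \sum_i pc i ^+ 3 * f i ^+ 2.
      by apply: eq_bigr => i _; rewrite /g; ring.
    by field; rewrite ?gt_eqF.
  apply: le_trans (EL_orb K bad1 bad2) _; rewrite lerD //.
    have psi0 pre : \sum_h p h * psi pre h = 0.
      under eq_bigr do rewrite mulrBr.
      by rewrite sumrB -mulr_suml pp.2 mul1r subrr.
    apply: le_trans (kolmogorov_ineq pp.1 pp.2 K del0 psi0) _.
    rewrite ler_pM2r ?invr_gt0 ?exprn_gt0 //.
    rewrite (eq_EL _ (h := awalk (fun pre h => psi pre h ^+ 2) [::])); last by move=> s _; rewrite asq_awalk.
    apply: le_trans (_ : EL p K (awalk (rep (fun i => f i ^+ 2)) [::]) <= _); last first.
      by apply: EL_awalk_rep_le => i; exact: sqr_ge0.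
    rewrite !EL_awalk; apply: ler_sum => j _; apply: (EL_le pp.1) => s _.
    have -> : \sum_h p h * psi s h ^+ 2 = \sum_h p h * rep (fun i => f i ^+ 2) s h - Q s ^+ 2.
      have -> : Q s ^+ 2 = 2 * Q s * Q s - Q s ^+ 2 * \sum_h p h by rewrite pp.2; ring.
      have e1 : 2 * Q s * Q s = \sum_h (2 * Q s) * (p h * rep f s h) by rewrite -mulr_sumr.
      have e2 : Q s ^+ 2 * \sum_h p h = \sum_h Q s ^+ 2 * p h by rewrite mulr_sumr.
      rewrite e1 e2 -!sumrB; apply: eq_bigr => h _.
      rewrite /psi /rep; case: ifP => _; ring.
    by rewrite lerBlDr lerDl sqr_ge0.
  have ag0 pre h : 0 <= rep ag pre h by rewrite /rep; case: ifP => // _; rewrite normr_ge0.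
  apply: le_trans (EL_markov (g := awalk (rep ag) [::]) pp.1 _ dK0 _) _.
  - by move=> s _; exact: awalk_ge0.
  - by [].
  apply: le_trans (_ : K%:R ^+ 2 * (\sum_i pc i ^+ 2 * ag i) / (del / K%:R) <= _).
    rewrite ler_pM2r ?invr_gt0 //; apply: EL_awalk_rep_le => i; exact: normr_ge0.
  have -> : \sum_i pc i ^+ 2 * ag i = \sum_i pc i ^+ 3 * `|f i|.
    apply: eq_bigr => i _; rewrite /ag /g normrM (ger0_norm (pushpmf_ge0 i)); ring.
  by rewrite le_eqVlt; apply/orP; left; apply/eqP; field; rewrite ?gt_eqF.
move=> s sK; rewrite !negb_or => /andP[/andP[/ahitPn n1 n2] n3] t tK.
have ts : (t <= size s)%N by rewrite sK.
have h1 := n1 t ts; rewrite add0r in h1.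
move: h1; rewrite /psi awalkB awalk_sum_prefix size_takel // => h1.
rewrite /bad2 -ltNge in n2.
have main : `|\sum_(j < t) Q (take j (take t s)) - (\sum_(j < t) j%:R) * m| <= 2 * del.
  rewrite mulr_suml -sumrB; apply: le_trans (ler_norm_sum _ _ _) _.
  apply: le_trans (_ : \sum_(j < t) (2 * (del / K%:R)) <= _); last first.
    rewrite sumr_const card_ord -[leLHS]mulr_natl mulrCA ler_wpM2l // mulrCA ler_piMr ?(ltW del0) //.
    by rewrite ler_pdivrMr // mul1r ler_nat.
  apply: ler_sum => j _; rewrite take_takel; last exact: ltnW.
  have js : (j <= size s)%N by rewrite (leq_trans _ ts) // ltnW.
  have -> : Q (take j s) = wsum (fun h => g (c h)) (take j s) - awalk (rep g) [::] (take j s).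
    rewrite -awalk_fresh_rep awalk_fresh_sum /Q sum_rep; apply: eq_bigr => i _.
    by rewrite /g mulrCA.
  have q1 := H3 s n3 j js.
  have q2 : `|awalk (rep g) [::] (take j s)| <= awalk (rep ag) [::] s.
    apply: le_trans (awalk_norm_le (phi := rep ag) _ _ _) _.
      by move=> pre h; rewrite /rep; case: ifP; rewrite ?normr0.
    by apply: awalk_take_le => pre h; rewrite /rep; case: ifP => // _; rewrite normr_ge0.
  have mE : \sum_i pc i * g i = m by apply: eq_bigr => i _; rewrite /g; ring.
  rewrite mE in q1; move: q1 q2 n2; rewrite ltr_norml ler_norml => /andP[? ?] /andP[? ?] ?.
  by rewrite ler_norml; apply/andP; split; lra.
move: h1 main; rewrite ltr_norml ler_norml => /andP[? ?] /andP[? ?].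
by rewrite ler_norml; apply/andP; split; lra.
Qed.

Lemma sizes_lln f K (del : R) : 0 < del -> (forall i, 0 <= f i) ->
  exists bad : pred (seq H),
    EL p K (fun s => (bad s)%:R) <=
      K%:R * (\sum_i pc i * f i ^+ 2) / del ^+ 2 + K%:R ^+ 2 * (\sum_i pc i ^+ 2 * f i) / del /\
    forall s, size s = K -> ~~ bad s -> forall t, (t <= K)%N ->
      `|awalk (fresh c f) [::] (take t s) - t%:R * \sum_i pc i * f i| <= 2 * del.
Proof.
move=> del0 f0; have [bad1 [P1 H1]] := centred_iid_lln f K del0.
pose bad2 (s : seq H) := del <= awalk (rep f) [::] s.
have rf0 pre h : 0 <= rep f pre h by rewrite /rep; case: ifP.
exists (fun s => bad1 s || bad2 s); split.
  apply: le_trans (EL_orb K bad1 bad2) _; rewrite lerD //.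
  apply: le_trans (EL_markov (g := awalk (rep f) [::]) pp.1 _ del0 _) _.
  - by move=> s _; exact: awalk_ge0.
  - by [].
  by rewrite ler_pM2r ?invr_gt0 //; exact: EL_awalk_rep_le.
move=> s sK; rewrite negb_or => /andP[n1]; rewrite /bad2 -ltNge => n2 t tK.
have := H1 s n1 t; rewrite sK tK => /(_ isT).
have := awalk_take_le s t rf0; have := awalk_ge0 [::] (take t s) rf0.
rewrite awalk_fresh_rep ltr_norml => ? ? /andP[? ?].
by rewrite ler_norml; apply/andP; split; lra.
Qed.

End repeats.

(** * One exceptional event for all errors of the exploration walk *)

Section walk_event.
Variables (R : realType) (H I : finType) (c : H -> I) (siz : I -> nat) (dmax smax : nat).
Hypothesis dmaxP : forall i, (hdeg c i <= dmax)%N.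
Hypothesis smaxP : forall i, (siz i <= smax)%N.
Hypothesis H0 : (0 < #|H|)%N.
Let p : H -> R := fun=> #|H|%:R^-1.

Lemma is_pmf_unif : is_pmf p.
Proof.
split=> [x|]; first by rewrite invr_ge0.
by rewrite /p sumr_const -[LHS]mulr_natl mulfV // pnatr_eq0 -lt0n.
Qed.

Lemma pushpmf_unif i : pushpmf c p i = (hdeg c i)%:R / #|H|%:R.
Proof. by rewrite /hdeg cardsE /pushpmf /p sumr_const -[LHS]mulr_natl. Qed.

Let pc := pushpmf c p.
Let f i : R := (hdeg c i)%:R - 2.
Let nu : R := \sum_i pc i * f i.
Let m : R := \sum_i pc i ^+ 2 * f i.
Let kap : R := \sum_i pc i * (siz i)%:R.

Lemma nbad_take xs (w : seq H) t : (nbad c xs [::] (take t w) <= nbad c xs [::] w)%N.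
Proof.
elim/last_ind: w t => [|w h IH] t //.
have [tw|tw] := leqP t (size w).
  by rewrite -cats1 takel_cat // cats1 nbad_rcons (leq_trans (IH t)) // leq_addr.
by rewrite take_oversize // size_rcons.
Qed.

(** The number [b] bounds the first-occurrence walk with room for [beta] bad draws. The bad set then
    has at most [3 * b + 2 * dmax] elements, and Markov's inequality bounds the probability of more
    than [beta] bad draws. *)
Lemma walk_event xs K (A del del' : R) (beta : nat) : covers xs -> (2 * K <= #|H|)%N -> (0 < K)%N ->
  0 < A -> 0 < del -> 0 < del' ->
  let b := A + K%:R * `|nu| + K%:R ^+ 2 * `|m| + 3 * del + beta%:R * (dmax%:R + 2) in
  exists bad : pred (seq H),
    EL p K (fun s => (bad s)%:R) <=
      K%:R * (\sum_i pc i * f i ^+ 2) / A ^+ 2 +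
      (K%:R ^+ 2 * (\sum_i pc i ^+ 2 * f i ^+ 2) / del ^+ 2 +
       K%:R ^+ 3 * (\sum_i pc i ^+ 3 * `|f i|) / del +
       K%:R ^+ 3 * (\sum_i pc i ^+ 3 * f i ^+ 2) / del ^+ 2) +
      (K%:R * (\sum_i pc i * (siz i)%:R ^+ 2) / del' ^+ 2 +
       K%:R ^+ 2 * (\sum_i pc i ^+ 2 * (siz i)%:R) / del') +
      K%:R * ((3 * b + 2 * dmax%:R) / #|H|%:R) / beta.+1%:R /\
    forall w, size w = K -> ~~ bad w -> forall t, (t <= K)%N ->
      [/\ `|wsum (fun h => f (c h)) (take t w) - t%:R * nu| < A,
          `|Zrun R c xs (take t w) -
            (wsum (fun h => f (c h)) (take t w) - (\sum_(j < t) j%:R) * m)|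
            <= 3 * del + beta%:R * (dmax%:R + 2) &
          `|Vrun R c siz xs (take t w) - t%:R * kap| <= 2 * del' + beta%:R * smax%:R].
Proof.
move=> cov KH K0 A0 del0 del0' b; have pp := is_pmf_unif.
have [bad1 [P1 H1]] := centred_iid_lln c pp f K A0.
have [bad2 [P2 H2]] := repeats_lln c pp f del0 K0.
have [bad3 [P3 H3]] := sizes_lln c pp K del0' (fun i => ler0n R (siz i)).
set M := 3 * b + 2 * dmax%:R.
have M0 : 0 <= M.
  rewrite /M /b; have := mulr_ge0 (ler0n R K) (normr_ge0 nu).
  have := mulr_ge0 (sqr_ge0 (K%:R : R)) (normr_ge0 m).
  have : 0 <= beta%:R * (dmax%:R + 2) :> R by rewrite mulr_ge0 // addr_ge0.
  have : 0 <= dmax%:R :> R by [].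
  by clear - A0 del0; lra.
pose bad4 (w : seq H) := (beta < nbadM c M xs [::] w)%N.
exists (fun s => bad1 s || bad2 s || bad3 s || bad4 s); split.
  apply: le_trans (EL_orb pp K (fun s => bad1 s || bad2 s || bad3 s) bad4) _; rewrite lerD //; last first.
    apply: le_trans (EL_markov (g := fun s => (nbadM c M xs [::] s)%:R) pp.1 _ (ltr0Sn R beta) _) _ => //.
    - by move=> s _; rewrite /bad4 ler_nat.
    by rewrite ler_pM2r ?invr_gt0 //; exact: EL_nbadM.
  apply: le_trans (EL_orb pp K (fun s => bad1 s || bad2 s) bad3) _; rewrite lerD //.
  by apply: le_trans (EL_orb pp K bad1 bad2) _; rewrite lerD.
move=> w wK; rewrite !negb_or => /andP[/andP[/andP[n1 n2] n3]]; rewrite /bad4 -leqNgt => n4.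
have rel t : (t <= K)%N -> [/\ `|wsum (fun h => f (c h)) (take t w) - t%:R * nu| < A,
    `|awalk (rep c f) [::] (take t w) - (\sum_(j < t) j%:R) * m| <= 3 * del &
    `|awalk (fresh c (fun i => (siz i)%:R)) [::] (take t w) - t%:R * kap| <= 2 * del'].
  by move=> tK; split; [apply: H1; rewrite ?wK|exact: H2|exact: H3].
have tri t : (t <= K)%N -> \sum_(j < t) j%:R <= K%:R ^+ 2 :> R.
  move=> tK; apply: le_trans (_ : \sum_(j < t) K%:R <= _).
    by apply: ler_sum => j _; rewrite ler_nat (leq_trans (ltnW (ltn_ord j))).
  by rewrite sumr_const card_ord -[leLHS]mulr_natl expr2 ler_wpM2r // ler_nat.
(* The truncated count is at most [beta], so by [nbad_nbadM] the true count cannot have reached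
   [beta.+1]. *)
have nb : (nbad c xs [::] w <= beta)%N.
  have := nbad_nbadM (w := w) (b := b) (beta := beta) dmaxP smaxP cov; rewrite wK => /(_ KH).
  have hyp : forall u, (u <= K)%N ->
     `|awalk (fresh c (fun i : I => (hdeg c i)%:R - 2)) [::] (take u w)| + beta%:R * (dmax%:R + 2) <= b.
    move=> u uK; rewrite lerD2r awalk_fresh_rep -/f.
    have [r1 r2 _] := rel u uK.
    have q1 : u%:R * `|nu| <= K%:R * `|nu| by rewrite ler_wpM2r // ler_nat.
    have q2 : (\sum_(j < u) j%:R) * `|m| <= K%:R ^+ 2 * `|m| by rewrite ler_wpM2r // tri.
    have n1' : `|u%:R * nu| = u%:R * `|nu| by rewrite normrM ger0_norm.
    have n2' : `|(\sum_(j < u) j%:R) * m| = (\sum_(j < u) j%:R) * `|m|.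
      by rewrite normrM ger0_norm // sumr_ge0.
    have := ler_norm (u%:R * nu); have := ler_norm (- (u%:R * nu)); rewrite normrN n1'.
    have := ler_norm ((\sum_(j < u) j%:R) * m); have := ler_norm (- ((\sum_(j < u) j%:R) * m)).
    rewrite normrN n2'; move: r1 r2 q1 q2.
    move: (u%:R * nu) (u%:R * `|nu|) ((\sum_(j < u) j%:R) * m) ((\sum_(j < u) j%:R) * `|m|).
    move: (K%:R * `|nu|) (K%:R ^+ 2 * `|m|) (wsum _ _) (awalk _ _ _).
    move=> X1 X2 X3 X4 Y1 Y2 Y3 Y4; rewrite ltr_norml => /andP[? ?]; rewrite ler_norml => /andP[? ?] *.
    by rewrite ler_norml; apply/andP; split; lra.
  move=> /(_ hyp); rewrite -/M => hmin.
  have := leq_trans hmin n4; rewrite geq_min ltnn orbF //.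
move=> t tK; have [r1 r2 r3] := rel t tK.
have KT : (2 * size (take t w) <= #|H|)%N.
  by rewrite size_takel ?wK // (leq_trans _ KH) // leq_mul2l tK orbT.
have [zA vA] := Zrun_approx R dmaxP smaxP cov KT.
have nbt : (nbad c xs [::] (take t w))%:R <= beta%:R :> R.
  by rewrite ler_nat; exact: leq_trans (nbad_take _ _ _) nb.
split => //.
  have d2 : 0 <= dmax%:R + 2 :> R by rewrite addr_ge0.
  move: (le_trans zA (ler_wpM2r d2 nbt)) r2; rewrite awalk_fresh_rep -/f.
  move: (beta%:R * _) (Zrun _ _ _ _) (wsum _ _) (awalk _ _ _) ((\sum_(j < t) _) * _).
  move=> X1 X2 X3 X4 X5; rewrite ler_norml => /andP[? ?]; rewrite ler_norml => /andP[? ?].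
  by rewrite ler_norml; apply/andP; split; lra.
move: (le_trans vA (ler_wpM2r (ler0n R smax) nbt)) r3.
move: (beta%:R * _) (Vrun _ _ _ _ _) (awalk _ _ _) (t%:R * _).
move=> X1 X2 X3 X4; rewrite ler_norml => /andP[? ?]; rewrite ler_norml => /andP[? ?].
by rewrite ler_norml; apply/andP; split; lra.
Qed.

End walk_event.

(** * Components of the hierarchical graph *)

Section sorted_counts.

Lemma nth_sort_geq (s : seq nat) k x : (0 < x)%N ->
  (x <= nth 0 (sort geq s) k)%N = (k < count (leq x) s)%N.
Proof.
move=> x0; rewrite -(count_sort geq) //.
have : sorted geq (sort geq s) by apply: sort_sorted => a b; exact: leq_total.
elim: (sort geq s) k => [|a t IH] k st /=; first by rewrite nth_nil leqNgt x0.
have st' := path_sorted st.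
case: k => [|k] /=.
  case: (leqP x a) => xa //=; rewrite add0n.
  apply/esym/negbTE; rewrite -leqNgt leqn0 -/(count _ t) -size_filter size_eq0.
  have /allP ta : all (geq a) t by apply: order_path_min st => u v w /= h1 h2; exact: leq_trans h2 h1.
  apply/eqP; rewrite (@eq_in_filter _ _ pred0) ?filter_pred0 // => b /ta /= ba.
  by apply/negbTE; rewrite -ltnNge (leq_ltn_trans ba).
rewrite IH //; case: (leqP x a) => xa /=; first by rewrite add1n ltnS.
rewrite add0n; have -> : count (leq x) t = 0%N; last by rewrite !ltn0.
apply/eqP; rewrite -size_filter size_eq0.
have /allP ta : all (geq a) t by apply: order_path_min st => u v w /= h1 h2; exact: leq_trans h2 h1.
apply/eqP; rewrite (@eq_in_filter _ _ pred0) ?filter_pred0 // => b /ta /= ba.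
by apply/negbTE; rewrite -ltnNge (leq_ltn_trans ba).
Qed.

Lemma inj_ord_uniq (T : eqType) (s : seq T) k : uniq s -> (k < size s)%N ->
  exists e : 'I_k.+1 -> T, injective e /\ forall i, e i \in s.
Proof.
case: s => // x s us ks; exists (fun i => nth x (x :: s) i); split=> [i j /eqP|i].
  rewrite nth_uniq //; [by move=> /eqP /val_inj| |]; exact: leq_ltn_trans (leq_ord _) ks.
by apply: mem_nth; exact: leq_ltn_trans (leq_ord _) ks.
Qed.

End sorted_counts.

(** * Large components missed by random starting vertices *)

Section late_components.
Variables (R : realType) (V : finType) (p : V -> R).
Hypothesis pp : is_pmf p.

Lemma EL_all (P : pred V) K : EL p K (fun s => (all P s)%:R) = (\sum_x p x * (P x)%:R) ^+ K.
Proof.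
elim: K => [|K IH] /=; first by rewrite expr0.
rewrite exprS -IH mulr_suml; apply: eq_bigr => x _; rewrite -mulrA; congr (_ * _).
by rewrite -ELZ; apply: eq_EL => s _; case: (P x); rewrite /= ?mul1r ?mul0r.
Qed.

(** Bernoulli's inequality for [1 + u], multiplied by [(1 - u) ^+ q]. *)
Lemma expr_le_inv (u : R) q : 0 <= u -> u <= 1 -> (1 - u) ^+ q <= (1 + q%:R * u)^-1.
Proof.
move=> u0 u1; have q0 : 0 < 1 + q%:R * u by rewrite ltr_pwDl // mulr_ge0.
rewrite -[leRHS]mul1r ler_pdivlMr //.
have : 1 + q%:R * u <= (1 + u) ^+ q.
  elim: q {q0} => [|q IH]; first by rewrite mul0r addr0 expr0.
  rewrite exprS; apply: le_trans (ler_wpM2l _ IH); last by rewrite addr_ge0.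
  have : 0 <= q%:R * u * u by rewrite !mulr_ge0.
  by rewrite -natr1; move: (q%:R : R) => z ?; nra.
move=> h; apply: le_trans (ler_wpM2l _ h) _; first by rewrite exprn_ge0 // subr_ge0.
rewrite -exprMn; apply: exprn_ile1; first by rewrite mulr_ge0 ?subr_ge0 ?addr_ge0.
by have := sqr_ge0 u; lra.
Qed.

Definition unhit (x : seq V) (X : {set V}) := all (fun v => v \notin X) x.

Lemma EL_unhit (X : {set V}) (u : R) q : 0 <= u -> u <= \sum_(v in X) p v ->
  EL p q (fun x => (unhit x X)%:R) <= (1 + q%:R * u)^-1.
Proof.
move=> u0 uX; rewrite EL_all.
have sX : \sum_v p v * (v \notin X)%:R = 1 - \sum_(v in X) p v.
  rewrite -[X in _ = X - _]pp.2 [X in _ = X - _](bigID (mem X)) /= addrAC subrr add0r big_mkcond /=.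
  rewrite [RHS]big_mkcond /=.
  by apply: eq_bigr => v _; case: (v \in X); rewrite /= ?mulr0 ?mulr1.
have X1 : \sum_(v in X) p v <= 1.
  by rewrite -subr_ge0 -sX; apply: sumr_ge0 => v _; rewrite mulr_ge0 // pp.1.
rewrite sX; have X0 : 0 <= \sum_(v in X) p v by apply: sumr_ge0 => v _; exact: pp.1.
apply: le_trans (expr_le_inv q X0 X1) _.
rewrite lef_pV2 ?posrE ?ltr_pwDl ?mulr_ge0 // lerD2l ler_wpM2l //.
Qed.

(* When more than half of the family is missed, Markov's inequality applies to the
   number of missed sets; otherwise the family is small and a union bound suffices. *)
Lemma EL_late (Bs : {set {set V}}) (u : R) q (M0 : nat) : 0 <= u -> (0 < M0)%N ->
  (forall X, X \in Bs -> u <= \sum_(v in X) p v) ->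
  EL p q (fun x => ([exists X in Bs, unhit x X] &&
     (#|[set X in Bs | ~~ unhit x X]%SET| <= M0)%N)%:R) <=
  2 * M0%:R * (1 + q%:R * u)^-1.
Proof.
move=> u0 M0p HB; set th := (1 + q%:R * u)^-1.
have th0 : 0 <= th by rewrite invr_ge0 addr_ge0 // mulr_ge0.
pose nun x := (\sum_(X in Bs) unhit x X)%N.
have Enun : EL p q (fun x => (nun x)%:R) <= #|Bs|%:R * th.
  rewrite (eq_EL _ (h := fun x => \sum_(X in Bs) (unhit x X)%:R)); last first.
    by move=> x _; rewrite /nun natr_sum.
  rewrite (EL_sum pp.2); apply: le_trans (_ : \sum_(X in Bs) th <= _).
    by apply: ler_sum => X XB; apply: EL_unhit => //; exact: HB.
  by rewrite sumr_const -[leLHS]mulr_natl.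
have nun1 x : [exists X in Bs, unhit x X] -> (0 < nun x)%N.
  by move=> /existsP[X /andP[XB ux]]; rewrite /nun (bigD1 X) //= ux.
have [small|big] := leqP #|Bs| (2 * M0).
  apply: le_trans (_ : EL p q (fun x => (nun x)%:R) <= _).
    apply: (EL_le pp.1) => x _; case: (boolP [exists X in Bs, unhit x X]) => [/nun1 h|_] //=.
    by rewrite ler_nat; case: (_ <= M0)%N.
  by apply: le_trans Enun _; rewrite ler_wpM2r // -natrM ler_nat.
have B0 : 0 < #|Bs|%:R / 2 :> R by rewrite divr_gt0 // ltr0n (leq_trans _ big).
apply: le_trans (EL_markov (g := fun x => (nun x)%:R) pp.1 _ B0 _) _ => //.
  move=> x _ /andP[_ hM]; have e : (#|Bs| = nun x + #|[set X in Bs | ~~ unhit x X]%SET|)%N.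
    rewrite /nun -big_mkcondr /= -!sum1_card (bigID (unhit x)) /=; congr (_ + _)%N.
    by apply: eq_bigl => X; rewrite inE.
  rewrite ler_pdivrMr // -natrM ler_nat; move: e hM big; clear; lia.
apply: le_trans (ler_wpM2r _ Enun) _; first by rewrite invr_ge0 ltW.
have b0 : #|Bs|%:R != 0 :> R by apply: lt0r_neq0; move: B0; rewrite pmulr_lgt0.
rewrite (_ : #|Bs|%:R * th / (#|Bs|%:R / 2) = 2 * th); last first.
  by clearbody th; move: (#|Bs|%:R) b0 => b b0; field.
by rewrite ler_wpM2r // ler_peMr // ler1n.
Qed.

End late_components.

(** * From components of communities to components of vertices *)

Section hcm_translation.
Variables (n : nat) (Hs : 'I_n -> community).
Hypothesis Hvalid : forall i, valid_community (Hs i).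
Implicit Types (m : {ffun hedge Hs -> hedge Hs}) (C : {set 'I_n}).

Definition hcomm (h : hedge Hs) : 'I_n := tag (tag h).
Definition vcomp C : {set vtx Hs} := [set x | tag x \in C]%SET.
Definition vsz C : nat := (\sum_(i in C) csize (Hs i))%N.
Local Notation comp := (comp_of hcomm).

Lemma hcm_matchingsE : hcm_matchings Hs = full_matchings (hedge Hs).
Proof. by []. Qed.

Lemma card_sigma_pred (T : finType) (F : T -> finType) (A : {set T}) :
  #|[set x : {i : T & F i} | tag x \in A]%SET| = (\sum_(i in A) #|F i|)%N.
Proof.
rewrite -sum1_card (eq_bigl (fun x : {i : T & F i} => (tag x \in A) && true)); last first.
  by move=> x; rewrite inE andbT.
rewrite -(sig_big_dep (fun i => i \in A) (fun _ _ => true) (fun _ _ => 1%N)) /=.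
by apply: eq_bigr => i _; rewrite sum1_card.
Qed.

Lemma card_vcomp C : #|vcomp C| = vsz C.
Proof.
rewrite /vcomp (card_sigma_pred (fun i => 'I_(csize (Hs i)) : finType)).
by apply: eq_bigr => i _; rewrite card_ord.
Qed.

Lemma card_vtx : #|vtx Hs| = hcm_N Hs.
Proof.
have := card_sigma_pred (fun i => 'I_(csize (Hs i)) : finType) [set: 'I_n]%SET.
rewrite (_ : [set _ | _]%SET = [set: _]%SET) ?cardsT; last by apply/setP => x; rewrite !inE.
move=> ->; apply: eq_big => [i|i _]; by rewrite ?inE ?card_ord.
Qed.

Lemma hdeg_hcomm i : hdeg hcomm i = cdtot (Hs i).
Proof.
rewrite /hdeg /cdtot.
have -> : [set h : hedge Hs | hcomm h == i]%SET =
    [set h : {x : vtx Hs & 'I_(vdeg x)} | tag h \in [set x : vtx Hs | tag x == i]%SET]%SET.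
  by apply/setP => h; rewrite !inE.
rewrite (card_sigma_pred (fun x : vtx Hs => 'I_(vdeg x) : finType)).
under eq_bigr do rewrite card_ord.
rewrite (eq_bigl (fun x : vtx Hs => (tag x == i) && true)); last by move=> x; rewrite inE andbT.
rewrite -(sig_big_dep (fun j => j == i) (fun _ _ => true)
  (fun j (v : 'I_(csize (Hs j))) => vdeg (Tagged (fun j => 'I_(csize (Hs j))) v))) /=.
by rewrite big_pred1_eq; apply: eq_bigr.
Qed.

Lemma card_hedge : #|hedge Hs| = (\sum_i cdtot (Hs i))%N.
Proof.
rewrite -sum1_card (partition_big hcomm xpredT) //=; apply: eq_bigr => i _.
by rewrite sum1_card -hdeg_hcomm /hdeg cardsE.
Qed.

Lemma connect_community m (x y : vtx Hs) : tag x = tag y -> connect (hcm_rel m) x y.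
Proof.
case: x y => [i u] [j v] /= ij; case: j / ij v => v.
have [_ _ _ /(_ u v) /connectP[s ps ->]] := Hvalid i.
elim: s u ps => [|w s IH] u /=; first by move=> _; exact: connect0.
move=> /andP[uw ps]; apply: connect_trans (connect1 _) (IH w ps).
rewrite /hcm_rel; apply/orP; left; apply/existsP; exists i; apply/existsP; exists u.
by apply/existsP; exists w; rewrite uw !eqxx.
Qed.

Lemma connect_lift m (i j : 'I_n) : connect (adj hcomm m) i j ->
  forall x y : vtx Hs, tag x = i -> tag y = j -> connect (hcm_rel m) x y.
Proof.
move=> /connectP[s ps ->]; elim: s i ps => [|k s IH] i /=.
  by move=> _ x y <- yx; apply: connect_community.
move=> /andP[/existsP[h /and3P[_ /eqP hi /eqP hk]] ps] x y xi yj.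
apply: connect_trans (IH k ps (tag (m h)) y hk yj).
apply: connect_trans (connect_community m (_ : tag x = tag (tag h))) (connect1 _); first by rewrite xi -hi.
by rewrite /hcm_rel; apply/orP; right; apply/existsP; exists h; rewrite !eqxx.
Qed.

Lemma hcm_rel_closed m C (x y : vtx Hs) : comp m C -> hcm_rel m x y ->
  tag x \in C -> tag y \in C.
Proof.
move=> cC /orP[/existsP[i /existsP[u /existsP[v /and3P[_ /eqP-> /eqP->]]]] //|].
move=> /existsP[h /andP[/eqP <- /eqP <-]] xC.
by have [_] := comp_closed cC xC.
Qed.

Lemma comp_class m C (x : vtx Hs) : comp m C -> tag x \in C ->
  [set y | connect (hcm_rel m) x y]%SET = vcomp C.
Proof.
move=> cC xC; apply/setP => y; rewrite !inE; apply/idP/idP.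
  move=> /connectP[s ps ->]; elim: s x xC ps => [|z s IH] x xC //= /andP[xz ps].
  by apply: IH ps; exact: hcm_rel_closed cC xz xC.
move=> yC; apply: (@connect_lift m (tag x) (tag y)) => //.
exact: (comp_conn cC).
Qed.

Lemma comp_hcm m C : comp m C -> vcomp C \in hcm_components m.
Proof.
move=> cC; have /set0Pn[i iC] := comp_neq0 cC.
have [s0 _ _ _] := Hvalid i.
pose x : vtx Hs := Tagged (fun i => 'I_(csize (Hs i))) (Ordinal s0).
by apply/imsetP; exists x => //; rewrite -(comp_class cC (x := x)).
Qed.

Lemma adj_sym m : m \in full_matchings (hedge Hs) -> connect_sym (adj hcomm m).
Proof.
move=> /full_matchingsP mm; apply: sym_connect_sym.
suff h i j : adj hcomm m i j -> adj hcomm m j i by move=> i j; apply/idP/idP; exact: h.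
move=> /existsP[h /and3P[h1 h2 h3]]; apply/existsP; exists (m h).
by have [e ne] := mm h; rewrite e h3 h2 eq_sym h1.
Qed.

Lemma hcm_comp m X : m \in full_matchings (hedge Hs) -> X \in hcm_components m ->
  exists2 C, comp m C & X = vcomp C.
Proof.
move=> mf /imsetP[x _ ->]; have sym := adj_sym mf.
pose C := [set j | connect (adj hcomm m) (tag x) j]%SET.
have cC : comp m C.
  split.
  - by apply/set0Pn; exists (tag x); rewrite inE connect0.
  - move=> h; rewrite !inE => hC; have [e ne] := full_matchingsP _ mf h; split=> //.
    apply: connect_trans hC (connect1 _); apply/existsP; exists h; by rewrite ne !eqxx.
  - move=> i j; rewrite !inE => xi xj; apply: connect_trans xj; by rewrite sym.
by exists C => //; rewrite (comp_class cC) // inE connect0.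
Qed.

Lemma vcomp_inj m C C' : comp m C -> comp m C' -> vcomp C = vcomp C' -> C = C'.
Proof.
move=> _ _ /setP e; apply/setP => i; have [s0 _ _ _] := Hvalid i.
by have := e (Tagged (fun i => 'I_(csize (Hs i))) (Ordinal s0)); rewrite !inE.
Qed.

Lemma comp_eq m C C' i : comp m C -> comp m C' -> i \in C -> i \in C' -> C = C'.
Proof.
move=> cC cC' iC iC'; apply: (vcomp_inj cC cC'); have [s0 _ _ _] := Hvalid i.
pose x : vtx Hs := Tagged (fun i => 'I_(csize (Hs i))) (Ordinal s0).
by rewrite -(comp_class cC (x := x)) // -(comp_class cC' (x := x)).
Qed.

Lemma sorted_comp_sizesE m k x : (0 < x)%N ->
  (x <= nth 0 (sorted_comp_sizes m) k)%N =
  (k < #|[set X in hcm_components m | (x <= #|X|)%N]%SET|)%N.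
Proof.
move=> x0; rewrite nth_sort_geq // count_map -sum1_count big_enum_cond /= -sum1_card.
by congr (_ < _)%N; apply: eq_bigl => X; rewrite inE.
Qed.

Lemma pairwise_nth_disj (T : Type) (r : rel T) (x0 : T) s i j : pairwise r s ->
  (i < j)%N -> (j < size s)%N -> r (nth x0 s i) (nth x0 s j).
Proof. by move=> /(pairwiseP x0) h ij js; apply: h => //; rewrite inE ?(ltn_trans ij). Qed.

Definition rec0 : nat * nat * {set 'I_n} := (0%N, 0%N, finset.set0).

Lemma recs_large m (recs : seq (nat * nat * {set 'I_n})) k x (e : 'I_k.+1 -> 'I_(size recs)) :
  (forall r, r \in recs -> comp m r.2) -> pairwise (@recdisj _) recs -> injective e ->
  (forall i, x <= vsz (nth rec0 recs (e i)).2)%N -> (x <= nth 0 (sorted_comp_sizes m) k)%N.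
Proof.
case: x => // x hc hd inj_e he; rewrite sorted_comp_sizesE //.
pose g i := vcomp (nth rec0 recs (e i)).2.
have ge i : comp m (nth rec0 recs (e i)).2 by apply: hc; exact: mem_nth.
have disj i j : (e i < e j)%N -> g i <> g j.
  move=> lt /(vcomp_inj (ge i) (ge j)) E.
  have := pairwise_nth_disj rec0 hd lt (ltn_ord _); rewrite /recdisj E finset.setIid => /eqP h0.
  by have := comp_neq0 (ge j); rewrite h0 eqxx.
have gi : injective g.
  move=> i j gij; case: (ltngtP (e i) (e j)) => [lt|lt|eij].
  - by case: (disj i j lt gij).
  - by case: (disj j i lt (esym gij)).
  - exact: inj_e (val_inj eij).
have := subset_leq_card (_ : codom g \subset [set X in hcm_components m | (x < #|X|)%N]%SET).
rewrite (card_codom gi) card_ord; apply.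
apply/fintype.subsetP => X /codomP[i ->]; rewrite inE comp_hcm //= card_vcomp; exact: he.
Qed.

Lemma large_recs m (recs : seq (nat * nat * {set 'I_n})) k x :
  m \in full_matchings (hedge Hs) -> (0 < x)%N ->
  (forall C, comp m C -> (x <= vsz C)%N -> exists2 r, r \in recs & r.2 = C) ->
  (x <= nth 0 (sorted_comp_sizes m) k)%N ->
  exists e : 'I_k.+1 -> 'I_(size recs), injective e /\
    forall i, (x <= vsz (nth rec0 recs (e i)).2)%N.
Proof.
move=> mf x0 hC; rewrite sorted_comp_sizesE // cardE => /(inj_ord_uniq (enum_uniq _))[g [ginj gin]].
have ch i : exists j : 'I_(size recs), vcomp (nth rec0 recs j).2 = g i.
  have := gin i; rewrite mem_enum inE => /andP[gc gx].
  have [C cC gE] := hcm_comp mf gc; move: gx; rewrite gE card_vcomp => xC.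
  have [r rin rC] := hC C cC xC.
  have ir : (index r recs < size recs)%N by rewrite index_mem.
  by exists (Ordinal ir); rewrite /= nth_index // rC.
have [e he] := choice ch; exists e; split; first by move=> i j eij; apply: ginj; rewrite -!he eij.
by move=> i; have := gin i; rewrite mem_enum inE -he card_vcomp => /andP[].
Qed.

End hcm_translation.

(** * Empirical moments *)

Section empirical_means.
Variable R : realType.
Implicit Types (phi psi : community -> R) (F : seq community).

Section expectation.
Variable P : community -> R.
Hypothesis P_ge0 : forall H, 0 <= P H.

Lemma cexp_fin phi : (forall H, 0 <= phi H) -> (cexp P phi < +oo)%E -> cexp P phi \is a fin_num.
Proof.
move=> p0 fin; rewrite ge0_fin_numE //; apply: esum_ge0 => H _.
by rewrite lee_fin mulr_ge0.
Qed.

Lemma cexp_seq_le phi F : (forall H, 0 <= phi H) -> (cexp P phi < +oo)%E -> uniq F ->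
  \sum_(H <- F) P H * phi H <= fine (cexp P phi).
Proof.
move=> p0 fin uF; rewrite -lee_fin fineK; last exact: cexp_fin.
apply: esum_ge; exists [set` F]; first by split=> //; exact: finite_seq.
by rewrite -fsbig_seq // sumEFin.
Qed.

Lemma cexp_seq_approx phi (e : R) : (forall H, 0 <= phi H) -> (cexp P phi < +oo)%E -> 0 < e ->
  exists F, uniq F /\ fine (cexp P phi) - e <= \sum_(H <- F) P H * phi H.
Proof.
move=> p0 fin e0; have fn := cexp_fin p0 fin.
have [_ [A [finA _] <-] lt] := ub_ereal_sup_adherent e0 fn.
exists (finmap.enum_fset (fset_set A)); split; first exact: finmap.fset_uniq.
rewrite -lee_fin EFinB fineK //; apply: ltW; apply: lt_le_trans lt _.
by rewrite fsbig_finite // sumEFin.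
Qed.

Lemma cexp_le_fin phi psi : (forall H, 0 <= phi H <= psi H) -> (cexp P psi < +oo)%E ->
  (cexp P phi < +oo)%E.
Proof.
move=> pp; apply: le_lt_trans; apply: le_esum => H _; rewrite lee_fin.
by apply: ler_wpM2l => //; case/andP: (pp H).
Qed.
End expectation.

Lemma emp_seq n (Hs : 'I_n -> community) phi F : uniq F ->
  \sum_(H <- F) emp_frac Hs H * phi H = emp_mean Hs (fun H => (H \in F)%:R * phi H).
Proof.
move=> uF; rewrite /emp_mean /emp_frac.
under eq_bigr do rewrite mulrAC.
rewrite -mulr_suml; congr (_ / _).
have E H : #|[set i : 'I_n | Hs i == H]%SET|%:R = \sum_i (Hs i == H)%:R :> R.
  by rewrite -natr_sum cardsE -sum1_card big_mkcond.
under eq_bigr do rewrite E mulr_suml.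
rewrite exchange_big /=; apply: eq_bigr => i _.
case: (boolP (Hs i \in F)) => iF.
  rewrite (bigD1_seq (Hs i)) //= eqxx big1 ?addr0 // => H /negPf nH.
  by rewrite eq_sym nH mul0r.
rewrite mul0r big1_seq // => H /andP[_ HF].
by case: eqP => [E'|_]; rewrite ?mul0r //; move: iF; rewrite E' HF.
Qed.

Lemma emp_meanD n (Hs : 'I_n -> community) phi psi :
  emp_mean Hs (fun H => phi H + psi H) = emp_mean Hs phi + emp_mean Hs psi.
Proof. by rewrite /emp_mean big_split mulrDl. Qed.

Lemma emp_meanZ n (Hs : 'I_n -> community) a phi :
  emp_mean Hs (fun H => a * phi H) = a * emp_mean Hs phi.
Proof. by rewrite /emp_mean -mulr_sumr mulrA. Qed.

Lemma emp_mean_le n (Hs : 'I_n -> community) phi psi : (forall H, phi H <= psi H) ->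
  emp_mean Hs phi <= emp_mean Hs psi.
Proof. by move=> h; rewrite /emp_mean ler_wpM2r ?invr_ge0 //; apply: ler_sum. Qed.

Unset Implicit Arguments.
Variables (Hs : forall n, 'I_n -> community).
Set Implicit Arguments.
Variables (P : community -> R) (psi : community -> R).
Hypothesis P_ge0 : forall H, 0 <= P H.
Hypothesis CR1 : forall H, (fun n => emp_frac (Hs n) H) @ \oo --> P H.
Hypothesis psi_ge0 : forall H, 0 <= psi H.
Hypothesis psi_fin : (cexp P psi < +oo)%E.
Hypothesis psi_cvg : (fun n => emp_mean (Hs n) psi) @ \oo --> fine (cexp P psi).

Lemma emp_seq_cvg phi F : uniq F ->
  (fun n => emp_mean (Hs n) (fun H => (H \in F)%:R * phi H)) @ \oo --> \sum_(H <- F) P H * phi H.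
Proof.
move=> uF; under eq_fun do rewrite -(emp_seq _ _ uF).
suff main (G : seq community) :
    (fun n => \sum_(H <- G) emp_frac (Hs n) H * phi H) @ \oo --> \sum_(H <- G) P H * phi H by exact: main.
elim: G => [|H G IH].
  rewrite big_nil (_ : (fun n => _) = (fun=> 0)); first exact: cvg_cst.
  by apply/funext => n; rewrite big_nil.
rewrite big_cons (_ : (fun n => _) =
    (fun n => emp_frac (Hs n) H * phi H + \sum_(H <- G) emp_frac (Hs n) H * phi H)).
  by apply: cvgD => //; apply: cvgM; [exact: CR1|exact: cvg_cst].
by apply/funext => n; rewrite big_cons.
Qed.

(** Uniform integrability: frequencies and the mean of [psi] both converge, so no mass of [psi]
    escapes from a large finite set of communities. *)
Lemma emp_tail (e : R) : 0 < e -> exists F, [/\ uniq F,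
  fine (cexp P psi) - e <= \sum_(H <- F) P H * psi H &
  \forall n \near \oo, emp_mean (Hs n) (fun H => (H \notin F)%:R * psi H) <= 2 * e].
Proof.
move=> e0; have [F [uF hF]] := cexp_seq_approx P_ge0 psi_ge0 psi_fin e0.
exists F; split=> //; have c1 := emp_seq_cvg (phi := psi) uF.
have c2 : (fun n => emp_mean (Hs n) psi - emp_mean (Hs n) (fun H => (H \in F)%:R * psi H)) @ \oo
    --> fine (cexp P psi) - \sum_(H <- F) P H * psi H by exact: cvgB.
have : \forall n \near \oo, emp_mean (Hs n) psi - emp_mean (Hs n) (fun H => (H \in F)%:R * psi H) <= 2 * e.
  by apply: (cvgr_le _ c2); lra.
apply: filterS => n; apply: le_trans; rewrite lerBrDr -emp_meanD.
by apply: emp_mean_le => H; case: (H \in F); rewrite /= ?mul1r ?mul0r ?add0r ?addr0.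
Qed.

(** Dominated convergence: on a finite set the frequencies converge, and off it [phi] is bounded by
    the small tail of [psi]. *)
Lemma emp_cvg phi : (forall H, 0 <= phi H <= psi H) ->
  (fun n => emp_mean (Hs n) phi) @ \oo --> fine (cexp P phi).
Proof.
move=> pp; have p0 H : 0 <= phi H by case/andP: (pp H).
have ple H : phi H <= psi H by case/andP: (pp H).
have pfin := cexp_le_fin P_ge0 pp psi_fin.
apply: cvgr_distP => e e0; have e4 : 0 < e / 8 by rewrite divr_gt0.
have [F [uF hF tF]] := emp_tail e4.
have c1 := emp_seq_cvg (phi := phi) uF.
(* A finite family nearly attaining the mean of [phi] is merged with [F]; its part outside [F] is
   bounded by the tail of [psi]. *)
have up : fine (cexp P phi) <= \sum_(H <- F) P H * phi H + e / 4.
  have [G [uG hG]] := cexp_seq_approx P_ge0 p0 pfin e4.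
  pose G' := [seq H <- G | H \notin F].
  have uFG : uniq (F ++ G').
    rewrite cat_uniq uF filter_uniq // andbT; apply/hasPn => H; rewrite mem_filter => /andP[] //.
  have h1 := cexp_seq_le P_ge0 psi_ge0 psi_fin uFG; rewrite big_cat /= in h1.
  have h2 : \sum_(H <- G') P H * phi H <= \sum_(H <- G') P H * psi H.
    by apply: ler_sum => H _; rewrite ler_wpM2l.
  have h3 : \sum_(H <- G) P H * phi H <= \sum_(H <- F) P H * phi H + \sum_(H <- G') P H * phi H.
    rewrite -big_cat /= (bigID (fun H => H \in F)) /= big_cat /= lerD //; last first.
      by rewrite /G' big_filter.
    rewrite -big_filter; apply: le_trans (_ : \sum_(H <- [seq H <- F | H \in G]) P H * phi H <= _).
      rewrite le_eqVlt; apply/orP; left; apply/eqP; apply: perm_big; apply: uniq_perm; rewrite ?filter_uniq //.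
      by move=> H; rewrite !mem_filter andbC.
    rewrite big_filter [leRHS](bigID (fun H => H \in G)) /= lerDl.
    by apply: sumr_ge0 => H _; rewrite mulr_ge0.
  by lra.
have dn := cexp_seq_le P_ge0 p0 pfin uF.
near=> n.
have t1 : emp_mean (Hs n) (fun H => (H \notin F)%:R * psi H) <= 2 * (e / 8) by near: n.
have t2 : `|\sum_(H <- F) P H * phi H - emp_mean (Hs n) (fun H => (H \in F)%:R * phi H)| <= e / 8.
  by near: n; move/cvgrPdist_le : c1 => /(_ _ e4).
have t3 : emp_mean (Hs n) phi = emp_mean (Hs n) (fun H => (H \in F)%:R * phi H) +
    emp_mean (Hs n) (fun H => (H \notin F)%:R * phi H).
  rewrite -emp_meanD; congr (_ / _); apply: eq_bigr => i _.
  by case: (Hs n i \in F); rewrite /= ?mul1r ?mul0r ?addr0 ?add0r.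
have t4 : emp_mean (Hs n) (fun H => (H \notin F)%:R * phi H) <= emp_mean (Hs n) (fun H => (H \notin F)%:R * psi H).
  by apply: emp_mean_le => H; rewrite ler_wpM2l.
have t5 : 0 <= emp_mean (Hs n) (fun H => (H \notin F)%:R * phi H).
  by rewrite /emp_mean mulr_ge0 ?invr_ge0 // sumr_ge0 // => i _; rewrite mulr_ge0.
move: t2; rewrite t3 ler_norml => /andP[? ?].
by rewrite ler_norml; apply/andP; split; lra.
Unshelve. all: by end_near. Qed.

(** A single community outside the finite set already contributes [psi / n] to the small tail mean.
    For cubes of degrees this makes the largest degree negligible against [n^(1/3)]. *)
Lemma emp_max (e : R) : 0 < e -> \forall n \near \oo, forall i, psi (Hs n i) <= e * n%:R.
Proof.
move=> e0; have e4 : 0 < e / 2 by rewrite divr_gt0.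
have [F [uF _ tF]] := emp_tail e4.
near=> n => i; have n0 : 0 < n%:R :> R by rewrite ltr0n; apply: leq_ltn_trans (ltn_ord i).
case: (boolP (Hs n i \in F)) => iF.
  apply: le_trans (_ : \sum_(H <- F) psi H <= _).
    by rewrite (bigD1_seq (Hs n i)) //= lerDl sumr_ge0.
  rewrite mulrC -ler_pdivrMr //; near: n; exists (Num.trunc (\sum_(H <- F) psi H / e)).+1 => // m /= hm.
  by apply: le_trans (ltW (truncnS_gt _)) _; rewrite mulr_suml ler_nat.
have : emp_mean (Hs n) (fun H => (H \notin F)%:R * psi H) <= 2 * (e / 2) by near: n.
rewrite /emp_mean ler_pdivrMr // (_ : 2 * (e / 2) = e); last lra.
apply: le_trans; rewrite (bigD1 i) //= iF mul1r lerDl; apply: sumr_ge0 => j _.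
by rewrite mulr_ge0.
Unshelve. all: by end_near. Qed.

Lemma emp_limit_pos phi (l : R) : (forall H, 0 <= phi H) -> (0 < cexp P phi)%E ->
  (fun n => emp_mean (Hs n) phi) @ \oo --> l -> 0 < l.
Proof.
move=> p0 pos cv; have [_ [A [finA _] <-] lt] := ereal_sup_gt pos.
pose F : seq community := finmap.enum_fset (fset_set A); have uF : uniq F by exact: finmap.fset_uniq.
have lt' : 0 < \sum_(H <- F) P H * phi H.
  by move: lt; rewrite fsbig_finite // sumEFin lte_fin.
apply: lt_le_trans lt' _.
have c1 := emp_seq_cvg (phi := phi) uF.
rewrite -(cvg_lim (@Rhausdorff R) cv) -(cvg_lim (@Rhausdorff R) c1).
apply: ler_lim; [by apply/cvg_ex; eexists; exact: c1|by apply/cvg_ex; eexists; exact: cv|].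
apply: nearW => n; apply: emp_mean_le => H.
by case: (H \in F); rewrite ?mul1r ?mul0r.
Qed.

End empirical_means.

Unset Implicit Arguments.
Record hcm_conditions (R : realType) (lam : R) (Hs : forall n : nat, 'I_n -> community)
    (P : community -> R) : Prop := HcmConditions {
  hc_valid : forall n (i : 'I_n), valid_community (Hs n i);
  hc_even : forall n, ~~ odd (\sum_(i < n) cdtot (Hs n i))%N;
  hc_ge0 : forall H, 0 <= P H;
  hc_cr1 : forall H, (fun n => emp_frac (Hs n) H) @ \oo --> P H;
  hc_cr2 : (fun n => emp_mean (Hs n) (fun H => (csize H)%:R)) @ \oo
           --> fine (cexp P (fun H => (csize H)%:R));
  hc_cr3 : (fun n => emp_mean (Hs n) (fun H => (cdtot H * csize H)%N%:R)) @ \oo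
           --> fine (cexp P (fun H => (cdtot H * csize H)%N%:R));
  hc_cr4 : (fun n : nat => (\max_(i < n) csize (Hs n i))%:R * ln n%:R
                          / (n%:R `^ (2 / 3)) : R) @ \oo --> (0 : R);
  hc_ic1fin : (cexp P (fun H => (cdtot H ^ 3)%N%:R) < +oo)%E;
  hc_ic1 : (fun n => emp_mean (Hs n) (fun H => (cdtot H ^ 3)%N%:R)) @ \oo
           --> fine (cexp P (fun H => (cdtot H ^ 3)%N%:R));
  hc_ic2 : (0 < cexp P (fun H => (cdtot H == 1)%N%:R))%E;
  hc_ic3 : (fun n : nat =>
            n%:R `^ (1 / 3) *
            (emp_mean (Hs n) (fun H => (cdtot H * (cdtot H).-1)%N%:R)
             / emp_mean (Hs n) (fun H => (cdtot H)%:R) - 1)) @ \oo --> lam }.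
Set Implicit Arguments.

(** * Limits of the parameters of the exploration walk *)

Section scaling_limits.
Variables (R : realType) (lam : R).
Unset Implicit Arguments.
Variable Hs : forall n : nat, 'I_n -> community.
Set Implicit Arguments.
Variable P : community -> R.
Hypothesis hc : hcm_conditions R lam Hs P.

Definition ES := fine (cexp P (fun H => (csize H)%:R)).
Definition EDS := fine (cexp P (fun H => (cdtot H * csize H)%N%:R)).
Definition mu := fine (cexp P (fun H => (cdtot H)%:R)).
Definition ED2 := fine (cexp P (fun H => (cdtot H ^ 2)%N%:R)).
Definition ED3 := fine (cexp P (fun H => (cdtot H ^ 3)%N%:R)).
Definition eta := ED3 * mu - ED2 ^+ 2.
(** At criticality [ED2 = 2 * mu], so this is the mean of [D * (D - 2)^2]. *)
Definition tau3 := ED3 - 4 * mu.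

Definition scale (n : nat) : R := n%:R `^ (1 / 3).
Local Notation a := scale.

Lemma scale_ge0 n : 0 <= a n. Proof. exact: powR_ge0. Qed.

Lemma scale3 n : a n ^+ 3 = n%:R.
Proof.
rewrite /scale -powR_mulrn ?powR_ge0 // -powRrM (_ : 1 / 3 * 3 = 1 :> R) ?powRr1 //.
by field.
Qed.

Lemma scale2 n : n%:R `^ (2 / 3) = a n ^+ 2 :> R.
Proof.
by rewrite /scale -powR_mulrn ?powR_ge0 // -powRrM; congr (_ `^ _); field.
Qed.

Lemma scale_gt0 n : (0 < n)%N -> 0 < a n.
Proof. by move=> n0; rewrite powR_gt0 // ltr0n. Qed.

Lemma scale_large (A : R) : \forall n \near \oo, A <= a n.
Proof.
pose A' := Num.max A 0; exists (Num.trunc (A' ^+ 3)).+1 => // n /= hn.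
apply: le_trans (_ : A' <= _); first by rewrite le_max lexx.
have A0 : 0 <= A' by rewrite le_max lexx orbT.
rewrite -(ler_pXn2r (_ : (0 < 3)%N)) ?nnegrE ?scale_ge0 // scale3.
by apply: le_trans (ltW (truncnS_gt _)) _; rewrite ler_nat.
Qed.

Lemma scale_inv_cvg0 : (fun n => (a n)^-1) @ \oo --> (0 : R).
Proof.
apply: cvgr_distP => e e0; near=> n.
have h : e^-1 <= a n by near: n; exact: scale_large.
have a0 : 0 < a n by apply: lt_le_trans h; rewrite invr_gt0.
by rewrite sub0r normrN ger0_norm ?invr_ge0 ?(ltW a0) // -[leRHS]invrK lef_pV2 ?posrE ?invr_gt0.
Unshelve. all: by end_near. Qed.

Local Notation em k := (fun n => emp_mean (Hs n) (fun H => (cdtot H ^ k)%N%:R) : R).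

Lemma leq_cube (d : nat) : (d <= d ^ 3)%N /\ (d ^ 2 <= d ^ 3)%N.
Proof. by case: d => // d; rewrite -{1}(expn1 d.+1) !leq_pexp2l. Qed.

Lemma em_cvg phi : (forall H, 0 <= phi H <= (cdtot H ^ 3)%N%:R) ->
  (fun n => emp_mean (Hs n) phi) @ \oo --> fine (cexp P phi).
Proof.
apply: (emp_cvg (hc_ge0 _ _ _ _ hc) (hc_cr1 _ _ _ _ hc) _ (hc_ic1fin _ _ _ _ hc) (hc_ic1 _ _ _ _ hc)).
by move=> H; exact: ler0n.
Qed.

Lemma em1_cvg : (fun n => emp_mean (Hs n) (fun H => (cdtot H)%:R)) @ \oo --> mu.
Proof. by apply: em_cvg => H; rewrite ler0n ler_nat (leq_cube _).1. Qed.

Lemma em2_cvg : em 2 @ \oo --> ED2.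
Proof. by apply: em_cvg => H; rewrite ler0n ler_nat (leq_cube _).2. Qed.

Lemma em3_cvg : em 3 @ \oo --> ED3.
Proof. by apply: em_cvg => H; rewrite ler0n lexx. Qed.

Definition pr1 := fine (cexp P (fun H => (cdtot H == 1)%N%:R)).

Lemma emd1_cvg : (fun n => emp_mean (Hs n) (fun H => (cdtot H == 1)%N%:R)) @ \oo --> pr1.
Proof. by apply: em_cvg => H; rewrite ler0n ler_nat; case: eqP => // ->. Qed.

Lemma pr1_gt0 : 0 < pr1.
Proof.
exact: (emp_limit_pos (hc_cr1 _ _ _ _ hc) (fun H => ler0n _ _) (hc_ic2 _ _ _ _ hc) emd1_cvg).
Qed.

Lemma cvgr_le_cvg (u v : nat -> R) (l l' : R) : u @ \oo --> l -> v @ \oo --> l' ->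
  (\forall n \near \oo, u n <= v n) -> l <= l'.
Proof.
move=> ul vl h; rewrite -(cvg_lim (@Rhausdorff R) ul) -(cvg_lim (@Rhausdorff R) vl).
by apply: ler_lim h; apply/cvg_ex; eexists; eassumption.
Qed.

Lemma cvgr_unique (u : nat -> R) (l l' : R) : u @ \oo --> l -> u @ \oo --> l' -> l = l'.
Proof.
move=> h h'; apply/eqP; rewrite eq_le.
by apply/andP; split; [apply: (cvgr_le_cvg h h')|apply: (cvgr_le_cvg h' h)]; exact: nearW.
Qed.

Lemma mu_gt0 : 0 < mu.
Proof.
apply: lt_le_trans pr1_gt0 _; apply: (cvgr_le_cvg emd1_cvg em1_cvg).
by apply: nearW => n; apply: emp_mean_le => H; rewrite ler_nat; case: eqP => // ->.
Qed.

Lemma em_nu n : emp_mean (Hs n) (fun H => (cdtot H * (cdtot H).-1)%N%:R) =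
  em 2 n - emp_mean (Hs n) (fun H => (cdtot H)%:R) :> R.
Proof.
rewrite /emp_mean -mulrBl -sumrB; congr (_ / _); apply: eq_bigr => i _.
case: (cdtot (Hs n i)) => [|d]; first by rewrite mul0n subrr.
by rewrite -pred_Sn natrM natrX -natr1; ring.
Qed.

Lemma nu_cvg : (fun n => a n * (em 2 n / emp_mean (Hs n) (fun H => (cdtot H)%:R) - 2)) @ \oo --> lam.
Proof.
apply: (cvgr_near_eq _ (hc_ic3 _ _ _ _ hc)).
have m0 : \forall n \near \oo, 0 < emp_mean (Hs n) (fun H => (cdtot H)%:R) :> R.
  by apply: (cvgr_gt mu em1_cvg); exact: mu_gt0.
apply: filterS m0 => n m0; rewrite em_nu mulrBl divff ?gt_eqF // -/(a n); congr (_ * _); lra.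
Qed.

(** Criticality: dividing the condition on [nu_n] by the diverging scale forces [nu_n] to tend to
    1. *)
Lemma ED2E : ED2 = 2 * mu.
Proof.
have h1 : (fun n => em 2 n / emp_mean (Hs n) (fun H => (cdtot H)%:R) - 2) @ \oo --> (0 : R).
  apply: (cvgrM_near (mul0r lam) _ scale_inv_cvg0 nu_cvg).
  near=> n; rewrite mulKf // gt_eqF //; apply: lt_le_trans (_ : 1 <= _) => //.
  by near: n; exact: scale_large.
have h2 : (fun n => em 2 n / emp_mean (Hs n) (fun H => (cdtot H)%:R) - 2) @ \oo --> ED2 / mu - 2.
  apply: cvgB; last exact: cvg_cst.
  by apply: cvgM; [exact: em2_cvg|apply: cvgV; [exact: lt0r_neq0 mu_gt0|exact: em1_cvg]].
have /esym /eqP := cvgr_unique h1 h2.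
rewrite subr_eq0 => /eqP <-.
by rewrite divfK // gt_eqF // mu_gt0.
Unshelve. all: by end_near. Qed.

Lemma etaE : eta = mu * tau3.
Proof. by rewrite /eta /tau3 ED2E; ring. Qed.

(** [d * (d - 2)^2] dominates the indicator of [d = 1], whose mean has a positive limit. *)
Lemma tau3_gt0 : 0 < tau3.
Proof.
apply: lt_le_trans pr1_gt0 _.
have cv : (fun n => em 3 n - 4 * em 2 n + 4 * emp_mean (Hs n) (fun H => (cdtot H)%:R)) @ \oo --> tau3.
  rewrite (_ : tau3 = ED3 - 4 * ED2 + 4 * mu); last by rewrite /tau3 ED2E; ring.
  apply: cvgD; last by apply: cvgM; [exact: cvg_cst|exact: em1_cvg].
  by apply: cvgB; [exact: em3_cvg|apply: cvgM; [exact: cvg_cst|exact: em2_cvg]].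
apply: (cvgr_le_cvg emd1_cvg cv); apply: nearW => n.
have -> : em 3 n - 4 * em 2 n + 4 * emp_mean (Hs n) (fun H => (cdtot H)%:R) =
    emp_mean (Hs n) (fun H => (cdtot H)%:R * ((cdtot H)%:R - 2) ^+ 2).
  rewrite -!emp_meanZ /emp_mean -mulrBl -mulrDl -sumrB -big_split /=; congr (_ / _).
  by apply: eq_bigr => i _; rewrite !natrX; ring.
apply: emp_mean_le => H; case: eqP => [->|_]; last by rewrite mulr_ge0 // sqr_ge0.
by rewrite mul1r (_ : (1 - 2 : R) = -1) ?sqrrN ?expr1n //; lra.
Qed.

Lemma eta_gt0 : 0 < eta.
Proof. by rewrite etaE mulr_gt0 ?mu_gt0 ?tau3_gt0. Qed.

Definition dmx n : nat := \max_(i < n) cdtot (Hs n i).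
Definition smx n : nat := \max_(i < n) csize (Hs n i).

Lemma dmxP n i : (cdtot (Hs n i) <= dmx n)%N. Proof. exact: leq_bigmax. Qed.
Lemma smxP n i : (csize (Hs n i) <= smx n)%N. Proof. exact: leq_bigmax. Qed.

Lemma dmx_small : (fun n => (dmx n)%:R / a n) @ \oo --> (0 : R).
Proof.
apply: cvgr_distP => e e0; near=> n.
have n0 : (0 < n)%N by near: n; exists 1%N.
have an := scale_gt0 n0.
rewrite sub0r normrN ger0_norm ?divr_ge0 ?(ltW an) // ler_pdivrMr //.
have H : forall i, ((cdtot (Hs n i) ^ 3)%N%:R : R) <= e ^+ 3 * n%:R.
  near: n; apply: (emp_max (hc_ge0 _ _ _ _ hc) (hc_cr1 _ _ _ _ hc) _ (hc_ic1fin _ _ _ _ hc)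
    (hc_ic1 _ _ _ _ hc)); last by rewrite exprn_gt0.
  by move=> H; exact: ler0n.
have cn : (0 < #|'I_n|)%N by rewrite card_ord.
have [i iE] := bigop.eq_bigmax (fun i => cdtot (Hs n i)) cn; rewrite /dmx iE.
rewrite -(ler_pXn2r (_ : (0 < 3)%N)) ?nnegrE ?mulr_ge0 ?(ltW e0) ?(ltW an) //.
by rewrite -natrX exprMn scale3.
Unshelve. all: by end_near. Qed.

Lemma ln_ge1 : \forall n \near \oo, 1 <= ln (n%:R : R).
Proof.
exists (Num.trunc (expR 1 : R)).+1 => // n /= hn.
rewrite -[leLHS]expRK ler_ln ?posrE ?expR_gt0 //.
  by apply: le_trans (ltW (truncnS_gt _)) _; rewrite ler_nat.
by rewrite ltr0n (leq_ltn_trans _ hn).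
Qed.

Lemma smx_small : (fun n => (smx n)%:R / a n ^+ 2) @ \oo --> (0 : R).
Proof.
apply: (squeeze_cvgr _ (cvg_cst 0) (hc_cr4 _ _ _ _ hc)); near=> n.
rewrite divr_ge0 ?exprn_ge0 ?scale_ge0 //= scale2 ler_wpM2r ?invr_ge0 ?exprn_ge0 ?scale_ge0 //.
rewrite ler_peMr //; near: n; exact: ln_ge1.
Unshelve. all: by end_near. Qed.

Lemma hcm_N_cvg : (fun n => (hcm_N (Hs n))%:R / n%:R) @ \oo --> ES.
Proof. by under eq_fun do rewrite /hcm_N natr_sum; exact: hc_cr2 hc. Qed.

Lemma hcm_N_ge n : (n <= hcm_N (Hs n))%N.
Proof.
rewrite /hcm_N; apply: leq_trans (_ : \sum_(i < n) 1 <= _)%N; first by rewrite sum1_card card_ord.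
by apply: leq_sum => i _; have [] := hc_valid _ _ _ _ hc n i.
Qed.

Lemma ES_ge1 : 1 <= ES.
Proof.
have c1 : (fun=> 1 : R) @ \oo --> (1 : R) by exact: cvg_cst.
apply: (cvgr_le_cvg c1 hcm_N_cvg); exists 1%N => // n /= n0.
by rewrite ler_pdivlMr ?ltr0n // mul1r ler_nat hcm_N_ge.
Qed.

Lemma mu_le_EDS : mu <= EDS.
Proof.
apply: (cvgr_le_cvg em1_cvg (hc_cr3 _ _ _ _ hc)); apply: nearW => n.
rewrite /emp_mean ler_wpM2r ?invr_ge0 //; apply: ler_sum => i _.
by rewrite ler_nat leq_pmulr //; have [] := hc_valid _ _ _ _ hc n i.
Qed.

Lemma EDS_gt0 : 0 < EDS. Proof. exact: lt_le_trans mu_gt0 mu_le_EDS. Qed.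

Definition hcp n (h : hedge (Hs n)) : R := #|hedge (Hs n)|%:R^-1.
Local Notation pc n := (pushpmf (@hcomm n (Hs n)) (@hcp n)).
Definition fdeg n (i : 'I_n) : R := (hdeg (@hcomm n (Hs n)) i)%:R - 2.
Definition nuS n : R := \sum_i pc n i * fdeg i.
Definition varS n : R := \sum_i pc n i * fdeg i ^+ 2.
(** To first order, the draw after [j] draws loses [j * mS] through repetition; the accumulated loss
    is the source of the parabola. *)
Definition mS n : R := \sum_i pc n i ^+ 2 * fdeg i.
Definition kapS n : R := \sum_i pc n i * (csize (Hs n i))%:R.

Lemma ellE n : (0 < n)%N -> #|hedge (Hs n)|%:R = n%:R * emp_mean (Hs n) (fun H => (cdtot H)%:R) :> R.
Proof.
by move=> n0; rewrite card_hedge natr_sum /emp_mean mulrC divfK // pnatr_eq0 -lt0n.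
Qed.

Lemma pcE n i : pc n i = (cdtot (Hs n i))%:R / #|hedge (Hs n)|%:R.
Proof. by rewrite pushpmf_unif hdeg_hcomm //; exact: hc_valid hc n. Qed.

Lemma fdegE n i : fdeg i = (cdtot (Hs n i))%:R - 2.
Proof. by rewrite /fdeg hdeg_hcomm //; exact: hc_valid hc n. Qed.

Let e1 n : R := emp_mean (Hs n) (fun H => (cdtot H)%:R).

Lemma em1_pos : \forall n \near \oo, 0 < e1 n /\ (0 < n)%N.
Proof.
near=> n; split; last by near: n; exists 1%N.
by near: n; apply: (cvgr_gt mu em1_cvg); exact: mu_gt0.
Unshelve. all: by end_near. Qed.

Lemma sum_pc n (g : 'I_n -> R) (phi : community -> R) : (0 < n)%N ->
  (forall i, (cdtot (Hs n i))%:R * g i = phi (Hs n i)) ->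
  \sum_i pc n i * g i = emp_mean (Hs n) phi / e1 n.
Proof.
move=> n0 h; have nn : (n%:R : R) != 0 by rewrite pnatr_eq0 -lt0n.
rewrite /emp_mean -mulrA -invfM -/(e1 n) -ellE // mulr_suml; apply: eq_bigr => i _.
by rewrite pcE mulrAC h.
Qed.

Lemma nuS_cvg : (fun n => a n * nuS n) @ \oo --> lam.
Proof.
apply: (cvgr_near_eq _ nu_cvg); apply: filterS em1_pos => n [e0 n0]; congr (_ * _).
rewrite /nuS (sum_pc (phi := fun H => (cdtot H)%:R * ((cdtot H)%:R - 2))) //; last first.
  by move=> i; rewrite fdegE.
have -> : emp_mean (Hs n) (fun H => (cdtot H)%:R * ((cdtot H)%:R - 2)) = em 2 n - 2 * e1 n.
  rewrite -emp_meanZ /emp_mean -mulrBl -sumrB; congr (_ / _); apply: eq_bigr => i _.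
  by rewrite natrX; ring.
by rewrite mulrBl mulfK // gt_eqF.
Qed.

Lemma varS_cvg : varS @ \oo --> tau3 / mu.
Proof.
have cv : (fun n => (em 3 n - 4 * em 2 n + 4 * e1 n) / e1 n) @ \oo --> tau3 / mu.
  rewrite (_ : tau3 = ED3 - 4 * ED2 + 4 * mu); last by rewrite /tau3 ED2E; ring.
  apply: cvgM; last by apply: cvgV; [exact: lt0r_neq0 mu_gt0|exact: em1_cvg].
  apply: cvgD; last by apply: cvgM; [exact: cvg_cst|exact: em1_cvg].
  by apply: cvgB; [exact: em3_cvg|apply: cvgM; [exact: cvg_cst|exact: em2_cvg]].
apply: (cvgr_near_eq _ cv); apply: filterS em1_pos => n [e0 n0].
rewrite /varS (sum_pc (phi := fun H => (cdtot H)%:R * ((cdtot H)%:R - 2) ^+ 2)) //; last first.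
  by move=> i; rewrite fdegE.
congr (_ / _); rewrite -!emp_meanZ /emp_mean -mulrBl -mulrDl -sumrB -big_split /=; congr (_ / _).
by apply: eq_bigr => i _; rewrite !natrX; ring.
Qed.

Lemma mS_cvg : (fun n => n%:R * mS n) @ \oo --> tau3 / mu ^+ 2.
Proof.
have cv : (fun n => (em 3 n - 2 * em 2 n) / e1 n ^+ 2) @ \oo --> tau3 / mu ^+ 2.
  rewrite (_ : tau3 = ED3 - 2 * ED2); last by rewrite /tau3 ED2E; ring.
  apply: cvgM; last first.
    apply: cvgV; first by rewrite expf_neq0 // lt0r_neq0 // mu_gt0.
    by rewrite !expr2; apply: cvgM; exact: em1_cvg.
  by apply: cvgB; [exact: em3_cvg|apply: cvgM; [exact: cvg_cst|exact: em2_cvg]].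
apply: (cvgr_near_eq _ cv); apply: filterS em1_pos => n [e0 n0].
have -> : mS n = (\sum_i pc n i * ((cdtot (Hs n i))%:R * ((cdtot (Hs n i))%:R - 2))) / #|hedge (Hs n)|%:R.
  by rewrite mulr_suml; apply: eq_bigr => i _; rewrite fdegE pcE; ring.
rewrite (sum_pc (phi := fun H => (cdtot H)%:R * ((cdtot H)%:R * ((cdtot H)%:R - 2)))) // ellE // -/(e1 n).
have -> : emp_mean (Hs n) (fun H => (cdtot H)%:R * ((cdtot H)%:R * ((cdtot H)%:R - 2))) = em 3 n - 2 * em 2 n.
  rewrite -emp_meanZ /emp_mean -mulrBl -sumrB; congr (_ / _); apply: eq_bigr => i _.
  by rewrite !natrX; ring.
have nn : (n%:R : R) != 0 by rewrite pnatr_eq0 -lt0n.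
by move: (e1 n) (gt_eqF e0) => z z0; field; rewrite ?nn ?z0.
Qed.

Lemma kapS_cvg : kapS @ \oo --> EDS / mu.
Proof.
have cv : (fun n => emp_mean (Hs n) (fun H => (cdtot H * csize H)%N%:R) / e1 n) @ \oo --> EDS / mu.
  apply: cvgM; first exact: hc_cr3 hc.
  by apply: cvgV; [exact: lt0r_neq0 mu_gt0|exact: em1_cvg].
apply: (cvgr_near_eq _ cv); apply: filterS em1_pos => n [e0 n0].
by rewrite /kapS (sum_pc (phi := fun H => (cdtot H * csize H)%N%:R)) // => i; rewrite natrM.
Qed.

Lemma deg_dev (d D : nat) : (d <= D)%N ->
  [/\ d%:R ^+ 2 * (d%:R - 2) ^+ 2 <= 9 * D%:R * d%:R ^+ 3 :> R,
      d%:R ^+ 3 * `|d%:R - 2| <= 9 * D%:R * d%:R ^+ 3 :> R &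
      d%:R ^+ 3 * (d%:R - 2) ^+ 2 <= 9 * D%:R ^+ 2 * d%:R ^+ 3 :> R].
Proof.
case: d => [|d] dD; first by split; rewrite !(mulr0n, expr0n, mul0r, mulr0) //=.
have x1 : 1 <= d.+1%:R :> R by rewrite ler1n.
have xD : d.+1%:R <= D%:R :> R by rewrite ler_nat.
move: (d.+1%:R : R) (D%:R : R) x1 xD => x y x1 xy.
have x0 : 0 <= x by lra.
have nx : `|x - 2| <= 3 * x by rewrite ler_norml; apply/andP; split; lra.
have sx : (x - 2) ^+ 2 <= 9 * x ^+ 2 by nra.
have x3 : 0 <= x ^+ 3 by rewrite exprn_ge0.
split.
- apply: le_trans (ler_wpM2l (sqr_ge0 x) sx) _.
  rewrite (_ : x ^+ 2 * (9 * x ^+ 2) = 9 * x * x ^+ 3); last by ring.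
  by rewrite ler_wpM2r // ler_wpM2l.
- rewrite [leRHS]mulrC ler_wpM2l //; apply: le_trans nx _; lra.
- rewrite [leRHS]mulrC ler_wpM2l //; apply: le_trans sx _; rewrite ler_wpM2l //.
  by rewrite ler_pXn2r ?nnegrE //; lra.
Qed.

Lemma squeeze0 (u v : nat -> R) : v @ \oo --> (0 : R) ->
  (\forall n \near \oo, 0 <= u n <= v n) -> u @ \oo --> (0 : R).
Proof. by move=> v0 h; apply: (squeeze_cvgr h (cvg_cst 0) v0). Qed.

Let e3 n : R := em 3 n.

Let dmx_em k : (fun n => 9 * ((dmx n)%:R / a n) * (e3 n / e1 n ^+ k)) @ \oo --> (0 : R).
Proof.
rewrite -(mul0r (ED3 / mu ^+ k)) -(mulr0 9); apply: cvgM; last first.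
  apply: cvgM; first exact: em3_cvg.
  apply: cvgV; first by rewrite expf_neq0 // lt0r_neq0 // mu_gt0.
  elim: k => [|k IH]; first by rewrite expr0; exact: cvg_cst.
  by rewrite exprS; under eq_fun do rewrite exprS; apply: cvgM => //; exact: em1_cvg.
by apply: cvgM; [exact: cvg_cst|exact: dmx_small].
Qed.

Let sum3 n : (0 < n)%N -> \sum_i (cdtot (Hs n i))%:R ^+ 3 = a n ^+ 3 * e3 n.
Proof.
move=> n0; rewrite scale3 /e3 /emp_mean mulrC divfK ?pnatr_eq0 -?lt0n //.
by apply: eq_bigr => i _; rewrite natrX.
Qed.

(** This and the following four lemmas treat terms of the failure probability in [walk_event]: each
    is a bounded quantity times at least one vanishing factor [dmx / a] or [smx / a ^+ 2]. *)
Lemma R2_cvg : (fun n => a n ^+ 2 * \sum_i pc n i ^+ 2 * fdeg i ^+ 2) @ \oo --> (0 : R).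
Proof.
apply: (squeeze0 (dmx_em 2)); apply: filterS em1_pos => n [e0 n0]; have an := scale_gt0 n0.
apply/andP; split.
  by rewrite mulr_ge0 ?sqr_ge0 // sumr_ge0 // => i _; rewrite mulr_ge0 ?sqr_ge0.
apply: le_trans (_ : a n ^+ 2 * \sum_i (9 * (dmx n)%:R * (cdtot (Hs n i))%:R ^+ 3) / #|hedge (Hs n)|%:R ^+ 2 <= _).
  rewrite ler_wpM2l ?sqr_ge0 //; apply: ler_sum => i _; rewrite pcE fdegE expr_div_n mulrAC.
  by rewrite ler_wpM2r ?invr_ge0 ?sqr_ge0 //; case: (deg_dev (dmxP i)).
rewrite -mulr_suml -mulr_sumr sum3 // ellE // -scale3 -/(e1 n) le_eqVlt; apply/orP; left; apply/eqP.
by move: (e1 n) (gt_eqF e0) (a n) (gt_eqF an) => z z0 y y0; field; rewrite ?y0 ?z0.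
Qed.

Lemma R3_cvg : (fun n => a n ^+ 5 * \sum_i pc n i ^+ 3 * `|fdeg i|) @ \oo --> (0 : R).
Proof.
apply: (squeeze0 (dmx_em 3)); apply: filterS em1_pos => n [e0 n0]; have an := scale_gt0 n0.
have pc0 i : 0 <= pc n i by rewrite pcE divr_ge0.
apply/andP; split.
  by rewrite mulr_ge0 ?exprn_ge0 ?(ltW an) // sumr_ge0 // => i _; rewrite mulr_ge0 ?exprn_ge0.
apply: le_trans (_ : a n ^+ 5 * \sum_i (9 * (dmx n)%:R * (cdtot (Hs n i))%:R ^+ 3) / #|hedge (Hs n)|%:R ^+ 3 <= _).
  rewrite ler_wpM2l ?exprn_ge0 ?(ltW an) //; apply: ler_sum => i _; rewrite pcE fdegE expr_div_n mulrAC.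
  by rewrite ler_wpM2r ?invr_ge0 ?exprn_ge0 //; case: (deg_dev (dmxP i)).
rewrite -mulr_suml -mulr_sumr sum3 // ellE // -scale3 -/(e1 n) le_eqVlt; apply/orP; left; apply/eqP.
by move: (e1 n) (gt_eqF e0) (a n) (gt_eqF an) => z z0 y y0; field; rewrite ?y0 ?z0.
Qed.

Lemma R5_cvg : (fun n => a n ^+ 4 * \sum_i pc n i ^+ 3 * fdeg i ^+ 2) @ \oo --> (0 : R).
Proof.
have cv : (fun n => ((dmx n)%:R / a n) * (9 * ((dmx n)%:R / a n) * (e3 n / e1 n ^+ 3))) @ \oo --> (0 : R).
  by rewrite -(mul0r (0 : R)); apply: cvgM; [exact: dmx_small|exact: dmx_em].
apply: (squeeze0 cv); apply: filterS em1_pos => n [e0 n0]; have an := scale_gt0 n0.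
have pc0 i : 0 <= pc n i by rewrite pcE divr_ge0.
apply/andP; split.
  by rewrite mulr_ge0 ?exprn_ge0 ?(ltW an) // sumr_ge0 // => i _; rewrite mulr_ge0 ?sqr_ge0 // exprn_ge0.
apply: le_trans (_ : a n ^+ 4 * \sum_i (9 * (dmx n)%:R ^+ 2 * (cdtot (Hs n i))%:R ^+ 3) / #|hedge (Hs n)|%:R ^+ 3 <= _).
  rewrite ler_wpM2l ?exprn_ge0 ?(ltW an) //; apply: ler_sum => i _; rewrite pcE fdegE expr_div_n mulrAC.
  by rewrite ler_wpM2r ?invr_ge0 ?exprn_ge0 //; case: (deg_dev (dmxP i)).
rewrite -mulr_suml -mulr_sumr sum3 // ellE // -scale3 -/(e1 n) le_eqVlt; apply/orP; left; apply/eqP.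
by move: (e1 n) (gt_eqF e0) (a n) (gt_eqF an) => z z0 y y0; field; rewrite ?y0 ?z0.
Qed.

Lemma R6_cvg : (fun n => (\sum_i pc n i * (csize (Hs n i))%:R ^+ 2) / a n ^+ 2) @ \oo --> (0 : R).
Proof.
have cv : (fun n => ((smx n)%:R / a n ^+ 2) * kapS n) @ \oo --> (0 : R).
  by rewrite -(mul0r (EDS / mu)); apply: cvgM; [exact: smx_small|exact: kapS_cvg].
apply: (squeeze0 cv); apply: nearW => n.
have pc0 i : 0 <= pc n i by rewrite pcE divr_ge0.
apply/andP; split; first by rewrite divr_ge0 ?sqr_ge0 // sumr_ge0 // => i _; rewrite mulr_ge0 // sqr_ge0.
rewrite mulrAC ler_wpM2r ?invr_ge0 ?sqr_ge0 // mulr_sumr; apply: ler_sum => i _.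
rewrite [leRHS]mulrCA ler_wpM2l // expr2 ler_wpM2r // ler_nat; exact: smxP.
Qed.

Lemma R7_cvg : (fun n => a n ^+ 2 * \sum_i pc n i ^+ 2 * (csize (Hs n i))%:R) @ \oo --> (0 : R).
Proof.
have cv : (fun n => ((dmx n)%:R / a n) * (kapS n / e1 n)) @ \oo --> (0 : R).
  rewrite -(mul0r (EDS / mu / mu)); apply: cvgM; first exact: dmx_small.
  by apply: cvgM; [exact: kapS_cvg|apply: cvgV; [exact: lt0r_neq0 mu_gt0|exact: em1_cvg]].
apply: (squeeze0 cv); apply: filterS em1_pos => n [e0 n0]; have an := scale_gt0 n0.
have pc0 i : 0 <= pc n i by rewrite pcE divr_ge0.
apply/andP; split; first by rewrite mulr_ge0 ?sqr_ge0 // sumr_ge0 // => i _; rewrite mulr_ge0 // sqr_ge0.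
apply: le_trans (_ : a n ^+ 2 * (((dmx n)%:R / #|hedge (Hs n)|%:R) * kapS n) <= _).
  rewrite ler_wpM2l ?sqr_ge0 // mulr_sumr; apply: ler_sum => i _.
  rewrite expr2 -mulrA ler_wpM2r ?mulr_ge0 // pcE ler_wpM2r ?invr_ge0 // ler_nat; exact: dmxP.
rewrite ellE // -scale3 -/(e1 n) le_eqVlt; apply/orP; left; apply/eqP.
by move: (e1 n) (gt_eqF e0) (a n) (gt_eqF an) => z z0 y y0; field; rewrite ?y0 ?z0.
Qed.

Lemma volume_scale : (fun n => (hcm_N (Hs n))%:R `^ (2 / 3) / a n ^+ 2) @ \oo --> ES `^ (2 / 3).
Proof.
have ES0 : 0 < ES by exact: lt_le_trans ES_ge1.
pose u n : R := (hcm_N (Hs n))%:R / n%:R.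
have cv : (fun n => expR (2 / 3 * ln (u n))) @ \oo --> expR (2 / 3 * ln ES).
  apply: (@cvg_comp _ _ _ (fun n => 2 / 3 * ln (u n)) expR); last exact: continuous_expR.
  apply: cvgM; first exact: cvg_cst.
  by apply: (@cvg_comp _ _ _ u (@ln R)); [exact: hcm_N_cvg|exact: continuous_ln].
rewrite [ES `^ _]/powR gt_eqF //; apply: (cvgr_near_eq _ cv); near=> n.
have n0 : (0 < n)%N by near: n; exists 1%N.
have nn : (n%:R : R) != 0 by rewrite pnatr_eq0 -lt0n.
have N0 : 0 < (hcm_N (Hs n))%:R :> R by rewrite ltr0n (leq_trans n0) // hcm_N_ge.
have u0 : 0 < u n by rewrite divr_gt0 // ltr0n.
have -> : expR (2 / 3 * ln (u n)) = u n `^ (2 / 3) by rewrite /powR gt_eqF.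
have E : (hcm_N (Hs n))%:R = u n * n%:R by rewrite /u divfK.
clearbody u; rewrite E powRM ?(ltW u0) // scale2 mulfK //.
by rewrite expf_neq0 // gt_eqF // scale_gt0.
Unshelve. all: by end_near. Qed.

End scaling_limits.

(** * Exploration on the critical scale *)

Lemma chain_nth n (recs : seq (nat * nat * {set 'I_n})) a b : chain a recs b ->
  (forall i, (i < size recs)%N ->
     (nth (rec0 n) recs i).1.1 = if i is i'.+1 then (nth (rec0 n) recs i').1.2 else a) /\
  b = if size recs is k.+1 then (nth (rec0 n) recs k).1.2 else a.
Proof.
elim: recs a => [|r recs IH] a /=; first by move=> ->.
move=> [ra /IH[h1 h2]]; split.
  by case=> [|i] //=; rewrite ltnS => /h1 ->; case: i.
by rewrite h2; case: (recs).
Qed.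

Lemma chain_length n (recs : seq (nat * nat * {set 'I_n})) a b : chain a recs b ->
  (forall r, r \in recs -> r.1.1 <= r.1.2)%N ->
  (\sum_(r <- recs) (r.1.2 - r.1.1) + a = b)%N.
Proof.
elim: recs a => [|r recs IH] a /=; first by rewrite big_nil => ->.
move=> [<- h] le; rewrite big_cons -[RHS](IH _ h); last first.
  by move=> r' r'in; apply: le; rewrite inE r'in orbT.
by have := le r (mem_head _ _); move: (\sum_(_ <- _) _)%N; clear; lia.
Qed.

Section error_bookkeeping.
Variables (R : realType) (e : R).
Hypothesis e0 : 0 < e.

Lemma error_trans (A B D : R) : A <= B -> B <= D + e -> A + e <= D + 5 * e.
Proof. by move: e0; lra. Qed.

Lemma error_trans_jump (A B D dd : R) : A - dd <= B -> dd <= e -> B <= D + e -> A + e <= D + 5 * e.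
Proof. by move: e0; lra. Qed.

Lemma error_lower (A B x : R) : `|A - B| <= 3 * e -> x <= A -> x - 5 * e <= B.
Proof. by rewrite ler_norml => /andP[_]; move: e0; lra. Qed.

Lemma error_upper (A B x : R) : `|A - B| <= 3 * e -> x + 5 * e <= B -> x <= A.
Proof. by rewrite ler_norml => /andP[+ _]; move: e0; lra. Qed.

End error_bookkeeping.

Section completed_components.
Variables (R : realType) (n : nat) (Hs : 'I_n -> community).
Hypothesis Hvalid : forall i, valid_community (Hs i).
Variables (dmax smax : nat) (aa vol T kap e rho : R) (f : R -> R).
Hypothesis dmaxP : forall i, (cdtot (Hs i) <= dmax)%N.
Hypothesis smaxP : forall i, (csize (Hs i) <= smax)%N.
Hypotheses (aa0 : 0 < aa) (vol0 : 0 < vol) (T0 : 0 <= T) (kap0 : 0 < kap) (e0 : 0 < e) (rho0 : 0 < rho).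
Hypothesis de : dmax%:R / aa <= e.
Hypothesis se : smax%:R / vol <= e.

Let K := Num.trunc (T * aa ^+ 2).
Let c := @hcomm n Hs.
Let siz i := csize (Hs i).

Variables (xv : seq (vtx Hs)) (w : seq (hedge Hs)) (m : {ffun hedge Hs -> hedge Hs}).
Let xs := map (fun v : vtx Hs => tag v) xv ++ enum 'I_n.
Hypothesis wK : size w = K.
Hypothesis mext : m \in extensions (mt (run c xs w)).
Hypothesis HZ : forall t : R, 0 <= t <= T ->
  `|Zrun R c xs (take (Num.trunc (t * aa ^+ 2)) w) / aa - f t| <= e.
Hypothesis HV : forall u, (u <= K)%N -> `|Vrun R c siz xs (take u w) / vol - kap * (u%:R / aa ^+ 2)| <= e.
Hypothesis HT : Zrun R c xs w < - \sum_(v <- xv) (cdtot (Hs (tag v)))%:R.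

Definition big_comps : {set {set vtx Hs}} :=
  [set X in hcm_components m | rho * vol <= #|X|%:R]%SET.

Let aa2 : 0 < aa ^+ 2. Proof. by rewrite exprn_gt0. Qed.

Let truncE u : Num.trunc (u%:R / aa ^+ 2 * aa ^+ 2) = u.
Proof. by rewrite divfK ?gt_eqF // natrK. Qed.

Let take_xs : take (size xv) xs = map (fun v : vtx Hs => tag v) xv.
Proof. by rewrite /xs take_size_cat // size_map. Qed.

Let mfull : m \in full_matchings (hedge Hs).
Proof. by case/extensionsP: mext. Qed.

Let dmaxP' i : (hdeg c i <= dmax)%N. Proof. by rewrite hdeg_hcomm. Qed.

(** By [HT] the walk has sunk below minus the total degree of the starting vertices, so each of
    these lies in a recorded component. *)
Let record : exists recs : seq (nat * nat * {set 'I_n}), exists tau, [/\ chain 0 recs tau, (tau <= K)%N,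
    (forall r, r \in recs -> rec_ok siz dmax smax (fun u => Zrun R c xs (take u w))
                               (fun u => Vrun R c siz xs (take u w)) K r),
    (forall u, (tau <= u <= K)%N -> Zrun R c xs (take tau w) - dmax%:R <= Zrun R c xs (take u w)) &
    [/\ (forall r, r \in recs -> comp_of c m r.2), pairwise (@recdisj _) recs &
    forall v C, v \in xv -> comp_of c m C -> tag v \in C -> exists2 r, r \in recs & r.2 = C]].
Proof.
have [recs [tau [h1 h2 h3 h4 [h5 h6 h7]]]] := trace_summary R dmaxP' smaxP mext.
rewrite wK in h2 h3 h4; exists recs, tau; split=> //; split=> // v C vx cC vC.
have : inrec recs (tag v).
  apply: (h7 (size xv)); last by rewrite take_xs; apply/mapP; exists v.
  rewrite take_xs big_map; under eq_bigr do rewrite hdeg_hcomm //; exact: HT.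
move=> /hasP[r rin vr]; exists r => //; exact: (comp_eq Hvalid (h5 r rin) cC vr vC).
Qed.

Let sizsumE C : sizsum R siz C = (vsz Hs C)%:R.
Proof. by rewrite /sizsum /vsz natr_sum. Qed.

Let rec_size r : rec_ok siz dmax smax (fun u => Zrun R c xs (take u w))
      (fun u => Vrun R c siz xs (take u w)) K r ->
  `|(vsz Hs r.2)%:R / vol - kap * (r.1.2%:R / aa ^+ 2 - r.1.1%:R / aa ^+ 2)| <= 3 * e.
Proof.
move=> [/andP[le1 le2] _ _]; rewrite sizsumE => /andP[v1 v2].
have V1 := HV (leq_trans le1 le2); have V2 := HV le2.
have w1 : (Vrun R c siz xs (take r.1.2 w) / vol - Vrun R c siz xs (take r.1.1 w) / vol) <= (vsz Hs r.2)%:R / vol.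
  by rewrite -mulrBl ler_pM2r ?invr_gt0.
have w2 : (vsz Hs r.2)%:R / vol <= (Vrun R c siz xs (take r.1.2 w) / vol - Vrun R c siz xs (take r.1.1 w) / vol) + smax%:R / vol.
  by rewrite -mulrBl -mulrDl ler_pM2r ?invr_gt0.
move: V1 V2 w1 w2 se; rewrite mulrBr.
move: (kap * _) (kap * _) (Vrun _ _ _ _ _ / _) (Vrun _ _ _ _ _ / _) (_%:R / vol) (_%:R / vol).
move=> X1 X2 X3 X4 X5 X6; rewrite ler_norml => /andP[? ?]; rewrite ler_norml => /andP[? ?] ? ? ?.
by rewrite ler_norml; apply/andP; split; lra.
Qed.

(** A large component hit by a starting vertex is recorded, and with size error [3 * e <= rho / 2]
    it occupies time at least [rho / (2 * kap)]; the records share a horizon of length [T]. *)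
Lemma hit_comps_le (M0 : nat) : 6 * e <= rho -> 2 * (kap * T) <= M0%:R * rho ->
  (#|[set X in big_comps | ~~ unhit xv X]%SET| <= M0)%N.
Proof.
move=> er MT; have [recs [tau [h1 h2 h3 _ [h5 h6 h7]]]] := record.
pose bigr := [seq r <- recs | rho * vol <= (vsz Hs r.2)%:R].
have card_le : (#|[set X in big_comps | ~~ unhit xv X]%SET| <= size bigr)%N.
  apply: leq_trans (_ : #|[set X in [seq vcomp Hs r.2 | r <- bigr]]%SET| <= _)%N; last first.
    by rewrite cardsE (leq_trans (card_size _)) // size_map.
  apply: subset_leq_card; apply/fintype.subsetP => X; rewrite !inE => /andP[/andP[Xc Xb]].
  move=> /allPn[v vx]; rewrite negbK => vX.
  have [C cC XE] := hcm_comp Hvalid mfull Xc; move: Xb vX; rewrite XE card_vcomp inE => Cb vC.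
  have [r rin rC] := h7 v C vx cC vC.
  by apply/mapP; exists r; rewrite ?rC // mem_filter rC Cb.
apply: leq_trans card_le _; rewrite -(ler_nat R) -(ler_pM2r rho0).
apply: le_trans MT; rewrite -ler_pdivrMl //.
have le r : r \in recs -> (r.1.1 <= r.1.2)%N by move=> /h3[/andP[]].
have len := chain_length h1 le; rewrite addn0 in len.
have tauT : tau%:R / aa ^+ 2 <= T.
  rewrite ler_pdivrMr //; apply: le_trans (_ : K%:R <= _); first by rewrite ler_nat.
  by have := trunc_bounds (mulr_ge0 T0 (ltW aa2)) => /andP[].
apply: le_trans (_ : kap * (tau%:R / aa ^+ 2) <= _); last by rewrite ler_wpM2l // ltW.
rewrite -len natr_sum mulr_suml mulr_sumr.
apply: le_trans (_ : \sum_(r <- bigr) kap * ((r.1.2 - r.1.1)%N%:R / aa ^+ 2) <= _); last first.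
  rewrite /bigr big_filter [leRHS](bigID (fun r : nat * nat * {set 'I_n} => rho * vol <= (vsz Hs r.2)%:R)) /= lerDl.
  by apply: sumr_ge0 => r _; rewrite mulr_ge0 ?(ltW kap0) // divr_ge0 // ltW.
apply: le_trans (_ : \sum_(r <- bigr) rho / 2 <= _).
  rewrite big_const_seq count_predT iter_addr addr0 -[leRHS]mulr_natl.
  by rewrite le_eqVlt; apply/orP; left; apply/eqP; ring.
rewrite big_seq [leRHS]big_seq; apply: ler_sum => r; rewrite mem_filter => /andP[rb rin].
have := rec_size (h3 r rin); rewrite ler_norml => /andP[_].
rewrite natrB ?le // mulrBl.
have : rho <= (vsz Hs r.2)%:R / vol by rewrite ler_pdivlMr.
move: (_%:R / vol) (kap * _) => X Y; lra.
Qed.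

(** The completion times of the records serve as the times of [compat]. If every component above
    [rho] is hit, each of them has a record, so no size is left unexplained. *)
Lemma no_late_compat : ~~ [exists X in big_comps, unhit xv X] ->
  compat T (5 * e) rho kap f (fun j => (nth 0%N (sorted_comp_sizes m) j)%:R / vol).
Proof.
move=> /existsPn hit; have [recs [tau [h1 h2 h3 h4 [h5 h6 h7]]]] := record.
have [cb ct] := chain_nth h1.
split; first by move=> k; rewrite divr_ge0 // ltW.
pose en i : nat := if i is i'.+1 then (nth (rec0 n) recs i').1.2 else 0%N.
pose r := size recs; pose times i : R := (en i)%:R / aa ^+ 2.
have recin i : (i < r)%N -> nth (rec0 n) recs i \in recs by exact: mem_nth.
have beg i : (i < r)%N -> (nth (rec0 n) recs i).1.1 = en i by move=> /cb ->; case: i.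
have enr : tau = en r by rewrite ct /en /r.
have en_le i : (i <= r)%N -> (en i <= K)%N.
  by case: i => // i /recin /h3[/andP[_]].
have timesT i : (i <= r)%N -> times i <= T.
  move=> ir; rewrite /times ler_pdivrMr //; apply: le_trans (_ : K%:R <= _).
    by rewrite ler_nat en_le.
  by have := trunc_bounds (mulr_ge0 T0 (ltW aa2)) => /andP[].
have t0 i : 0 <= times i by rewrite divr_ge0 // ltW.
have up i (s : R) : 0 <= s -> s <= times i -> (Num.trunc (s * aa ^+ 2) <= en i)%N.
  move=> s0 st; rewrite -[X in (_ <= X)%N]truncE; apply: leq_trunc; first by rewrite mulr_ge0 // ltW.
  by rewrite ler_pM2r.
have dn i (s : R) : times i <= s -> (en i <= Num.trunc (s * aa ^+ 2))%N.
  move=> st; rewrite -[X in (X <= _)%N]truncE; apply: leq_trunc; first by rewrite divfK ?gt_eqF.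
  by rewrite ler_pM2r.
have sK (s : R) : 0 <= s -> s <= T -> (Num.trunc (s * aa ^+ 2) <= K)%N.
  by move=> s0 sT; apply: leq_trunc; [exact: mulr_ge0 s0 (ltW aa2)|rewrite ler_pM2r].
have ft i : (i <= r)%N -> f (times i) <= Zrun R c xs (take (en i) w) / aa + e.
  move=> ir; have := HZ (t := times i); rewrite t0 timesT // truncE => /(_ isT).
  by rewrite ler_norml => /andP[]; lra.
have fs (s : R) : 0 <= s -> s <= T -> Zrun R c xs (take (Num.trunc (s * aa ^+ 2)) w) / aa <= f s + e.
  by move=> s0 sT; have := HZ (t := s); rewrite s0 sT => /(_ isT); rewrite ler_norml => /andP[_]; lra.
have rsz i : (i < r)%N -> `|(vsz Hs (nth (rec0 n) recs i).2)%:R / vol - kap * (times i.+1 - times i)| <= 3 * e.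
  by move=> ir; have := rec_size (h3 _ (recin i ir)); rewrite (beg i ir).
have Zdiv (x y : R) : x <= y -> x / aa <= y / aa by move=> xy; rewrite ler_pM2r // invr_gt0.
exists r, times; split.
- by rewrite /times mul0r.
- move=> i ir; rewrite /times ler_pM2r ?invr_gt0 // ler_nat -(beg i ir).
  by have [/andP[]] := h3 _ (recin i ir).
- exact: timesT.
- move=> i s ir /andP[s0 st]; apply: le_trans (ft i ir) _.
  have sT := le_trans st (timesT i ir).
  have : Zrun R c xs (take (en i) w) / aa <= Zrun R c xs (take (Num.trunc (s * aa ^+ 2)) w) / aa.
    apply: Zdiv; have ui := up i s s0 st; case: i ir ui {st} => [|i] ir ui.
      by move: ui; rewrite leqn0 => /eqP ->; exact: lexx.
    by have [_ hz _ _] := h3 _ (recin i ir); exact: hz.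
  by move=> h; exact: (error_trans e0 h (fs s s0 sT)).
split.
- move=> i s ir /andP[st1 st2]; apply: le_trans (ft i (ltnW ir)) _.
  have s0 := le_trans (t0 i) st1; have sT := le_trans st2 (timesT i.+1 ir).
  have [_ _ + _] := h3 _ (recin i ir); rewrite (beg i ir).
  move=> /(_ (Num.trunc (s * aa ^+ 2))); rewrite (dn i s st1) (up i.+1 s s0 st2) => /(_ isT) h.
  have : Zrun R c xs (take (en i) w) / aa - dmax%:R / aa <= Zrun R c xs (take (Num.trunc (s * aa ^+ 2)) w) / aa.
    by rewrite -mulrBl; exact: Zdiv.
  by move=> hj; exact: (error_trans_jump e0 hj de (fs s s0 sT)).
- move=> s /andP[st1 sT]; apply: le_trans (ft r (leqnn r)) _.
  have s0 := le_trans (t0 r) st1.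
  have := h4 (Num.trunc (s * aa ^+ 2)); rewrite {1}enr (dn r s st1) (sK s s0 sT) => /(_ isT) h.
  have : Zrun R c xs (take (en r) w) / aa - dmax%:R / aa <= Zrun R c xs (take (Num.trunc (s * aa ^+ 2)) w) / aa.
    by rewrite -mulrBl; apply: Zdiv; rewrite -enr.
  by move=> hj; exact: (error_trans_jump e0 hj de (fs s s0 sT)).
- move=> k x xrho xy; set N0 := nth 0%N (sorted_comp_sizes m) k in xy.
  have xN : x * vol <= N0%:R by rewrite -ler_pdivlMr.
  have N0p : (0 < N0)%N.
    by rewrite -(ltr_nat R); apply: lt_le_trans xN; rewrite mulr_gt0 // (lt_trans rho0).
  have [|g [ginj gN]] := large_recs (recs := recs) (k := k) Hvalid mfull N0p _ (leqnn N0).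
    move=> C cC NC; have Xb : vcomp Hs C \in big_comps.
      rewrite inE (comp_hcm Hvalid) //= card_vcomp; apply: le_trans (_ : N0%:R <= _); last by rewrite ler_nat.
      by apply: le_trans xN; rewrite ler_wpM2r ?(ltW vol0) // ltW.
    have := hit (vcomp Hs C); rewrite Xb /= => /allPn[v vx]; rewrite negbK inE => vC.
    exact: h7 vx cC vC.
  exists g; split=> // i.
  have : x <= (vsz Hs (nth (rec0 n) recs (g i)).2)%:R / vol.
    by rewrite ler_pdivlMr //; apply: le_trans xN _; rewrite ler_nat.
  by move=> h; exact: (error_lower e0 (rsz (g i) (ltn_ord _)) h).
- move=> k x g ginj gx; have [x0|x0] := leP x 0; first by rewrite (le_trans x0) // divr_ge0 // ltW.
  have [i0 _ imin] := arg_minnP (fun i : 'I_k.+1 => vsz Hs (nth (rec0 n) recs (g i)).2) (erefl true : xpredT (ord0 : 'I_k.+1)).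
  have := recs_large Hvalid h5 h6 ginj (fun i => imin i isT).
  rewrite -(ler_nat R) => h; apply: le_trans (_ : (vsz Hs (nth (rec0 n) recs (g i0)).2)%:R / vol <= _); last first.
    by rewrite ler_pM2r ?invr_gt0.
  exact: (error_upper e0 (rsz (g i0) (ltn_ord _)) (gx i0)).
Qed.

End completed_components.

(** After [u = t a^2] draws the sum of [j < u] is about [t^2 a^4 / 2]; with [m] about [2 cc / a^3]
    and heights measured in units of [a] this gives [cc * t^2]. *)
Lemma drift_error (R : realType) (a nu m lam cc T z t : R) : 0 < a -> a^-1 <= z -> z <= 1 ->
  `|a * nu - lam| <= z -> `|a ^+ 3 * m - 2 * cc| <= z -> 0 <= cc -> 0 <= t <= T ->
  forall u, u = Num.trunc (t * a ^+ 2) ->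
  `|u%:R * nu / a - (\sum_(j < u) j%:R) * m / a - (lam * t - cc * t ^+ 2)| <=
    z * (T + `|lam| + T ^+ 2 + 3 * cc * T).
Proof.
move=> a0 az z1 hnu hm cc0 t0T u uE; case/andP: (t0T) => t0 tT.
have a2 : 0 < a ^+ 2 by rewrite exprn_gt0.
have ai0 : 0 < a^-1 by rewrite invr_gt0.
have /andP[u1 u2] := trunc_bounds (mulr_ge0 t0 (ltW a2)); rewrite -uE in u1 u2.
have tri : \sum_(j < u) j%:R = u%:R * (u%:R - 1) / 2 :> R.
  clear; elim: u => [|v IH]; first by rewrite big_ord0 mul0r mul0r.
  by rewrite big_ord_recr /= IH -natr1; field.
pose x : R := u%:R / a ^+ 2.
have x0 : 0 <= x by rewrite divr_ge0 // ltW.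
have xt : x <= t by rewrite ler_pdivrMr.
have z0 : 0 < z by exact: lt_le_trans az.
have ia2 : (a ^+ 2)^-1 <= z.
  rewrite -exprVn expr2; apply: le_trans (_ : 1 * z <= _); last by rewrite mul1r.
  by rewrite ler_pM ?(ltW ai0) // (le_trans az).
have tx : t - x <= z.
  apply: le_trans ia2; rewrite -div1r lerBlDr -mulrDl ler_pdivlMr //.
  by rewrite addrC ltW.
have E1 : u%:R * nu / a = x * (a * nu).
  by rewrite /x; field; rewrite gt_eqF.
have E2 : (\sum_(j < u) j%:R) * m / a = (x ^+ 2 - x / a ^+ 2) / 2 * (a ^+ 3 * m).
  by rewrite tri /x; field; rewrite gt_eqF.
rewrite E1 E2; set y := x ^+ 2 - x / a ^+ 2.
have xa : 0 <= x / a ^+ 2 <= T * z.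
  rewrite divr_ge0 ?(ltW a2) //= ler_pM ?invr_ge0 ?(ltW a2) //.
  exact: le_trans tT.
have xx : t ^+ 2 - x ^+ 2 <= 2 * T * z.
  rewrite subr_sqr; apply: le_trans (_ : z * (T + T) <= _); last by lra.
  by rewrite ler_pM // ?subr_ge0 ?addr_ge0 // lerD // (le_trans xt).
have xx0 : x ^+ 2 <= t ^+ 2 by rewrite ler_pXn2r ?nnegrE.
have y1 : t ^+ 2 - y <= 3 * T * z by rewrite /y; case/andP: xa; lra.
have y2 : y <= t ^+ 2 by rewrite /y; case/andP: xa; lra.
have t2T : t ^+ 2 <= T ^+ 2 by rewrite ler_pXn2r ?nnegrE // (le_trans t0).
have yb : `|y / 2| <= T ^+ 2.
  have y0 : - T ^+ 2 <= y.
    have hx : x / a ^+ 2 <= x ^+ 2 + 0 \/ u = 0%N.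
      case: (posnP u) => [->|u0]; [by right|left].
      have -> : x / a ^+ 2 = x * (1 / a ^+ 2) by rewrite div1r.
      rewrite addr0 expr2 ler_wpM2l // ler_pM2r ?invr_gt0 // ler1n.
      exact: u0.
    case: hx => [hx|u00]; first by rewrite /y; have := sqr_ge0 T; lra.
    by rewrite /y /x u00 !mul0r expr0n /= subr0 oppr_le0 sqr_ge0.
  rewrite ler_norml; apply/andP; split; have := sqr_ge0 T; lra.
have b1 : `|x * (a * nu - lam)| <= T * z.
  by rewrite normrM (ger0_norm x0) ler_pM // (le_trans xt).
have b2 : `|lam * (x - t)| <= `|lam| * z.
  by rewrite normrM ler_wpM2l // distrC ger0_norm // subr_ge0.
have b3 : `|y / 2 * (a ^+ 3 * m - 2 * cc)| <= T ^+ 2 * z by rewrite normrM ler_pM.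
have b4 : `|cc * (t ^+ 2 - y)| <= cc * (3 * T * z).
  by rewrite normrM (ger0_norm cc0) ler_wpM2l // ger0_norm // subr_ge0.
clearbody y x.
rewrite (_ : _ - _ - (_ - _) = x * (a * nu - lam) + lam * (x - t) - y / 2 * (a ^+ 3 * m - 2 * cc) + cc * (t ^+ 2 - y)); last by field.
move: b1 b2 b3 b4; rewrite !mulrDr.
move: (x * _) (lam * _) (y / 2 * _) (cc * (t ^+ 2 - y)) => X1 X2 X3 X4.
rewrite ler_norml => /andP[? ?]; rewrite ler_norml => /andP[? ?].
rewrite ler_norml => /andP[? ?]; rewrite ler_norml => /andP[? ?].
by rewrite ler_norml; apply/andP; split; lra.
Qed.

Lemma frac_le (R : realType) (K x S d c Y th : R) : K <= x -> 0 <= S -> 0 < d -> 0 < c ->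
  x * S / d = c * Y -> Y <= th / c -> K * S / d <= th.
Proof.
move=> Kx S0 d0 c0 E; rewrite ler_pdivlMr // mulrC -E; apply: le_trans.
by rewrite ler_wpM2r ?invr_ge0 ?(ltW d0) // ler_wpM2r.
Qed.

(** The bad set has size of order [a]. With order [a^2] draws among order [a^3] half-edges, the
    expected number of bad draws stays bounded. *)
Lemma active_bound (R : realType) (K a T A nu m lam c2 z del beta d e : R) : 0 < a ->
  0 <= K -> K <= T * a ^+ 2 -> a^-1 <= z -> z <= 1 -> 0 <= T -> 0 <= c2 -> 0 <= beta ->
  `|a * nu - lam| <= z -> `|a ^+ 3 * m - c2| <= z -> d / a <= z -> 3 * del = e / 4 ->
  3 * z * (beta + 1) <= e / 4 -> 0 <= d ->
  3 * (A * a + K * `|nu| + K ^+ 2 * `|m| + 3 * (del * a) + beta * (d + 2)) + 2 * d <=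
  a * (3 * (A + T * (`|lam| + 1) + T ^+ 2 * (c2 + 1) + e / 2) + 2).
Proof.
move=> a0 K0 Ka az z1 T0 c0 b0 hnu hm da de ze d0.
have a2 : 0 < a ^+ 2 by rewrite exprn_gt0.
have h1 : K * `|nu| <= a * (T * (`|lam| + 1)).
  have : a * `|nu| <= `|lam| + 1.
    rewrite -{1}(gtr0_norm a0) -normrM -lerBlDl.
    by apply: le_trans z1; apply: le_trans hnu; exact: lerB_dist.
  move=> h; apply: le_trans (_ : T * a ^+ 2 * `|nu| <= _); first by rewrite ler_wpM2r.
  rewrite (_ : T * a ^+ 2 * _ = a * (T * (a * `|nu|))); last by ring.
  by rewrite ler_pM2l // ler_wpM2l.
have h2 : K ^+ 2 * `|m| <= a * (T ^+ 2 * (c2 + 1)).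
  have : a ^+ 3 * `|m| <= c2 + 1.
    rewrite -{1}(gtr0_norm (exprn_gt0 3 a0)) -normrM -lerBlDl.
    apply: le_trans z1; apply: le_trans hm; rewrite -{1}(ger0_norm c0); exact: lerB_dist.
  move=> h; apply: le_trans (_ : (T * a ^+ 2) ^+ 2 * `|m| <= _).
    by rewrite ler_wpM2r // ler_pXn2r ?nnegrE // mulr_ge0 // ltW.
  rewrite (_ : (T * a ^+ 2) ^+ 2 * `|m| = a * (T ^+ 2 * (a ^+ 3 * `|m|))); last by ring.
  by rewrite ler_pM2l // ler_wpM2l // sqr_ge0.
have za : 1 <= z * a by rewrite -ler_pdivrMr // div1r.
have dz : d <= z * a by rewrite -ler_pdivrMr.
have h3 : beta * (d + 2) <= a * (e / 4).
  apply: le_trans (_ : a * (3 * z * (beta + 1)) <= _); last by rewrite ler_pM2l.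
  apply: le_trans (_ : beta * (3 * (z * a)) <= _); first by rewrite ler_wpM2l //; lra.
  rewrite (_ : a * _ = beta * (3 * (z * a)) + 3 * (z * a)); last by ring.
  by rewrite lerDl; lra.
have h4 : d <= a by apply: le_trans dz _; rewrite ger_pMl.
have h5 : 3 * (del * a) = a * (e / 4) by rewrite mulrA de mulrC.
rewrite h5.
rewrite [leRHS](_ : _ = 3 * (a * A + a * (T * (`|lam| + 1)) + a * (T ^+ 2 * (c2 + 1)) + a * (e / 4) + a * (e / 4)) + 2 * a); last by field.
rewrite (mulrC A); lra.
Qed.

Lemma walk_dist (R : realType) (Z W S m nu u a p q e1 e2 del : R) : 0 < a ->
  `|Z - (W - S * m)| <= del -> del / a <= e1 -> p = (W - u * nu) / a ->
  `|u * nu / a - S * m / a - q| <= e2 -> `|Z / a - (p + q)| <= e1 + e2.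
Proof.
move=> a0 hZ da -> hd.
rewrite (_ : _ - _ = (Z - (W - S * m)) / a + (u * nu / a - S * m / a - q)); last first.
  by rewrite !mulrBl; ring.
apply: le_trans (ler_normD _ _) _; apply: lerD => //.
by apply: le_trans da; rewrite normrM normfV (gtr0_norm a0) ler_pM2r ?invr_gt0.
Qed.

Lemma volume_dist (R : realType) (V u a2 vol kap kV T z del e1 : R) : 0 < a2 -> a2 <= vol -> 0 <= u ->
  u <= T * a2 -> `|V - u * kap| <= del -> del / a2 <= e1 -> `|kap * (a2 / vol) - kV| <= z ->
  `|V / vol - kV * (u / a2)| <= e1 + T * z.
Proof.
move=> a0 av u0 uT hV de hk; have v0 : 0 < vol by exact: lt_le_trans av.
rewrite (_ : _ - _ = (V - u * kap) / vol + u / a2 * (kap * (a2 / vol) - kV)); last first.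
  by field; rewrite !gt_eqF.
apply: le_trans (ler_normD _ _) _; apply: lerD.
  apply: le_trans de; rewrite normrM normfV (gtr0_norm v0) ler_pM ?invr_ge0 ?(ltW v0) //.
  by rewrite lef_pV2 ?posrE.
have ua : 0 <= u / a2 by rewrite divr_ge0 // ltW.
by rewrite normrM (ger0_norm ua) ler_pM // ler_pdivrMr.
Qed.

Section linear_facts.
Variable R : realType.
Implicit Types th e d z a b c T : R.

Lemma sum_three th : 0 < th -> th + (th / 5 + th / 5 + th / 5) + (th / 5 + th / 5) + th <= 3 * th.
Proof. by lra. Qed.

Lemma add2_le d z a : d <= z * a -> 1 <= z * a -> d + 2 <= 3 * z * a.
Proof. by rewrite -mulrA; lra. Qed.

Lemma quarter_add e a b : b <= e / 4 * a -> e / 4 * a + b <= e / 2 * a.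
Proof. by lra. Qed.

Lemma third_le e b z : b * (3 * z) <= e / 4 -> b * z <= e / 12.
Proof. by lra. Qed.

Lemma first_le T a b c : 0 < T -> 0 <= a -> 0 < c -> 0 <= b -> T <= T + a + b + c + 1.
Proof. by lra. Qed.

Lemma three_quarters e : 0 < e -> e / 2 + e / 4 <= e.
Proof. by lra. Qed.

Lemma two_thirds e z : z <= e / 4 -> 0 < e -> e / 3 + e / 12 + z <= e.
Proof. by lra. Qed.

End linear_facts.

(** * The exploration walk against the drifted path *)

Section walk_stage.
Variables (R : realType) (lam : R).
Unset Implicit Arguments.
Variable Hs : forall n : nat, 'I_n -> community.
Set Implicit Arguments.
Variable P : community -> R.
Hypothesis hc : hcm_conditions R lam Hs P.

Local Notation mu := (mu P).
Local Notation eta := (eta P).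
Local Notation tau3 := (tau3 P).
Local Notation ES := (ES P).
Local Notation EDS := (EDS P).
Local Notation a := (@scale R).

Definition sgm : R := Num.sqrt eta / mu.
Definition cdr : R := eta / (2 * mu ^+ 3).
Definition kapV : R := ES `^ (- (2 / 3)) * (EDS / mu).
Definition vol n : R := (hcm_N (Hs n))%:R `^ (2 / 3).
(** The variance times [a n ^+ 2] tends to 1, because [sgm ^+ 2 = tau3 / mu]. *)
Definition xiw n (h : hedge (Hs n)) : R := (fdeg R Hs (hcomm h) - nuS R Hs n) / (a n * sgm).
Definition drift (t : R) : R := lam * t - cdr * t ^+ 2.
Definition fpath n (w : seq (hedge (Hs n))) (t : R) : R :=
  sgm * walkpath (@xiw n) (a n ^+ 2) w t + drift t.

Let mu0 : 0 < mu := mu_gt0 hc.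
Let eta0 : 0 < eta := eta_gt0 hc.

Lemma sgm_gt0 : 0 < sgm.
Proof. by rewrite divr_gt0 // sqrtr_gt0. Qed.

Lemma cdr_gt0 : 0 < cdr.
Proof. by rewrite divr_gt0 // mulr_gt0 // exprn_gt0. Qed.

Lemma kapV_gt0 : 0 < kapV.
Proof.
rewrite mulr_gt0 ?powR_gt0 ?divr_gt0 ?(EDS_gt0 hc) //.
exact: lt_le_trans (ES_ge1 hc).
Qed.

Lemma cdrE : 2 * cdr = tau3 / mu ^+ 2.
Proof. by rewrite /cdr (etaE hc); field; rewrite gt_eqF. Qed.

Lemma wsum_xiw n (w : seq (hedge (Hs n))) : 0 < a n ->
  sgm * wsum (@xiw n) w = (wsum (fun h => fdeg R Hs (hcomm h)) w - (size w)%:R * nuS R Hs n) / a n.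
Proof.
move=> an; have s0 := sgm_gt0; rewrite /wsum mulr_sumr.
have -> : (size w)%:R * nuS R Hs n = \sum_(h <- w) nuS R Hs n.
  by rewrite big_const_seq count_predT iter_addr addr0 mulr_natl.
rewrite -sumrB mulr_suml; apply: eq_bigr => h _.
by rewrite /xiw; field; rewrite !gt_eqF.
Qed.

Lemma vol_ge n : a n ^+ 2 <= vol n.
Proof.
by rewrite -scale2 /vol ge0_ler_powR ?nnegrE // ?ler_nat ?(hcm_N_ge hc) // divr_ge0.
Qed.

Lemma kap_cvg : (fun n => kapS R Hs n * (a n ^+ 2 / vol n)) @ \oo --> kapV.
Proof.
have ES0 : 0 < ES by exact: lt_le_trans (ES_ge1 hc).
have cv : (fun n => kapS R Hs n * (vol n / a n ^+ 2)^-1) @ \oo --> (EDS / mu) * (ES `^ (2 / 3))^-1.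
  apply: cvgM; first exact: (kapS_cvg hc).
  apply: cvgV; first by rewrite gt_eqF // powR_gt0.
  exact: (volume_scale hc).
rewrite /kapV powRN mulrC; apply: (cvgr_near_eq _ cv); apply: nearW => n.
by rewrite invf_div.
Qed.

Lemma near_le0 (u : nat -> R) (e : R) : u @ \oo --> (0 : R) -> 0 < e -> \forall n \near \oo, u n <= e.
Proof. by move=> u0 e0; apply: (cvgr_le 0 u0). Qed.

Lemma near_dist (u : nat -> R) (l e : R) : u @ \oo --> l -> 0 < e -> \forall n \near \oo, `|u n - l| <= e.
Proof.
by move=> ul e0; move/cvgrPdist_le : ul => /(_ e e0); apply: filterS => n; rewrite distrC.
Qed.

(** [walk_event] on the critical scale. The failure probability splits into [th] for the centred
    walk exceeding [A], five vanishing terms of at most [th / 5], and [th] for too many bad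
    draws. *)
Lemma walk_stage (T A th e : R) : 0 < T -> 0 < A -> 0 < th -> 0 < e ->
  T * (2 * tau3 / mu) / A ^+ 2 <= th -> \forall n \near \oo,
  forall xs : seq 'I_n, covers xs -> exists bad : pred (seq (hedge (Hs n))),
    EL (@hcp R Hs n) (Num.trunc (T * a n ^+ 2)) (fun w => (bad w)%:R) <= 3 * th /\
    forall w, size w = Num.trunc (T * a n ^+ 2) -> ~~ bad w ->
    [/\ (forall t : R, 0 <= t <= T ->
          `|Zrun R (@hcomm n (Hs n)) xs (take (Num.trunc (t * a n ^+ 2)) w) / a n - fpath w t| <= e),
        (forall u, (u <= Num.trunc (T * a n ^+ 2))%N ->
          `|Vrun R (@hcomm n (Hs n)) (fun i => csize (Hs n i)) xs (take u w) / vol n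
            - kapV * (u%:R / a n ^+ 2)| <= e) &
        sgm * walkpath (@xiw n) (a n ^+ 2) w T < A].
Proof.
move=> T0 A0 th0 e0 hA.
have tau0 := tau3_gt0 hc; have cd0 := cdr_gt0; have mu0' := mu0; have eta0' := eta0.
pose Cb := 3 * (A + T * (`|lam| + 1) + T ^+ 2 * (2 * cdr + 1) + e / 2) + 2.
have l0 : 0 <= `|lam| by [].
have Cb0 : 0 < Cb.
  rewrite /Cb; have : 0 < T * (`|lam| + 1) by rewrite mulr_gt0 //; lra.
  have : 0 < T ^+ 2 * (2 * cdr + 1) by rewrite mulr_gt0 ?exprn_gt0 //; lra.
  by lra.
(* The expected number of bad draws is at most [2 * T / mu * Cb], so Markov's inequality with
   [beta.+1] gives [th]. *)
pose beta := Num.trunc (2 * T / mu * Cb / th).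
have betaP : 2 * T / mu * Cb / beta.+1%:R <= th.
  by rewrite ler_pdivrMr // [leRHS]mulrC -ler_pdivrMr // ltW // truncnS_gt.
have b1 : 0 < beta%:R + 1 :> R by rewrite ltr_wpDl.
pose D := T + `|lam| + T ^+ 2 + 3 * cdr * T + 1.
have D0 : 0 < D.
  rewrite /D; have := sqr_ge0 T; have : 0 < 3 * cdr * T by apply: mulr_gt0 => //; apply: mulr_gt0.
  by lra.
(* One tolerance for all converging parameters: [z * D] controls the drift, [z * (beta + 1)] the
   effect of bad draws. *)
pose z := Num.min 1 (Num.min (e / (4 * D)) (e / (12 * (beta%:R + 1)))).
have z0 : 0 < z by rewrite !lt_min ltr01 !divr_gt0 // ?mulr_gt0.
have z1 : z <= 1 by rewrite ge_min lexx.
have zD : z * D <= e / 4.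
  rewrite -ler_pdivlMr // /z !ge_min (_ : e / 4 / D = e / (4 * D)) ?lexx ?orbT //.
  by field; rewrite gt_eqF.
have zb : 3 * z * (beta%:R + 1) <= e / 4.
  rewrite -ler_pdivlMr // -ler_pdivlMl // /z !ge_min.
  by rewrite (_ : 3^-1 * (e / 4 / (beta%:R + 1)) = e / (12 * (beta%:R + 1))) ?lexx ?orbT //; field; rewrite gt_eqF.
pose del := e / 12; have del0 : 0 < del by rewrite divr_gt0.
pose del' := e / 6; have del'0 : 0 < del' by rewrite divr_gt0.
have th5 : 0 < th / 5 by rewrite divr_gt0.
have T2 : 0 < T ^+ 2 by rewrite exprn_gt0.
have T3 : 0 < T ^+ 3 by rewrite exprn_gt0.
have dl2 : 0 < del ^+ 2 by rewrite exprn_gt0.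
have dl'2 : 0 < del' ^+ 2 by rewrite exprn_gt0.
have em0 : \forall n \near \oo, mu / 2 <= emp_mean (Hs n) (fun H => (cdtot H)%:R) :> R.
  by apply: (cvgr_ge mu (em1_cvg hc)); lra.
have q2 : \forall n \near \oo, a n ^+ 2 * (\sum_i pushpmf (@hcomm n (Hs n)) (@hcp R Hs n) i ^+ 2 * fdeg R Hs i ^+ 2) <= th / 5 / (T ^+ 2 / del ^+ 2).
  by apply: (near_le0 (R2_cvg hc)); rewrite !divr_gt0.
have q3 : \forall n \near \oo, a n ^+ 5 * (\sum_i pushpmf (@hcomm n (Hs n)) (@hcp R Hs n) i ^+ 3 * `|fdeg R Hs i|) <= th / 5 / (T ^+ 3 / del).
  by apply: (near_le0 (R3_cvg hc)); rewrite !divr_gt0.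
have q5 : \forall n \near \oo, a n ^+ 4 * (\sum_i pushpmf (@hcomm n (Hs n)) (@hcp R Hs n) i ^+ 3 * fdeg R Hs i ^+ 2) <= th / 5 / (T ^+ 3 / del ^+ 2).
  by apply: (near_le0 (R5_cvg hc)); rewrite !divr_gt0.
have q6 : \forall n \near \oo, (\sum_i pushpmf (@hcomm n (Hs n)) (@hcp R Hs n) i * (csize (Hs n i))%:R ^+ 2) / a n ^+ 2 <= th / 5 / (T / del' ^+ 2).
  by apply: (near_le0 (R6_cvg hc)); rewrite !divr_gt0.
have q7 : \forall n \near \oo, a n ^+ 2 * (\sum_i pushpmf (@hcomm n (Hs n)) (@hcp R Hs n) i ^+ 2 * (csize (Hs n i))%:R) <= th / 5 / (T ^+ 2 / del').
  by apply: (near_le0 (R7_cvg hc)); rewrite !divr_gt0.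
have qv : \forall n \near \oo, varS R Hs n <= 2 * tau3 / mu.
  apply: (cvgr_le (tau3 / mu) (varS_cvg hc)).
  by rewrite -mulrA ltr_pMl ?divr_gt0 //; lra.
have qnu := near_dist (nuS_cvg hc) z0.
have qm := near_dist (mS_cvg hc) z0.
have qd := near_le0 (dmx_small hc) z0.
have qs := near_le0 (smx_small hc) z0.
have qk := near_dist kap_cvg z0.
have qa : \forall n \near \oo, Num.max z^-1 (Num.max (T^-1 + 1) (4 * T / mu)) <= a n by exact: scale_large.
near=> n => xs cov.
have n0 : (0 < n)%N by near: n; exists 1%N.
have an := scale_gt0 R n0.
have a2 : 0 < a n ^+ 2 by rewrite exprn_gt0.
have : Num.max z^-1 (Num.max (T^-1 + 1) (4 * T / mu)) <= a n by near: n.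
rewrite !ge_max => /and3P[az aT amu].
have ai : (a n)^-1 <= z by rewrite -[leRHS]invrK lef_pV2 ?posrE ?invr_gt0.
have emn : mu / 2 <= emp_mean (Hs n) (fun H => (cdtot H)%:R) :> R by near: n.
have ellE' := ellE R Hs n0.
have ell_ge : a n ^+ 3 * (mu / 2) <= #|hedge (Hs n)|%:R.
  by rewrite ellE' scale3 ler_wpM2l.
have ell0 : 0 < #|hedge (Hs n)|%:R :> R.
  by apply: lt_le_trans ell_ge; rewrite mulr_gt0 ?divr_gt0 // exprn_gt0.
have H0 : (0 < #|hedge (Hs n)|)%N by rewrite -(ltr_nat R).
set K := Num.trunc (T * a n ^+ 2).
have /andP[K1 K2] := trunc_bounds (mulr_ge0 (ltW T0) (ltW a2)); rewrite -/K in K1 K2.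
have K0 : (0 < K)%N.
  rewrite lt0n; apply/eqP => K00; move: K2; rewrite K00 mulr0n add0r ltNge => /negP; apply.
  rewrite -ler_pdivrMl // mulr1; apply: le_trans (_ : a n <= _); first by apply: le_trans aT; rewrite lerDl.
  rewrite expr2 ler_peMr ?(ltW an) //; apply: le_trans aT; rewrite lerDr invr_ge0 ltW //.
have KH : (2 * K <= #|hedge (Hs n)|)%N.
  rewrite -(ler_nat R) natrM; apply: le_trans ell_ge.
  apply: le_trans (_ : 2 * (T * a n ^+ 2) <= _); first by rewrite ler_wpM2l.
  rewrite exprSr -mulrA [X in _ <= X](_ : _ = (a n * mu / 2) * a n ^+ 2); last by ring.
  rewrite mulrA ler_wpM2r ?(ltW a2) //; move: amu; rewrite ler_pdivrMr //; lra.
have Ka : 0 < A * a n by rewrite mulr_gt0.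
have da : 0 < del * a n by rewrite mulr_gt0.
have da' : 0 < del' * a n ^+ 2 by rewrite mulr_gt0.
have dP i : (hdeg (@hcomm n (Hs n)) i <= dmx Hs n)%N.
  by rewrite hdeg_hcomm; exact: dmxP.
have [bad [Pb Hb]] := walk_event dP (@smxP Hs n) H0 beta cov KH K0 Ka da da'.
have TK : K%:R <= T * a n ^+ 2 by [].
have TK2 : K%:R ^+ 2 <= (T * a n ^+ 2) ^+ 2 by rewrite ler_pXn2r ?nnegrE // mulr_ge0 // ltW.
have TK3 : K%:R ^+ 3 <= (T * a n ^+ 2) ^+ 3 by rewrite ler_pXn2r ?nnegrE // mulr_ge0 // ltW.
have pg i : 0 <= pushpmf (@hcomm n (Hs n)) (@hcp R Hs n) i.
  by rewrite /pushpmf; apply: sumr_ge0 => h _; rewrite /hcp invr_ge0.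
have hnu : `|a n * nuS R Hs n - lam| <= z by near: n.
have hm : `|a n ^+ 3 * mS R Hs n - 2 * cdr| <= z by rewrite cdrE scale3; near: n.
have hd : (dmx Hs n)%:R / a n <= z by near: n.
have hs : (smx Hs n)%:R / a n ^+ 2 <= z by near: n.
have hkap : `|kapS R Hs n * (a n ^+ 2 / vol n) - kapV| <= z by near: n.
have ang := lt0r_neq0 an; have delg := lt0r_neq0 del0; have delg' := lt0r_neq0 del'0.
have Ag := lt0r_neq0 A0.
exists bad; split.
  apply: le_trans Pb _.
  have g1 : K%:R * varS R Hs n / (A * a n) ^+ 2 <= th.
    apply: (@frac_le _ _ (T * a n ^+ 2) _ _ (T / A ^+ 2) (varS R Hs n)) => //.
    - by apply: sumr_ge0 => i _; rewrite mulr_ge0 ?sqr_ge0.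
    - by rewrite exprn_gt0.
    - by rewrite divr_gt0 // exprn_gt0.
    - by field; rewrite ang Ag.
    - rewrite ler_pdivlMr ?divr_gt0 ?exprn_gt0 //; apply: le_trans hA.
      rewrite [leRHS]mulrAC mulrC ler_pM2l ?divr_gt0 ?exprn_gt0 //.
      by near: n.
  have g2 : K%:R ^+ 2 * (\sum_i pushpmf (@hcomm n (Hs n)) (@hcp R Hs n) i ^+ 2 * fdeg R Hs i ^+ 2) / (del * a n) ^+ 2 <= th / 5.
    apply: (@frac_le _ _ ((T * a n ^+ 2) ^+ 2) _ _ (T ^+ 2 / del ^+ 2) (a n ^+ 2 * (\sum_i pushpmf (@hcomm n (Hs n)) (@hcp R Hs n) i ^+ 2 * fdeg R Hs i ^+ 2))) => //.
    - by apply: sumr_ge0 => i _; rewrite mulr_ge0 ?sqr_ge0.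
    - by rewrite exprn_gt0.
    - by rewrite divr_gt0.
    - by field; rewrite ang delg.
    - by near: n.
  have g3 : K%:R ^+ 3 * (\sum_i pushpmf (@hcomm n (Hs n)) (@hcp R Hs n) i ^+ 3 * `|fdeg R Hs i|) / (del * a n) <= th / 5.
    apply: (@frac_le _ _ ((T * a n ^+ 2) ^+ 3) _ _ (T ^+ 3 / del) (a n ^+ 5 * (\sum_i pushpmf (@hcomm n (Hs n)) (@hcp R Hs n) i ^+ 3 * `|fdeg R Hs i|))) => //.
    - by apply: sumr_ge0 => i _; rewrite mulr_ge0 ?exprn_ge0.
    - by rewrite divr_gt0.
    - by field; rewrite ang delg.
    - by near: n.
  have g4 : K%:R ^+ 3 * (\sum_i pushpmf (@hcomm n (Hs n)) (@hcp R Hs n) i ^+ 3 * fdeg R Hs i ^+ 2) / (del * a n) ^+ 2 <= th / 5.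
    apply: (@frac_le _ _ ((T * a n ^+ 2) ^+ 3) _ _ (T ^+ 3 / del ^+ 2) (a n ^+ 4 * (\sum_i pushpmf (@hcomm n (Hs n)) (@hcp R Hs n) i ^+ 3 * fdeg R Hs i ^+ 2))) => //.
    - by apply: sumr_ge0 => i _; rewrite mulr_ge0 ?sqr_ge0 ?exprn_ge0.
    - by rewrite exprn_gt0.
    - by rewrite divr_gt0.
    - by field; rewrite ang delg.
    - by near: n.
  have g5 : K%:R * (\sum_i pushpmf (@hcomm n (Hs n)) (@hcp R Hs n) i * (csize (Hs n i))%:R ^+ 2) / (del' * a n ^+ 2) ^+ 2 <= th / 5.
    apply: (@frac_le _ _ (T * a n ^+ 2) _ _ (T / del' ^+ 2) ((\sum_i pushpmf (@hcomm n (Hs n)) (@hcp R Hs n) i * (csize (Hs n i))%:R ^+ 2) / a n ^+ 2)) => //.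
    - by apply: sumr_ge0 => i _; rewrite mulr_ge0 ?sqr_ge0.
    - by rewrite exprn_gt0.
    - by rewrite divr_gt0.
    - by field; rewrite ang delg'.
    - by near: n.
  have g6 : K%:R ^+ 2 * (\sum_i pushpmf (@hcomm n (Hs n)) (@hcp R Hs n) i ^+ 2 * (csize (Hs n i))%:R) / (del' * a n ^+ 2) <= th / 5.
    apply: (@frac_le _ _ ((T * a n ^+ 2) ^+ 2) _ _ (T ^+ 2 / del') (a n ^+ 2 * (\sum_i pushpmf (@hcomm n (Hs n)) (@hcp R Hs n) i ^+ 2 * (csize (Hs n i))%:R))) => //.
    - by apply: sumr_ge0 => i _; rewrite mulr_ge0 ?sqr_ge0.
    - by rewrite divr_gt0.
    - by field; rewrite ang delg'.
    - by near: n.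
  have d3 : 3 * del = e / 4 by rewrite /del; field.
  have := @active_bound _ K%:R (a n) T A _ _ lam (2 * cdr) z del beta%:R (dmx Hs n)%:R e an
    (ler0n _ _) TK ai z1 (ltW T0) (mulr_ge0 (ler0n _ 2) (ltW cd0)) (ler0n _ _) hnu hm hd d3 zb (ler0n _ _).
  rewrite -/Cb; set bb := (3 * _ + 2 * _ : R) => hbb.
  have g7 : K%:R * (bb / #|hedge (Hs n)|%:R) / beta.+1%:R <= th.
    apply: le_trans betaP; rewrite ler_pM2r ?invr_gt0 ?ltr0Sn //.
    apply: le_trans (_ : K%:R * (a n * Cb / #|hedge (Hs n)|%:R) <= _).
      by rewrite ler_wpM2l // ler_pM2r ?invr_gt0.
    apply: le_trans (_ : T * a n ^+ 2 * (a n * Cb / #|hedge (Hs n)|%:R) <= _).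
      by rewrite ler_wpM2r // divr_ge0 // mulr_ge0 // ltW.
    rewrite mulrA ler_pdivrMr //.
    rewrite (_ : T * a n ^+ 2 * (a n * Cb) = 2 * T / mu * Cb * (a n ^+ 3 * (mu / 2))); last first.
      by field; rewrite gt_eqF.
    by rewrite ler_wpM2l // mulr_ge0 ?(ltW Cb0) // divr_ge0 ?(ltW mu0') // mulr_ge0 // ltW.
  have q : th + (th / 5 + th / 5 + th / 5) + (th / 5 + th / 5) + th <= 3 * th by exact: sum_three.
  apply: le_trans q; apply: lerD; last exact: g7.
  apply: lerD; last by apply: lerD; [exact: g5|exact: g6].
  apply: lerD; first exact: g1.
  apply: lerD; last exact: g4.
  by apply: lerD; [exact: g2|exact: g3].
move=> w wK nb; have Hw := Hb w wK nb.
have bz : beta%:R * (3 * z) <= e / 4.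
  by apply: le_trans zb; rewrite mulrC ler_pM2l ?mulr_gt0 // lerDl.
have za : 1 <= z * a n by rewrite -ler_pdivrMr // div1r.
have da3 : (3 * (del * a n) + beta%:R * ((dmx Hs n)%:R + 2)) / a n <= e / 2.
  rewrite ler_pdivrMr //; have dz : (dmx Hs n)%:R <= z * a n by rewrite -ler_pdivrMr.
  have b4 : beta%:R * ((dmx Hs n)%:R + 2) <= e / 4 * a n.
    apply: le_trans (_ : beta%:R * (3 * z) * a n <= _); last by rewrite ler_pM2r.
    by rewrite -mulrA ler_wpM2l //; exact: add2_le.
  have -> : 3 * (del * a n) = e / 4 * a n by rewrite /del; field.
  by exact: quarter_add.
have ds3 : (2 * (del' * a n ^+ 2) + beta%:R * (smx Hs n)%:R) / a n ^+ 2 <= e / 3 + e / 12.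
  rewrite mulrDl; apply: lerD; first by rewrite /del' (_ : _ / _ = e / 3) //; field.
  rewrite -mulrA; apply: le_trans (_ : beta%:R * z <= _); first by rewrite ler_wpM2l.
  by exact: third_le.
have Tz : T * z <= e / 4.
  apply: le_trans zD; rewrite mulrC ler_pM2l // /D; have := sqr_ge0 T.
  have : 0 < 3 * cdr * T by apply: mulr_gt0 => //; apply: mulr_gt0.
  by move=> h1 h2; exact: first_le.
have wpE t : 0 <= t <= T -> (Num.trunc (t * a n ^+ 2) <= K)%N /\
   sgm * walkpath (@xiw n) (a n ^+ 2) w t =
   (wsum (fun h => fdeg R Hs (hcomm h)) (take (Num.trunc (t * a n ^+ 2)) w) - (Num.trunc (t * a n ^+ 2))%:R * nuS R Hs n) / a n.
  move=> /andP[t0 tT].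
  have uK : (Num.trunc (t * a n ^+ 2) <= K)%N.
    have u0 := mulr_ge0 t0 (ltW a2).
    have uT : t * a n ^+ 2 <= T * a n ^+ 2 by rewrite ler_pM2r.
    by apply: leq_trunc.
  by split => //; rewrite /walkpath wsum_xiw // size_takel // wK.
split.
- move=> t tT; have [uK E] := wpE t tT; have [_ h2 _] := Hw _ uK.
  apply: le_trans (_ : e / 2 + e / 4 <= _); last by exact: three_quarters.
  apply: (walk_dist an h2 da3 E); apply: le_trans zD.
  apply: le_trans (@drift_error _ (a n) _ _ lam cdr T z t an ai z1 hnu hm (ltW cd0) tT _ erefl) _.
  by rewrite ler_pM2l // /D lerDl.
- move=> u uK; have [_ _ h3] := Hw _ uK.
  apply: le_trans (_ : (e / 3 + e / 12) + T * z <= _); last by exact: two_thirds.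
  have uT : u%:R <= T * a n ^+ 2 by apply: le_trans K1; rewrite ler_nat.
  exact: (volume_dist a2 (vol_ge n) (ler0n _ _) uT h3 ds3 hkap).
- have TT : 0 <= T <= T by rewrite lexx ltW.
  have [uK E] := wpE T TT; have [h1 _ _] := Hw _ uK.
  rewrite E ltr_pdivrMr //; exact: le_lt_trans (ler_norm _) h1.
Unshelve. all: by end_near. Qed.
End walk_stage.

Lemma compat_perturb (R : realType) (T eps eps' rho kap d : R) (f g : R -> R) y : 0 <= d ->
  (forall t, 0 <= t <= T -> `|f t - g t| <= d) -> eps + 2 * d <= eps' ->
  compat T eps rho kap f y -> compat T eps' rho kap g y.
Proof.
move=> d0 fg epsd [y0 [r [tau [tau0 taum taur p1 [p2 p2' p3 p4]]]]].
have ee : eps <= eps' by apply: le_trans epsd; rewrite lerDl mulr_ge0.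
have mono := times_mono taum.
have tauT i : (i <= r)%N -> 0 <= tau i <= T.
  move=> ir; rewrite -{1}tau0 mono //=; apply: le_trans taur; apply: mono.
  by rewrite ir leqnn.
have cmp u v : 0 <= u <= T -> 0 <= v <= T -> f u <= f v + eps -> g u <= g v + eps'.
  move=> uT vT h; have := fg _ uT; have := fg _ vT.
  by rewrite !ler_distl => /andP[? ?] /andP[? ?]; lra.
split=> //; exists r, tau; split=> //.
  move=> i s ir sT; apply: cmp; [exact: tauT| |exact: p1].
  case/andP: (tauT i ir) => _ h; case/andP: sT => -> /= h'; exact: le_trans h.
split=> //.
- move=> i s ir sT; apply: cmp; [exact/tauT/ltnW| |exact: p2].
  case/andP: (tauT _ ir) => _ h; case/andP: (tauT _ (ltnW ir)) => h0 _.
  by case/andP: sT => h1 h2; rewrite (le_trans h0) // (le_trans h2).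
- move=> s sT; apply: cmp; [exact: tauT| |exact: p2'].
  case/andP: (tauT _ (leqnn r)) => h0 _; case/andP: sT => h1 h2.
  by rewrite (le_trans h0).
- move=> k x hx hy; have [e2 [inj_e He]] := p3 k x hx hy; exists e2; split=> // i.
  by apply: le_trans (He i); rewrite lerB.
- move=> k x e2 inj_e He; apply: (p4 k x e2 inj_e) => i.
  by apply: le_trans (He i); rewrite lerD.
Qed.

(** Neighbours in the enumeration are paired. Hence averages over matchings are not divisions by
    zero. *)
Lemma full_matchings_nonempty (H : finType) : ~~ odd #|H| -> exists m, m \in full_matchings H.
Proof.
move=> ev; pose sw k := if odd k then k.-1 else k.+1.
have swlt k : (k < #|H|)%N -> (sw k < #|H|)%N.
  rewrite /sw; case: ifP => ok kH; first by apply: leq_ltn_trans kH; exact: leq_pred.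
  by rewrite ltn_neqAle kH andbT; apply: contraNneq ev => <-; rewrite /= ok.
have swK k : sw (sw k) = k.
  rewrite /sw; case: k => [|k] //=; case ok: (odd k) => //=; last by rewrite ok.
  by rewrite ok.
have swN k : sw k != k by rewrite /sw; case: k => [|k] //=; case: (odd k) => /=; lia.
exists [ffun h => nth h (enum H) (sw (index h (enum H)))].
have il (h : H) : (index h (enum H) < #|H|)%N by rewrite cardE index_mem mem_enum.
have im (h : H) : index (nth h (enum H) (sw (index h (enum H)))) (enum H) = sw (index h (enum H)).
  by rewrite index_uniq ?enum_uniq // -cardE swlt.
apply/full_matchingsP => h; rewrite !ffunE im swK; split.
  by rewrite (set_nth_default h) ?nth_index ?mem_enum // -cardE.
apply/eqP => E; have := swN (index h (enum H)); rewrite -im E eqxx //.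
Qed.

Lemma indicator_le (R : realType) (b1 b2 b3 : bool) (g h M : R) : - M <= g <= M -> - M <= h <= M ->
  (~~ b1 -> ~~ b2 -> ~~ b3 -> g <= h) ->
  g + M <= h + M + 2 * M * b1%:R + 2 * M * b2%:R + 2 * M * b3%:R.
Proof.
move=> /andP[? ?] /andP[? ?]; case: b1; case: b2; case: b3 => H; rewrite ?mulr1 ?mulr0; by [lra|have := H isT isT isT; lra].
Qed.

(** * Averaging over starting vertices, draws and matchings *)

Section mixture.
Variables (R : realType) (H I V : finType) (c : H -> I) (pv : V -> R).
Hypotheses (H0 : (0 < #|H|)%N) (Heven : ~~ odd #|H|) (ppv : is_pmf pv).
Let p : H -> R := fun=> #|H|%:R^-1.
Local Notation avg g := ((\sum_(m in full_matchings H) g m) / #|full_matchings H|%:R).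

Lemma Eext_bound (g h : {ffun H -> H} -> R) m C L : 0 <= C ->
  (forall m', m' \in extensions m -> g m' <= C + L * h m') -> Eext g m <= C + L * Eext h m.
Proof.
move=> C0 gh; rewrite /Eext; have [->|n0] := eqVneq #|extensions m| 0%N.
  by rewrite invr0 !mulr0 addr0.
have n0' : 0 < #|extensions m|%:R :> R by rewrite ltr0n lt0n.
rewrite ler_pdivrMr // mulrDl mulrA divfK ?gt_eqF //.
apply: le_trans (ler_sum _ gh) _; rewrite big_split /= -mulr_sumr sumr_const.
by rewrite -[C *+ _]mulr_natr.
Qed.

(** The law of the matching does not depend on the starting vertices, so the two averages can be
    exchanged: late components are estimated for a fixed matching with random starting vertices,
    although the exploration uses them in the opposite order. *)
Lemma mixture_bound (xs : seq V -> seq I) (K q : nat) (g : {ffun H -> H} -> R) (Hf : seq H -> R)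
  (badw : seq V -> pred (seq H)) (badx : pred (seq V)) (late : seq V -> pred {ffun H -> H})
  (M th1 th2 th3 : R) : 0 <= M -> (forall m, - M <= g m <= M) -> (forall w, - M <= Hf w <= M) ->
  (forall x, size x = q -> EL p K (fun w => (badw x w)%:R) <= th1) ->
  EL pv q (fun x => (badx x)%:R) <= th2 ->
  (forall m, m \in full_matchings H -> EL pv q (fun x => (late x m)%:R) <= th3) ->
  (forall x w m, size x = q -> size w = K -> m \in extensions (mt (run c (xs x) w)) ->
     ~~ badx x -> ~~ badw x w -> ~~ late x m -> g m <= Hf w) ->
  avg g <= EL p K Hf + 2 * M * (th1 + th2 + th3).
Proof.
move=> M0 gM HM hw hx hl key.
have [m0 m0P] := full_matchings_nonempty Heven.
have F0 : 0 < #|full_matchings H|%:R :> R by rewrite ltr0n; apply/card_gt0P; exists m0.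
have pp : is_pmf p by exact: is_pmf_unif.
have M2 : 0 <= 2 * M by rewrite mulr_ge0.
have avgM (h : {ffun H -> H} -> R) : avg (fun m => h m + M) = avg h + M.
  by rewrite big_split /= sumr_const mulrDl -[M *+ _]mulr_natr mulfK // gt_eqF.
(* Adding [M] makes the constant nonnegative, as [Eext_bound] requires for partial matchings without
   completion. *)
have bx x : size x = q -> avg g + M <=
    EL p K Hf + M + 2 * M * (badx x)%:R + 2 * M * th1 + 2 * M * avg (fun m => (late x m)%:R).
  move=> xq; rewrite -avgM -(Eext_run c _ (xs x) K H0) -(Eext_run c _ (xs x) K H0).
  apply: le_trans (_ : EL p K (fun w => (Hf w + M + 2 * M * (badx x)%:R + 2 * M * (badw x w)%:R)
     + 2 * M * Eext (fun m => (late x m)%:R) (mt (run c (xs x) w))) <= _).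
    apply: EL_le => [|w wK]; first by exact: pp.1.
    have /andP[h1 h2] := HM w.
    have hb b : 0 <= 2 * M * b%:R by rewrite mulr_ge0.
    apply: Eext_bound => [|m mP]; first by have := hb (badx x); have := hb (badw x w); lra.
    by apply: indicator_le => // b1 b2 b3; exact: key x w m xq wK mP b1 b2 b3.
  rewrite !ELD !(ELZ p) !(EL_cst pp.2) lerD2r lerD2l ler_wpM2l //; exact: hw.
have key2 : avg g + M <= EL pv q (fun x => EL p K Hf + M + 2 * M * (badx x)%:R + 2 * M * th1 + 2 * M * avg (fun m => (late x m)%:R)).
  by rewrite -[leLHS](EL_cst ppv.2 q); apply: EL_le => [|x]; [exact: ppv.1|exact: bx].
have lateE : EL pv q (fun x => avg (fun m => (late x m)%:R)) <= th3.
  rewrite [leLHS](_ : _ = (\sum_(m in full_matchings H) EL pv q (fun x => (late x m)%:R)) / #|full_matchings H|%:R); last first.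
    rewrite -(EL_sum ppv.2) mulrC -ELZ; apply: eq_EL => x _; by rewrite mulrC.
  rewrite ler_pdivrMr //; apply: le_trans (ler_sum _ hl) _.
  by rewrite sumr_const mulr_natr.
move: key2; rewrite !ELD !(ELZ pv) !(EL_cst ppv.2).
have := ler_wpM2l M2 hx; have := ler_wpM2l M2 lateE; rewrite !mulrDr.
by move=> ? ? ?; lra.
Qed.

End mixture.

Section discrete_bound.
Variables (R : realType) (lam : R).
Unset Implicit Arguments.
Variable Hs : forall n : nat, 'I_n -> community.
Set Implicit Arguments.
Variable P : community -> R.
Hypothesis hc : hcm_conditions R lam Hs P.

Local Notation mu := (mu P).
Local Notation eta := (eta P).
Local Notation tau3 := (tau3 P).
Local Notation ES := (ES P).
Local Notation EDS := (EDS P).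
Local Notation a := (@scale R).
Local Notation kapV := (kapV P).
Local Notation sgm := (sgm P).
Local Notation cdr := (cdr P).
Local Notation vol := (vol R Hs).
Local Notation fpath := (fpath lam P).

Let uv n : vtx (Hs n) -> R := fun=> #|vtx (Hs n)|%:R^-1.
(* Uniform vertices pick communities in proportion to their size, so that a component
   is missed by all of them with probability decreasing in its number of vertices. *)
Let roots n (x : seq (vtx (Hs n))) : seq 'I_n := map (fun v : vtx (Hs n) => tag v) x ++ enum 'I_n.

Lemma roots_cover n (x : seq (vtx (Hs n))) : covers (roots x).
Proof. by move=> i; rewrite mem_cat mem_enum orbT. Qed.

Lemma root_degrees n (B : R) (q : nat) : 0 < B -> (0 < n)%N ->
  EL (@uv n) q (fun x => ((B <= \sum_(v <- x) (cdtot (Hs n (tag v)))%:R)%R)%:R) <=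
  q%:R * emp_mean (Hs n) (fun H => (cdtot H * csize H)%N%:R) / B.
Proof.
move=> B0 n0; have N0 : (0 < #|vtx (Hs n)|)%N by rewrite card_vtx (leq_trans n0) // (hcm_N_ge hc).
have pp := is_pmf_unif R N0.
apply: le_trans (@EL_markov _ _ _ pp.1 q _ (fun x => \sum_(v <- x) (cdtot (Hs n (tag v)))%:R) B _ B0 _) _ => //.
  by move=> x _; apply: sumr_ge0.
rewrite (EL_count pp.2) ler_pM2r ?invr_gt0 // ler_wpM2l //.
rewrite /emp_mean -mulr_sumr mulrC.
have -> : \sum_(v : vtx (Hs n)) (cdtot (Hs n (tag v)))%:R = \sum_(i < n) (cdtot (Hs n i) * csize (Hs n i))%N%:R :> R.
  rewrite (partition_big (fun v : vtx (Hs n) => tag v) xpredT) //=; apply: eq_bigr => i _.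
  rewrite (eq_bigr (fun=> (cdtot (Hs n i))%:R)); last by move=> v /eqP ->.
  rewrite sumr_const natrM mulr_natr; congr (_ *+ _).
  have := card_vcomp (Hs n) [set i]%SET; rewrite /vsz big_set1 => <-.
  by apply: eq_card => v; rewrite !inE.
apply: ler_wpM2l; first by apply: sumr_ge0.
by rewrite lef_pV2 ?posrE ?ltr0n // ler_nat card_vtx (hcm_N_ge hc).
Qed.

(** At time [s ^+ 2] the parabola is of order [s^4] and outweighs both the fluctuation and the
    starting degrees of order [s^3]. *)
Lemma endpoint_low (K1 A1 s e : R) : 0 < cdr -> 0 <= K1 -> 0 <= A1 -> e <= 1 -> 1 <= s ->
  (K1 + `|lam| + A1 + 2) / cdr <= s ->
  s * A1 + lam * s ^+ 2 - cdr * (s ^+ 2) ^+ 2 + e < - (s ^+ 3 * K1).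
Proof.
move=> c0 k0 a0 e1 s1; rewrite ler_pdivrMr // => h.
have s2 : s <= s ^+ 2 by rewrite expr2 ler_peMr // (le_trans ler01).
have s0 : 0 <= s by rewrite (le_trans ler01).
have s3 : s ^+ 2 <= s ^+ 3 by rewrite exprS ler_peMl // sqr_ge0.
have h3 := ler_wpM2l (exprn_ge0 3 s0) h.
have l1 : lam * s ^+ 2 <= s ^+ 3 * `|lam|.
  apply: le_trans (_ : `|lam| * s ^+ 2 <= _); first by rewrite ler_wpM2r ?sqr_ge0 ?ler_norm.
  by rewrite mulrC ler_wpM2r.
have l2 : s * A1 <= s ^+ 3 * A1 by rewrite ler_wpM2r // (le_trans s2).
have l3 : cdr * (s ^+ 2) ^+ 2 = s ^+ 3 * (s * cdr) by ring.
rewrite l3; move: h3 l1 l2; rewrite !mulrDr.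
move: (s ^+ 3 * (s * cdr)) (s ^+ 3 * `|lam|) (s ^+ 3 * A1) (s ^+ 3 * K1) (lam * s ^+ 2) (s * A1) => *.
by lra.
Qed.

(** At most order [s^2] large components, each missed with probability of order [s^(-3)]. *)
Lemma late_small (L E rho s q M0 an vl N n th : R) : 0 < L -> 1 <= E -> 0 < rho -> 0 < s -> 0 < th -> 0 < an ->
  0 < N -> 0 < n -> an ^+ 3 = n -> an ^+ 2 <= vl -> N / n <= 2 * E -> s ^+ 3 * an / 2 <= q ->
  0 <= M0 -> M0 <= s ^+ 2 * L -> 3 * (L * (4 * E / rho)) / th <= s ->
  M0 * (1 + q * (rho * vl / N))^-1 <= th / 3.
Proof.
move=> L0 E1 r0 s0 th0 a0 N0 n0 a3 av NE hq M00 hM hs.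
have E0 : 0 < E by lra.
have av1 : (2 * E)^-1 <= an * vl / N.
  apply: le_trans (_ : an ^+ 3 / N <= _); last first.
    by rewrite ler_pM2r ?invr_gt0 // exprS ler_pM2l.
  by rewrite a3 -[n / N]invf_div lef_pV2 ?posrE ?divr_gt0 // mulr_gt0.
have qu : s ^+ 3 * rho / (4 * E) <= q * (rho * vl / N).
  apply: le_trans (_ : s ^+ 3 * an / 2 * (rho * vl / N) <= _); last first.
    rewrite ler_wpM2r // divr_ge0 ?(ltW N0) // mulr_ge0 ?(ltW r0) //.
    by apply: le_trans av; rewrite sqr_ge0.
  rewrite (_ : _ / (4 * E) = s ^+ 3 * rho / 2 * (2 * E)^-1); last by field; rewrite gt_eqF.
  rewrite (_ : s ^+ 3 * an / 2 * _ = s ^+ 3 * rho / 2 * (an * vl / N)); last by field; rewrite gt_eqF.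
  by rewrite ler_pM2l // divr_gt0 // mulr_gt0 // exprn_gt0.
have u0 : 0 < s ^+ 3 * rho / (4 * E) by rewrite divr_gt0 ?mulr_gt0 ?exprn_gt0.
have w0 : 0 < 1 + q * (rho * vl / N) by lra.
rewrite ler_pdivrMr //; apply: le_trans hM _.
apply: le_trans (_ : th / 3 * (s ^+ 3 * rho / (4 * E)) <= _); last first.
  by rewrite ler_pM2l ?divr_gt0 //; lra.
rewrite (_ : th / 3 * _ = s ^+ 2 * (s * (th * rho / (12 * E)))); last by field; rewrite gt_eqF.
rewrite ler_pM2l ?exprn_gt0 // -ler_pdivrMr ?divr_gt0 ?mulr_gt0 //.
rewrite (_ : L / _ = 3 * (L * (4 * E / rho)) / th) //.
by field; rewrite !gt_eqF.
Qed.

(** The relation [compat] is the only link between sizes and path, so any [Hf] dominating [G] along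
    it bounds the expectation over graphs by one over walks. The horizon [s0] does not depend on
    [e]. *)
Lemma discrete_bound (rho theta : R) : 0 < rho -> 0 < theta -> exists s0 : R, 1 <= s0 /\
  forall s, s0 <= s -> forall e, 0 < e -> \forall n \near \oo,
  forall (M : R) (G : (nat -> R) -> R) (Hf : (R -> R) -> R),
    (forall y, - M <= G y <= M) -> (forall p, - M <= Hf p <= M) ->
    (forall p y, compat (s ^+ 2) e rho kapV p y -> G y <= Hf p) ->
    hcm_expect (Hs n) (fun m => G (scaled_comp_sizes m)) <=
    EL (@hcp R Hs n) (Num.trunc (s ^+ 2 * a n ^+ 2)) (fun w => Hf (fpath w)) + 2 * M * theta.
Proof.
move=> rho0 th0.
have mu0 := mu_gt0 hc; have tau0 := tau3_gt0 hc; have c0 := cdr_gt0 hc.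
have kv0 := kapV_gt0 hc; have ES1 := ES_ge1 hc; have EDS0 := EDS_gt0 hc.
(* The walk may fail with probability [3 * th = theta / 3]; the degrees of the starting vertices and
   the late components get [theta / 3] each. *)
pose th := theta / 9; have th90 : 0 < th by rewrite divr_gt0.
pose A1 := Num.sqrt (2 * tau3 / mu / th).
have C0 : 0 < 2 * tau3 / mu by rewrite divr_gt0 // mulr_gt0.
have A10 : 0 < A1 by rewrite sqrtr_gt0 divr_gt0.
have A12 : A1 ^+ 2 = 2 * tau3 / mu / th by rewrite sqr_sqrtr // divr_ge0 // ltW.
(* By Markov's inequality the starting degrees exceed [s ^+ 3 * K1 * a n] with probability at most
   [theta / 3]. *)
pose K1 := (EDS + 1) * (3 / theta).
have K10 : 0 < K1 by apply: mulr_gt0; [lra|rewrite divr_gt0].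
pose L1 := (4 * kapV / rho + 2) * (4 * ES / rho).
have L10 : 0 < L1.
  apply: mulr_gt0; last by rewrite divr_gt0 // mulr_gt0 //; lra.
  by have : 0 < 4 * kapV / rho by [rewrite divr_gt0 // mulr_gt0]; lra.
pose s0 := Num.max 1 (Num.max ((K1 + `|lam| + A1 + 2) / cdr) (3 * L1 / theta)).
exists s0; split; first by rewrite le_max lexx.
move=> s; rewrite !ge_max => /and3P[s1 sK sL] e e0.
have sg0 : 0 < s by exact: lt_le_trans s1.
pose e' := Num.min (e / 5) (Num.min (rho / 6) 1).
have e'0 : 0 < e' by rewrite !lt_min !divr_gt0 //=.
have e'e : 5 * e' <= e by rewrite -ler_pdivlMl // mulrC ge_min lexx.
have e'r : 6 * e' <= rho by rewrite -ler_pdivlMl // mulrC !ge_min lexx !orbT.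
have e'1 : e' <= 1 by rewrite !ge_min lexx !orbT.
pose T := s ^+ 2; have T0 : 0 < T by rewrite exprn_gt0.
(* The variance over the horizon grows like [s^2], so a height proportional to [s] keeps the failure
   probability at [th]. *)
pose A := s * A1; have A0 : 0 < A by rewrite mulr_gt0.
have hA : T * (2 * tau3 / mu) / A ^+ 2 <= th.
  rewrite /A exprMn A12 -/T (_ : _ / _ = th) //.
  by field; rewrite !gt_eqF.
pose M0 := (Num.trunc (2 * kapV * T / rho)).+1.
have kT0 : 0 <= 2 * kapV * T / rho.
  by apply: divr_ge0; [apply: mulr_ge0; [apply: mulr_ge0|]|] => //; exact: ltW.
have /andP[M01 M02] := trunc_bounds kT0.
have M0E : M0%:R = (Num.trunc (2 * kapV * T / rho))%:R + 1 :> R by rewrite natr1.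
have HM0 : 2 * (kapV * T) <= M0%:R * rho.
  by rewrite -ler_pdivrMr // mulrA M0E ltW.
have M0s : 2 * M0%:R <= s ^+ 2 * (4 * kapV / rho + 2).
  have s21 : 1 <= s ^+ 2 by rewrite exprn_ege1.
  have -> : s ^+ 2 * (4 * kapV / rho + 2) = 2 * (2 * kapV * T / rho) + 2 * s ^+ 2 by rewrite /T; ring.
  by rewrite M0E; lra.
have em : \forall n \near \oo, emp_mean (Hs n) (fun H => (cdtot H * csize H)%N%:R) <= EDS + 1.
  by apply: (cvgr_le EDS (hc_cr3 _ _ _ _ hc)); lra.
have hN : \forall n \near \oo, (hcm_N (Hs n))%:R / n%:R <= 2 * ES.
  by apply: (cvgr_le ES (hcm_N_cvg hc)); lra.
have hd := near_le0 (dmx_small hc) e'0.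
have hs := near_le0 (smx_small hc) e'0.
have ha : \forall n \near \oo, 2 <= a n by exact: scale_large.
have hell := em1_pos hc.
apply: filter_app (walk_stage hc T0 A0 th90 e'0 hA).
near=> n => ws M G Hf GM HM comp.
have n0 : (0 < n)%N by near: n; exists 1%N.
have an := scale_gt0 R n0.
have a2 : 0 < a n ^+ 2 by rewrite exprn_gt0.
have [badw Hbw] := boolp.choice (fun x => ws _ (@roots_cover n x)).
have [e10 _] : 0 < emp_mean (Hs n) (fun H => (cdtot H)%:R) :> R /\ (0 < n)%N by near: n.
have H0 : (0 < #|hedge (Hs n)|)%N by rewrite -(ltr_nat R) ellE // mulr_gt0 ?ltr0n.
have Hev : ~~ odd #|hedge (Hs n)| by rewrite card_hedge; exact: (hc_even _ _ _ _ hc).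
have N0 : (0 < #|vtx (Hs n)|)%N by rewrite card_vtx (leq_trans n0) // (hcm_N_ge hc).
have ppv : is_pmf (@uv n) := is_pmf_unif R N0.
have s30 : 0 < s ^+ 3 by rewrite exprn_gt0.
have sa0 : 0 <= s ^+ 3 * a n by rewrite mulr_ge0 // ltW.
pose q := Num.trunc (s ^+ 3 * a n).
have /andP[q1 q2] := trunc_bounds sa0; rewrite -/q in q1 q2.
have hq : s ^+ 3 * a n / 2 <= q%:R.
  have a2n : 2 <= a n by near: n.
  have : 2 <= s ^+ 3 * a n by apply: (le_trans a2n); rewrite ler_peMl ?(ltW an) // exprn_ege1.
  by lra.
have M0' : 0 <= M by have /andP[? ?] := GM (fun=> 0); lra.
have v2 := vol_ge hc n; have v0 : 0 < vol n by exact: lt_le_trans v2.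
have em' : emp_mean (Hs n) (fun H => (cdtot H * csize H)%N%:R) <= EDS + 1 by near: n.
have ka0 : 0 < s ^+ 3 * K1 * a n by rewrite mulr_gt0 // mulr_gt0.
pose u := rho * vol n / #|vtx (Hs n)|%:R.
have u0 : 0 <= u by rewrite divr_ge0 // mulr_ge0 // ltW.
rewrite /hcm_expect hcm_matchingsE.
rewrite (_ : 2 * M * theta = 2 * M * (3 * th + theta / 3 + theta / 3)); last by rewrite /th; field.
apply: (@mixture_bound R (hedge (Hs n)) 'I_n (vtx (Hs n)) (@hcomm n (Hs n)) (@uv n) H0 Hev ppv (@roots n)
  (Num.trunc (s ^+ 2 * a n ^+ 2)) q (fun m => G (scaled_comp_sizes m)) (fun w => Hf (fpath w))
  badw (fun x => (s ^+ 3 * K1 * a n <= \sum_(v <- x) (cdtot (Hs n (tag v)))%:R)%R)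
  (fun x m => [exists X in big_comps (vol n) rho m, unhit x X] &&
     (#|[set X in big_comps (vol n) rho m | ~~ unhit x X]%SET| <= M0)%N)) => //.
- by move=> x xq; case: (Hbw x).
- apply: le_trans (root_degrees q ka0 n0) _; rewrite ler_pdivrMr //.
  apply: le_trans (_ : s ^+ 3 * a n * (EDS + 1) <= _); first by rewrite ler_pM // /emp_mean divr_ge0 // sumr_ge0.
  by rewrite /K1 le_eqVlt; apply/orP; left; apply/eqP; field; rewrite gt_eqF.
- move=> m mF; apply: le_trans (EL_late ppv q u0 (ltn0Sn _) _) _.
    move=> X; rewrite inE => /andP[_ hX]; rewrite /uv sumr_const -[_ *+ _]mulr_natl /u.
    by rewrite ler_pM2r ?invr_gt0 ?ltr0n.
  apply: (late_small (L := 4 * kapV / rho + 2) (E := ES) (s := s) (an := a n) (n := n%:R)) => //.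
  + by have : 0 < 4 * kapV / rho by [rewrite divr_gt0 // mulr_gt0]; lra.
  + by rewrite ltr0n.
  + by rewrite ltr0n.
  + exact: scale3.
  + by rewrite card_vtx; near: n.
- move=> x w m xq wK mE bx bw lt.
  have [_ Hw] := Hbw x; have [HZ HV HT] := Hw w wK bw.
  have HTz : Zrun R (@hcomm n (Hs n)) (roots x) w < - \sum_(v <- x) (cdtot (Hs n (tag v)))%:R.
    have TT : 0 <= T <= T by rewrite lexx ltW.
    have := HZ T TT; rewrite take_oversize ?wK // ler_distl => /andP[_ hz].
    have := endpoint_low c0 (ltW K10) (ltW A10) e'1 s1 sK; rewrite -/T -/A => hl.
    have zl : Zrun R (@hcomm n (Hs n)) (roots x) w / a n < - (s ^+ 3 * K1).
      apply: le_lt_trans hz _; apply: lt_trans hl; rewrite ltrD2r /fpath /drift -addrA ltrD2r //.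
    rewrite ltr_pdivrMr // in zl; apply: lt_trans zl _.
    by rewrite mulNr ltrN2 ltNge.
  have de : (dmx Hs n)%:R / a n <= e' by near: n.
  have se : (smx Hs n)%:R / vol n <= e'.
    apply: le_trans (_ : (smx Hs n)%:R / a n ^+ 2 <= _); last by near: n.
    by rewrite ler_wpM2l // lef_pV2 ?posrE.
  have hv := hc_valid _ _ _ _ hc n.
  have dP i : (cdtot (Hs n i) <= dmx Hs n)%N by exact: dmxP.
  have sP i : (csize (Hs n i) <= smx Hs n)%N by exact: smxP.
  have hit := hit_comps_le hv dP sP an v0 (ltW T0) kv0 rho0 se wK mE HV HTz e'r HM0.
  have nl : ~~ [exists X in big_comps (vol n) rho m, unhit x X].
    by move: lt; rewrite hit andbT.
  apply: comp; apply: (@compat_perturb _ _ (5 * e') _ _ _ 0 (fpath w)); rewrite ?mulr0 ?addr0 //.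
    by move=> t _; rewrite subrr normr0.
  exact: (no_late_compat hv dP sP an v0 (ltW T0) e'0 rho0 de se wK mE HZ HV HTz nl).
Unshelve. all: by end_near. Qed.

End discrete_bound.

(** * Passage to the limit *)

Section bounded_fatou.
Context d (Om : measurableType d) (R : realType) (Pr : probability Om R).

(* No measurability is needed: both sides are suprema over simple functions. *)
Lemma le_integral_any (f g : Om -> \bar R) : (forall w, (f w <= g w)%E) ->
  (\int[Pr]_w f w <= \int[Pr]_w g w)%E.
Proof.
move=> fg; have pos (h k : Om -> \bar R) : (forall w, (0 <= h w)%E) -> (forall w, (h w <= k w)%E) ->
    (\int[Pr]_w h w <= \int[Pr]_w k w)%E.
  move=> h0 hk; have k0 w : (0 <= k w)%E := le_trans (h0 w) (hk w).
  rewrite !ge0_integralTE //; apply: le_ereal_sup => x [s hs <-]; exists s => // w.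
  exact: le_trans (hs w) (hk w).
rewrite integralE [leRHS]integralE leeB //.
  by apply: pos => [w|w]; [exact: funepos_ge0|apply: (@funepos_le _ _ setT); rewrite ?inE].
by apply: pos => [w|w]; [exact: funeneg_ge0|apply: (@funeneg_le _ _ setT); rewrite ?inE].
Qed.

Lemma integral_sandwich (M : R) (g1 g2 F : Om -> R) : measurable_fun setT g1 -> measurable_fun setT g2 ->
  (forall w, `|g1 w| <= M) -> (forall w, `|g2 w| <= M) -> (forall w, `|F w| <= M) ->
  {ae Pr, forall w, g1 w <= F w <= g2 w} -> \int[Pr]_w g1 w = \int[Pr]_w g2 w ->
  (\int[Pr]_w (F w)%:E = (\int[Pr]_w g1 w)%:E)%E.
Proof.
move=> mg1 mg2 b1 b2 bF [N [mN N0 NF]] E12.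
have mNC : measurable (~` N) by exact: measurableC.
have intE (g : Om -> R) (c : R) : measurable_fun setT g -> (forall w, `|g w| <= M) ->
    (\int[Pr]_w (if w \in N then c else g w)%:E = (\int[Pr]_w g w)%:E)%E.
  move=> mg bg; rewrite /Rintegral fineK; last first.
    by apply: integrable_fin_num => //; exact: (integrable_bounded Pr mg bg).
  apply: ae_eq_integral => //; last first.
  - exists N; split=> // w /= /not_implyP[_ h]; apply: contrapT => nN; apply: h.
    by rewrite memNset.
  - exact/measurable_EFinP.
  - apply/measurable_EFinP; apply: measurable_fun_if => //.
    + apply: (measurable_fun_bool true); rewrite setTI.
      have -> : (fun w => w \in N) @^-1` [set true] = N; last by [].
      by apply/seteqP; split=> w /= h; [exact: set_mem|exact: mem_set].
    + exact: measurable_funTS.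
apply/eqP; rewrite eq_le; apply/andP; split.
  rewrite E12 -(intE g2 M) //; apply: le_integral_any => w; rewrite lee_fin.
  case: ifPn => wN; first exact: le_trans (ler_norm _) (bF w).
  suff /andP[] : g1 w <= F w <= g2 w by [].
  by apply: contrapT => h; move/negP: wN; apply; rewrite inE; apply: NF.
rewrite -(intE g1 (- M)) //; apply: le_integral_any => w; rewrite lee_fin.
case: ifPn => wN; first by have := bF w; rewrite ler_norml => /andP[].
suff /andP[] : g1 w <= F w <= g2 w by [].
by apply: contrapT => h; move/negP: wN; apply; rewrite inE; apply: NF.
Qed.

(** The pointwise lower limit as a real-valued measurable function; Fatou's lemma is put in the form
    of a concrete large index, ready for iteration over two parameters. *)
Lemma bounded_fatou (u : nat -> Om -> R) (C : R) : (forall n, measurable_fun setT (u n)) ->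
  (forall n w, 0 <= u n w <= C) -> exists Phi : Om -> R, [/\ measurable_fun setT Phi,
    (forall w, 0 <= Phi w <= C),
    (forall w (c : R), (\forall n \near \oo, c <= u n w) -> c <= Phi w) &
    (forall e : R, 0 < e -> forall n0, exists2 n, (n0 <= n)%N & \int[Pr]_w Phi w <= \int[Pr]_w u n w + e)].
Proof.
move=> mu uC; pose v n w := (u n w)%:E.
pose Psi w := limn_einf (v^~ w).
have v0 n w : (0 <= v n w)%E by rewrite lee_fin; case/andP: (uC n w).
have einf_ge w (c : R) n : (forall k, (n <= k)%N -> c <= u k w) -> (c%:E <= einfs (v^~ w) n)%E.
  by move=> H; apply: le_ereal_inf_tmp => _ [k /= nk <-]; rewrite lee_fin H.
have PsiE w : Psi w = ereal_sup (range (einfs (v^~ w))).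
  by rewrite /Psi limn_einf_lim; apply/cvg_lim => //; exact: cvg_einfs_sup.
have Psi_ge w (c : R) : (\forall n \near \oo, c <= u n w) -> (c%:E <= Psi w)%E.
  case=> n _ H; rewrite PsiE.
  by apply: le_trans (einf_ge w c n _) _; [move=> k nk; exact: H|apply: ereal_sup_ubound; exists n].
have Psi0 w : (0 <= Psi w)%E by apply: Psi_ge; apply: nearW => n; case/andP: (uC n w).
have PsiC w : (Psi w <= C%:E)%E.
  rewrite PsiE.
  apply: ge_ereal_sup => _ [n _ <-]; apply: (@le_trans _ _ (v n w)).
    by apply: ereal_inf_lbound; exists n => /=.
  by rewrite lee_fin; case/andP: (uC n w).
have fin w : Psi w \is a fin_num.
  by rewrite ge0_fin_numE // (le_lt_trans (PsiC w)) // ltry.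
have mPsi : measurable_fun setT Psi.
  rewrite /Psi; under eq_fun do rewrite limn_einf_lim.
  apply: (emeasurable_fun_cvg (fun n w => einfs (v^~ w) n)).
    by apply: measurable_fun_einfs => n; exact/measurable_EFinP.
  by move=> w _; exact: is_cvg_einfs.
have PhiC w : 0 <= fine (Psi w) <= C by rewrite -!lee_fin fineK // Psi0 PsiC.
have mPhi : measurable_fun setT (fun w => fine (Psi w)) by exact: measurableT_comp.
have intE n : (\int[Pr]_w v n w = (\int[Pr]_w u n w)%:E)%E.
  rewrite /Rintegral fineK //; apply: integrable_fin_num => //.
  by apply: (integrable_bounded Pr (mu n) (M := C)) => w; case/andP: (uC n w) => h0 h1; rewrite ger0_norm.
have intP : (\int[Pr]_w Psi w = (\int[Pr]_w fine (Psi w))%:E)%E.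
  rewrite /Rintegral fineK; first by apply: eq_integral => w _; rewrite fineK.
  apply: integrable_fin_num => //.
  by apply: (integrable_bounded Pr mPhi (M := C)) => w; case/andP: (PhiC w) => h0 h1; rewrite ger0_norm.
exists (fun w => fine (Psi w)); split=> //.
  by move=> w c /Psi_ge h; rewrite -lee_fin fineK.
move=> e e0 n0; apply: contrapT => nex.
have : (\int[Pr]_w Psi w <= limn_einf (fun n => \int[Pr]_w v n w))%E.
  by apply: fatou => // n; exact/measurable_EFinP.
rewrite intP limn_einf_lim (cvg_lim (@ereal_hausdorff R) (@cvg_einfs_sup R _)) leNgt => /negP; apply.
apply: (@le_lt_trans _ _ (\int[Pr]_w fine (Psi w) - e)%:E); last by rewrite lte_fin; lra.
apply: ge_ereal_sup => _ [n _ <-].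
apply: (@le_trans _ _ (\int[Pr]_w v (maxn n n0) w)%E).
  by apply: ereal_inf_lbound; exists (maxn n n0) => //=; rewrite leq_maxl.
rewrite intE lee_fin leNgt; apply/negP => h; apply: nex; exists (maxn n n0); first by rewrite leq_maxr.
by lra.
Qed.

End bounded_fatou.

(** Only finitely many coordinates matter: otherwise points violating the bound would converge
    coordinatewise to [x]. *)
Lemma ptws_continuous_at (R : realType) (f : {ptws nat -> R} -> R) (x : nat -> R) (del : R) :
  continuous f -> 0 < del -> exists k0 : nat, exists2 e : R, 0 < e &
  forall y : nat -> R, (forall k, (k < k0)%N -> `|y k - x k| <= e) -> `|f y - f x| <= del.
Proof.
move=> cf del0; apply: contrapT => nex.
have H n : exists y : nat -> R, (forall k, (k < n)%N -> `|y k - x k| <= n.+1%:R^-1) /\ ~ `|f y - f x| <= del.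
  apply: contrapT => ny; apply: nex; exists n; exists n.+1%:R^-1; first by rewrite invr_gt0.
  by move=> y yx; apply: contrapT => fy; apply: ny; exists y.
have [y Hy] := boolp.choice H.
have cy : {ptws, (fun n => y n : {ptws nat -> R}) @ \oo --> (x : {ptws nat -> R})}.
  apply/pointwise_cvgP => k; suff ck : (fun n => y n k) @ \oo --> x k by exact: ck.
  apply: cvgr_distP => e e0.
  have hs : \forall n \near \oo, n.+1%:R^-1 <= e.
    by have := near_divSn_le 1 e0; apply: filterS => n; rewrite div1r.
  near=> n; rewrite distrC; apply: le_trans (_ : n.+1%:R^-1 <= _); last by near: n.
  by apply: (proj1 (Hy n)); near: n; exists k.+1.
have /cvgrPdist_le/(_ _ del0)[n _ /(_ n (leqnn n))] :
    (fun n => f (y n)) @ \oo --> f x by exact: (cvg_comp _ _ cy (cf x)).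
by rewrite /= distrC => h; apply: (proj2 (Hy n)).
Unshelve. all: by end_near. Qed.

Section compat_supremum.
Variables (R : realType) (T rho kap L M : R) (G : (nat -> R) -> R).
Hypotheses (L0 : 0 <= L) (GM : forall y, - M <= G y <= M).

(* The best value of [G] over the size vectors compatible with a path, the tolerance
   being charged at rate [L]: this makes the supremum Lipschitz in the path. *)
Definition compat_sup (p : R -> R) : R :=
  sup [set v : R | v = - M \/ exists eps y, [/\ 0 <= eps, compat T eps rho kap p y & v = G y - L * eps]].

Let valM p v : (v = - M \/ exists eps y, [/\ 0 <= eps, compat T eps rho kap p y & v = G y - L * eps]) ->
  v <= M.
Proof.
have /andP[m1 m2] := GM (fun=> 0).
case=> [->|[eps [y [e0 _ ->]]]]; first by lra.
have /andP[_ h] := GM y; have := mulr_ge0 L0 e0; lra.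
Qed.

Let has_sup_vals p :
  has_sup [set v : R | v = - M \/ exists eps y, [/\ 0 <= eps, compat T eps rho kap p y & v = G y - L * eps]].
Proof. by split; [exists (- M); left|exists M => v /= /valM]. Qed.

Lemma compat_sup_itv p : - M <= compat_sup p <= M.
Proof.
apply/andP; split; first by apply: ub_le_sup; [exact: (has_sup_vals p).2|left].
by apply: ge_sup; [exact: (has_sup_vals p).1|move=> v /= /valM].
Qed.

Lemma compat_sup_ge p eps y : 0 <= eps -> compat T eps rho kap p y -> G y <= compat_sup p + L * eps.
Proof.
move=> e0 cp; rewrite -lerBlDr; apply: ub_le_sup; first exact: (has_sup_vals p).2.
by right; exists eps, y.
Qed.

Lemma compat_sup_le p c : - M <= c ->
  (forall eps y, 0 <= eps -> compat T eps rho kap p y -> G y - L * eps <= c) -> compat_sup p <= c.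
Proof.
move=> Mc H; apply: ge_sup; first exact: (has_sup_vals p).1.
by move=> v /= [->//|[eps [y [e0 cp ->]]]]; exact: H.
Qed.

Lemma lip_compat_sup : lip_path T (2 * L) compat_sup.
Proof.
have half p q (d : R) : 0 <= d -> (forall t : R, 0 <= t <= T -> `|p t - q t| <= d) ->
    compat_sup p <= compat_sup q + 2 * L * d.
  move=> d0 pq; have /andP[m1 _] := compat_sup_itv q.
  have Ld : 0 <= 2 * L * d by rewrite !mulr_ge0.
  apply: compat_sup_le => [|eps y e0 cp]; first by lra.
  have ed0 : 0 <= eps + 2 * d by rewrite addr_ge0 // mulr_ge0.
  have := compat_sup_ge ed0 (compat_perturb d0 pq (lexx _) cp); rewrite mulrDr; lra.
move=> p q d d0 pq; rewrite ler_distl; apply/andP; split; last exact: half.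
rewrite lerBlDr; apply: half => // t tT; rewrite distrC; exact: pq.
Qed.

End compat_supremum.

Section compat_supremum_limit.
Variables (R : realType) (kap M : R) (G : (nat -> R) -> R) (f : R -> R).
Hypotheses (kap0 : 0 < kap) (GM : forall y, - M <= G y <= M).
Hypotheses (cf : ccont f) (md : minima_differ f) (be : bounded_excursions f).
Let sizes : nat -> R := fun k => kap * ord_excursion (reflected f) k.

(** A tolerance above [eps0] costs at least [2 * M] once [L] is large and cannot pay off; below
    [eps0] the first [k0] sizes are pinned down by [compat_upper] and [compat_lower]. *)
Lemma compat_sup_limit (del : R) (k0 : nat) (e : R) : 0 < del -> 0 < e ->
  (forall y : nat -> R, (forall k, (k < k0)%N -> `|y k - sizes k| <= e) -> `|G y - G sizes| <= del) ->
  exists T0 : R, forall T rho : R, T0 <= T -> 0 < rho -> rho <= e / 2 -> exists L0 : R, forall L, L0 <= L ->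
    compat_sup T rho kap L M G f <= G sizes + del.
Proof.
move=> del0 e0 HG; have e2 : 0 < e / 2 by rewrite divr_gt0.
have sz0 k : 0 <= sizes k by rewrite mulr_ge0 ?(ltW kap0) ?ord_excursion_ge0.
have [T_ HT] := boolp.choice (fun k => compat_lower k cf md be kap0 e0).
have [T0 HT0] : exists T0, forall k, (k < k0)%N -> T_ k <= T0.
  elim: k0 {HG} => [|k [T1 H1]]; first by exists 0.
  exists (Num.max T1 (T_ k)) => j; rewrite ltnS leq_eqVlt => /predU1P[->|/H1 h].
    by rewrite le_max lexx orbT.
  by rewrite le_max h.
exists T0 => T rho TT rho0 rhoe.
have [eps0 eps00 Heps] : exists2 eps0 : R, 0 < eps0 & forall k, (k < k0)%N -> forall (eps : R) y,
    0 <= eps <= eps0 -> compat T eps rho kap f y -> `|y k - sizes k| <= e.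
  elim: k0 HT0 {HG} => [|k IH] HT0; first by exists 1.
  have [|e1 e10 H1] := IH; first by move=> j jk; apply: HT0; exact: ltnW.
  have [e3 e30 H3] := HT k T (le_trans (HT0 k (ltnSn _)) TT).
  have [e4 e40 H4] := compat_upper T rho k cf md be kap0 e2.
  exists (Num.min e1 (Num.min e3 e4)); first by rewrite !lt_min e10 e30 e40.
  move=> j; rewrite ltnS => jk eps y; rewrite !le_min => /andP[ep0 /and3P[ee1 ee3 ee4]] cp.
  move: jk; rewrite leq_eqVlt => /predU1P[->|jk]; last by apply: (H1 j jk eps y) => //; rewrite ep0.
  have a3 : 0 <= eps <= e3 by rewrite ep0.
  have a4 : 0 <= eps <= e4 by rewrite ep0.
  have lo := H3 rho eps y a3 cp; have up := H4 eps y a4 cp.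
  have : Num.max (sizes k) rho <= sizes k + e / 2 by rewrite ge_max; have := sz0 k; lra.
  by rewrite ler_distl; move: lo up; rewrite -/(sizes k) => *; apply/andP; split; lra.
exists (2 * M / eps0) => L hL.
have M0 : 0 <= M by have /andP[? ?] := GM (fun=> 0); lra.
have L0 : 0 <= L by apply: le_trans hL; rewrite divr_ge0 ?mulr_ge0 // ltW.
have /andP[g1 g2] := GM sizes.
apply: compat_sup_le => //; first by lra.
move=> eps y ep0 cp; have [small|big] := leP eps eps0.
  have : `|G y - G sizes| <= del.
    by apply: HG => k kk; apply: (Heps k kk eps) => //; rewrite ep0.
  by rewrite ler_distl => /andP[_ h]; have := mulr_ge0 L0 ep0; lra.
have /andP[_ h] := GM y.
have : 2 * M <= L * eps.
  by rewrite ler_pdivrMr // in hL; apply: le_trans hL _; rewrite ler_wpM2l // ltW.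
by lra.
Qed.

End compat_supremum_limit.

Section hcm_donsker.
Variables (R : realType) (lam : R).
Unset Implicit Arguments.
Variable Hs : forall n : nat, 'I_n -> community.
Set Implicit Arguments.
Variable P : community -> R.
Hypothesis hc : hcm_conditions R lam Hs P.
Context d (Om : measurableType d) (Pr : probability Om R) (B : R -> Om -> R).
Hypothesis hB : is_std_BM Pr B.

Local Notation mu := (mu P).
Local Notation eta := (eta P).
Local Notation tau3 := (tau3 P).
Local Notation a := (@scale R).
Local Notation sgm := (sgm P).

Lemma xiw_mean n : (0 < #|hedge (Hs n)|)%N ->
  \sum_h @hcp R Hs n h * @xiw R Hs P n h = 0.
Proof.
move=> H0; have pp : is_pmf (@hcp R Hs n) := is_pmf_unif R H0.
rewrite (eq_bigr (fun h => (@hcp R Hs n h * fdeg R Hs (hcomm h) - @hcp R Hs n h * nuS R Hs n) / (a n * sgm))).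
  rewrite -mulr_suml sumrB -mulr_suml pp.2 mul1r.
  by rewrite (sum_pushpmf (@hcomm n (Hs n)) _ (@fdeg R Hs n)) subrr mul0r.
by move=> h _; rewrite /xiw mulrA mulrBr.
Qed.

Lemma xiw_var n : (0 < #|hedge (Hs n)|)%N -> 0 < a n -> 0 < sgm ->
  a n ^+ 2 * \sum_h @hcp R Hs n h * @xiw R Hs P n h ^+ 2 = (varS R Hs n - nuS R Hs n ^+ 2) / sgm ^+ 2.
Proof.
move=> H0 an s0; have pp : is_pmf (@hcp R Hs n) := is_pmf_unif R H0.
rewrite mulr_sumr.
rewrite (eq_bigr (fun h => (@hcp R Hs n h * fdeg R Hs (hcomm h) ^+ 2 - 2 * nuS R Hs n * (@hcp R Hs n h * fdeg R Hs (hcomm h))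
    + @hcp R Hs n h * nuS R Hs n ^+ 2) / sgm ^+ 2)).
  rewrite -mulr_suml big_split sumrB /=.
  have E1 : \sum_h @hcp R Hs n h * fdeg R Hs (hcomm h) = nuS R Hs n.
    exact: (sum_pushpmf (@hcomm n (Hs n)) (@hcp R Hs n) (@fdeg R Hs n)).
  have -> : \sum_h @hcp R Hs n h * fdeg R Hs (hcomm h) ^+ 2 = varS R Hs n.
    exact: (sum_pushpmf (@hcomm n (Hs n)) (@hcp R Hs n) (fun i => fdeg R Hs i ^+ 2)).
  have -> : \sum_h 2 * nuS R Hs n * (@hcp R Hs n h * fdeg R Hs (hcomm h)) = 2 * nuS R Hs n * nuS R Hs n.
    by rewrite -mulr_sumr E1.
  have -> : \sum_h @hcp R Hs n h * nuS R Hs n ^+ 2 = nuS R Hs n ^+ 2 by rewrite -mulr_suml pp.2 mul1r.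
  by congr (_ / _); ring.
by move=> h _; rewrite /xiw; field; rewrite !gt_eqF.
Qed.

Lemma xiw_bound n h : 0 < a n -> 0 < sgm ->
  `|@xiw R Hs P n h| <= ((dmx Hs n)%:R / a n + (2 + `|nuS R Hs n|) / a n) / sgm.
Proof.
move=> an s0; rewrite /xiw invfM mulrA normrM normfV (gtr0_norm s0) ler_pM2r ?invr_gt0 //.
rewrite -mulrDl normrM normfV (gtr0_norm an) ler_pM2r ?invr_gt0 //.
apply: le_trans (ler_normB _ _) _; rewrite addrA lerD2r fdegE //.
apply: le_trans (ler_normB _ _) _; rewrite normr_nat ger0_norm // lerD2r ler_nat; exact: dmxP.
Qed.

Lemma nuS_cvg0 : nuS R Hs @ \oo --> (0 : R).
Proof.
apply: (cvgrM_near (f := fun n => a n * nuS R Hs n) (g := fun n => (a n)^-1) (mulr0 lam)).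
- near=> n; have n0 : (0 < n)%N by near: n; exists 1%N.
  by rewrite mulrAC divff ?mul1r // gt_eqF // scale_gt0.
- exact: (nuS_cvg hc).
- exact: scale_inv_cvg0.
Unshelve. all: by end_near. Qed.

Lemma hcm_donsker (T M L : R) (F : (R -> R) -> R) : 0 < T -> 0 <= L -> (forall p, `|F p| <= M) ->
  lip_path T L F ->
  (fun n => EL (@hcp R Hs n) (Num.trunc (T * a n ^+ 2)) (fun w => F (walkpath (@xiw R Hs P n) (a n ^+ 2) w)))
  @ \oo --> \int[Pr]_w F (B^~ w).
Proof.
move=> T0 L0 FM FL; have s0 := sgm_gt0 hc.
(* For small [n] there may be no half-edge and hence no law of a draw, so the sequence is shifted by
   [N0]. *)
have [N0 _ HN] : \forall n \near \oo, 0 < emp_mean (Hs n) (fun H => (cdtot H)%:R) :> R /\ (0 < n)%N by exact: em1_pos hc.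
have H0 n : (0 < #|hedge (Hs (n + N0)%N)|)%N.
  have [|e1 n0] := HN (n + N0)%N; first by rewrite /= leq_addl.
  by rewrite -(ltr_nat R) ellE // mulr_gt0 ?ltr0n.
have an n : 0 < a (n + N0)%N.
  by have [|_ n0] := HN (n + N0)%N; [rewrite /= leq_addl|exact: scale_gt0].
have shift (u : nat -> R) (l : R) : u @ \oo --> l -> (fun n => u (n + N0)%N) @ \oo --> l by rewrite cvg_shiftn.
have pp n : is_pmf (@hcp R Hs (n + N0)%N) by exact: is_pmf_unif.
have dn := donsker hB T0 L0 FM FL (T_ := fun n => hedge (Hs (n + N0)%N)) (p := fun n => @hcp R Hs (n + N0)%N)
  (xi := fun n => @xiw R Hs P (n + N0)%N) (N := fun n => a (n + N0)%N ^+ 2)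
  (b := fun n => ((dmx Hs (n + N0)%N)%:R / a (n + N0)%N + (2 + `|nuS R Hs (n + N0)%N|) / a (n + N0)%N) / sgm)
  (K := fun n => (Num.trunc (T * a (n + N0)%N ^+ 2)).+1) pp.
have {dn} := dn (fun n => xiw_mean (H0 n)) (fun n h => xiw_bound h (an n) s0).
move=> dn; rewrite -(cvg_shiftn N0).
apply: cvgr_near_eq (dn _ _ _ _).
(* [donsker] was used with one draw more than the horizon contains; [F] does not see it. *)
- apply: nearW => n; have K0 : 0 <= T * a (n + N0)%N ^+ 2 by rewrite mulr_ge0 ?sqr_ge0 // ltW.
  have E := EL_take (pp n).2 (Num.trunc (T * a (n + N0)%N ^+ 2)) 1
    (fun w => F (walkpath (@xiw R Hs P (n + N0)%N) (a (n + N0)%N ^+ 2) w)).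
  rewrite addn1 in E; apply: (etrans _ E); apply: eq_EL => w wK.
  apply/eqP; rewrite -subr_eq0 -normr_le0 -[leRHS](mulr0 L); apply: FL => // t /andP[t0 tT]; rewrite /walkpath take_takel ?subrr ?normr0 //.
  have u0 : 0 <= t * a (n + N0)%N ^+ 2 by rewrite mulr_ge0 ?sqr_ge0.
  have uT : t * a (n + N0)%N ^+ 2 <= T * a (n + N0)%N ^+ 2 by rewrite ler_wpM2r ?sqr_ge0.
  by apply: leq_trunc.
- apply/cvgryPge => A; have [N1 _ H1] := @scale_large R (Num.max 1 A).
  exists N1 => // n /= nN; have := H1 (n + N0)%N; rewrite /= ge_max => /(_ (leq_trans nN (leq_addr _ _)))/andP[h1 h2].
  by apply: le_trans h2 _; rewrite expr2 ler_peMr // (le_trans ler01).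
- apply: (shift (fun n => ((dmx Hs n)%:R / a n + (2 + `|nuS R Hs n|) / a n) / sgm)).
  rewrite -(mul0r sgm^-1); apply: cvgMl; rewrite -(addr0 0); apply: cvgD; first exact: (dmx_small hc).
  apply: (cvgrM_near (f := fun n => 2 + `|nuS R Hs n|) (g := fun n => (a n)^-1) (mulr0 (2 + `|0 : R|))).
  + by apply: nearW.
  + by apply: cvgD; [exact: cvg_cst|apply: cvg_norm; exact: nuS_cvg0].
  + exact: scale_inv_cvg0.
- have v : (fun n => (varS R Hs n - nuS R Hs n ^+ 2) / sgm ^+ 2) @ \oo --> (1 : R).
    have -> : 1 = (tau3 / mu - 0 ^+ 2) / sgm ^+ 2.
      have mu0 := mu_gt0 hc; have t0 := tau3_gt0 hc; have e0 := eta_gt0 hc.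
      rewrite /sgm expr_div_n sqr_sqrtr ?(ltW e0) // (etaE hc); field; rewrite !gt_eqF //.
    apply: cvgMl; apply: cvgB; first exact: (varS_cvg hc).
    by rewrite expr2; under eq_fun do rewrite expr2; apply: cvgM; exact: nuS_cvg0.
  apply: cvgr_near_eq (shift _ _ v); apply: nearW => n; by rewrite xiw_var.
- by move=> n; rewrite ltW // truncnS_gt.
Qed.

End hcm_donsker.

Section continuity_algebra.
Variable R : realType.
Implicit Types p q : R -> R.

Lemma ccontD p q : ccont p -> ccont q -> ccont (fun t => p t + q t).
Proof.
move=> cp cq x x0 e e0; have e2 : 0 < e / 2 by rewrite divr_gt0.
have [d1 d10 H1] := cp x x0 _ e2; have [d2 d20 H2] := cq x x0 _ e2.
exists (Num.min d1 d2); first by rewrite lt_min d10.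
move=> y y0; rewrite le_min => /andP[y1 y2].
rewrite opprD addrACA; apply: le_trans (ler_normD _ _) _.
by have := H1 y y0 y1; have := H2 y y0 y2; lra.
Qed.

Lemma ccontZ (c : R) p : 0 < c -> ccont p -> ccont (fun t => c * p t).
Proof.
move=> c0 cp x x0 e e0; have [d1 d10 H1] := cp x x0 _ (divr_gt0 e0 c0).
exists d1 => // y y0 yx; rewrite -mulrBr normrM (gtr0_norm c0) mulrC -ler_pdivlMr //; exact: H1.
Qed.

End continuity_algebra.

Lemma Rintegral_cstT d (Om : measurableType d) (R : realType) (Pr : probability Om R) (c : R) :
  \int[Pr]_w cst c w = c.
Proof.
apply: etrans (Rintegral_cst _ measurableT c) _; rewrite -[RHS]mulr1; congr (_ * _).
have -> : (1 : R) = fine 1%E by [].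
by congr fine; exact: probability_setT.
Qed.

Lemma ptws_continuousN (R : realType) (f : {ptws nat -> R} -> R) :
  continuous f -> continuous (fun y => - f y).
Proof. by move=> cf y; exact (cvgN (cf y)). Qed.

Section scaling_limit.
Variables (R : realType) (lam : R).
Unset Implicit Arguments.
Variable Hs : forall n : nat, 'I_n -> community.
Set Implicit Arguments.
Variable P : community -> R.
Hypothesis hc : hcm_conditions R lam Hs P.
Context d (Om : measurableType d) (Pr : probability Om R) (B : R -> Om -> R).
Hypothesis hB : is_std_BM Pr B.

Local Notation mu := (mu P).
Local Notation eta := (eta P).
Local Notation a := (@scale R).
Local Notation sgm := (sgm P).
Local Notation cdr := (cdr P).
Local Notation kapV := (kapV P).
Local Notation drift := (drift lam P).

Let fB w : R -> R := fun t => sgm * B t w + drift t.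

Lemma ccont_drift : ccont drift.
Proof.
apply: ccont_within; apply: continuous_subspaceT => t; rewrite /drift.
by apply: cvgB; [apply: cvgMr; exact: cvg_id|apply: cvgMr; exact: exprn_continuous].
Qed.

Lemma BM_path_good : {ae Pr, forall w, [/\ ccont (fB w), minima_differ (fB w) & bounded_excursions (fB w)]}.
Proof.
have s0 := sgm_gt0 hc; have c0 := cdr_gt0 hc.
have cf w : ccont (fB w) by apply: ccontD ccont_drift; apply: ccontZ => //; exact: (BM_ccont hB).
have loc (T : R) : exists G : R, forall s : R, 0 <= s <= T -> `|drift s| <= G.
  exists (`|lam| * T + cdr * T ^+ 2) => s /andP[s0' sT].
  rewrite /drift; apply: le_trans (ler_normB _ _) _.
  have e1 : `|lam * s| = `|lam| * s by rewrite normrM (ger0_norm s0').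
  have e2 : `|cdr * s ^+ 2| = cdr * s ^+ 2 by apply: ger0_norm; apply: mulr_ge0; [exact: ltW|exact: sqr_ge0].
  rewrite e1 e2; apply: lerD; first exact: ler_wpM2l.
  apply: ler_wpM2l; first exact: ltW.
  by rewrite ler_pXn2r ?nnegrE // (le_trans s0').
have md := ae_minima_differ hB s0 loc; have gr := BM_growth hB.
near=> w; split=> //; first by near: w.
have [C HC] : exists C : R, forall t : R, 0 <= t -> `|B t w| <= 2 * t + C by near: w.
have C0 : 0 <= C by have := le_trans (normr_ge0 _) (HC 0 (lexx 0)); rewrite mulr0 add0r.
apply: (@bounded_excursions_parabola _ _ lam cdr (sgm * 2) (sgm * C)) => //.
- by rewrite mulr_ge0 // ltW.
- by rewrite mulr_ge0 // ltW.
move=> t t0; rewrite /fB /drift addrK normrM (gtr0_norm s0) -mulrA -mulrDr ler_wpM2l ?(ltW s0) //.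
exact: HC.
Unshelve. all: by end_near. Qed.

Section one_sided.
Variables (M : R) (G : (nat -> R) -> R).
Hypothesis GM : forall y, - M <= G y <= M.

Let cs (s rho L : R) w := compat_sup (s ^+ 2) rho kapV L M G (fB w).

Let csF (s rho L : R) (p : R -> R) := compat_sup (s ^+ 2) rho kapV L M G (fun t => sgm * p t + drift t).

Let csF_M s rho L p : 0 <= L -> `|csF s rho L p| <= M.
Proof.
by move=> L0; have /andP[? ?] := compat_sup_itv (s ^+ 2) rho kapV L0 GM (fun t => sgm * p t + drift t);
  rewrite ler_norml; apply/andP.
Qed.

Let csF_lip s rho L : 0 <= L -> lip_path (s ^+ 2) (2 * L * sgm) (csF s rho L).
Proof.
move=> L0 p q e e0 pq; have s0 := sgm_gt0 hc; rewrite -[leRHS]mulrA.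
have se0 : 0 <= sgm * e by apply: mulr_ge0 => //; exact: ltW.
have spq t : 0 <= t <= s ^+ 2 -> `|(sgm * p t + drift t) - (sgm * q t + drift t)| <= sgm * e.
  move=> tT; rewrite opprD addrACA subrr addr0 -mulrBr normrM (gtr0_norm s0).
  by apply: ler_wpM2l; [exact: ltW|exact: pq].
exact: (@lip_compat_sup R (s ^+ 2) rho kapV L M G L0 GM (fun t => sgm * p t + drift t)
  (fun t => sgm * q t + drift t) (sgm * e) se0 spq).
Qed.

Let measurable_cs s rho L : 0 < s -> 0 <= L -> measurable_fun setT (cs s rho L).
Proof.
move=> s0 L0; have L20 : 0 <= 2 * L * sgm := mulr_ge0 (mulr_ge0 (ler0n _ 2) L0) (ltW (sgm_gt0 hc)).
exact: (donsker_measurable hB (exprn_gt0 2 s0) L20 (fun p => @csF_M s rho L p L0) (@csF_lip s rho L L0)).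
Qed.

(** Running [discrete_bound] with tolerance [theta / (L + 1)] keeps the charge [L * eps] below
    [theta]; this shift also turns the bound [M] into [M + theta]. *)
Lemma expect_upper (rho theta : R) : 0 < rho -> 0 < theta -> exists s0 : R, 1 <= s0 /\
  forall s, s0 <= s -> forall L, 0 <= L -> forall e, 0 < e -> \forall n \near \oo,
  hcm_expect (Hs n) (fun m => G (scaled_comp_sizes m)) <=
    \int[Pr]_w cs s rho L w + theta + 2 * (M + theta) * theta + e.
Proof.
move=> rho0 th0; have [s0 [s01 Hs0]] := discrete_bound hc rho0 th0.
exists s0; split=> // s ss L L0 e e0; have sg0 : 0 < s by rewrite (lt_le_trans ltr01) // (le_trans s01).
have L1 : 0 < L + 1 by lra.
have e1 : 0 < theta / (L + 1) by rewrite divr_gt0.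
have Le : L * (theta / (L + 1)) <= theta.
  by rewrite mulrCA ger_pMr // ler_pdivrMr //; lra.
have Le0 : 0 <= L * (theta / (L + 1)) by rewrite mulr_ge0 // ltW.
have L20 : 0 <= 2 * L * sgm := mulr_ge0 (mulr_ge0 (ler0n _ 2) L0) (ltW (sgm_gt0 hc)).
have dn := hcm_donsker hc hB (exprn_gt0 2 sg0) L20 (fun p => @csF_M s rho L p L0) (@csF_lip s rho L L0).
have hell := em1_pos hc.
have := Hs0 s ss _ e1; apply: filter_app; near=> n => H.
have [e10 n0] : 0 < emp_mean (Hs n) (fun H => (cdtot H)%:R) :> R /\ (0 < n)%N by near: n.
have H0 : (0 < #|hedge (Hs n)|)%N by rewrite -(ltr_nat R) ellE // mulr_gt0 ?ltr0n.
have pp : is_pmf (@hcp R Hs n) := is_pmf_unif R H0.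
have /(_ _ _ _)/le_trans := H (M + theta) G (fun p => compat_sup (s ^+ 2) rho kapV L M G p + L * (theta / (L + 1))).
apply.
- by move=> y; have /andP[? ?] := GM y; apply/andP; split; lra.
- by move=> p; have /andP[? ?] := compat_sup_itv (s ^+ 2) rho kapV L0 GM p; apply/andP; split; lra.
- by move=> p y cp; exact: (compat_sup_ge L0 GM (ltW e1) cp).
rewrite ELD (EL_cst pp.2) [leRHS]addrAC lerD2r.
have : EL (@hcp R Hs n) (Num.trunc (s ^+ 2 * a n ^+ 2)) (fun w => compat_sup (s ^+ 2) rho kapV L M G (fpath lam P w)) <=
    \int[Pr]_w cs s rho L w + e.
  by near: n; apply: (cvgr_le _ dn); rewrite ltrDl.
by lra.
Unshelve. all: by end_near. Qed.

Lemma upper_envelope : continuous (G : {ptws nat -> R} -> R) -> exists Phi : Om -> R,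
  [/\ measurable_fun setT Phi, (forall w, 0 <= Phi w <= 2 * M),
   {ae Pr, forall w, M - G (fun k => kapV * ord_excursion (reflected (fB w)) k) <= Phi w} &
   forall e : R, 0 < e -> \forall n \near \oo,
     hcm_expect (Hs n) (fun m => G (scaled_comp_sizes m)) <= M - \int[Pr]_w Phi w + e].
Proof.
move=> cG; pose r j : R := j.+1%:R^-1.
have r0 j : 0 < r j by rewrite invr_gt0.
have M0 : 0 <= M by have /andP[? ?] := GM (fun=> 0); lra.
have [s0 Hs0] := boolp.choice (fun j => expect_upper (r0 j) (r0 j)).
pose s j := Num.max (s0 j) j%:R.
have s1 j : 1 <= s j by rewrite le_max (proj1 (Hs0 j)).
have sg0 j : 0 < s j by exact: lt_le_trans (s1 j).
pose u j (L : nat) w := M - cs (s j) (r j) L%:R w.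
have csM j (L : nat) w : `|cs (s j) (r j) L%:R w| <= M by exact: (@csF_M (s j) (r j) L%:R (B^~ w) (ler0n _ L)).
have mcs j (L : nat) : measurable_fun setT (cs (s j) (r j) L%:R) by exact: measurable_cs.
have mu_ j L : measurable_fun setT (u j L) by apply: measurable_funB.
have uM j L w : 0 <= u j L w <= 2 * M.
  by have := csM j L w; rewrite ler_norml /u => /andP[? ?]; apply/andP; split; lra.
have [Psi HPsi] := boolp.choice (fun j => bounded_fatou Pr (mu_ j) (uM j)).
have mPsi j : measurable_fun setT (Psi j) by case: (HPsi j).
have PsiM j w : 0 <= Psi j w <= 2 * M by case: (HPsi j).
have [Phi [mPhi PhiM Phi_ge Phi_int]] := bounded_fatou Pr mPsi PsiM.
exists Phi; split=> //.
  have := BM_path_good; apply: filterS => w [cf md be]; apply/ler_addgt0Pr => del del0.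
  rewrite -lerBlDr; apply: Phi_ge.
  have [k0 [e e0 HG]] := ptws_continuous_at (fun k => kapV * ord_excursion (reflected (fB w)) k) cG del0.
  have [T0 HT0] := compat_sup_limit (kapV_gt0 hc) GM cf md be del0 e0 HG.
  have rs : \forall j \near \oo, r j <= e / 2.
    by have := near_divSn_le 1 (divr_gt0 e0 (ltr0n _ 2)); apply: filterS => j; rewrite div1r.
  near=> j; have [_ _ h _] := HPsi j; apply: h.
  have Ts : T0 <= s j ^+ 2.
    apply: le_trans (_ : s j <= _); last by rewrite expr2 ler_peMr // ltW.
    rewrite le_max; apply/orP; right; near: j.
    by exists (Num.trunc T0).+1 => // k /= kT; apply: le_trans (ltW (truncnS_gt _)) _; rewrite ler_nat.
  have rj : r j <= e / 2 by near: j.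
  have [L0 HL0] := HT0 _ _ Ts (r0 j) rj.
  exists (Num.trunc L0).+1 => // L /= LL; rewrite /u.
  have : L0 <= L%:R by apply: le_trans (ltW (truncnS_gt _)) _; rewrite ler_nat.
  by move=> /HL0 h'; rewrite /cs; lra.
move=> e e0; have e4 : 0 < e / 4 by rewrite divr_gt0.
have [j0 _ Hj0] := near_divSn_le (3 + 2 * M) e4.
have [j jj Hj] := Phi_int _ e4 j0.
have [_ _ _ HL] := HPsi j; have [L _ HLj] := HL _ e4 0%N.
have int_u : \int[Pr]_w u j L w = M - \int[Pr]_w cs (s j) (r j) L%:R w.
  have i1 : Pr.-integrable setT (EFin \o cst M) by exact: finite_measure_integrable_cst.
  have i2 := integrable_bounded Pr (mcs j L) (csM j L).
  by rewrite (RintegralB measurableT i1 i2) Rintegral_cstT.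
have ss : s0 j <= s j by rewrite le_max lexx.
have := (proj2 (Hs0 j)) _ ss _ (ler0n R L) _ e4; apply: filterS => n h; apply: le_trans h _.
have rj : (3 + 2 * M) * r j <= e / 4 by exact: Hj0.
have r1 : r j <= 1 by rewrite /r invf_le1 ?ltr0n // ler1n.
have : r j + 2 * (M + r j) * r j <= (3 + 2 * M) * r j.
  rewrite -subr_ge0 (_ : _ - _ = 2 * r j * (1 - r j)); last by ring.
  by rewrite !mulr_ge0 // ?(ltW (r0 j)) // subr_ge0.
rewrite int_u in HLj; move: Hj HLj rj.
move: (2 * (M + _) * _) ((3 + _) * _) (\int[Pr]_w Phi w) (\int[Pr]_w Psi j w) (\int[Pr]_w cs _ _ _ w) => *.
by lra.
Unshelve. all: by end_near. Qed.

End one_sided.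

(** The envelopes of [f] and [- f] bound the expectations by [M - Phi] from above and [Psi - M] from
    below in the mean, while pointwise the limit lies between them in the opposite order. All
    integrals therefore coincide. *)
Lemma component_sizes_cvg (f : {ptws nat -> R} -> R) (M : R) : continuous f -> (forall x, `|f x| <= M) ->
  (fun n => (hcm_expect (Hs n) (fun m => f (scaled_comp_sizes (R := R) m)))%:E) @ \oo -->
  (\int[Pr]_w (f (fun k => kapV * ord_excursion (reflected (fB w)) k))%:E)%E.
Proof.
move=> cf fM; pose an n := hcm_expect (Hs n) (fun m => f (scaled_comp_sizes (R := R) m)).
have f1 y : - M <= f y <= M by rewrite -ler_norml.
pose f' : (nat -> R) -> R := fun y => - f y.
have f2 y : - M <= f' y <= M by rewrite /f'; have /andP[? ?] := f1 y; apply/andP; split; lra.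
have [Phi [mPhi PhiM Phi_ge Phi_up]] := upper_envelope f1 cf.
have cNf : continuous (f' : {ptws nat -> R} -> R) by exact: ptws_continuousN.
have [Psi [mPsi PsiM Psi_ge Psi_up]] := @upper_envelope M f' f2 cNf.
have int_ (h : Om -> R) : measurable_fun setT h -> (forall w, 0 <= h w <= 2 * M) ->
    Pr.-integrable setT (EFin \o h).
  move=> mh hM; apply: (integrable_bounded Pr mh (M := 2 * M)) => w.
  by case/andP: (hM w) => ? ?; rewrite ger0_norm.
have icst c : Pr.-integrable setT (EFin \o cst (c : R)) by exact: finite_measure_integrable_cst.
have E1 : \int[Pr]_w (M - Phi w) = M - \int[Pr]_w Phi w.
  by rewrite (RintegralB measurableT (icst M) (int_ _ mPhi PhiM)) Rintegral_cstT.
have E2 : \int[Pr]_w (Psi w - M) = \int[Pr]_w Psi w - M.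
  by rewrite (RintegralB measurableT (int_ _ mPsi PsiM) (icst M)) Rintegral_cstT.
have neg n : hcm_expect (Hs n) (fun m => f' (scaled_comp_sizes (R := R) m)) = - an n.
  by rewrite /hcm_expect /f' sumrN mulNr.
have up e : 0 < e -> \forall n \near \oo, an n <= M - \int[Pr]_w Phi w + e by exact: Phi_up.
have lo e : 0 < e -> \forall n \near \oo, \int[Pr]_w Psi w - M - e <= an n.
  by move=> e0; have := Psi_up e e0; apply: filterS => n; rewrite neg; lra.
have lu : \int[Pr]_w Psi w - M <= M - \int[Pr]_w Phi w.
  apply/ler_addgt0Pr => e e0; have e2 : 0 < e / 2 by rewrite divr_gt0.
  have [n _ /(_ n (leqnn n))[h1 h2]] : \forall n \near \oo,
      an n <= M - \int[Pr]_w Phi w + e / 2 /\ \int[Pr]_w Psi w - M - e / 2 <= an n.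
    by near=> n; split; near: n; [exact: up|exact: lo].
  by lra.
have ge : {ae Pr, forall w, M - Phi w <= f (fun k => kapV * ord_excursion (reflected (fB w)) k) <= Psi w - M}.
  move: Phi_ge Psi_ge; apply: filterS2 => w h1; rewrite /f' => h2; apply/andP; split; lra.
have ul : M - \int[Pr]_w Phi w <= \int[Pr]_w Psi w - M.
  have mD : measurable_fun setT (fun w => Phi w + Psi w) by exact: measurable_funD.
  have iD : Pr.-integrable setT (EFin \o (fun w => Phi w + Psi w)).
    apply: (integrable_bounded Pr mD (M := 4 * M)) => w.
    by have /andP[? ?] := PhiM w; have /andP[? ?] := PsiM w; rewrite ger0_norm; lra.
  have M0 : 0 <= M by have /andP[? ?] := f1 (fun=> 0); lra.
  have : \int[Pr]_w cst (2 * M) w <= \int[Pr]_w (Phi w + Psi w).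
    have k1 := integrable_fin_num measurableT (icst (2 * M)).
    have k2 := integrable_fin_num measurableT iD.
    apply: (fine_le k1 k2).
    apply: ae_ge0_le_integral => //.
    - by move=> w _; rewrite lee_fin mulr_ge0.
    - by apply/measurable_EFinP; exact: measurable_cst.
    - by move=> w _; rewrite lee_fin; have /andP[? ?] := PhiM w; have /andP[? ?] := PsiM w; rewrite addr_ge0.
    - exact/measurable_EFinP.
    - by move: ge; apply: filterS => w /andP[h1 h2] _; have := le_trans h1 h2; rewrite lee_fin /=; clear h1 h2; lra.
  rewrite Rintegral_cstT (RintegralD measurableT (int_ _ mPhi PhiM) (int_ _ mPsi PsiM)); lra.
have EE : \int[Pr]_w Psi w - M = M - \int[Pr]_w Phi w by apply/eqP; rewrite eq_le lu ul.
rewrite (@integral_sandwich _ _ _ Pr M (fun w => M - Phi w) (fun w => Psi w - M)) //; first last.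
- by rewrite E1 E2.
- by move=> w; have /andP[? ?] := PsiM w; rewrite ler_norml; apply/andP; split; lra.
- by move=> w; have /andP[? ?] := PhiM w; rewrite ler_norml; apply/andP; split; lra.
- by apply: measurable_funB.
- by apply: measurable_funB.
rewrite E1; apply: cvg_EFin; first by apply: nearW.
apply: cvgr_distP => e e0; near=> n; rewrite ler_distl; apply/andP; split.
  by rewrite lerBlDr; near: n; exact: up.
rewrite -lerBlDr -EE; near: n; exact: lo.
Unshelve. all: by end_near. Qed.

End scaling_limit.

Theorem theorem1p1 (R : realType) (lam : R)
  (Hs : forall n : nat, 'I_n -> community) (P : community -> R)
  (* well-formed HCM: simple connected communities, even number of half-edges *)
  (Hvalid : forall n (i : 'I_n), valid_community (Hs n i))
  (Heven : forall n, ~~ odd (\sum_(i < n) cdtot (Hs n i))%N)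
  (* P is a probability distribution on communities *)
  (P_ge0 : forall H, 0 <= P H)
  (P_sum1 : cexp P (fun=> 1) = 1%E)
  (* Community regularity condition *)
  (CR1 : forall H, (fun n => emp_frac (Hs n) H) @ \oo --> P H)
  (CR2fin : (cexp P (fun H => (csize H)%:R) < +oo)%E)
  (CR2 : (fun n => emp_mean (Hs n) (fun H => (csize H)%:R)) @ \oo
           --> fine (cexp P (fun H => (csize H)%:R)))
  (CR3fin : (cexp P (fun H => (cdtot H * csize H)%N%:R) < +oo)%E)
  (CR3 : (fun n => emp_mean (Hs n) (fun H => (cdtot H * csize H)%N%:R)) @ \oo
           --> fine (cexp P (fun H => (cdtot H * csize H)%N%:R)))
  (CR4 : (fun n : nat => (\max_(i < n) csize (Hs n i))%:R * ln n%:R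
                          / (n%:R `^ (2 / 3)) : R) @ \oo --> 0)
  (* Inter-community connectivity condition *)
  (IC1fin : (cexp P (fun H => (cdtot H ^ 3)%N%:R) < +oo)%E)
  (IC1 : (fun n => emp_mean (Hs n) (fun H => (cdtot H ^ 3)%N%:R)) @ \oo
           --> fine (cexp P (fun H => (cdtot H ^ 3)%N%:R)))
  (IC2a : (cexp P (fun H => (cdtot H == 0)%N%:R) < 1)%E)
  (IC2b : (0 < cexp P (fun H => (cdtot H == 1)%N%:R) < 1)%E)
  (IC3 : (fun n : nat =>
            n%:R `^ (1 / 3) *
            (emp_mean (Hs n) (fun H => (cdtot H * (cdtot H).-1)%N%:R)
             / emp_mean (Hs n) (fun H => (cdtot H)%:R) - 1)) @ \oo --> lam) :
  let ES := fine (cexp P (fun H => (csize H)%:R)) in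
  let EDS := fine (cexp P (fun H => (cdtot H * csize H)%N%:R)) in
  let mu := fine (cexp P (fun H => (cdtot H)%:R)) in
  let ED2 := fine (cexp P (fun H => (cdtot H ^ 2)%N%:R)) in
  let ED3 := fine (cexp P (fun H => (cdtot H ^ 3)%N%:R)) in
  let eta := ED3 * mu - ED2 ^+ 2 in
  forall (dT : measure_display) (T : measurableType dT) (Pr : probability T R)
         (B : R -> T -> R),
  is_std_BM Pr B ->
  forall f : {ptws nat -> R} -> R,
    continuous f -> (exists M : R, forall x, `|f x| <= M) ->
    (fun n : nat =>
       (hcm_expect (Hs n) (fun m => f (scaled_comp_sizes (R:=R) m)))%:E) @ \oo
    --> (\int[Pr]_w
          (f (fun j => ES `^ (- (2 / 3)) * (EDS / mu) * gamma_lambda mu eta lam B j w))%:E)%E.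
Proof.
move=> ES' EDS' mu' ED2' ED3' eta' dT T Pr B hB f cf [M fM].
have hc : hcm_conditions R lam Hs P.
  by apply: HcmConditions => //; have /andP[] := IC2b.
have := component_sizes_cvg hc hB cf fM.
congr (_ --> _); apply: eq_integral => w _; congr (f _)%:E; apply/funext => k.
congr (_ * ord_excursion (reflected _) k); apply/funext => t.
rewrite /drifted_BM /sgm /drift /cdr -addrA; congr (_ + _).
by rewrite mulrAC.
Qed.
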